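(* Let $\alpha\in(0,1)$ and let $m\ge 2$ be an integer. Set $$\Omega_m^\alpha=\frac{\Gamma(1-\alpha)}{2^{1-\alpha}\Gamma^2(1-\frac\alpha2)}\left(\frac{\Gamma(1+\frac\alpha2)}{\Gamma(2-\frac\alpha2)}-\frac{\Gamma(m+\frac\alpha2)}{\Gamma(m+1-\frac\alpha2)}\right).$$ Then there exist $a>0$ and continuous functions $\Omega:(-a,a)\to\mathbb R$ and $s\mapsto\phi_s$ from $(-a,a)$ to $C^{2-\alpha}(\mathbb T)$ with $\Omega(0)=\Omega_m^\alpha$ and $\phi_0=\mathrm{Id}$, such that for every $s\in(-a,a)$, $\phi_s$ solves $$\operatorname{Im}\left\{\left(\Omega(s)\,\phi_s(w)-C_\alpha\frac{1}{2\pi i}\int_{\mathbb T}\frac{\phi_s'(\tau)\,d\tau}{|\phi_s(w)-\phi_s(\tau)|^\alpha}\right)\overline{w}\,\overline{\phi_s'(w)}\right\}=0\qquad\forall w\in\mathbb T,$$ the family is non-trivial ($\phi_s\neq \mathrm{Id}$ for $s\ne0$), and $\phi_s$ has the expansion $$\phi_s(w)=w\Big(1+\frac{s}{w^m}+s\sum_{n\ge2}\frac{a_{nm-1}(s)}{w^{nm}}\Big),\qquad w\in\mathbb T,$$ with real coefficients $a_{nm-1}(s)$. Moreover $\phi_s$ (extended by this series) is conformal on $\mathbb C\setminus\overline{\mathbb D}$, the bounded domain $D_s$ whose complement is $\phi_s(\mathbb C\setminus\overline{\mathbb D})$ is an $m$-fold symmetric rotating patch of the generalized SQG equation with angular velocity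 $\Omega(s)$, and $\partial D_s$ is of class $C^{2-\alpha}$.
   Context: The generalized SQG equation with parameter $\alpha\in(0,1)$ is $\partial_t\theta+u\cdot\nabla\theta=0$ on $\mathbb R_+\times\mathbb R^2$, $u=-\nabla^\perp(-\Delta)^{-1+\frac\alpha2}\theta$, $\nabla^\perp=(-\partial_2,\partial_1)$, where $(-\Delta)^{-1+\frac\alpha2}\theta(x)=\frac{C_\alpha}{2\pi}\int_{\mathbb R^2}\frac{\theta(y)}{|x-y|^\alpha}dy$ and $C_\alpha=\frac{\Gamma(\alpha/2)}{2^{1-\alpha}\Gamma(\frac{2-\alpha}{2})}$. A rotating patch (V-state) with angular velocity $\Omega$ is a bounded simply connected smooth domain $D$ such that the solution with initial datum $\mathbf 1_D$ is $\mathbf 1_{D_t}$ with $D_t$ the rotation of $D$ about a fixed point by angle $\Omega t$. $m$-fold symmetric means invariant under rotation by $2\pi/m$ about its center. $\mathbb D$ is the open unit disc, $\mathbb T$ the unit circle, integrals $\int_{\mathbb T}\dots d\tau$ are complex line integrals over the positively oriented circle, and $\phi'$ denotes $d\phi/dw$. $\Gamma$ is the Gamma function. *)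

(* Defs.v *)
(* MathComp + MathComp-Analysis, over an arbitrary R : realType.
   The complex plane is modelled as (R[i])^o (mathcomp-real-closed complex
   numbers, with the normed-module structure over itself, so that
   [derivable f z 1] is complex differentiability). *)
From HB Require Import structures.
From mathcomp Require Import all_boot all_order all_algebra.
From mathcomp Require Import all_classical all_reals all_analysis.
From mathcomp Require Import complex.
Set Implicit Arguments.
Unset Strict Implicit.
Unset Printing Implicit Defensive.
Import Order.TTheory GRing.Theory Num.Theory.
Import numFieldNormedType.Exports.
Local Open Scope ring_scope.
Local Open Scope classical_set_scope.
Local Open Scope complex_scope.

Section Defs.
Context {R : realType}.
Local Notation C := ((R[i])^o).

Definition Rc (x : R) : C := Complex x 0.
Definition cmod (z : C) : R := Num.sqrt (complex.Re z ^+ 2 + complex.Im z ^+ 2).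
Definition cconj (z : C) : C := Complex (complex.Re z) (- complex.Im z).
Definition expi (t : R) : C := Complex (cos t) (sin t).
Definition unitT : set C := [set z | cmod z = 1].
Definition toC (p : R * R) : C := Complex p.1 p.2.

Definition Gamma (x : R) : R :=
  fine (\int[@lebesgue_measure R]_(t in [set t : R | (0 < t)%R])
          ((t `^ (x - 1)) * expR (- t))%:E)%E.

Definition Calpha (alpha : R) : R :=
  Gamma (alpha / 2) / (2 `^ (1 - alpha) * Gamma ((2 - alpha) / 2)).

Definition Omega_m (alpha : R) (m : nat) : R :=
  Gamma (1 - alpha) / (2 `^ (1 - alpha) * Gamma (1 - alpha / 2) ^+ 2) *
  (Gamma (1 + alpha / 2) / Gamma (2 - alpha / 2)
   - Gamma (m%:R + alpha / 2) / Gamma (m%:R + 1 - alpha / 2)).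

(** * Complex line integral over the positively oriented unit circle:
    int_T f(tau) dtau = int_0^{2 pi} f(e^{it}) i e^{it} dt
    (Lebesgue integral of real and imaginary parts). *)

Definition Tintegrand (f : C -> C) (t : R) : C := f (expi t) * 'i * expi t.

Definition Tintegrable (f : C -> C) : Prop :=
  (@lebesgue_measure R).-integrable [set t : R | (0 <= t <= 2 * pi)%R]
     (fun t => (complex.Re (Tintegrand f t))%:E) /\
  (@lebesgue_measure R).-integrable [set t : R | (0 <= t <= 2 * pi)%R]
     (fun t => (complex.Im (Tintegrand f t))%:E).

Definition Tint (f : C -> C) : C :=
  Complex
    (fine (\int[@lebesgue_measure R]_(t in [set t : R | (0 <= t <= 2 * pi)%R])
             (complex.Re (Tintegrand f t))%:E)%E)
    (fine (\int[@lebesgue_measure R]_(t in [set t : R | (0 <= t <= 2 * pi)%R])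
             (complex.Im (Tintegrand f t))%:E)%E).

Definition has_derT (phi : C -> C) (w l : C) : Prop :=
  (fun tau => (phi tau - phi w) / (tau - w)) @
     within [set tau | unitT tau /\ tau <> w] (nbhs w) --> l.

Definition derT (phi : C -> C) (w : C) : C :=
  lim ((fun tau => (phi tau - phi w) / (tau - w)) @
     within [set tau | unitT tau /\ tau <> w] (nbhs w)).

Definition holderT (beta : R) (f : C -> C) (H : R) : Prop :=
  forall w z, unitT w -> unitT z -> cmod (f w - f z) <= H * (cmod (w - z)) `^ beta.

Definition C2a (alpha : R) (phi : C -> C) : Prop :=
  (forall w, unitT w -> exists l, has_derT phi w l) /\
  (exists H, holderT (1 - alpha) (derT phi) H).

(* ||f - g||_{C^{2-alpha}(T)} <= e, for the norm
   sup_T |h| + sup_T |h'| + [h']_{1-alpha} *)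
Definition C2a_dist_le (alpha : R) (f g : C -> C) (e : R) : Prop :=
  exists A B H, A + B + H <= e /\
    (forall w, unitT w -> cmod (f w - g w) <= A) /\
    (forall w, unitT w -> cmod (derT f w - derT g w) <= B) /\
    holderT (1 - alpha) (fun w => derT f w - derT g w) H.

Definition vstate_eq (alpha Om : R) (phi : C -> C) : Prop :=
  forall w, unitT w ->
    let F := fun tau => derT phi tau / Rc ((cmod (phi w - phi tau)) `^ alpha) in
    Tintegrable F /\
    complex.Im
      ((Rc Om * phi w - Rc (Calpha alpha) * (1 / (Rc (2 * pi) * 'i)) * Tint F)
        * cconj w * cconj (derT phi w)) = 0.

Definition conformal_on (U : set C) (f : C -> C) : Prop :=
  (forall z, U z -> derivable f z 1) /\
  (forall z1 z2, U z1 -> U z2 -> f z1 = f z2 -> z1 = z2).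

Definition bounded_domain (D : set C) : Prop :=
  open D /\ D !=set0 /\ connected D /\ exists r : R, forall x, D x -> cmod x <= r.

Definition simply_connected (D : set C) : Prop :=
  connected D /\
  forall gam : R -> C,
    {within `[0, 1]%classic, continuous gam} -> gam 0 = gam 1 ->
    (forall t, 0 <= t <= 1 -> D (gam t)) ->
    exists Hm : R * R -> C,
      {within [set p : R * R | 0 <= p.1 <= 1 /\ 0 <= p.2 <= 1], continuous Hm} /\
      (forall t, 0 <= t <= 1 -> Hm (0, t) = gam t /\ Hm (1, t) = gam 0) /\
      (forall u, 0 <= u <= 1 -> Hm (u, 0) = Hm (u, 1)) /\
      (forall u t, 0 <= u <= 1 -> 0 <= t <= 1 -> D (Hm (u, t))).

Definition m_fold_symmetric (m : nat) (D : set C) : Prop :=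
  exists c : C, forall x, D x <-> D (c + expi (2 * pi / m%:R) * (x - c)).

Definition topo_boundary (D : set C) : set C := closure D `\` interior D.

Definition C2a_boundary (alpha : R) (D : set C) : Prop :=
  exists gam : C -> C, C2a alpha gam /\
    (forall w z, unitT w -> unitT z -> gam w = gam z -> w = z) /\
    (forall w, unitT w -> derT gam w <> 0) /\
    topo_boundary D = gam @` unitT.

Definition leb2 := product_measure1 (@lebesgue_measure R) (@lebesgue_measure R).
Definition leb3 := product_measure1 (@lebesgue_measure R) leb2.

(* stream function (-Delta)^{-1+alpha/2} 1_A (x)
   = C_alpha/(2 pi) int_A |x-y|^{-alpha} dy *)
Definition stream (alpha : R) (A : set C) (x : R * R) : R :=
  Calpha alpha / (2 * pi) *
  fine (\int[leb2]_(y in [set y : R * R | A (toC y)])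
          (1 / (cmod (toC x - toC y)) `^ alpha)%:E)%E.

(* u = - grad^perp psi = (d_2 psi, - d_1 psi) *)
Definition vel1 (alpha : R) (A : set C) (x : R * R) : R :=
  'D_((0 : R), (1 : R)) (stream alpha A) x.
Definition vel2 (alpha : R) (A : set C) (x : R * R) : R :=
  - 'D_((1 : R), (0 : R)) (stream alpha A) x.

Definition test_fun (psi : R * (R * R) -> R) : Prop :=
  (forall p, differentiable psi p) /\
  continuous (fun p => 'D_((1 : R), ((0 : R), (0 : R))) psi p) /\
  continuous (fun p => 'D_((0 : R), ((1 : R), (0 : R))) psi p) /\
  continuous (fun p => 'D_((0 : R), ((0 : R), (1 : R))) psi p) /\
  exists r : R, forall p, r < `|p| -> psi p = 0.

(* theta(t, x) = 1_{Dt t}(x) is a weak solution on R_+ x R^2 of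
   d_t theta + u . grad theta = 0, u = -grad^perp (-Delta)^{-1+alpha/2} theta,
   with initial datum 1_{Dt 0} *)
Definition patch_solution (alpha : R) (Dt : R -> set C) : Prop :=
  let theta := fun t (x : R * R) => \1_[set y : R * R | Dt t (toC y)] x : R in
  (forall t x, differentiable (stream alpha (Dt t)) x) /\
  forall psi, test_fun psi ->
    (\int[leb3]_(p in [set p : R * (R * R) | (0 <= p.1)%R])
        (theta p.1 p.2 *
          ('D_((1 : R), ((0 : R), (0 : R))) psi p
           + vel1 alpha (Dt p.1) p.2 * 'D_((0 : R), ((1 : R), (0 : R))) psi p
           + vel2 alpha (Dt p.1) p.2 * 'D_((0 : R), ((0 : R), (1 : R))) psi p))%:E
     + \int[leb2]_x (theta 0 x * psi (0, x))%:E = 0)%E.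

Definition rot_set (D : set C) (x0 : C) (ang : R) : set C :=
  [set x | D (x0 + expi (- ang) * (x - x0))].

Definition rotating_patch (alpha : R) (D : set C) (Om : R) : Prop :=
  bounded_domain D /\ simply_connected D /\
  exists x0 : C, patch_solution alpha (fun t => rot_set D x0 (Om * t)).

End Defs.

(* Main.v *)
(* Write phi(w) = w + sum_i b_i w^(1 - M_i) with M_i = (i + 1) m and b_0 = s.  The
   V-state equation at e^(i th) is then an odd function of m th, whose i-th sine
   coefficient is M_i (Om - Omega_(M_i)) b_i plus terms of second order in b.  Since
   Omega_M is strictly increasing in M, only the coefficient i = 0 degenerates at
   Om = Omega_m: dividing by s, the equation for Om and the b_i / s, i > 0, is a fixed
   point problem for a contraction of a weighted l^1 space, Lipschitz in s.  The
   quadratic remainders are estimated in a Wiener algebra of functions of th and of the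
   angle eta to the integration point, in which the factor (1 + h)^(-alpha/2) of the
   kernel is a power series; the singular factor |1 - e^(i eta)|^(-alpha) is only
   integrated against.  The Beta integral behind Omega_m is identified with Gamma
   functions by a Bohr-Mollerup argument.

   The l^1 norm controls phi'' on |w| >= 1, so that phi, reflected across the circle,
   extends to a bi-Lipschitz perturbation of the identity of the plane: this gives
   injectivity and the topology of D.  All b_i being real, D is symmetric about the real
   axis and its vertical slices are intervals, on which Green's formula reduces to two
   integrations by parts.  It turns the velocity into a boundary integral (after
   regularizing the kernel) and the boundary equation into the weak form of the
   stationary equation in the rotating frame. *)
Require Import Defs.
From HB Require Import structures.
From mathcomp Require Import all_boot all_order all_algebra.
From mathcomp Require Import all_classical all_reals all_analysis.
From mathcomp Require Import measurable_realfun.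
From mathcomp Require Import complex ring lra zify.
Set Implicit Arguments.
Unset Strict Implicit.
Unset Printing Implicit Defensive.
Import Order.TTheory GRing.Theory Num.Theory.
Import numFieldNormedType.Exports.
Local Open Scope ring_scope.
Local Open Scope classical_set_scope.

(** * Derivatives and one-dimensional integrals *)

(** The obstacle is a loss of one derivative: the velocity is a contour integral of [phi']. The
    linear part of the equation at mode [i] is [M_i] times a factor bounded away from 0 for i > 0,
    so inverting it gives back exactly that derivative. Hence two weights: the unknown lives in l^1
    with weight [M_i (i + 2)], the remainder only in l^1 with weight [i + 2], and the solution
    operator maps the second space into the first. Distances enter through their squares, so the
    exponent is written alpha = 2 [be], and [be] < 1/2 is the integrability threshold of the kernel
    on the circle. The room between [be] and 1/2 is used a second time: the regularized kernel
    converges at a rate paid for by a slightly larger exponent, so the boundary potentials converge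
    uniformly on the whole plane, across the boundary included. Continuity of the velocity and
    differentiability of the stream function come from that uniformity. The geometry only asks that
    [kap1], which bounds phi'', be at most 1/8. A Lipschitz phi' gives the Hoelder exponent 1 -
    alpha on the circle, so all continuity statements in s are in fact Lipschitz estimates. *)

Section Derivatives.
Context {R : realType}.
Implicit Types (f g : R -> R) (x a b c : R).

(* [is_derive] outside the class mechanism, so that applying the rules below leaves every premise as a goal *)
Definition hasD f x a : Prop := is_derive x 1 f a.

Lemma dC x c : hasD (fun _ : R => c) x 0.
Proof. exact: is_derive_cst. Qed.
Lemma dI x : hasD (fun t : R => t) x 1.
Proof. exact: is_derive_id. Qed.
Lemma dD f g x a b : hasD f x a -> hasD g x b ->
  hasD (fun t => f t + g t) x (a + b).
Proof. by move=> hf hg; apply: is_deriveD. Qed.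
Lemma dN f x a : hasD f x a -> hasD (fun t => - f t) x (- a).
Proof. by move=> hf; apply: is_deriveN. Qed.
Lemma dM f g x a b : hasD f x a -> hasD g x b ->
  hasD (fun t => f t * g t) x (a * g x + f x * b).
Proof.
move=> hf hg.
have h : hasD (fun t => f t * g t) x (f x *: b + g x *: a).
  by apply: is_deriveM.
suff -> : a * g x + f x * b = f x *: b + g x *: a by [].
by rewrite addrC; congr (_ + _); rewrite /GRing.scale/= mulrC.
Qed.
Lemma dcos f x a : hasD f x a ->
  hasD (fun t => cos (f t)) x (- sin (f x) * a).
Proof. by move=> h; apply: (is_derive1_comp (f := cos) (g := f)). Qed.
Lemma dsin f x a : hasD f x a ->
  hasD (fun t => sin (f t)) x (cos (f x) * a).
Proof. by move=> h; apply: (is_derive1_comp (f := sin) (g := f)). Qed.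
Lemma dexp f x a : hasD f x a ->
  hasD (fun t => expR (f t)) x (expR (f x) * a).
Proof. by move=> h; apply: (is_derive1_comp (f := expR) (g := f)). Qed.
Lemma dpow f x a p : 0 < f x -> hasD f x a ->
  hasD (fun t => f t `^ p) x (p * f x `^ (p - 1) * a).
Proof.
move=> h0 h; have h1 := is_derive1_powR p h0.
have h2 := is_derive1_comp (f := fun y : R => y `^ p) (g := f) h1 h.
exact: h2.
Qed.
Lemma dV f x a : f x != 0 -> hasD f x a ->
  hasD (fun t => (f t)^-1) x (- a / (f x) ^+ 2).
Proof.
move=> h0 h; have := @is_deriveV _ f x a 1 h0 h.
by rewrite /GRing.scale/= mulNr mulrC -mulNr.
Qed.
Lemma deq f x a b : hasD f x a -> a = b -> hasD f x b.
Proof. by move=> h <-. Qed.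
Lemma dcont f x a : hasD f x a -> {for x, continuous f}.
Proof.
by move=> [h _]; apply: differentiable_continuous; exact/derivable1_diffP.
Qed.
Lemma dcontT f (F : R -> R) : (forall x, hasD f x (F x)) -> continuous f.
Proof. by move=> h x; apply: (@dcont f x); exact: h. Qed.

End Derivatives.

Ltac der := repeat first
  [ assumption | apply: dC | apply: dI | apply: dD | apply: dN | apply: dM
  | apply: dcos | apply: dsin | apply: dexp ].

(** * Fundamental theorem of calculus for integrands singular at the ends *)

Section FTC.
Context {R : realType}.
Local Notation mu := (@lebesgue_measure R).
Implicit Types (f F : R -> R) (a b x : R).

Lemma within_cont f (A : set R) :
  (forall x, A x -> {for x, continuous f}) -> {within A, continuous f}.
Proof. by move=> h; apply: continuous_in_subspaceT => x; rewrite inE => /h. Qed.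

Lemma ftc_cc F f a b : a <= b ->
  (forall x, a <= x <= b -> hasD F x (f x)) ->
  (forall x, a <= x <= b -> {for x, continuous f}) ->
  (\int[mu]_(x in `[a, b]) (f x)%:E = (F b - F a)%:E)%E.
Proof.
rewrite le_eqVlt => /predU1P[<- _ _|ab hd hc].
  by rewrite set_itv1 integral_set1 subrr.
have inI x : x \in `]a, b[%R -> a <= x <= b.
  by rewrite in_itv/= => /andP[/ltW -> /ltW ->].
rewrite (@continuous_FTC2 _ f F) //.
- by apply: within_cont => x /=; rewrite in_itv/= => /hc.
- split.
  + by move=> x /inI /hd [].
  + apply: cvg_at_right_filter; apply: (dcont (hd _ _)); lra.
  + apply: cvg_at_left_filter; apply: (dcont (hd _ _)); lra.
- by move=> x /inI /hd h; rewrite derive1E; case: h => _ ->.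
Qed.

Section Exhaustion.
Variables (D : set R) (A B : nat -> R) (F f : R -> R).
Hypotheses (AB : forall n, A n <= B n) (nA : nonincreasing_seq A)
  (nB : nondecreasing_seq B) (DE : D = \bigcup_n `[A n, B n])
  (hF : forall x, D x -> hasD F x (f x))
  (hc : forall x, D x -> {for x, continuous f}).

Let ftcn n : (\int[mu]_(x in `[A n, B n]) (f x)%:E = (F (B n) - F (A n))%:E)%E.
Proof.
by apply: ftc_cc => // x xi; [apply: hF|apply: hc]; rewrite DE; exists n;
  rewrite //= in_itv.
Qed.

Let mD : measurable D.
Proof. by rewrite DE; apply: bigcup_measurable. Qed.

Let inD n : `[A n, B n] `<=` D.
Proof. by rewrite DE => x h; exists n. Qed.

(** On each compact piece the integral is a difference of two values of [F], hence at most [K + K];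
    positivity lets monotone convergence pass to the union. Integrability is read off a bounded
    primitive. *)
Lemma exh_integrable (K : R) : measurable_fun D f -> (forall x, D x -> 0 <= f x) ->
  (forall x, D x -> `|F x| <= K) -> mu.-integrable D (EFin \o f).
Proof.
move=> mf f0 FK; apply/integrableP; split; first exact/measurable_EFinP.
under eq_integral => x.
  rewrite inE => Dx; rewrite /= ger0_norm; last exact: f0.
  over.
have : ((fun n => \int[mu]_(x in `[A n, B n]) (f x)%:E) @ \oo -->
   \int[mu]_(x in \bigcup_n `[A n, B n]) (f x)%:E)%E.
  apply: ge0_nondecreasing_set_cvg_integral => //.
  - move=> m n mn; apply/subsetPset => x /=; rewrite !in_itv/= => /andP[h1 h2].
    by rewrite (le_trans _ h1) ?nA//= (le_trans h2)// nB.
  - move=> n; apply/measurable_EFinP; apply: measurable_funS mf => //.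
  - by move=> n x h; rewrite lee_fin f0//; apply: inD h.
rewrite -DE => h; apply: (@le_lt_trans _ _ (K + K)%:E%E); last exact: ltry.
have <- := cvg_lim _ h => //.
apply: lime_le; first by apply/cvg_ex; eexists; exact: h.
apply: nearW => n; rewrite ftcn lee_fin.
have h1 : `|F (B n)| <= K by apply: FK; apply: (@inD n); rewrite /= in_itv/= lexx AB.
have h2 : `|F (A n)| <= K by apply: FK; apply: (@inD n); rewrite /= in_itv/= lexx AB.
by rewrite (le_trans (ler_norm _))// (le_trans (ler_normB _ _))// lerD.
Qed.

(** Dominated convergence, the integrand itself being the majorant. The ends enter only through
    limits of [F] along [A] and [B], so the same lemma serves open intervals and the half-line. *)
Lemma exh_ftc (p q : R) : mu.-integrable D (EFin \o f) ->
  (F \o B) @ \oo --> q -> (F \o A) @ \oo --> p ->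
  (\int[mu]_(x in D) (f x)%:E = (q - p)%:E)%E.
Proof.
move=> fi Bq Ap.
have mf : measurable_fun D (EFin \o f) by case/integrableP: fi.
have h : ((fun n => \int[mu]_(x in D) ((EFin \o f) \_ `[A n, B n]) x) @ \oo -->
   \int[mu]_(x in D) (f x)%:E)%E.
  apply: (@dominated_cvg _ _ _ mu D mD _ _ (abse \o (EFin \o f))) => //.
  - by move=> n; apply/measurable_restrict => //;
      apply: measurable_funS mf => //; apply: subIsetl.
  - move=> x Dx; apply: cvg_near_cst; move: Dx; rewrite DE => -[n0 _ xn0].
    near=> n; rewrite patchE mem_set//.
    move: xn0; rewrite /= !in_itv/= => /andP[h1 h2].
    have n0n : (n0 <= n)%N by near: n; exists n0.
    by rewrite (le_trans _ h1) ?nA//= (le_trans h2)// nB.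
  - exact: integrable_abse.
  - by move=> n x Dx; rewrite patchE; case: ifP => // _; rewrite abse0 /= lee_fin.
have h2 : ((fun n => \int[mu]_(x in D) ((EFin \o f) \_ `[A n, B n]) x) @ \oo -->
   (q - p)%:E)%E.
  under eq_fun => n.
    rewrite -integral_mkcondr (_ : D `&` `[A n, B n] = `[A n, B n]%classic); last first.
      by apply/setIidPr; exact: inD.
    rewrite ftcn; over.
  by apply: cvg_EFin; [exact: nearW|apply: cvgB].
by rewrite -(cvg_lim _ h)// (cvg_lim _ h2).
Unshelve. all: by end_near. Qed.

End Exhaustion.

(** The shift [n.+3] keeps the left end below the right one from the first interval on. *)
Lemma itvoo_exh a b : a < b -> `]a, b[%classic =
  \bigcup_n `[a + (b - a) / n.+3%:R, b - (b - a) / n.+3%:R]%classic.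
Proof.
move=> ab; have ab0 : 0 < b - a by rewrite subr_gt0.
apply/seteqP; split => x /=; rewrite in_itv/=.
  move=> /andP[ax xb].
  pose t := Num.min (x - a) (b - x).
  have t0 : 0 < t by rewrite lt_min !subr_gt0 ax.
  exists (Num.truncn ((b - a) / t)) => //; rewrite /= in_itv/=.
  set n := Num.truncn _.
  have hn : (b - a) / n.+3%:R < t.
    rewrite ltr_pdivrMr// -ltr_pdivrMl// mulrC.
    rewrite (lt_le_trans (truncnS_gt _))// ler_nat.
    by rewrite -/n; lia.
  have t1 : t <= x - a by rewrite ge_min lexx.
  have t2 : t <= b - x by rewrite ge_min lexx orbT.
  move: hn; set X := _ / _; clearbody X t => hn; apply/andP; split; lra.
move=> [n _] /=; rewrite in_itv/= => /andP[h1 h2].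
have : 0 < (b - a) / n.+3%:R by rewrite divr_gt0.
set X := _ / _ in h1 h2 *; clearbody X => X0; apply/andP; split; lra.
Qed.

Lemma exh_mono (c : R) : 0 <= c -> nonincreasing_seq (fun n => c / n.+3%:R).
Proof.
by move=> c0 m n mn; rewrite ler_wpM2l// lef_pV2 ?posrE ?ltr0n// ler_nat !ltnS.
Qed.

Lemma exh_cvg (c : R) : (fun n => c / n.+3%:R) @ \oo --> (0 : R).
Proof.
rewrite -[X in _ --> X](mulr0 c); apply: cvgMr.
rewrite (_ : (fun n => n.+3%:R^-1) = (fun n => harmonic (n + 2)%N))//.
  by rewrite (@cvg_shiftn 2 R (@harmonic R)); exact: cvg_harmonic.
by apply/funext => n; rewrite /harmonic /= addn2.
Qed.

Lemma integrable_ooW f a b : measurable_fun setT f ->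
  mu.-integrable `]a, b[ (EFin \o f) -> mu.-integrable `[a, b] (EFin \o f).
Proof.
move=> mf h.
have [ab|ba] := leP a b; last by rewrite set_itv_ge ?bnd_simp -?ltNge//; exact: integrable_set0.
have e1 : measurable ([set a] : set R) by [].
have e2 : measurable ([set b] : set R) by [].
apply/(@negligible_integrable _ _ R mu `[a, b]%classic ([set a] `|` [set b])) => //.
- exact: measurableU.
- by apply/measurable_EFinP; apply: measurable_funS mf.
- by apply: null_set_setU => //; exact: lebesgue_measure_set1.
- apply: integrableS h => //.
    by apply: measurableD => //; exact: measurableU.
  move=> x /= [+ /not_orP[/eqP xa /eqP xb]]; rewrite !in_itv/= => /andP[h1 h2].
  by rewrite !lt_neqAle h1 h2 eq_sym xa xb.
Qed.

(** The integrand may blow up at [a] and [b], where only [F] is continuous: the form needed for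
    negative powers of the chord, singular at 0 and 2 pi. *)
Lemma ftc_oo F f a b : a < b -> mu.-integrable `[a, b] (EFin \o f) ->
  (forall x, a < x < b -> hasD F x (f x)) ->
  (forall x, a < x < b -> {for x, continuous f}) ->
  {for a, continuous F} -> {for b, continuous F} ->
  (\int[mu]_(x in `[a, b]) f x = F b - F a)%R.
Proof.
move=> ab fi hd hc ca cb.
have ab0 : 0 < b - a by rewrite subr_gt0.
have fio : mu.-integrable `]a, b[ (EFin \o f).
  by apply: integrableS fi => //; exact: subset_itvW.
have <- : \int[mu]_(x in `]a, b[) f x = \int[mu]_(x in `[a, b]) f x.
  rewrite Rintegral_itv_bndo_bndc// Rintegral_itv_obnd_cbnd//.
  apply: integrableS fi => // x /=; rewrite !in_itv/=.
  by move=> /andP[/ltW -> ->].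
rewrite /Rintegral (@exh_ftc _ _ _ F f _ _ _ (itvoo_exh ab) _ _ (F a) (F b))//.
- move=> n; have : (b - a) / n.+3%:R <= (b - a) / 2.
    by rewrite ler_wpM2l ?(ltW ab0)// lef_pV2 ?posrE ?ltr0n// ler_nat.
  have -> : (b - a) / 2 = 2^-1 * b - 2^-1 * a by rewrite mulrC mulrBr.
  set X := _ / _; clearbody X => h; lra.
- by move=> m n mn; rewrite lerD2l; apply: exh_mono => //; exact: ltW.
- by move=> m n mn; rewrite lerD2l lerN2; apply: exh_mono => //; exact: ltW.
- have hb : (fun n => b - (b - a) / n.+3%:R) @ \oo --> b.
    by rewrite -[X in _ --> X]subr0; apply: cvgB; [exact: cvg_cst|exact: exh_cvg].
  exact: cvg_comp hb cb.
- have ha : (fun n => a + (b - a) / n.+3%:R) @ \oo --> a.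
    by rewrite -[X in _ --> X]addr0; apply: cvgD; [exact: cvg_cst|exact: exh_cvg].
  exact: cvg_comp ha ca.
Qed.

Lemma integrable_oo_ge0 F f a b (K : R) : a < b -> measurable_fun setT f ->
  (forall x, a < x < b -> 0 <= f x) ->
  (forall x, a < x < b -> hasD F x (f x)) ->
  (forall x, a < x < b -> {for x, continuous f}) ->
  (forall x, a < x < b -> `|F x| <= K) ->
  mu.-integrable `[a, b] (EFin \o f).
Proof.
move=> ab mf f0 hd hc FK; apply: integrable_ooW => //.
have ab0 : 0 < b - a by rewrite subr_gt0.
apply: (@exh_integrable _ _ _ F f _ _ _ (itvoo_exh ab) _ _ K).
- move=> n; have : (b - a) / n.+3%:R <= (b - a) / 2.
    by rewrite ler_wpM2l ?(ltW ab0)// lef_pV2 ?posrE ?ltr0n// ler_nat.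
  have -> : (b - a) / 2 = 2^-1 * b - 2^-1 * a by rewrite mulrC mulrBr.
  set X := _ / _; clearbody X => h; lra.
- by move=> m n mn; rewrite lerD2l; apply: exh_mono => //; exact: ltW.
- by move=> m n mn; rewrite lerD2l lerN2; apply: exh_mono => //; exact: ltW.
- by move=> x /=; rewrite in_itv/=; exact: hd.
- by move=> x /=; rewrite in_itv/=; exact: hc.
- by apply: measurable_funS mf.
- by move=> x /=; rewrite in_itv/=; exact: f0.
- by move=> x /=; rewrite in_itv/=; exact: FK.
Qed.

Lemma integrable_bdd f a b (K : R) : measurable_fun setT f ->
  (forall x, a <= x <= b -> `|f x| <= K) -> mu.-integrable `[a, b] (EFin \o f).
Proof.
move=> mf fK; apply: measurable_bounded_integrable => //.
- by rewrite /= lebesgue_measure_itv/=; case: ifP => _; rewrite ?ltry.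
- by apply: measurable_funS mf.
- exists K; split; first exact: num_real.
  by move=> M KM x /= xab; rewrite (le_trans _ (ltW KM))// fK// -in_itv.
Qed.

Lemma intZ d (T : measurableType d) (m : {measure set T -> \bar R}) (D : set T) (f : T -> R) (c : R) :
  measurable D -> m.-integrable D (EFin \o f) ->
  m.-integrable D (EFin \o (fun t => c * f t)).
Proof. by move=> mD h; exact: (integrableZl mD c h). Qed.

Lemma intD d (T : measurableType d) (m : {measure set T -> \bar R}) (D : set T) (f g : T -> R) :
  measurable D -> m.-integrable D (EFin \o f) -> m.-integrable D (EFin \o g) ->
  m.-integrable D (EFin \o (fun t => f t + g t)).
Proof. by move=> mD h k; exact: (integrableD mD h k). Qed.

Lemma intB d (T : measurableType d) (m : {measure set T -> \bar R}) (D : set T) (f g : T -> R) :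
  measurable D -> m.-integrable D (EFin \o f) -> m.-integrable D (EFin \o g) ->
  m.-integrable D (EFin \o (fun t => f t - g t)).
Proof. by move=> mD h k; exact: (integrableB mD h k). Qed.

Lemma integrable_dom (D : set R) f g : measurable D -> measurable_fun setT f ->
  mu.-integrable D (EFin \o g) -> (forall x, D x -> `|f x| <= g x) ->
  mu.-integrable D (EFin \o f).
Proof.
move=> mD mf gi fg; apply: le_integrable gi => //.
  by apply/measurable_EFinP; apply: measurable_funS mf.
by move=> x Dx /=; rewrite lee_fin (le_trans (fg _ Dx))// ler_norm.
Qed.

End FTC.

Section PowerLimits.
Context {R : realType}.
Implicit Types (b : R).

Lemma pow_cvg0 {T : Type} (Fi : set_system T) {FF : Filter Fi} (v : T -> R) b :
  0 < b -> (forall x, 0 <= v x) -> v @ Fi --> 0 -> (fun x => v x `^ b) @ Fi --> 0.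
Proof.
move=> b0 v0 hv; apply/cvgrPdist_lt => e e0.
have e1 : 0 < e `^ b^-1 by rewrite powR_gt0.
move/cvgrPdist_lt: hv => /(_ _ e1); apply: filterS => x.
rewrite !sub0r !normrN (ger0_norm (v0 x)) ger0_norm ?powR_ge0// => h.
have <- : (e `^ b^-1) `^ b = e by rewrite -powRrM mulVf ?gt_eqF// powRr1// ltW.
by apply: gt0_ltr_powR => //; rewrite nnegrE ?powR_ge0.
Qed.

Lemma dom_cvg0 {T : Type} (Fi : set_system T) {FF : Filter Fi} (F w : T -> R) (K : R) :
  (\forall x \near Fi, `|F x| <= K * w x) -> w @ Fi --> 0 -> F @ Fi --> 0.
Proof.
move=> h /cvgrPdist_lt hw; apply/cvgrPdist_lt => e e0.
have K0 : 0 < `|K| + 1 by rewrite ltr_wpDl.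
have /hw : 0 < e / (`|K| + 1) by rewrite divr_gt0.
apply: filterS2 h => x h1; rewrite !sub0r !normrN ltr_pdivlMr// => h2.
apply: le_lt_trans h1 _; apply: le_lt_trans h2; rewrite mulrC.
apply: le_trans (ler_norm _) _; rewrite normrM ler_wpM2l// lerDl//.
Qed.

Lemma cont0_pow (F v : R -> R) x0 b (K : R) : 0 < b -> {for x0, continuous v} ->
  v x0 = 0 -> (forall x, 0 <= v x) -> (forall x, `|F x| <= K * v x `^ b) ->
  {for x0, continuous F}.
Proof.
move=> b0 cv vx0 v0 h.
have F0 : F x0 = 0.
  by have := h x0; rewrite vx0 powR0 ?gt_eqF// mulr0 normr_le0 => /eqP.
suff : F x @[x --> x0] --> (0 : R) by rewrite -F0.
apply: (@dom_cvg0 _ (nbhs x0) _ _ (fun x => v x `^ b) K); first exact: nearW.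
by apply: (@pow_cvg0 _ (nbhs x0) _ v b) => //; move: cv; rewrite /prop_for/= /continuous_at vx0.
Qed.

Lemma ler_powR2 (x y a : R) : 0 <= a -> 0 <= x -> x <= y -> x `^ a <= y `^ a.
Proof. by move=> a0 x0 xy; apply: ge0_ler_powR => //; rewrite nnegrE ?(le_trans x0). Qed.

(* AM-GM with weights 1 - x and x *)
Lemma powR_chord (t x : R) : 0 <= t -> 0 < x < 1 -> t `^ x <= (1 - x) + x * t.
Proof.
rewrite le_eqVlt => /predU1P[<- /andP[x0 x1]|t0 /andP[x0 x1]].
  by rewrite powR0 ?gt_eqF// mulr0 addr0 subr_ge0 ltW.
set A := 1 - x + x * t.
have A0 : 0 < A by rewrite /A; nra.
(* Tangent line of [ln] at 1, used at [t / A] and [1 / A] where [A] is the weighted mean. With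
   weights [x] and [1 - x] the two right-hand sides cancel, which is concavity of [ln] at [A]. *)
have ln_le (z : R) : 0 < z -> ln z <= z - 1.
  by move=> z0; have := @le_ln1Dx R (z - 1); rewrite addrCA subrr addr0; apply; lra.
have h1 := ln_le (t / A) (divr_gt0 t0 A0).
have h2 : ln (A^-1) <= A^-1 - 1 by apply: ln_le; rewrite invr_gt0.
rewrite ln_div ?posrE// in h1; rewrite lnV ?posrE// in h2.
rewrite /powR gt_eqF// -[leRHS](lnK (_ : A \in Num.pos))// ler_expR.
have h3 : x * (t / A - 1) + (1 - x) * (A^-1 - 1) = 0.
  by rewrite /A; field; rewrite -/A gt_eqF.
have h4 : x * (ln t - ln A) <= x * (t / A - 1) by rewrite ler_wpM2l// ltW.
have h5 : (1 - x) * (- ln A) <= (1 - x) * (A^-1 - 1) by rewrite ler_wpM2l// subr_ge0 ltW.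
lra.
Qed.

End PowerLimits.

(** * Powers of the chord of the circle: integrability and moment recurrences *)

Section Circle.
Context {R : realType}.
Local Notation mu := (@lebesgue_measure R).
Implicit Types (a eta p : R) (k n : nat).

(* squared chord between angles differing by eta *)
Definition chord2 eta : R := 2 - 2 * cos eta.

Lemma chord2_ge0 eta : 0 <= chord2 eta.
Proof. by rewrite /chord2; have := cos_le1 eta; lra. Qed.

Lemma chord2_le4 eta : chord2 eta <= 4.
Proof. by rewrite /chord2; have := cos_geN1 eta; lra. Qed.

Lemma chord2_half eta : chord2 eta = 4 * sin (eta / 2) ^+ 2.
Proof.
have e : eta = (eta / 2) *+ 2 by rewrite -mulr_natr; field.
rewrite /chord2 {1}e cos_mulr2n sin2cos2; ring.
Qed.

Lemma chord2_gt0 eta : 0 < eta < 2 * pi -> 0 < chord2 eta.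
Proof.
move=> h; rewrite chord2_half mulr_gt0// exprn_gt0//.
by apply: sin_gt0_pi; rewrite divr_gt0 ?ltr0n//= ?ltr_pdivrMr ?ltr0n//; lra.
Qed.

Lemma chord2_der eta : hasD chord2 eta (2 * sin eta).
Proof. by rewrite /chord2; apply: deq; [der|rewrite /=; ring]. Qed.

Lemma chord2_cont : continuous chord2.
Proof. by apply: dcontT; exact: chord2_der. Qed.

Lemma chord2_0 : chord2 0 = 0.
Proof. by rewrite /chord2 cos0; ring. Qed.

Lemma chord2_2pi : chord2 (2 * pi) = 0.
Proof. by rewrite /chord2 (mulr_natl pi) cos2pi; ring. Qed.

Lemma chord2_pow_meas a : measurable_fun setT (fun eta => chord2 eta `^ a).
Proof.
by apply: (measurableT_comp (measurable_powR a)); apply: continuous_measurable_fun;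
  exact: chord2_cont.
Qed.

Lemma chord2_pow_der a eta : 0 < eta < 2 * pi ->
  hasD (fun t => chord2 t `^ a) eta
    (a * chord2 eta `^ (a - 1) * (2 * sin eta)).
Proof. by move=> /chord2_gt0 h; apply: dpow => //; exact: chord2_der. Qed.

(** From sin^2 = (1 - cos)(1 + cos) <= 2 (1 - cos). It makes sin times [chord2] to the power a
    vanish at both ends of the period when a > -1/2. *)
Lemma sin_le_chord eta : `|sin eta| <= chord2 eta `^ 2^-1.
Proof.
rewrite powR12_sqrt ?chord2_ge0// -sqrtr_sqr ler_wsqrtr//.
by rewrite sin2cos2 /chord2; have := cos_le1 eta; have := cos_geN1 eta; nra.
Qed.

Lemma sub_le_chord k p eta :
  `|sin (k.+1%:R * eta + p) - sin (k%:R * eta + p)| <= chord2 eta `^ 2^-1.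
Proof.
rewrite powR12_sqrt ?chord2_ge0// -sqrtr_sqr ler_wsqrtr//.
have -> : k.+1%:R * eta + p = (k%:R * eta + p) + eta by rewrite -natr1; ring.
set z := _ + p; rewrite sinD /chord2.
have := cos2Dsin2 z; have := cos2Dsin2 eta.
set S := sin z; set C := cos z; set s := sin eta; set c := cos eta => h1 h2.
(* The squared chord is the sum of the squared increments of sine and cosine from z to z + eta; [h3]
   is positivity of the cosine part. *)
have h3 : 0 <= (S * s + C * (1 - c)) ^+ 2 by exact: sqr_ge0.
have -> : 2 - 2 * c = (C ^+ 2 + S ^+ 2) * ((c - 1) ^+ 2 + s ^+ 2).
  by rewrite h2 mul1r; lra.
nra.
Qed.

Lemma mul_chord_le (F : R -> R) a : (forall x, `|F x| <= chord2 x `^ 2^-1) ->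
  - 2^-1 < a -> forall x, `|F x * chord2 x `^ a| <= 1 * chord2 x `^ (2^-1 + a).
Proof.
move=> h a1 x; rewrite mul1r powRD; last first.
  by apply/implyP => /eqP ?; exfalso; lra.
by rewrite normrM (ger0_norm (powR_ge0 _ _)) ler_wpM2r ?powR_ge0.
Qed.

Lemma chord2_pow_le a eta : 0 <= a -> chord2 eta `^ a <= 4 `^ a.
Proof. by move=> a0; apply: ler_powR2 => //; rewrite ?chord2_ge0 ?chord2_le4. Qed.

Lemma twopi_gt0 : 0 < 2 * pi :> R.
Proof. by rewrite mulr_gt0// pi_gt0. Qed.

Lemma chord2_sub1 a eta : 0 < eta < 2 * pi ->
  chord2 eta `^ a = chord2 eta `^ (a - 1) * chord2 eta.
Proof.
move=> /chord2_gt0 h; rewrite -[X in _ * X](powRr1 (ltW h)) -powRD ?subrK//.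
by rewrite (gt_eqF h) implybT.
Qed.

(** Since sin^2 = chord2 - chord2^2 / 4 and cos = 1 - chord2 / 2, only the powers [a] and [a + 1]
    survive. This identity yields both integrability and the recurrence in the exponent. *)
Lemma sinchord_der a eta : 0 < eta < 2 * pi ->
  hasD (fun t => sin t * chord2 t `^ a) eta
    ((1 + 2 * a) * chord2 eta `^ a - (1 + a) / 2 * chord2 eta `^ (a + 1)).
Proof.
move=> h; apply: deq.
  by apply: dM; [der|exact: chord2_pow_der].
rewrite (chord2_sub1 (a + 1))// (chord2_sub1 a)// addrK (chord2_sub1 a)//.
set P := _ `^ _; have := cos2Dsin2 eta; rewrite /chord2.
move: (cos eta) (sin eta) => c s hcs.
have e : s * s = 1 - c * c by rewrite -!expr2; lra.
have e2 : (2 * a * P) * (s * s) = (2 * a * P) * (1 - c * c) by rewrite e.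
lra.
Qed.

Lemma chord2_pow_cont a eta : 0 < eta < 2 * pi ->
  {for eta, continuous (fun t => chord2 t `^ a)}.
Proof. by move=> h; apply: dcont; exact: (chord2_pow_der a h). Qed.

Lemma chord2_pow_bint a : 0 <= a ->
  mu.-integrable `[0, 2 * pi] (EFin \o (fun eta => chord2 eta `^ a)).
Proof.
move=> a0; apply: (integrable_bdd (K := 4 `^ a)); first exact: chord2_pow_meas.
by move=> x _; rewrite ger0_norm ?powR_ge0// chord2_pow_le.
Qed.

(** By [sinchord_der] a primitive of the singular power, up to the factor 1 + 2 a, is sin times that
    power plus a multiple of the integral of the bounded power [a + 1]. It stays bounded because
    |sin| is at most the chord. *)
Lemma chord2_pow_int a : - 2^-1 < a ->
  mu.-integrable `[0, 2 * pi] (EFin \o (fun eta => chord2 eta `^ a)).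
Proof.
move=> a1; pose I eta := (\int[mu]_(t in `[0, eta]) (chord2 t `^ (a + 1)))%R.
have bi : mu.-integrable `[0, 2 * pi] (EFin \o (fun eta => chord2 eta `^ (a + 1))).
  by apply: chord2_pow_bint; lra.
have Ib eta : 0 < eta < 2 * pi -> `|I eta| <= I (2 * pi).
  move=> /andP[e0 e1]; rewrite ger0_norm; last first.
    by apply: Rintegral_ge0 => *; rewrite powR_ge0.
  rewrite /I -subr_ge0 (@Rintegral_itvB _ _ (BLeft 0) (BRight (2 * pi)) eta) ?bnd_simp ?(ltW e0) ?(ltW e1)//.
  by apply: Rintegral_ge0 => *; rewrite powR_ge0.
have a2 : 0 < 1 + 2 * a by lra.
have h : mu.-integrable `[0, 2 * pi] (EFin \o (fun eta => (1 + 2 * a) * chord2 eta `^ a)).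
  apply: (integrable_oo_ge0 (F := fun eta => sin eta * chord2 eta `^ a + (1 + a) / 2 * I eta)
     (K := 4 `^ (2^-1 + a) + `|(1 + a) / 2| * I (2 * pi))).
  - exact: twopi_gt0.
  - by apply: measurable_funM => //; exact: chord2_pow_meas.
  - by move=> x _; rewrite mulr_ge0 ?powR_ge0 ?ltW.
  - move=> x xI; apply: deq.
      apply: dD; first exact: sinchord_der.
      apply: dM; first exact: dC.
      have /andP[x0 x1] := xI.
      have [] := @continuous_FTC1_closed R (fun eta => chord2 eta `^ (a + 1)) 0 x (2 * pi) x1 bi x0 (@chord2_pow_cont _ _ xI).
      by move=> d1 d2; split; [exact: d1|rewrite -derive1E; exact: d2].
    by rewrite mul0r add0r subrK.
  - move=> x xI; apply: dcont; apply: dM; [exact: dC|exact: chord2_pow_der].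
  - move=> x xI; apply: le_trans (ler_normD _ _) _; apply: lerD.
      apply: le_trans (mul_chord_le sin_le_chord a1 x) _.
      by rewrite mul1r chord2_pow_le//; lra.
    by rewrite normrM ler_wpM2l// Ib.
have := @intZ _ _ _ mu _ _ ((1 + 2 * a)^-1) (measurable_itv _) h.
apply: eq_integrable => // x _ /=; congr EFin.
by rewrite mulrA mulVf ?mul1r ?gt_eqF.
Qed.

Definition chordint a : R := \int[mu]_(eta in `[0, 2 * pi]) (chord2 eta `^ a).

Lemma end_cont (F : R -> R) a : (forall x, `|F x| <= chord2 x `^ 2^-1) -> - 2^-1 < a ->
  {for 0, continuous (fun x => F x * chord2 x `^ a)} /\
  {for 2 * pi, continuous (fun x => F x * chord2 x `^ a)}.
Proof.
move=> h a1; split; apply: (cont0_pow (v := chord2) (b := 2^-1 + a) (K := 1)).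
all: rewrite ?chord2_0 ?chord2_2pi//; try exact: chord2_cont.
all: try exact: chord2_ge0.
all: try exact: (mul_chord_le h a1).
all: lra.
Qed.

Lemma chordint_rec a : - 2^-1 < a ->
  (1 + 2 * a) * chordint a = (1 + a) / 2 * chordint (a + 1).
Proof.
move=> a1; have [c0 c1] := end_cont sin_le_chord a1.
have i0 := chord2_pow_int a1.
have i1 : mu.-integrable `[0, 2 * pi] (EFin \o (fun eta => chord2 eta `^ (a + 1))).
  by apply: chord2_pow_int; lra.
have j0 : mu.-integrable `[0, 2 * pi] (EFin \o (fun eta => (1 + 2 * a) * chord2 eta `^ a)).
  exact: intZ.
have j1 : mu.-integrable `[0, 2 * pi] (EFin \o (fun eta => (1 + a) / 2 * chord2 eta `^ (a + 1))).
  exact: intZ.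
have := @ftc_oo R (fun t => sin t * chord2 t `^ a) (fun eta => (1 + 2 * a) * chord2 eta `^ a - (1 + a) / 2 * chord2 eta `^ (a + 1)) 0 (2 * pi) twopi_gt0.
rewrite RintegralB// !RintegralZl// => h.
apply/eqP; rewrite -subr_eq0; apply/eqP; rewrite /chordint h//.
- by rewrite sin0 mulr_natl sin2pi !mul0r subrr.
- exact: intB.
- by move=> x xI; exact: sinchord_der.
- move=> x xI; apply: (@dcont _ _ _ ((1 + 2 * a) * (a * chord2 x `^ (a - 1) * (2 * sin x)) - (1 + a) / 2 * ((a + 1) * chord2 x `^ (a + 1 - 1) * (2 * sin x)))).
  apply: deq; first by apply: dD; [apply: dM; [exact: dC|exact: chord2_pow_der]|apply: dN; apply: dM; [exact: dC|exact: chord2_pow_der]].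
  by rewrite /=; ring.
Qed.

Variable be : R.
Hypothesis beP : 0 < be < 2^-1.

(** With alpha = 2 [be] this is |1 - e^(i eta)|^(-alpha). *)
Definition kap eta : R := chord2 eta `^ (- be).

(* phase-shifted cosine moments of the kernel; p = 0 and p = - pi / 2 give the
   cosine and sine moments *)
Definition cmom p k : R := \int[mu]_(eta in `[0, 2 * pi]) (cos (k%:R * eta + p) * kap eta).

Lemma kap_int : mu.-integrable `[0, 2 * pi] (EFin \o kap).
Proof. by apply: chord2_pow_int; have := beP; lra. Qed.

Lemma kap_ge0 eta : 0 <= kap eta. Proof. exact: powR_ge0. Qed.

Lemma kap_meas : measurable_fun setT kap.
Proof. exact: chord2_pow_meas. Qed.

Lemma kapM_int (F : R -> R) (K : R) : measurable_fun setT F ->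
  (forall x, `|F x| <= K) -> mu.-integrable `[0, 2 * pi] (EFin \o (fun x => F x * kap x)).
Proof.
move=> mF FK; apply: (integrable_dom (g := fun x => K * kap x)) => //.
- by apply: measurable_funM => //; exact: kap_meas.
- by apply: intZ => //; exact: kap_int.
- by move=> x _; rewrite normrM (ger0_norm (kap_ge0 _)) ler_wpM2r ?kap_ge0.
Qed.

Lemma meas_cos k p : measurable_fun setT (fun eta : R => cos (k%:R * eta + p)).
Proof.
apply: continuous_measurable_fun.
by apply: (@dcontT _ _ (fun eta => - sin (k%:R * eta + p) * (0 * eta + k%:R * 1 + 0))) => x; der.
Qed.

(** Integrate the derivative of sin ((k + 1) eta + p) - sin (k eta + p) times [kap]. The difference
    of neighbouring sines has the size of the chord, so the product vanishes at both ends, and its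
    derivative involves two consecutive moments only. *)
Lemma cmom_rec p k :
  (k.+1%:R - be) * cmom p k.+1 = (k%:R + be) * cmom p k.
Proof.
have a1 : - 2^-1 < - be by have := beP; lra.
have [c0 c1] := end_cont (sub_le_chord k p) a1.
have jj q : mu.-integrable `[0, 2 * pi] (EFin \o (fun eta => cos (q%:R * eta + p) * kap eta)).
  by apply: (kapM_int (K := 1)); [exact: meas_cos|move=> x; exact: cos_max].
have := @ftc_oo R (fun t => (sin (k.+1%:R * t + p) - sin (k%:R * t + p)) * chord2 t `^ (- be))
  (fun eta => (k.+1%:R - be) * (cos (k.+1%:R * eta + p) * kap eta) - (k%:R + be) * (cos (k%:R * eta + p) * kap eta)) 0 (2 * pi) twopi_gt0.
rewrite RintegralB//; last 2 first.
- exact: intZ.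
- exact: intZ.
rewrite !RintegralZl// => h.
apply/eqP; rewrite -subr_eq0; apply/eqP; rewrite h//.
(* At the ends the boundary value is literally 0, since 0 to a nonzero power, even a negative one,
   is 0 by convention; continuity there is [end_cont]. *)
- have be0 : - be != 0 by rewrite oppr_eq0 gt_eqF//; case/andP: beP.
  by rewrite chord2_0 chord2_2pi powR0// !mulr0 subrr.
- by apply: intB => //; exact: intZ.
- move=> x xI; apply: deq.
    apply: dM; last exact: chord2_pow_der.
    by apply: dD; [|apply: dN]; apply: dsin; apply: dD (dC _ _); apply: dM; [exact: dC|exact: dI|exact: dC|exact: dI].
  rewrite /= /kap (chord2_sub1 (- be))//; set P := _ `^ _.
  have -> : k.+1%:R * x + p = (k%:R * x + p) + x by rewrite -natr1; ring.
  rewrite -natr1 sinD cosD /chord2; set z := _ + p.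
  have := cos2Dsin2 x.
  move: (cos x) (sin x) (cos z) (sin z) (k%:R : R) => c s C S K hcs.
  have e : s * s = 1 - c * c by rewrite -!expr2; lra.
  have e2 : 2 * s * (S * c + C * s - S) = (2 - 2 * c) * (C * c - S * s + C).
    suff : (2 * C) * (s * s) = (2 * C) * (1 - c * c) by move=> ?; lra.
    by rewrite e.
  rewrite -[LHS](_ : (K + 1) * (C * c - S * s) * (P * (2 - 2 * c)) - K * C * (P * (2 - 2 * c)) - be * P * (2 * s * (S * c + C * s - S)) = _); last by ring.
  by rewrite e2; ring.
- move=> x xI; apply: dcont; apply: dD; [|apply: dN]; (apply: dM; [exact: dC|apply: dM; [der|exact: chord2_pow_der]]).
Qed.

End Circle.

(** * Gamma function and Beta-type integrals *)

Section GammaFunction.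
Context {R : realType}.
Local Notation mu := (@lebesgue_measure R).
Implicit Types (x t : R) (n : nat).

Definition halfline : set R := [set t : R | 0 < t].

Lemma halfline_exh : halfline = \bigcup_n `[n.+1%:R^-1, n.+1%:R]%classic.
Proof.
apply/seteqP; split => t /=.
  move=> t0; exists (Num.truncn (t + t^-1)) => //=; rewrite in_itv/=.
  have it0 : 0 < t^-1 by rewrite invr_gt0.
  have := truncnS_gt (t + t^-1); set n := Num.truncn _ => h.
  have n0 : (0 : R) < n.+1%:R by rewrite ltr0n.
  apply/andP; split; last by apply: ltW; apply: lt_trans h; rewrite ltrDl.
  rewrite -[leRHS]invrK lef_pV2 ?posrE//; apply: ltW; apply: le_lt_trans h.
  by rewrite lerDr ltW.
move=> [n _] /=; rewrite in_itv/= => /andP[h _].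
by apply: lt_le_trans h; rewrite invr_gt0 ltr0n.
Qed.

Lemma measurable_halfline : measurable halfline.
Proof. by rewrite halfline_exh; apply: bigcup_measurable. Qed.

Definition gammaf x t : R := t `^ (x - 1) * expR (- t).

Lemma gammaf_meas x : measurable_fun setT (gammaf x).
Proof.
apply: measurable_funM; first exact: measurable_powR.
apply: continuous_measurable_fun.
by apply: (@dcontT _ _ (fun t => expR (- t) * (- 1))) => t; der.
Qed.

(** After rounding [p] up to an integer, one term of the exponential series at 1 + t is enough; this
    shift is the origin of the factor [expR 1] in [K]. *)
Lemma exp_dominates (p : R) : exists2 K : R, 0 < K &
  forall t, 0 <= t -> (1 + t) `^ p <= K * expR t.
Proof.
pose n := Num.truncn `|p|.
exists ((n.+1)`!%:R * expR 1) => [|t t0]; first by rewrite mulr_gt0 ?expR_gt0// ltr0n fact_gt0.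
have pn : p <= n.+1%:R by apply: le_trans (ler_norm _) _; exact/ltW/truncnS_gt.
have t1 : 1 <= 1 + t by lra.
apply: le_trans (ler_powR t1 pn) _.
rewrite powR_mulrn; last by lra.
have h := @expR_ge1Dxn R (1 + t) n (le_trans ler01 t1).
rewrite -mulrA -expRD mulrC -ler_pdivrMr ?ltr0n ?fact_gt0//.
by apply: le_trans h; rewrite lerDr.
Qed.

Let w t : R := t / (1 + t).

Let w_der t : 0 <= t -> hasD w t ((1 + t) ^- 2).
Proof.
move=> t0; apply: deq.
  apply: dM; [exact: dI|apply: dV; [|by der]].
  by rewrite /= gt_eqF; lra.
by rewrite /=; field; rewrite gt_eqF; lra.
Qed.

Let w01 t : 0 < t -> 0 < w t <= 1.
Proof. by move=> t0; rewrite /w divr_gt0 ?ler_pdivrMr//=; lra. Qed.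

(** The majorant is a multiple of the derivative of (t / (1 + t))^x, a function with values in
    [0, 1]. That derivative is x t^(x - 1) (1 + t)^(-(x + 1)): the right singularity at 0, and a
    decay slower than the exponential. *)
Lemma gammaf_int x : 0 < x -> mu.-integrable halfline (EFin \o gammaf x).
Proof.
move=> x0.
have [K K0 HK] := exp_dominates (x + 1).
pose g t := x * w t `^ (x - 1) * (1 + t) ^- 2.
have gd t : 0 < t -> hasD (fun t => w t `^ x) t (g t).
  move=> t0; have /andP[wt _] := w01 t0.
  by apply: dpow => //; apply: w_der; exact: ltW.
have mw : measurable_fun (halfline : set R) g.
  suff : {in halfline, continuous g}.
    by move=> h; apply: open_continuous_measurable_fun => //; exact: open_gt.
  move=> t; rewrite inE => t0.
  have /andP[wt _] := w01 t0.
  apply: dcont; apply: dM.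
    apply: dM; first exact: dC.
    by apply: dpow => //; apply: w_der; exact: ltW.
  by apply: dV; [rewrite expf_neq0 ?gt_eqF//; rewrite /halfline/= in t0; lra|apply: dM; der].
have gi : mu.-integrable halfline (EFin \o g).
  apply: (@exh_integrable _ _ _ _ (fun t => w t `^ x) g _ _ _ halfline_exh _ _ 1) => //.
  - by move=> n; rewrite (le_trans (y := 1)) ?invf_le1 ?ler1n ?ltr0n.
  - by move=> m n mn; rewrite lef_pV2 ?posrE ?ltr0n// ler_nat ltnS.
  - by move=> m n mn; rewrite ler_nat ltnS.
  - move=> t t0; have /andP[wt _] := w01 t0; apply: dcont; apply: dM.
      apply: dM; first exact: dC.
      by apply: dpow => //; apply: w_der; exact: ltW.
    by apply: dV; [rewrite expf_neq0 ?gt_eqF//; rewrite /halfline/= in t0; lra|apply: dM; der].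
  - move=> t t0; rewrite /g mulr_ge0 ?invr_ge0 ?sqr_ge0// mulr_ge0 ?powR_ge0//; exact: ltW.
  - move=> t t0; rewrite ger0_norm ?powR_ge0//; have /andP[w0 w1] := w01 t0.
    by apply: le_trans (ler_powR2 (ltW x0) (ltW w0) w1) _; rewrite powR1.
apply: (integrable_dom (g := fun t => K / x * g t)).
- exact: measurable_halfline.
- exact: gammaf_meas.
- by apply: intZ => //; exact: measurable_halfline.
move=> t t0; rewrite ger0_norm ?mulr_ge0 ?powR_ge0 ?expR_ge0//.
have t1 : 0 < 1 + t by rewrite /halfline/= in t0; lra.
rewrite /gammaf /g /w powRM ?invr_ge0 ?(ltW t0) ?(ltW t1)//.
rewrite -!mulrA mulKf ?gt_eqF//.
rewrite (mulrCA K) ler_wpM2l ?powR_ge0//.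
have -> : (1 + t)^-1 `^ (x - 1) / (1 + t) ^+ 2 = (1 + t) `^ (- (x + 1)).
  rewrite -(powR_inv1 (ltW t1)) -powRrM -(powR_mulrn 2 (ltW t1)) -powRN.
  rewrite -powRD ?(gt_eqF t1) ?implybT//; congr (_ `^ _).
  by rewrite -[2%:R]/(2 : R); ring.
rewrite expRN -(ler_pM2r (expR_gt0 t)) mulVf ?expR_eq0//.
rewrite powRN mulrAC ler_pdivlMr ?powR_gt0// mul1r.
by apply: HK; exact: ltW.
Qed.

Definition Gam x : R := \int[mu]_(t in halfline) gammaf x t.

Lemma Gam_rec x : 0 < x -> Gam (x + 1) = x * Gam x.
Proof.
move=> x0; have i0 := gammaf_int x0.
have x1 : 0 < x + 1 by lra.
have i1 := gammaf_int x1.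
have [K K0 HK] := exp_dominates (x + 1).
have e : \int[mu]_(t in halfline) (x * gammaf x t - gammaf (x + 1) t) = 0 - 0.
  rewrite /Rintegral (@exh_ftc _ _ _ _ (fun t => t `^ x * expR (- t)) _ _ _ _ halfline_exh _ _ 0 0)//.
  - by move=> n; rewrite (le_trans (y := 1)) ?invf_le1 ?ler1n ?ltr0n.
  - by move=> m n mn; rewrite lef_pV2 ?posrE ?ltr0n// ler_nat ltnS.
  - by move=> m n mn; rewrite ler_nat ltnS.
  - move=> t t0; apply: deq; first by apply: dM; [apply: dpow; [exact: t0|exact: dI]|der].
    by rewrite /gammaf addrK; ring.
  - move=> t t0; apply: dcont; apply: dD; [|apply: dN]; [apply: dM; first exact: dC|].
      by apply: dM; [apply: dpow; [exact: t0|exact: dI]|der].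
    by apply: dM; [apply: dpow; [exact: t0|exact: dI]|der].
  - by apply: intB => //; [exact: measurable_halfline|apply: intZ => //; exact: measurable_halfline].
  - apply: (@dom_cvg0 _ _ \oo _ _ (fun n => harmonic n) K); last exact: cvg_harmonic.
    apply: nearW => n; rewrite /= /harmonic ger0_norm ?mulr_ge0 ?powR_ge0 ?expR_ge0//.
    set t : R := n.+1%:R; have t0 : 0 < t by rewrite ltr0n.
    rewrite ler_pdivlMr// expRN mulrAC ler_pdivrMr ?expR_gt0//.
    apply: le_trans (HK t (ltW t0)).
    rewrite -[X in _ * X]powRr1 ?(ltW t0)// -powRD ?(gt_eqF t0) ?implybT//.
    by apply: ler_powR2; lra.
  - apply: (@dom_cvg0 _ _ \oo _ _ (fun n => (harmonic n : R) `^ x) 1).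
      apply: nearW => n; rewrite /= mul1r /harmonic ger0_norm ?mulr_ge0 ?powR_ge0 ?expR_ge0//.
      by rewrite ler_piMr ?powR_ge0// expR_le1 oppr_le0 invr_ge0.
    by apply: pow_cvg0 => //; [move=> n; exact: harmonic_ge0|exact: cvg_harmonic].
move: e; rewrite RintegralB//; last 2 first.
- exact: measurable_halfline.
- by apply: intZ => //; exact: measurable_halfline.
rewrite RintegralZl//; last exact: measurable_halfline.
by rewrite subrr => /eqP; rewrite subr_eq0 /Gam => /eqP ->.
Qed.

End GammaFunction.

(** * Log-convexity of moments *)

Section Moments.
Context d (T : measurableType d) (R : realType) (m : {measure set T -> \bar R}).
Variables (D : set T) (u w : T -> R).
Hypotheses (mD : measurable D) (u0 : forall t, D t -> 0 <= u t)
  (w0 : forall t, D t -> 0 <= w t).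
Let Mom (a : R) : R := \int[m]_(t in D) (u t `^ a * w t).

(** [powR_chord] is applied pointwise at u / l. The free scale [l] plays the part of Hoelder's
    inequality: taken as the ratio of two moments, it turns this linear bound into log-convexity. *)
Lemma moment_convex (a x l : R) : 0 < x < 1 -> 0 < l -> 0 <= a ->
  (forall b, a <= b -> m.-integrable D (EFin \o (fun t => u t `^ b * w t))) ->
  Mom (a + x) <= l `^ x * ((1 - x) * Mom a + x / l * Mom (a + 1)).
Proof.
move=> x01 l0 a0 hi; have /andP[x0 x1] := x01.
have i0 := hi a (lexx a).
have i1 : m.-integrable D (EFin \o (fun t => u t `^ (a + 1) * w t)) by apply: hi; lra.
have ix : m.-integrable D (EFin \o (fun t => u t `^ (a + x) * w t)) by apply: hi; lra.
rewrite /Mom -!RintegralZl// -RintegralD//; try exact: intZ.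
rewrite -RintegralZl//; last by apply: intD => //; exact: intZ.
apply: le_Rintegral => //; first by apply: intZ => //; apply: intD => //; exact: intZ.
move=> t Dt; have ut := u0 Dt.
have ax : a + x != 0 by rewrite gt_eqF; lra.
have a1 : a + 1 != 0 by rewrite gt_eqF; lra.
rewrite (@powRD _ (u t) a x) ?(negbTE ax)// (@powRD _ (u t) a 1) ?(negbTE a1)// powRr1//.
have -> : l `^ x * ((1 - x) * (u t `^ a * w t) + x / l * (u t `^ a * u t * w t)) =
  (u t `^ a * w t) * (l `^ x * ((1 - x) + x * (u t / l))) by ring.
have -> : u t `^ a * u t `^ x * w t = (u t `^ a * w t) * u t `^ x by ring.
apply: ler_wpM2l; first by rewrite mulr_ge0 ?powR_ge0 ?w0.
have {1}-> : u t = l * (u t / l) by rewrite mulrC divfK ?gt_eqF.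
have ul : 0 <= u t / l by rewrite divr_ge0// ltW.
rewrite powRM ?(ltW l0)// ler_wpM2l ?powR_ge0//.
exact: powR_chord.
Qed.

Lemma moment_upper (a x r : R) : 0 < x < 1 -> 0 < r -> 0 <= a ->
  (forall b, a <= b -> m.-integrable D (EFin \o (fun t => u t `^ b * w t))) ->
  Mom (a + 1) = r * Mom a -> Mom (a + x) <= r `^ x * Mom a.
Proof.
move=> x01 r0 a0 hi e; apply: le_trans (moment_convex x01 r0 a0 hi) _.
by rewrite e mulrA divfK ?gt_eqF// -mulrDl subrK mul1r.
Qed.

(** The upper bound started at a + x with exponent 1 - x, read from the other end. *)
Lemma moment_lower (a x r : R) : 0 < x < 1 -> 0 < r -> 0 <= a ->
  (forall b, a <= b -> m.-integrable D (EFin \o (fun t => u t `^ b * w t))) ->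
  Mom (a + x + 1) = r * Mom (a + x) -> Mom (a + 1) <= r `^ (1 - x) * Mom (a + x).
Proof.
move=> x01 r0 a0 hi e; have -> : a + 1 = (a + x) + (1 - x) by ring.
apply: moment_upper => //; [lra|lra|move=> b ab; apply: hi; lra].
Qed.

End Moments.

(** * Bohr-Mollerup evaluation of the chord integral *)

Section ChordGamma.
Context {R : realType}.
Local Notation mu := (@lebesgue_measure R).
Local Notation S := (@chordint R).
Implicit Types (a x : R) (N : nat).

Definition Gam1p a : R := Gam (1 + a).

(** The quotient S (a + 1) / S a, which increases to 4, the square of the diameter. *)
Definition chordratio a : R := 2 * (1 + 2 * a) / (1 + a).

Lemma chordint_mom a : S a = \int[mu]_(t in `[0, 2 * pi]) (chord2 t `^ a * 1).
Proof. by apply: eq_Rintegral => t _; rewrite mulr1. Qed.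

Lemma chordint_integrable a : - 2^-1 < a ->
  mu.-integrable `[0, 2 * pi] (EFin \o (fun t => chord2 t `^ a * 1)).
Proof.
by move=> /chord2_pow_int; apply: eq_integrable => // t _ /=; rewrite mulr1.
Qed.

Lemma chordint_rec' a : - 2^-1 < a -> S (a + 1) = chordratio a * S a.
Proof.
by move=> a1; have h := chordint_rec a1; rewrite /chordratio; apply: (@mulfI _ ((1 + a) / 2));
  [apply/eqP; lra|rewrite -h; field; apply/eqP; lra].
Qed.

Lemma chordratio_gt0 a : 0 <= a -> 0 < chordratio a.
Proof. by move=> a0; rewrite /chordratio divr_gt0//; lra. Qed.

Lemma chordratio_le4 a : 0 <= a -> chordratio a <= 4.
Proof. by move=> a0; rewrite /chordratio ler_pdivrMr//; lra. Qed.

Lemma chordint_upper a x : 0 < x < 1 -> 0 <= a -> S (a + x) <= chordratio a `^ x * S a.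
Proof.
move=> x01 a0; rewrite !chordint_mom; apply: (moment_upper _ _ _ x01) => //.
- by move=> *; exact: chord2_ge0.
- exact: chordratio_gt0.
- by move=> b ab; apply: chordint_integrable; lra.
- by rewrite -!chordint_mom; apply: chordint_rec'; lra.
Qed.

Lemma chordint_lower a x : 0 < x < 1 -> 0 <= a -> S (a + 1) <= chordratio (a + x) `^ (1 - x) * S (a + x).
Proof.
move=> x01 a0; rewrite !chordint_mom; apply: (moment_lower _ _ _ x01) => //.
- by move=> *; exact: chord2_ge0.
- by apply: chordratio_gt0; lra.
- by move=> b ab; apply: chordint_integrable; lra.
- by rewrite -!chordint_mom; apply: chordint_rec'; lra.
Qed.

Lemma Gam1p_mom a : Gam1p a = \int[mu]_(t in halfline) (t `^ a * expR (- t)).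
Proof. by rewrite /Gam1p /Gam /gammaf addrC addKr. Qed.

Lemma Gam1p_int a : 0 <= a -> mu.-integrable halfline (EFin \o (fun t => t `^ a * expR (- t))).
Proof.
move=> a0; have h : 0 < 1 + a by lra.
by have := gammaf_int h; rewrite /gammaf addrC addKr.
Qed.

Lemma Gam1p_rec a : 0 <= a -> Gam1p (a + 1) = (a + 1) * Gam1p a.
Proof. by move=> a0; rewrite /Gam1p addrA Gam_rec; [rewrite addrC|lra]. Qed.

Lemma Gam1p_upper a x : 0 < x < 1 -> 0 <= a -> Gam1p (a + x) <= (a + 1) `^ x * Gam1p a.
Proof.
move=> x01 a0; rewrite !Gam1p_mom; apply: (moment_upper _ _ _ x01) => //.
- exact: measurable_halfline.
- by move=> t /ltW.
- by lra.
- by move=> b ab; apply: Gam1p_int; lra.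
- by rewrite -!Gam1p_mom; apply: Gam1p_rec.
Qed.

Lemma Gam1p_lower a x : 0 < x < 1 -> 0 <= a -> Gam1p (a + 1) <= (a + x + 1) `^ (1 - x) * Gam1p (a + x).
Proof.
move=> x01 a0; rewrite !Gam1p_mom; apply: (moment_lower _ _ _ x01) => //.
- exact: measurable_halfline.
- by move=> t /ltW.
- by lra.
- by move=> b ab; apply: Gam1p_int; lra.
- by rewrite -!Gam1p_mom; apply: Gam1p_rec; lra.
Qed.

Lemma Gam_1 : @Gam R 1 = 1.
Proof.
have i0 := @gammaf_int R 1 ltr01.
rewrite /Gam /Rintegral (@exh_ftc _ _ _ _ (fun t : R => 1 - expR (- t)) _ _ _ _ halfline_exh _ _ 0 1)/= ?subr0//.
- by move=> n; rewrite (le_trans (y := 1)) ?invf_le1 ?ler1n ?ltr0n.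
- by move=> m n mn; rewrite lef_pV2 ?posrE ?ltr0n// ler_nat ltnS.
- by move=> m n mn; rewrite ler_nat ltnS.
- move=> t t0; apply: deq; first by der.
  by rewrite /gammaf subrr powRr0; ring.
- move=> t t0; apply: dcont; apply: dM; [apply: dpow; [exact: t0|exact: dI]|der].
- rewrite -[X in _ --> X]subr0; apply: cvgB; first exact: cvg_cst.
  apply: (@dom_cvg0 _ _ \oo _ _ (fun n => harmonic n) 1); last exact: cvg_harmonic.
  apply: nearW => n; rewrite /= /harmonic mul1r ger0_norm ?expR_ge0// expRN.
  rewrite lef_pV2 ?posrE ?ltr0n ?expR_gt0//.
  by apply: le_trans (expR_ge1Dx _); rewrite lerDr.
- apply: (@dom_cvg0 _ _ \oo _ _ (fun n => harmonic n) 1); last exact: cvg_harmonic.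
  apply: nearW => n; rewrite /= /harmonic mul1r ger0_norm; last first.
    by rewrite subr_ge0 expR_le1 oppr_le0 invr_ge0.
  set I := _^-1; have := expR_ge1Dx (- I); clearbody I; lra.
Qed.

Lemma Gam_nat_gt0 N : 0 < @Gam R (1 + N%:R).
Proof.
elim: N => [|N IH]; first by rewrite addr0 Gam_1.
by rewrite -natr1 addrA Gam_rec ?mulr_gt0// ltr_pwDl.
Qed.

Lemma Gam_gt0 a : 0 < a -> 0 < @Gam R a.
Proof.
have h1 x : 0 < x < 1 -> 0 < @Gam R x.
  (* Log-convexity bounds Gam 2 by a positive multiple of Gam (1 + x), so positivity on (0, 1) is
     inherited from an integer. *)
  move=> x01; have := Gam1p_lower x01 (lexx 0); rewrite /Gam1p !add0r.
  have := Gam_nat_gt0 1 => p0 p1.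
  have : 0 < (x + 1) `^ (1 - x) * Gam (1 + x) by apply: lt_le_trans p1.
  rewrite (addrC 1 x) Gam_rec; last by case/andP: x01.
  rewrite pmulr_rgt0; last by apply: powR_gt0; lra.
  by rewrite pmulr_rgt0//; case/andP: x01.
have h2 N x : 0 < x <= 1 -> 0 < @Gam R (x + N%:R).
  move=> /andP[x0]; rewrite le_eqVlt => /predU1P[->|x1]; first exact: Gam_nat_gt0.
  elim: N => [|N IH]; first by rewrite addr0 h1// x0.
  by rewrite -natr1 addrA Gam_rec ?mulr_gt0// ltr_wpDr.
move=> a0; have := archi_boundP (ltW a0); move: (Num.bound a) => N aN.
elim: N a a0 aN => [|N IH] a a0 aN; first by lra.
have [a1|a1] := leP a 1; first by have := h2 0%N a; rewrite addr0 a0 a1 => ->.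
have -> : a = (a - 1) + 1 by rewrite subrK.
rewrite Gam_rec; last by lra.
rewrite mulr_gt0//; first by lra.
by apply: IH; [lra|rewrite -natr1 in aN; lra].
Qed.

(** The goal is S a = 2 pi Gam (1 + 2 a) / Gam (1 + a)^2. Cleared of denominators it compares two
    functions obeying the same first-order recurrence. *)
Definition chordgamA a : R := S a * Gam1p a ^+ 2.
Definition chordgamB a : R := Gam1p (2 * a).

Lemma chordgamA_rec a : - 2^-1 < a -> chordgamA (a + 1) = 2 * (1 + 2 * a) * (1 + a) * chordgamA a.
Proof.
move=> a1; rewrite /chordgamA /Gam1p chordint_rec'//; have -> : 1 + (a + 1) = (1 + a) + 1 by ring.
rewrite Gam_rec; last by lra.
by rewrite /chordratio; field; apply/eqP; lra.
Qed.

Lemma chordgamB_rec a : - 2^-1 < a -> chordgamB (a + 1) = 2 * (1 + 2 * a) * (1 + a) * chordgamB a.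
Proof.
move=> a1; rewrite /chordgamB /Gam1p.
have -> : 1 + 2 * (a + 1) = (1 + 2 * a) + 1 + 1 by ring.
by rewrite Gam_rec; [rewrite Gam_rec; [ring|lra]|lra].
Qed.

Lemma chordint0 : S 0 = 2 * pi.
Proof.
rewrite /chordint; under eq_Rintegral do rewrite powRr0.
rewrite Rintegral_cst// mul1r /= lebesgue_measure_itv/= lte_fin twopi_gt0/=.
by rewrite subr0.
Qed.

Lemma chordgam_nat N : chordgamA N%:R = 2 * pi * chordgamB N%:R.
Proof.
elim: N => [|N IH]; first by rewrite /chordgamA /chordgamB /Gam1p chordint0 mulr0 addr0 Gam_1; ring.
have N0 : - 2^-1 < N%:R :> R by rewrite (lt_le_trans _ (ler0n _ _))// oppr_lt0 invr_gt0.
by rewrite -natr1 chordgamA_rec// chordgamB_rec// IH; ring.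
Qed.

Lemma chordgam_shift x N : - 2^-1 < x -> chordgamA (x + N%:R) * chordgamB x = chordgamB (x + N%:R) * chordgamA x.
Proof.
move=> x0; elim: N => [|N IH]; first by rewrite addr0 mulrC.
have N0 : - 2^-1 < x + N%:R by rewrite ltr_wpDr.
by rewrite -natr1 addrA chordgamA_rec// chordgamB_rec// -[LHS]mulrA IH; ring.
Qed.

Lemma affine_le0 (c K : R) : (forall N, c * (2 * N%:R + 1) <= K) -> c <= 0.
Proof.
move=> h; rewrite leNgt; apply/negP => c0.
have K0 : 0 <= K by apply: le_trans (h 0%N); rewrite mulr0 add0r mulr1 ltW.
have := archi_boundP (divr_ge0 K0 (ltW c0)); set N := Num.bound _.
rewrite ltr_pdivrMr// => hN; have := h N; have : 0 <= c * N%:R by rewrite mulr_ge0 ?ltW.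
lra.
Qed.

Lemma powR_sqr2 (c : R) : 2 `^ (2 * c) = 4 `^ c.
Proof.
have -> : (4 : R) = 2 `^ 2%:R by rewrite powR_mulrn//; ring.
by rewrite -powRrM.
Qed.

Section HalfStrip.
Variables (x n : R).
Hypotheses (x01 : 2^-1 < x < 1) (n0 : 0 <= n).

Let x01' : 0 < x < 1. Proof. by have := x01; lra. Qed.
(** In the range 1/2 < x < 1 both x and 2 x - 1 lie in (0, 1), so log-convexity applies to Gam at 1
    + x + n and, after one step of the recurrence, at 1 + 2 (x + n). *)
Let yP : exists2 y : R, 0 < y < 1 & 2 * x = 1 + y.
Proof. by exists (2 * x - 1); have := x01; lra. Qed.

Lemma chordint_ge0 (a : R) : 0 <= S a.
Proof. by apply: Rintegral_ge0 => *; rewrite powR_ge0. Qed.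

Lemma Gam1p_gt0 (a : R) : 0 <= a -> 0 < Gam1p a.
Proof. by move=> a0; apply: Gam_gt0; lra. Qed.

Let BE (y : R) : 0 < y < 1 -> 2 * x = 1 + y ->
  chordgamB (x + n) = (2 * n + 1 + y) * Gam1p (2 * n + y).
Proof.
move=> y01 xE; have n0_ := n0.
rewrite /chordgamB /Gam1p.
have -> : 1 + 2 * (x + n) = (1 + (2 * n + y)) + 1 by rewrite mulrDr xE; ring.
have h : 0 < 1 + (2 * n + y) by case/andP: y01 => ? ?; lra.
by rewrite Gam_rec// addrA (addrC 1).
Qed.

Lemma chordgamB_lower : chordgamB n * (2 * n + 1) `^ (2 * x) <= chordgamB (x + n).
Proof.
have n0_ := n0; have [y y01 xE] := yP.
have n2 : 0 <= 2 * n by lra.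
have h := Gam1p_lower y01 n2; rewrite Gam1p_rec// in h.
have g0 : 0 < Gam1p (2 * n) by exact: Gam1p_gt0.
rewrite (BE y01 xE) xE /chordgamB; clear xE.
have q0 : 0 < 2 * n + 1 by lra.
have p0 : 0 < 2 * n + y + 1 by lra.
move: h g0; set g := Gam1p _; set g' := Gam1p _; clearbody g g' => h g0.
have -> : 2 * n + 1 + y = (2 * n + y + 1) `^ y * (2 * n + y + 1) `^ (1 - y).
  rewrite -powRD ?(gt_eqF p0) ?implybT//; have -> : y + (1 - y) = 1 by ring.
  by rewrite powRr1 ?(ltW p0)//; ring.
rewrite powRD ?(gt_eqF q0) ?implybT// powRr1 ?(ltW q0)//.
rewrite [leLHS](_ : _ = (2 * n + 1) `^ y * ((2 * n + 1) * g)); last by ring.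
rewrite -[leRHS]mulrA.
apply: ler_pM => //; rewrite ?powR_ge0 ?mulr_ge0 ?ltW//.
have y0 : 0 < y by case/andP: y01.
by apply: gt0_ltr_powR; rewrite ?nnegrE ?ltW//; lra.
Qed.

Lemma chordgamB_upper : chordgamB (x + n) <= (2 * n + 2) `^ (2 * x) * chordgamB n.
Proof.
have n0_ := n0; have [y y01 xE] := yP.
have n2 : 0 <= 2 * n by lra.
have h := Gam1p_upper y01 n2.
have g0 : 0 < Gam1p (2 * n) by exact: Gam1p_gt0.
have g1 : 0 < Gam1p (2 * n + y) by apply: Gam1p_gt0; case/andP: y01 => ? _; lra.
rewrite (BE y01 xE) xE /chordgamB; clear xE.
have q0 : 0 < 2 * n + 2 by lra.
move: h g0 g1; set g := Gam1p _; set g' := Gam1p _; clearbody g g' => h g0 g1.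
rewrite powRD ?(gt_eqF q0) ?implybT// powRr1 ?(ltW q0)// -mulrA.
have c0 : 0 <= 2 * n + 1 + y by lra.
have c1 : 2 * n + 1 + y <= 2 * n + 2 by lra.
apply: ler_pM => //; first exact: ltW.
apply: le_trans h _; rewrite ler_wpM2r ?(ltW g1) ?(ltW g0)//.
by apply: ler_powR2; lra.
Qed.

Lemma chordgamA_upper : chordgamA (x + n) <= (2 * n + 2) `^ (2 * x) * chordgamA n.
Proof.
have n0_ := n0; have x01_ := x01.
have n1 : 0 < n + 1 by lra.
have nx : 0 <= n + x by lra.
have x0 : 0 <= x by lra.
have h1 := chordint_upper x01' n0.
have h2 := Gam1p_upper x01' n0.
have s0 := chordint_ge0 n.
have g0 : 0 <= Gam1p n by apply: ltW; exact: Gam1p_gt0.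
have g1 : 0 <= Gam1p (n + x) by apply: ltW; exact: Gam1p_gt0.
have h3 : S (n + x) <= 4 `^ x * S n.
  apply: le_trans h1 _; rewrite ler_wpM2r//.
  apply: ler_powR2; [exact: x0|exact: ltW (chordratio_gt0 n0)|exact: chordratio_le4].
rewrite /chordgamA (addrC x n).
have -> : (2 * n + 2) `^ (2 * x) * (S n * Gam1p n ^+ 2) = (4 `^ x * S n) * ((n + 1) `^ x * Gam1p n) ^+ 2.
  have -> : 2 * n + 2 = 2 * (n + 1) by ring.
  rewrite powRM ?(ltW n1)// powR_sqr2.
  have -> : (2 * x : R) = x + x by ring.
  by rewrite powRD ?(gt_eqF n1) ?implybT//; ring.
apply: ler_pM => //; [exact: chordint_ge0|exact: sqr_ge0|].
by apply: lerXn2r; rewrite ?nnegrE// mulr_ge0 ?powR_ge0.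
Qed.

(** Both factors are compared with their values at n + 1. The bounds [chordratio] <= 4 and n + x + 1
    <= n + 2 then merge into one power of 2 n + 4 = 2 (n + 2). *)
Lemma chordgamA_lower :
  chordratio n * (n + 1) ^+ 2 * (2 * n + 4) `^ (2 * x - 2) * chordgamA n <= chordgamA (x + n).
Proof.
have n0_ := n0; have x01_ := x01.
have n2 : 0 < n + 2 by lra.
have nx : 0 <= n + x by lra.
have x1 : 0 <= 1 - x by lra.
have m1 : 0 <= n + x + 1 by lra.
have m2 : n + x + 1 <= n + 2 by lra.
have n1 : 0 <= n + 1 by lra.
have h1 := chordint_lower x01' n0; have h2 := Gam1p_lower x01' n0.
have Sn := chordint_ge0 n.
have Gn : 0 <= Gam1p n by apply: ltW; exact: Gam1p_gt0.
have g1 : 0 <= Gam1p (n + x) by apply: ltW; exact: Gam1p_gt0.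
have xm : x - 1 = - (1 - x) by ring.
have k1 : chordratio n * 4 `^ (x - 1) * S n <= S (n + x).
  rewrite chordint_rec' in h1; last by apply: lt_le_trans n0; rewrite oppr_lt0 invr_gt0.
  have r4 : chordratio (n + x) `^ (1 - x) <= 4 `^ (1 - x).
    by apply: ler_powR2 => //; [exact: ltW (chordratio_gt0 nx)|exact: chordratio_le4].
  rewrite xm powRN mulrAC ler_pdivrMr ?powR_gt0//; apply: le_trans h1 _.
  by rewrite [leRHS]mulrC ler_wpM2r// chordint_ge0.
have k2 : (n + 1) * (n + 2) `^ (x - 1) * Gam1p n <= Gam1p (n + x).
  rewrite Gam1p_rec// in h2.
  have r4 := ler_powR2 x1 m1 m2.
  rewrite xm powRN mulrAC ler_pdivrMr ?powR_gt0//; apply: le_trans h2 _.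
  by rewrite [leRHS]mulrC ler_wpM2r.
rewrite /chordgamA (addrC x n).
rewrite [leLHS](_ : _ = (chordratio n * 4 `^ (x - 1) * S n) * ((n + 1) * (n + 2) `^ (x - 1) * Gam1p n) ^+ 2); last first.
  have -> : 2 * n + 4 = 2 * (n + 2) by ring.
  rewrite powRM ?(ltW n2)//; have -> : 2 * x - 2 = 2 * (x - 1) by ring.
  rewrite powR_sqr2; have -> : (2 * (x - 1) : R) = (x - 1) + (x - 1) by ring.
  by rewrite (@powRD _ (n + 2)) ?(gt_eqF n2) ?implybT//; ring.
have c0 := ltW (chordratio_gt0 n0).
apply: ler_pM => //; [apply: mulr_ge0 => //; apply: mulr_ge0 => //; exact: powR_ge0|exact: sqr_ge0|].
by apply: lerXn2r; rewrite ?nnegrE// !mulr_ge0 ?powR_ge0.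
Qed.

(** Replaces a real power by a rational function of [n]: the quotient is at least 1 and 2 x <= 2, so
    its square dominates. *)
Lemma pow_ratio_upper :
  (2 * n + 2) `^ (2 * x) <= (2 * n + 1) `^ (2 * x) * ((2 * n + 2) / (2 * n + 1)) ^+ 2.
Proof.
have n0_ := n0; have x01_ := x01.
have q0 : 0 < 2 * n + 1 by lra.
have t1 : 1 <= (2 * n + 2) / (2 * n + 1) by rewrite ler_pdivlMr//; lra.
have e : 2 * n + 2 = (2 * n + 1) * ((2 * n + 2) / (2 * n + 1)) by rewrite [RHS]mulrC divfK ?gt_eqF.
move: t1 e; set t := _ / _; clearbody t => t1 e; rewrite e.
have t0 : 0 <= t by lra.
rewrite powRM ?(ltW q0)// ler_wpM2l ?powR_ge0// -powR_mulrn//.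
by apply: ler_powR => //; rewrite -[2%:R]/(2 : R); lra.
Qed.

(** The counterpart from below, where the exponent 2 x - 2 is at least -1. *)
Lemma pow_ratio_lower :
  (2 * n + 2) `^ (2 * x) <= (2 * n + 4) `^ (2 * x - 2) * ((2 * n + 2) * (2 * n + 4)).
Proof.
have n0_ := n0; have x01_ := x01.
have q0 : 0 < 2 * n + 2 by lra.
have t1 : 1 <= (2 * n + 4) / (2 * n + 2) by rewrite ler_pdivlMr//; lra.
have e : 2 * n + 4 = (2 * n + 2) * ((2 * n + 4) / (2 * n + 2)) by rewrite [RHS]mulrC divfK ?gt_eqF.
move: t1 e; set t := _ / _; clearbody t => t1 e; rewrite e.
have t0 : 0 < t by lra.
rewrite powRM ?(ltW q0) ?(ltW t0)//.
have h : t `^ (- 1) <= t `^ (2 * x - 2) by apply: ler_powR => //; lra.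
rewrite powR_inv1 ?(ltW t0)// in h.
have -> : 2 * x = (2 * x - 2) + 2%:R by rewrite -[2%:R]/(2 : R); ring.
rewrite powRD ?(gt_eqF q0) ?implybT// addrK powR_mulrn ?(ltW q0)//.
rewrite -!mulrA ler_wpM2l ?powR_ge0//.
have t2 : 0 <= (2 * n + 2) * ((2 * n + 2) * t) by rewrite !mulr_ge0 ?ltW.
apply: le_trans (ler_wpM2r t2 h).
rewrite le_eqVlt; apply/orP; left; apply/eqP; field; rewrite gt_eqF//.
Qed.

End HalfStrip.

(** Compare at x + N with the integer N, where the identity is known, then come back to x with the
    common recurrence. What is lost is a factor tending to 1 with N. *)
Lemma chordgam_le x N : 2^-1 < x < 1 ->
  chordgamA x * (2 * N%:R + 1) ^+ 2 <= 2 * pi * chordgamB x * (2 * N%:R + 2) ^+ 2.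
Proof.
move=> x01; have n0 : 0 <= N%:R :> R by [].
have xh : - 2^-1 < x by lra.
have x0 : 0 <= x by lra.
have Bx : 0 < chordgamB x by apply: Gam1p_gt0; lra.
have Bn : 0 < chordgamB N%:R by apply: Gam1p_gt0; rewrite mulr_ge0.
have Bxn : 0 < chordgamB (x + N%:R) by apply: Gam1p_gt0; rewrite mulr_ge0// addr_ge0.
have h1 := chordgamA_upper x01 n0; have h2 := chordgamB_lower x01 n0.
have h3 := pow_ratio_upper x01 n0; have sh := chordgam_shift N xh.
rewrite chordgam_nat in h1.
have pi0 := @twopi_gt0 R; move: (2 * pi) pi0 h1 => p p0 h1.
have q0 : 0 < 2 * N%:R + 1 :> R by rewrite ltr_wpDl// mulr_ge0.
have h : chordgamA (x + N%:R) <= p * ((2 * N%:R + 2) / (2 * N%:R + 1)) ^+ 2 * chordgamB (x + N%:R).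
  apply: le_trans h1 _.
  apply: le_trans (ler_wpM2r _ h3) _; first by rewrite mulr_ge0 ?ltW.
  rewrite [leLHS](_ : _ = p * ((2 * N%:R + 2) / (2 * N%:R + 1)) ^+ 2 * (chordgamB N%:R * (2 * N%:R + 1) `^ (2 * x))); last by ring.
  by rewrite ler_wpM2l// mulr_ge0 ?sqr_ge0 ?ltW.
rewrite -ler_pdivlMr ?exprn_gt0// -(ler_pM2l Bxn) -sh.
apply: le_trans (ler_wpM2r (ltW Bx) h) _; rewrite expr_div_n le_eqVlt.
by apply/orP; left; apply/eqP; ring.
Qed.

Lemma chordgam_ge x N : 2^-1 < x < 1 ->
  2 * pi * chordgamB x * (2 * N%:R + 1) <= chordgamA x * (2 * N%:R + 4).
Proof.
move=> x01; have n0 : 0 <= N%:R :> R by [].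
have xh : - 2^-1 < x by lra.
have x0 : 0 <= x by lra.
have Bx : 0 < chordgamB x by apply: Gam1p_gt0; lra.
have Bn : 0 < chordgamB N%:R by apply: Gam1p_gt0; rewrite mulr_ge0.
have Bxn : 0 < chordgamB (x + N%:R) by apply: Gam1p_gt0; rewrite mulr_ge0// addr_ge0.
have h1 := chordgamA_lower x01 n0; have h2 := chordgamB_upper x01 n0.
have h3 := pow_ratio_lower x01 n0; have sh := chordgam_shift N xh.
rewrite chordgam_nat in h1.
have pi0 := @twopi_gt0 R; move: (2 * pi) pi0 h1 => p p0 h1.
have q0 : 0 < 2 * N%:R + 1 :> R by rewrite ltr_wpDl// mulr_ge0.
have q4 : 0 < 2 * N%:R + 4 :> R by rewrite ltr_wpDl// mulr_ge0.
have n1 : (N%:R : R) + 1 != 0 by rewrite gt_eqF// ltr_wpDl.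
have n1' : 1 + (N%:R : R) != 0 by rewrite addrC.
have h : p * (2 * N%:R + 1) * chordgamB (x + N%:R) <= chordgamA (x + N%:R) * (2 * N%:R + 4).
  apply: le_trans (ler_wpM2r (ltW q4) h1).
  have hB := le_trans h2 (ler_wpM2r (ltW Bn) h3).
  have c0 : 0 <= p * (2 * N%:R + 1) by rewrite mulr_ge0 ?ltW.
  apply: le_trans (ler_wpM2l c0 hB) _.
  by rewrite le_eqVlt; apply/orP; left; apply/eqP; rewrite /chordratio; field.
rewrite -(ler_pM2l Bxn) [leRHS]mulrA -sh [leRHS]mulrAC.
apply: le_trans (ler_wpM2r (ltW Bx) h).
by rewrite le_eqVlt; apply/orP; left; apply/eqP; ring.
Qed.

(* [chordgamA / chordgamB] is 1-periodic, equals [2 * pi] at the integers, and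
   log-convexity squeezes it between them *)
Lemma chordgam_half x : 2^-1 < x < 1 -> chordgamA x = 2 * pi * chordgamB x.
Proof.
move=> x01; have lo N := chordgam_ge N x01; have up N := chordgam_le N x01.
have pB : 0 < 2 * pi * chordgamB x by rewrite mulr_gt0 ?twopi_gt0//; apply: Gam1p_gt0; lra.
move: (2 * pi * chordgamB x) (chordgamA x) lo up pB => b a lo up pB.
apply/eqP; rewrite eq_le; apply/andP; split; rewrite -subr_le0.
  (* With q = 2 N + 1 the bound reads a q^2 <= b (q + 1)^2, hence (a - b) q <= 2 b + b / q <= 4
     b. *)
  apply: (@affine_le0 _ (4 * b)) => N.
  have n0 : 0 <= N%:R :> R by []; move: (up N) n0; move: (N%:R : R) => n h n0.
  have q0 : 0 < 2 * n + 1 by lra.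
  rewrite -(ler_pM2r q0); nra.
apply: (@affine_le0 _ (3 * a)) => N; have := lo N; lra.
Qed.

(** The point 1 - be lies in (1/2, 1), where the identity is known; one step of the recurrence,
    valid since -be > -1/2, brings it down to -be. *)
Lemma chordint_Gam (be : R) : 0 < be < 2^-1 ->
  chordint (- be) = 2 * pi * (Gam (1 - 2 * be) / Gam (1 - be) ^+ 2).
Proof.
move=> b; have h : chordgamA (1 - be) = 2 * pi * chordgamB (1 - be) by apply: chordgam_half; lra.
have b1 : - 2^-1 < - be by lra.
have e : chordgamA (- be) = 2 * pi * chordgamB (- be).
  rewrite (addrC 1) chordgamA_rec// chordgamB_rec// in h.
  apply: (@mulfI _ (2 * (1 + 2 * (- be)) * (1 - be))); last by rewrite h; ring.
  by rewrite !mulf_neq0//; apply/eqP; lra.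
rewrite /chordgamA /chordgamB /Gam1p in e.
have g0 : 0 < @Gam R (1 - be) by apply: Gam_gt0; lra.
have -> : 1 - 2 * be = 1 + 2 * - be by ring.
by rewrite mulrA -e mulfK// sqrf_eq0 gt_eqF.
Qed.

End ChordGamma.

(** * Cosine moments of the kernel *)

Section KernelMoments.
Context {R : realType}.
Variable be : R.
Hypothesis beP : 0 < be < 2^-1.
Implicit Types (k n : nat).

(** The Fourier coefficients of [kap]; the eigenvalues of the linearized equation are built from
    their differences. *)
Definition gam k : R := cmom be 0 k / (2 * pi).

Lemma gam_rec k : (k.+1%:R - be) * gam k.+1 = (k%:R + be) * gam k.
Proof. by rewrite /gam !mulrA (cmom_rec beP). Qed.

Lemma sub1_be_gt0 k : 0 < k.+1%:R - be.
Proof. by have b := beP; rewrite -natr1; have : 0 <= k%:R :> R by []; lra. Qed.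

Lemma gam_succ k : gam k.+1 = (k%:R + be) / (k.+1%:R - be) * gam k.
Proof.
rewrite mulrAC -gam_rec mulrAC mulfV ?mul1r// gt_eqF//; exact: sub1_be_gt0.
Qed.

Lemma gam0E : gam 0 = Gam (1 - 2 * be) / Gam (1 - be) ^+ 2.
Proof.
rewrite /gam /cmom; under eq_Rintegral do rewrite mul0r add0r cos0 mul1r.
rewrite -[X in X / _]/(chordint (- be)) (chordint_Gam beP) mulrC mulKf//.
by rewrite gt_eqF// twopi_gt0.
Qed.

Lemma gam_gt0 k : 0 < gam k.
Proof.
have b := beP; elim: k => [|k IH].
  by rewrite gam0E divr_gt0 ?exprn_gt0// Gam_gt0//; lra.
rewrite gam_succ mulr_gt0// divr_gt0 ?sub1_be_gt0//.
by have : 0 <= k%:R :> R by []; lra.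
Qed.

Lemma gam_decr k : gam k.+1 < gam k.
Proof.
have b := beP; rewrite gam_succ gtr_pMl ?gam_gt0// ltr_pdivrMr ?sub1_be_gt0//.
by rewrite mul1r -natr1; lra.
Qed.

Lemma gam_le k n : (k <= n)%N -> gam n <= gam k.
Proof.
elim: n => [|n IH]; first by rewrite leqn0 => /eqP ->.
rewrite leq_eqVlt => /predU1P[->//|kn].
by apply: le_trans (IH kn); exact: ltW (gam_decr _).
Qed.

(** The kernel is symmetric under eta -> 2 pi - eta. Here the vanishing starts at k = 0, where cos
    (- pi / 2) = 0, and propagates along the recurrence. *)
Lemma smom0 k : cmom be (- (pi / 2)) k = 0.
Proof.
elim: k => [|k IH].
  rewrite /cmom; under eq_Rintegral do rewrite mul0r add0r cosN cos_pihalf mul0r.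
  by rewrite Rintegral_cst// mul0r.
have := cmom_rec beP (- (pi / 2)) k; rewrite IH mulr0 => /eqP.
by rewrite mulf_eq0 gt_eqF ?sub1_be_gt0//= => /eqP.
Qed.

Lemma gam_Gam k :
  gam k * (Gam be * Gam (k%:R + 1 - be)) = gam 0 * (Gam (k%:R + be) * Gam (1 - be)).
Proof.
have b := beP; elim: k => [|k IH]; first by rewrite !add0r.
have h0 : 0 < k%:R + 1 - be by have := sub1_be_gt0 k; rewrite -natr1.
have h1 : 0 < k%:R + be by have : 0 <= k%:R :> R by []; lra.
rewrite -natr1; have -> : k%:R + 1 + 1 - be = k%:R + 1 - be + 1 by ring.
have -> : k%:R + 1 + be = k%:R + be + 1 by ring.
rewrite !Gam_rec//; have := gam_rec k; rewrite -natr1 => e.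
rewrite [LHS](_ : _ = ((k%:R + 1 - be) * gam k.+1) * (Gam be * Gam (k%:R + 1 - be))); last by ring.
by rewrite e -[LHS]mulrA IH; ring.
Qed.

Lemma Gamma_Gam (x : R) : Gamma x = Gam x.
Proof. by []. Qed.

Lemma Calpha_gt0 : 0 < Calpha (2 * be).
Proof.
have b := beP; rewrite /Calpha !Gamma_Gam divr_gt0// ?mulr_gt0 ?powR_gt0 ?Gam_gt0//; lra.
Qed.

(** The Gamma quotients in [Omega_m] are Fourier coefficients of the kernel in disguise. In this
    form growth in [n] is just the decrease of [gam]. *)
Lemma Omega_mE n : Omega_m (2 * be) n = Calpha (2 * be) * (gam 1 - gam n).
Proof.
have b := beP; rewrite /Omega_m /Calpha !Gamma_Gam.
have -> : 2 * be / 2 = be by field.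
have -> : (2 - 2 * be) / 2 = 1 - be by field.
have g k : gam k = gam 0 * (Gam (k%:R + be) * Gam (1 - be)) / (Gam be * Gam (k%:R + 1 - be)).
  have k0 : 0 <= k%:R :> R by [].
  by rewrite -gam_Gam mulfK// mulf_neq0// gt_eqF// Gam_gt0//; lra.
have e2 : 2 - be = 1%:R + 1 - be by rewrite -[1%:R]/(1 : R); ring.
rewrite (g 1%N) (g n) gam0E e2 -[1 + be]/(1%:R + be).
have n0 : 0 <= n%:R :> R by [].
have p1 : Gam (1 - be) != 0 by rewrite gt_eqF// Gam_gt0//; lra.
have p2 : Gam be != 0 by rewrite gt_eqF// Gam_gt0//; lra.
have p3 : Gam (1%:R + 1 - be) != 0 by rewrite -e2 gt_eqF// Gam_gt0//; lra.
have p4 : Gam (n%:R + 1 - be) != 0 by rewrite gt_eqF// Gam_gt0//; lra.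
have p5 : 2 `^ (1 - 2 * be) != 0 :> R by rewrite gt_eqF// powR_gt0.
move: p1 p2 p3 p4 p5; move: (Gam (1 - be)) (Gam be) (Gam (1%:R + 1 - be)) (Gam (n%:R + 1 - be)) (2 `^ (1 - 2 * be)) (Gam (1%:R + be)) (Gam (n%:R + be)) (Gam (1 - 2 * be)) => q1 q2 q3 q4 q5 q6 q7 q8 p1 p2 p3 p4 p5.
by field; rewrite ?p1 ?p2 ?p3 ?p4 ?p5.
Qed.

End KernelMoments.

(** * Binomial series of a negative power *)

Section Binomial.
Context {R : realType}.
Variable be : R.
Hypothesis beP : 0 < be < 2^-1.
Implicit Types (x : R) (n k : nat).

Fixpoint bincoef n : R :=
  if n is k.+1 then - bincoef k * ((k%:R + be) / k.+1%:R) else 1.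

Lemma bincoef_rec k : k.+1%:R * bincoef k.+1 = - (k%:R + be) * bincoef k.
Proof.
rewrite [bincoef k.+1]/=; have := pnatr_eq0 R k.+1.
by move: (k.+1%:R : R) => q /negbT q0; field.
Qed.

Lemma bincoef_le1 k : `|bincoef k| <= 1.
Proof.
elim: k => [|k IH]; first by rewrite normr1.
have b := beP; have k0 : 0 <= k%:R :> R by [].
rewrite [bincoef _]/= normrM normrN mulr_ile1// ger0_norm.
  by rewrite ler_pdivrMr ?ltr0n// mul1r -natr1; lra.
by rewrite divr_ge0//; lra.
Qed.

Arguments bincoef : simpl never.

Definition binpoly n x : R := \sum_(k < n) bincoef k * x ^+ k.

Lemma dX n x : hasD (fun t => t ^+ n) x (n%:R * x ^+ n.-1).
Proof.
elim: n => [|n IH].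
  by rewrite mul0r; apply: (@deq _ _ _ 0); [exact: (dC x 1)|].
have h : hasD (fun t : R => t * t ^+ n) x (1 * x ^+ n + x * (n%:R * x ^+ n.-1)).
  exact: dM (dI x) IH.
suff -> : n.+1%:R * x ^+ n.+1.-1 = 1 * x ^+ n + x * (n%:R * x ^+ n.-1).
  by rewrite (_ : (fun t => t ^+ n.+1) = fun t => t * t ^+ n)//; apply/funext => t; rewrite exprS.
case: n {IH h} => [|n] /=; first by rewrite expr0; ring.
by rewrite -[in LHS]natr1 exprS; ring.
Qed.

Lemma dsum (f : nat -> R -> R) (d : nat -> R) x n :
  (forall k, hasD (f k) x (d k)) ->
  hasD (fun t => \sum_(k < n) f k t) x (\sum_(k < n) d k).
Proof.
move=> h; elim: n => [|n IH].
  rewrite big_ord0 (_ : (fun t => _) = fun _ : R => 0); first exact: dC.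
  by apply/funext => t; rewrite big_ord0.
rewrite big_ord_recr (_ : (fun t => _) = fun t => \sum_(k < n) f k t + f n t).
  exact: dD.
by apply/funext => t; rewrite big_ord_recr.
Qed.

(* the partial sums solve the ODE [(1 + x) y' + be y = 0] of [(1 + x)^(-be)] up
   to one monomial *)
Lemma binpoly_ode n x :
  (1 + x) * (\sum_(k < n.+1) bincoef k * (k%:R * x ^+ k.-1)) + be * binpoly n.+1 x =
  - (n.+1%:R * bincoef n.+1 * x ^+ n).
Proof.
elim: n => [|n IH].
  by rewrite /binpoly !big_ord_recr !big_ord0 bincoef_rec/= expr0; ring.
rewrite /binpoly big_ord_recr [X in be * X]big_ord_recr/= -/(binpoly n.+1 x).
rewrite [LHS](_ : _ = ((1 + x) * (\sum_(k < n.+1) bincoef k * (k%:R * x ^+ k.-1)) + be * binpoly n.+1 x) + ((1 + x) * (bincoef n.+1 * (n.+1%:R * x ^+ n)) + be * (bincoef n.+1 * x ^+ n.+1))); last by ring.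
by rewrite IH (bincoef_rec n.+1) exprS; ring.
Qed.

Lemma binpoly_der n x :
  hasD (binpoly n) x (\sum_(k < n) bincoef k * (k%:R * x ^+ k.-1)).
Proof.
apply: (@dsum (fun k t => bincoef k * t ^+ k)
  (fun k => bincoef k * (k%:R * x ^+ k.-1))) => k; apply: deq.
  by apply: dM; [exact: dC|exact: dX].
by rewrite mul0r add0r.
Qed.

Lemma mean_value (F d : R -> R) (K a b : R) :
  (forall x, Num.min a b <= x <= Num.max a b -> hasD F x (d x)) ->
  (forall x, Num.min a b <= x <= Num.max a b -> `|d x| <= K) ->
  `|F b - F a| <= K * `|b - a|.
Proof.
wlog ab : a b / a <= b.
  move=> H; case/orP: (le_total a b) => ab; first exact: H.
  by rewrite minC maxC distrC (distrC b); exact: H.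
rewrite min_l// max_r// => hd hK; move: ab; rewrite le_eqVlt => /predU1P[->|ab].
  by rewrite !subrr normr0 mulr0.
have hd' (x : R) : x \in `]a, b[%R -> is_derive x 1 F (d x).
  by rewrite in_itv/= => /andP[/ltW h1 /ltW h2]; apply: hd; rewrite h1 h2.
have hc : {within `[a, b]%classic, continuous F}.
  by apply: within_cont => x /=; rewrite in_itv/= => h; apply: dcont; exact: hd.
have [c cab ->] := MVT ab hd' hc.
move: cab; rewrite in_itv/= => /andP[/ltW h1 /ltW h2].
by rewrite normrM ler_wpM2r// hK// h1 h2.
Qed.

(** Multiply the partial sum by (1 + x)^be. By [binpoly_ode] the product has a single monomial times
    (1 + t)^(be - 1) as derivative, so it stays close to its value 1 at 0. For |x| <= 1/2 the powers
    (1 + t)^(be - 1) and (1 + x)^(-be) are each at most 2, hence the 4. *)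
Lemma binpoly_approx n x : `|x| <= 2^-1 ->
  `|(1 + x) `^ (- be) - binpoly n.+1 x| <= 4 * n.+1%:R * 2^-1 ^+ n.
Proof.
move=> xh; have b := beP.
pose F t := (1 + t) `^ be * binpoly n.+1 t.
pose d t := - ((1 + t) `^ (be - 1) * (n.+1%:R * bincoef n.+1 * t ^+ n)).
have pos (t : R) : `|t| <= 2^-1 -> 2^-1 <= 1 + t.
  by rewrite ler_norml => /andP[h _]; lra.
have bet (t : R) : Num.min 0 x <= t <= Num.max 0 x -> `|t| <= 2^-1.
  move=> /andP[]; rewrite ge_min le_max => h1 h2.
  move: xh; rewrite !ler_norml => /andP[x1 x2].
  by case/orP: h1 => ?; case/orP: h2 => ?; apply/andP; split; lra.
have hd (t : R) : Num.min 0 x <= t <= Num.max 0 x -> hasD F t (d t).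
  move=> /bet th; have t0 := pos t th; have t1 : 0 < 1 + t by lra.
  apply: deq; first apply: dM (binpoly_der _ _).
    by apply: dpow; [exact: t1|apply: dD; [exact: dC|exact: dI]].
  rewrite /d -mulrN -(binpoly_ode n t) /=.
  have -> : (1 + t) `^ be = (1 + t) `^ (be - 1) * (1 + t).
    by rewrite -[X in _ * X](powRr1 (ltW t1)) -powRD ?subrK// (gt_eqF t1) implybT.
  ring.
have pw (t : R) : `|t| <= 2^-1 -> (1 + t) `^ (be - 1) <= 2.
  move=> /pos t0; have t1 : 0 < 1 + t by lra.
  have -> : be - 1 = - (1 - be) by ring.
  rewrite powRN -[leRHS]invrK lef_pV2 ?posrE ?powR_gt0 ?invr_gt0//.
  apply: (@le_trans _ _ (2^-1 `^ (1 - be))).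
    rewrite -{1}(@powRr1 _ (2^-1 : R)) ?invr_ge0//; apply: ger_powR; last by lra.
    by rewrite invr_gt0 ltr0n/= invf_le1 ?ler1n.
  by apply: ler_powR2 => //; lra.
have hK (t : R) : Num.min 0 x <= t <= Num.max 0 x -> `|d t| <= 2 * (n.+1%:R * 2^-1 ^+ n).
  move=> /bet th; rewrite normrN normrM (ger0_norm (powR_ge0 _ _)).
  rewrite (normrM (n.+1%:R * bincoef n.+1)) (normrM n.+1%:R) normr_nat normrX -mulrA.
  apply: ler_pM; rewrite ?powR_ge0 ?pw ?mulr_ge0 ?exprn_ge0// ler_wpM2l//.
  rewrite -[leRHS]mul1r; apply: ler_pM; rewrite ?exprn_ge0 ?bincoef_le1//.
  by apply: lerXn2r; rewrite ?nnegrE ?invr_ge0.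
have := mean_value hd hK.
have -> : F 0 = 1.
  rewrite /F addr0 powR1 mul1r /binpoly big_ord_recl big1 ?addr0 ?expr0 ?mulr1//.
  by move=> i _; rewrite exprS mul0r mulr0.
rewrite subr0 => h.
have t0 := pos x xh; have t1 : 0 < 1 + x by lra.
have -> : (1 + x) `^ (- be) - binpoly n.+1 x = - ((1 + x) `^ (- be) * (F x - 1)).
  rewrite /F mulrBr mulrA -powRD ?(gt_eqF t1) ?implybT//.
  by rewrite (_ : - be + be = 0) ?powRr0 ?mul1r; ring.
rewrite normrN normrM (ger0_norm (powR_ge0 _ _)).
have p2 : (1 + x) `^ (- be) <= 2.
  rewrite powRN -[leRHS]invrK lef_pV2 ?posrE ?powR_gt0 ?invr_gt0//.
  apply: (@le_trans _ _ (2^-1 `^ be)).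
    rewrite -{1}(@powRr1 _ (2^-1 : R)) ?invr_ge0//; apply: ger_powR; last by lra.
    by rewrite invr_gt0 ltr0n/= invf_le1 ?ler1n.
  by apply: ler_powR2 => //; lra.
have -> : 4 * n.+1%:R * 2^-1 ^+ n = 2 * (2 * (n.+1%:R * 2^-1 ^+ n)) :> R by ring.
apply: ler_pM; rewrite ?powR_ge0//.
apply: le_trans h _; rewrite -[leRHS]mulr1 ler_wpM2l ?mulr_ge0 ?exprn_ge0 ?invr_ge0//.
by apply: le_trans xh _; rewrite invf_le1 ?ler1n.
Qed.

Lemma geom_lin_cvg : (fun n => 4 * n.+1%:R * 2^-1 ^+ n : R) @ \oo --> (0 : R).
Proof.
have h n : n.+1%:R * n%:R <= 4 * 2 ^+ n :> R.
  rewrite -natrX -!natrM ler_nat; elim: n => // n IH.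
  by rewrite expnS; have := ltn_expl n (isT : 1 < 2)%N; nia.
apply: (@dom_cvg0 _ _ \oo _ _ (fun n => harmonic n) 32); last exact: cvg_harmonic.
near=> n; rewrite ger0_norm ?mulr_ge0 ?exprn_ge0 ?invr_ge0// /harmonic/=.
have n0 : (0 < n)%N by near: n; exists 1%N.
rewrite exprVn ler_pdivrMr ?exprn_gt0// mulrAC ler_pdivlMr ?ltr0n//.
rewrite -mulrA; have := h n; have : n.+1%:R <= 2 * n%:R :> R by rewrite -natrM ler_nat; lia.
move: (n.+1%:R : R) (ler0n R n.+1) => p p0 h1 h2.
have : p * p <= p * (2 * n%:R) by rewrite ler_wpM2l.
lra.
Unshelve. all: by end_near. Qed.

End Binomial.

#[global] Arguments bincoef {R} be n : simpl never.

(** * Wiener algebra *)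

Section WienerClass.
Context {R : realType}.
Implicit Types (th et M e : R).

(* a term [((c, a), (j, l))] stands for [c cos (j th + l et + a)] *)
Definition trig : Type := ((R * R) * (int * int))%type.
Implicit Types (t u : trig) (s : seq trig).

Definition tev t th et : R := t.1.1 * cos (t.2.1%:~R * th + t.2.2%:~R * et + t.1.2).
(** The second variable is only integrated out against the kernel, so its frequency carries no
    weight. Adding 1 to |j| makes the weight submultiplicative. *)
Definition twt t : R := `|t.1.1| * (`|t.2.1%:~R| + 1).
Definition ev s th et : R := \sum_(t <- s) tev t th et.
Definition wn s : R := \sum_(t <- s) twt t.

(* functions of norm at most M in the Wiener algebra whose weight is one
   derivative in the first variable *)
Definition wiener M (f : R -> R -> R) : Prop := forall e, 0 < e ->
  exists2 s, wn s <= M & forall th et, `|f th et - ev s th et| <= e.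

Lemma twt_ge0 t : 0 <= twt t.
Proof. by rewrite mulr_ge0 ?addr_ge0. Qed.

Lemma wn_ge0 s : 0 <= wn s.
Proof. by apply: sumr_ge0 => t _; exact: twt_ge0. Qed.

Lemma tev_le t th et : `|tev t th et| <= twt t.
Proof.
rewrite normrM ler_wpM2l//; apply: le_trans (cos_max _) _.
by rewrite lerDr.
Qed.

Lemma ev_le s th et : `|ev s th et| <= wn s.
Proof.
by apply: le_trans (ler_norm_sum _ _ _) _; apply: ler_sum => t _; exact: tev_le.
Qed.

Lemma wiener_ge0 M f : wiener M f -> 0 <= M.
Proof. by move=> /(_ 1 ltr01)[s h _]; apply: le_trans h; exact: wn_ge0. Qed.

Lemma wiener_ev s : wiener (wn s) (ev s).
Proof. by move=> e e0; exists s => // th et; rewrite subrr normr0 ltW. Qed.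

Lemma wiener_le M M' f : wiener M f -> M <= M' -> wiener M' f.
Proof. by move=> h MM e /h[s h1 h2]; exists s => //; exact: le_trans MM. Qed.

Lemma wiener_ext M f g : wiener M f -> (forall th et, f th et = g th et) -> wiener M g.
Proof. by move=> h fg e /h[s h1 h2]; exists s => // th et; rewrite -fg. Qed.

Lemma wiener_bound M f th et : wiener M f -> `|f th et| <= M.
Proof.
move=> h; apply/ler_addgt0Pr => e /h[s h1 h2].
rewrite -[f th et](subrK (ev s th et)); apply: le_trans (ler_normD _ _) _.
by rewrite addrC lerD// (le_trans (ev_le _ _ _)).
Qed.

(** The class only asks for approximation by trigonometric sums of bounded weight, so a bound on the
    norm survives uniform limits. Power series and infinite sums of modes enter the class this
    way. *)
Lemma wiener_lim M f : (forall e, 0 < e ->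
  exists2 g, wiener M g & forall th et, `|f th et - g th et| <= e) -> wiener M f.
Proof.
move=> h e e0; have e2 : 0 < e / 2 by rewrite divr_gt0.
have [g gM fg] := h _ e2; have [s sM gs] := gM _ e2; exists s => // th et.
rewrite -[f th et](subrK (g th et)) -addrA; apply: le_trans (ler_normD _ _) _.
by rewrite (splitr e) lerD.
Qed.

Lemma ev_cat s1 s2 th et : ev (s1 ++ s2) th et = ev s1 th et + ev s2 th et.
Proof. by rewrite /ev big_cat. Qed.

Lemma wn_cat s1 s2 : wn (s1 ++ s2) = wn s1 + wn s2.
Proof. by rewrite /wn big_cat. Qed.

Lemma wienerD M1 M2 f g : wiener M1 f -> wiener M2 g ->
  wiener (M1 + M2) (fun th et => f th et + g th et).
Proof.
move=> hf hg e e0; have e2 : 0 < e / 2 by rewrite divr_gt0.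
have [s sM fs] := hf _ e2; have [s' sM' gs] := hg _ e2.
exists (s ++ s') => [|th et]; first by rewrite wn_cat lerD.
rewrite ev_cat opprD addrACA; apply: le_trans (ler_normD _ _) _.
by rewrite (splitr e) lerD.
Qed.

Definition scl (c : R) s : seq trig := [seq ((c * t.1.1, t.1.2), t.2) | t <- s].

Lemma ev_scl c s th et : ev (scl c s) th et = c * ev s th et.
Proof. by rewrite /ev big_map mulr_sumr; apply: eq_bigr => t _; rewrite /tev /= mulrA. Qed.

Lemma wn_scl c s : wn (scl c s) = `|c| * wn s.
Proof.
by rewrite /wn big_map mulr_sumr; apply: eq_bigr => t _; rewrite /twt /= normrM mulrA.
Qed.

Lemma wienerZ c M f : wiener M f -> wiener (`|c| * M) (fun th et => c * f th et).
Proof.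
move=> hf e e0; have c0 : 0 < `|c| + 1 by rewrite ltr_wpDl.
have /hf[s sM fs] : 0 < e / (`|c| + 1) by rewrite divr_gt0.
exists (scl c s) => [|th et]; first by rewrite wn_scl ler_wpM2l.
rewrite ev_scl -mulrBr normrM; apply: le_trans (ler_wpM2l (normr_ge0 _) (fs _ _)) _.
by rewrite mulrCA ler_piMr ?(ltW e0)// ler_pdivrMr// mul1r lerDl.
Qed.

Lemma wienerN M f : wiener M f -> wiener M (fun th et => - f th et).
Proof.
move=> h; have := wienerZ (-1) h; rewrite normrN normr1 mul1r.
by move=> /wiener_ext; apply => th et; rewrite mulN1r.
Qed.

Lemma wienerB M1 M2 f g : wiener M1 f -> wiener M2 g ->
  wiener (M1 + M2) (fun th et => f th et - g th et).
Proof. by move=> hf hg; exact: wienerD hf (wienerN hg). Qed.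

Lemma wiener0 : wiener 0 (fun _ _ => 0).
Proof.
have := wiener_ev [::]; rewrite /wn big_nil => /wiener_ext; apply => th et.
by rewrite /ev big_nil.
Qed.

Lemma wiener_sum n (M : nat -> R) (f : nat -> R -> R -> R) :
  (forall k, (k < n)%N -> wiener (M k) (f k)) ->
  wiener (\sum_(k < n) M k) (fun th et => \sum_(k < n) f k th et).
Proof.
elim: n => [|n IH] h.
  by rewrite big_ord0; apply: wiener_ext wiener0 _ => th et; rewrite big_ord0.
rewrite big_ord_recr/=; apply: wiener_ext (wienerD (IH _) (h n _)) _ => //.
  by move=> k kn; apply: h; exact: ltnW.
by move=> th et; rewrite big_ord_recr.
Qed.

Definition trigM t u : seq trig :=
  [:: ((t.1.1 * u.1.1 / 2, t.1.2 + u.1.2), (t.2.1 + u.2.1, t.2.2 + u.2.2));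
      ((t.1.1 * u.1.1 / 2, t.1.2 - u.1.2), (t.2.1 - u.2.1, t.2.2 - u.2.2))].

Lemma ev_trigM t u th et : ev (trigM t u) th et = tev t th et * tev u th et.
Proof.
rewrite /ev /trigM !big_cons big_nil /tev /= !intrD !intrN.
set A := _ * th + _ * et + t.1.2; set B := _ * th + _ * et + u.1.2.
rewrite (_ : _ + _ + (t.1.2 + u.1.2) = A + B); last by rewrite /A /B; ring.
rewrite (_ : _ + _ + (t.1.2 - u.1.2) = A - B); last by rewrite /A /B; ring.
by rewrite cosD cosB; field.
Qed.

(** The product formula halves the amplitude of each of the two terms, and 1 + |j| + |k| <= (1 +
    |j|)(1 + |k|). *)
Lemma wn_trigM t u : wn (trigM t u) <= twt t * twt u.
Proof.
rewrite /wn /trigM !big_cons big_nil /twt /= !intrD !intrN.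
set j := _%:~R; set k := _%:~R.
have h1 : `|j + k| <= `|j| + `|k| by exact: ler_normD.
have h2 : `|j - k| <= `|j| + `|k| by exact: ler_normB.
have c0 : `|t.1.1 * u.1.1 / 2| = `|t.1.1| * `|u.1.1| / 2.
  by rewrite !normrM normfV (ger0_norm (ler0n R 2)).
rewrite !c0 addr0.
rewrite [leRHS](_ : _ = `|t.1.1| * `|u.1.1| / 2 * (2 * ((`|j| + 1) * (`|k| + 1)))); last by field.
rewrite -mulrDr ler_wpM2l ?divr_ge0 ?mulr_ge0//.
have : 0 <= `|j| * `|k| by rewrite mulr_ge0.
lra.
Qed.

Definition evM s1 s2 : seq trig :=
  flatten [seq flatten [seq trigM t u | u <- s2] | t <- s1].

Lemma ev_evM s1 s2 th et : ev (evM s1 s2) th et = ev s1 th et * ev s2 th et.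
Proof.
rewrite /ev /evM big_flatten big_map mulr_suml; apply: eq_bigr => t _.
rewrite big_flatten big_map mulr_sumr; apply: eq_bigr => u _.
exact: ev_trigM.
Qed.

Lemma wn_evM s1 s2 : wn (evM s1 s2) <= wn s1 * wn s2.
Proof.
rewrite /wn /evM big_flatten big_map mulr_suml; apply: ler_sum => t _.
rewrite big_flatten big_map mulr_sumr; apply: ler_sum => u _.
exact: wn_trigM.
Qed.

Lemma wienerM M1 M2 f g : wiener M1 f -> wiener M2 g ->
  wiener (M1 * M2) (fun th et => f th et * g th et).
Proof.
move=> hf hg; have m1 := wiener_ge0 hf; have m2 := wiener_ge0 hg.
move=> e e0; have c0 : 0 < M1 + M2 + 1 by rewrite ltr_wpDl// addr_ge0.
have e1 : 0 < e / (M1 + M2 + 1) by rewrite divr_gt0.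
have [s sM fs] := hf _ e1; have [s' sM' gs] := hg _ e1.
exists (evM s s') => [|th et].
  by apply: le_trans (wn_evM _ _) _; apply: ler_pM => //; exact: wn_ge0.
rewrite ev_evM.
rewrite (_ : _ - _ = (f th et - ev s th et) * g th et + ev s th et * (g th et - ev s' th et)); last by ring.
apply: le_trans (ler_normD _ _) _; rewrite !normrM.
have h1 : `|f th et - ev s th et| * `|g th et| <= e / (M1 + M2 + 1) * M2.
  by apply: ler_pM => //; exact: wiener_bound.
have h2 : `|ev s th et| * `|g th et - ev s' th et| <= M1 * (e / (M1 + M2 + 1)).
  by apply: ler_pM => //; apply: le_trans (ev_le _ _ _) _.
apply: le_trans (lerD h1 h2) _; rewrite (mulrC M1) -mulrDr mulrAC ler_pdivrMr//.
by rewrite ler_wpM2l ?ltW//; lra.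
Qed.

Lemma wienerX M f n : wiener M f -> wiener (M ^+ n) (fun th et => f th et ^+ n).
Proof.
move=> hf; elim: n => [|n IH].
  have -> : M ^+ 0 = wn [:: ((1, 0), (0, 0))].
    by rewrite expr0 /wn big_seq1 /twt /= normr1 normr0 add0r mulr1.
  apply: wiener_ext (wiener_ev _) _ => th et.
  by rewrite /ev big_seq1 /tev /= !mul0r !add0r cos0 mulr1 expr0.
rewrite exprS; apply: wiener_ext (wienerM hf IH) _ => th et.
by rewrite exprS.
Qed.

Lemma wienerXB (r d : R) f g n : wiener r f -> wiener r g ->
  wiener d (fun th et => f th et - g th et) ->
  wiener (n%:R * r ^+ n.-1 * d) (fun th et => f th et ^+ n - g th et ^+ n).
Proof.
move=> hf hg hd; have r0 := wiener_ge0 hf; have d0 := wiener_ge0 hd.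
elim: n => [|n IH].
  by rewrite !mul0r; apply: wiener_ext wiener0 _ => th et; rewrite !expr0 subrr.
have h := wienerD (wienerM hd (wienerX n hf)) (wienerM hg IH).
apply: wiener_le (wiener_ext h _) _ => [th et|]; first by rewrite /= !exprS; ring.
rewrite le_eqVlt; apply/orP; left; apply/eqP => /=.
case: n {IH h} => [|n] /=; first by rewrite !expr0; ring.
by rewrite -[in RHS]natr1 exprS; ring.
Qed.

Section BinomialPower.
Variable be : R.
Hypothesis beP : 0 < be < 2^-1.

(** The series of (k + 2) 2^(-k) sums to 6, the constant of both remainder bounds: k + 2 comes from
    the Lipschitz constant of x^(k + 2), and 1/2 is the radius. *)
Let S2 n : R := \sum_(k < n) (k.+2%:R * 2^-1 ^+ k).
Let S2_le n : S2 n <= 6.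
Proof.
suff -> : S2 n = 6 - (2 * n%:R + 6) * 2^-1 ^+ n.
  by rewrite gerBl mulr_ge0 ?exprn_ge0 ?addr_ge0 ?mulr_ge0 ?invr_ge0.
rewrite /S2; elim: n => [|n IH]; first by rewrite big_ord0 expr0; ring.
by rewrite big_ord_recr/= IH exprS -!natr1; field.
Qed.

Let rem (x : R) : R := (1 + x) `^ (- be) - 1 + be * x.
Let prem n (x : R) : R := \sum_(k < n) bincoef be k.+2 * x ^+ k.+2.

Let premE n x : binpoly be n.+2 x - 1 + be * x = prem n x.
Proof.
elim: n => [|n IH].
  have := bincoef_rec be 0; rewrite mul1r add0r => e.
  rewrite /prem big_ord0 /binpoly !big_ord_recr big_ord0 /= e (_ : bincoef be 0 = 1) ?expr0 ?expr1//.
  by ring.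
by rewrite /prem big_ord_recr /= -/(prem n x) -IH /binpoly [in LHS]big_ord_recr /=; ring.
Qed.

Let near_prem (x : R) e : 0 < e -> exists n, forall x, `|x| <= 2^-1 -> `|rem x - prem n x| <= e.
Proof.
move=> e0; have /cvgrPdist_le /(_ e e0) [N _ hN] := geom_lin_cvg beP.
exists N => {}x xh; rewrite -premE /rem.
rewrite (_ : _ - _ = (1 + x) `^ (- be) - binpoly be N.+2 x); last by ring.
apply: le_trans (binpoly_approx beP N.+1 xh) _.
by have := hN N.+1 (leqnSn N); rewrite /= sub0r normrN ger0_norm// mulr_ge0 ?exprn_ge0 ?invr_ge0// mulr_ge0.
Qed.

Lemma wiener_pow_rem (r : R) f : r <= 2^-1 -> wiener r f ->
  wiener (6 * r ^+ 2) (fun th et => (1 + f th et) `^ (- be) - 1 + be * f th et).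
Proof.
move=> r2 hf; have r0 := wiener_ge0 hf.
apply: wiener_lim => e e0; have [n hn] := near_prem 0 e0.
exists (fun th et => prem n (f th et)); last first.
  by move=> th et; apply: hn; apply: le_trans (wiener_bound th et hf) _.
apply: wiener_le (wiener_sum (f := fun k th et => bincoef be k.+2 * f th et ^+ k.+2) (M := fun k => r ^+ 2 * (k.+2%:R * 2^-1 ^+ k)) _) _.
  move=> k _; apply: wiener_le (wienerZ _ (wienerX _ hf)) _.
  rewrite [r ^+ k.+2](_ : _ = r ^+ 2 * r ^+ k); last by rewrite -exprD add2n.
  rewrite mulrCA ler_wpM2l ?exprn_ge0//.
  apply: ler_pM => //; first exact: exprn_ge0.
    by apply: le_trans (bincoef_le1 beP _) _; rewrite ler1n.
  by apply: lerXn2r; rewrite ?nnegrE ?invr_ge0.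
rewrite -mulr_sumr mulrC ler_wpM2r ?exprn_ge0//; exact: S2_le.
Qed.

(** A difference of powers k + 2 costs (k + 2) r^(k + 1) d. One factor [r] is kept outside, so the
    Lipschitz constant of the remainder is itself small. *)
Lemma wiener_pow_remB (r d : R) f g : r <= 2^-1 -> wiener r f -> wiener r g ->
  wiener d (fun th et => f th et - g th et) ->
  wiener (6 * r * d) (fun th et => ((1 + f th et) `^ (- be) - 1 + be * f th et) -
     ((1 + g th et) `^ (- be) - 1 + be * g th et)).
Proof.
move=> r2 hf hg hd; have r0 := wiener_ge0 hf; have d0 := wiener_ge0 hd.
apply: wiener_lim => e e0; have e2 : 0 < e / 2 by rewrite divr_gt0.
have [n hn] := near_prem 0 e2.
exists (fun th et => prem n (f th et) - prem n (g th et)); last first.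
  move=> th et; rewrite -!/(rem _) opprB [X in `|X|](_ : _ = (rem (f th et) - prem n (f th et)) - (rem (g th et) - prem n (g th et))); last by ring.
  apply: le_trans (ler_normB _ _) _; rewrite (splitr e).
  apply: lerD; apply: hn; [apply: le_trans (wiener_bound th et hf) _|apply: le_trans (wiener_bound th et hg) _] => //.
apply: wiener_le (wiener_ext (wiener_sum (f := fun k th et => bincoef be k.+2 * (f th et ^+ k.+2 - g th et ^+ k.+2)) (M := fun k => r * d * (k.+2%:R * 2^-1 ^+ k)) _) _) _.
- move=> k _; apply: wiener_le (wienerZ _ (wienerXB k.+2 hf hg hd)) _.
  rewrite /= exprS.
  rewrite [leLHS](_ : _ = r * d * (`|bincoef be k.+2| * (k.+2%:R * r ^+ k))); last by ring.
  rewrite ler_wpM2l ?mulr_ge0//.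
  rewrite -[leRHS]mul1r; apply: ler_pM => //; first by rewrite mulr_ge0 ?exprn_ge0.
    exact: bincoef_le1.
  by rewrite ler_wpM2l//; apply: lerXn2r; rewrite ?nnegrE ?invr_ge0.
- by move=> th et; rewrite /prem -sumrB; apply: eq_bigr => k _; rewrite mulrBr.
rewrite -mulr_sumr [leRHS](_ : _ = r * d * 6); last by ring.
by rewrite ler_wpM2l ?mulr_ge0//; exact: S2_le.
Qed.

End BinomialPower.

End WienerClass.

(** * Sine coefficients of functions in the Wiener algebra *)

Section TrigIntegrals.
Context {R : realType}.
Local Notation mu := (@lebesgue_measure R).
Implicit Types (th et a x : R) (q j : int) (i k n : nat).

Lemma cos_intperiod q x : cos (x + q%:~R * (2 * pi)) = cos x.
Proof.
have h n y : cos (y + n%:R * (2 * pi)) = cos y :> R.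
  rewrite -[RHS](periodicn (@cosD2pi R) n) -mulr_natr -[pi *+ 2]mulr_natr.
  by congr cos; ring.
case: q => n; first exact: h.
rewrite NegzE intrN mulNr -[LHS](h n.+1); congr cos; rewrite -[n.+1%:~R]/(n.+1%:R).
ring.
Qed.

Lemma int_sin q a : \int[mu]_(th in `[0, 2 * pi]) sin (q%:~R * th + a) =
  if q == 0 then 2 * pi * sin a else 0.
Proof.
case: eqP => [->|/eqP q0].
  under eq_Rintegral do rewrite mul0r add0r.
  rewrite Rintegral_cst//= lebesgue_measure_itv/= lte_fin twopi_gt0/=.
  by rewrite subr0 mulrC.
have q1 : q%:~R != 0 :> R by rewrite intr_eq0.
rewrite /Rintegral (@ftc_cc _ (fun t => - cos (q%:~R * t + a) * q%:~R^-1)) ?ltW ?twopi_gt0//=.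
- rewrite mulr0 add0r [_ * _ + a]addrC cos_intperiod; ring.
- move=> x _; apply: deq.
    apply: dM; [apply: dN; apply: dcos; apply: dD; [apply: dM; [exact: dC|exact: dI]|exact: dC]|exact: dC].
  by rewrite /=; field.
- move=> x _; apply: dcont; apply: dsin; apply: dD; [apply: dM; [exact: dC|exact: dI]|exact: dC].
Qed.

Lemma int_cst (c : R) : \int[mu]_(t in `[0, 2 * pi]) c = 2 * pi * c.
Proof.
rewrite Rintegral_cst//= lebesgue_measure_itv/= lte_fin twopi_gt0/=.
by rewrite subr0 mulrC.
Qed.

Lemma cos_cont j a : continuous (fun th => cos (j%:~R * th + a)).
Proof.
move=> x; apply: dcont; apply: dcos; apply: dD; [apply: dM; [exact: dC|exact: dI]|exact: dC].
Qed.

Lemma sin_cont j a : continuous (fun th => sin (j%:~R * th + a)).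
Proof.
move=> x; apply: dcont; apply: dsin; apply: dD; [apply: dM; [exact: dC|exact: dI]|exact: dC].
Qed.

Lemma cont_meas (f : R -> R) : continuous f -> measurable_fun setT f.
Proof. exact: continuous_measurable_fun. Qed.

(** Indexed from 0: [sincoef k] belongs to the frequency k + 1, the constant having no sine
    partner. *)
Definition sincoef k (F : R -> R) : R :=
  pi^-1 * \int[mu]_(th in `[0, 2 * pi]) (F th * sin (k.+1%:R * th)).

Lemma sin_int (f : R -> R) (K : R) k : measurable_fun setT f -> (forall x, `|f x| <= K) ->
  mu.-integrable `[0, 2 * pi] (EFin \o (fun th => f th * sin (k.+1%:R * th))).
Proof.
move=> mf fK; apply: (integrable_bdd (K := K)).
  apply: measurable_funM => //; apply: cont_meas => x; apply: dcont; apply: dsin.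
  apply: dM; [exact: dC|exact: dI].
move=> x _; rewrite normrM; apply: le_trans (ler_wpM2l (normr_ge0 _) (sin_max _)) _.
by rewrite mulr1.
Qed.

Lemma sincoefB k (f g : R -> R) (K : R) : measurable_fun setT f -> (forall x, `|f x| <= K) ->
  measurable_fun setT g -> (forall x, `|g x| <= K) ->
  sincoef k (fun th => f th - g th) = sincoef k f - sincoef k g.
Proof.
move=> mf fK mg gK; rewrite /sincoef -mulrBr -RintegralB//; try exact: (@sin_int _ K).
by congr (_ * _); apply: eq_Rintegral => t _; rewrite mulrBl.
Qed.

Lemma sincoefD k (f g : R -> R) (K : R) : measurable_fun setT f -> (forall x, `|f x| <= K) ->
  measurable_fun setT g -> (forall x, `|g x| <= K) ->
  sincoef k (fun th => f th + g th) = sincoef k f + sincoef k g.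
Proof.
move=> mf fK mg gK; rewrite /sincoef -mulrDr -RintegralD//; try exact: (@sin_int _ K).
by congr (_ * _); apply: eq_Rintegral => t _; rewrite mulrDl.
Qed.

Lemma sincoefZ k (f : R -> R) (c K : R) : measurable_fun setT f -> (forall x, `|f x| <= K) ->
  sincoef k (fun th => c * f th) = c * sincoef k f.
Proof.
move=> mf fK; rewrite /sincoef [RHS]mulrCA; congr (_ * _).
rewrite -RintegralZl//; last exact: (@sin_int _ K).
by apply: eq_Rintegral => t _; rewrite mulrA.
Qed.

Lemma sincoef_le k (f : R -> R) (e : R) : measurable_fun setT f -> (forall x, `|f x| <= e) ->
  `|sincoef k f| <= 2 * e.
Proof.
move=> mf fe; have p0 := @pi_gt0 R.
have i1 := sin_int k mf fe.
rewrite /sincoef normrM ger0_norm ?invr_ge0 ?(ltW p0)// ler_pdivrMl// mulrCA mulrA -int_cst.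
apply: le_trans (le_normr_Rintegral _ i1) _ => //.
apply: le_Rintegral => //.
- exact: integrable_norm.
- by apply: (integrable_bdd (K := `|e|)).
- move=> x _; rewrite normrM; apply: le_trans (ler_wpM2l (normr_ge0 _) (sin_max _)) _.
  by rewrite mulr1.
Qed.

Definition sincos k j a : R := - ((sgz j)%:~R * (k.+1 == `|j|%N)%:R * sin a).

Lemma sincoef_cos k j a : sincoef k (fun th => cos (j%:~R * th + a)) = sincos k j a.
Proof.
have e th : cos (j%:~R * th + a) * sin (k.+1%:R * th) =
   2^-1 * (sin ((j + k.+1%:Z)%:~R * th + a) - sin ((j - k.+1%:Z)%:~R * th + a)).
  rewrite !intrD intrN -[(k.+1%:Z)%:~R]/(k.+1%:R).
  set A := _ * th + a; set B := k.+1%:R * th.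
  have -> : (j%:~R + k.+1%:R) * th + a = A + B by rewrite /A /B; ring.
  have -> : (j%:~R - k.+1%:R) * th + a = A - B by rewrite /A /B; ring.
  by rewrite sinD sinB; field.
have i q : mu.-integrable `[0, 2 * pi] (EFin \o (fun th => sin (q%:~R * th + a))).
  apply: (integrable_bdd (K := 1)); first by apply: cont_meas; exact: sin_cont.
  by move=> x _; exact: sin_max.
rewrite /sincoef; under eq_Rintegral do rewrite e.
rewrite RintegralZl//; last exact: intB.
rewrite RintegralB// !int_sin /sincos.
have p0 : pi != 0 :> R by rewrite gt_eqF// pi_gt0.
have e3 : pi^-1 * (2^-1 * (2 * pi * sin a)) = sin a.
  by rewrite -[2 * pi * _]mulrA mulKf ?pnatr_eq0// mulKf.
case: j {e} => n.
  have -> : (n%:Z + k.+1%:Z == 0) = false by apply/negbTE; lia.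
  have -> : (n%:Z - k.+1%:Z == 0) = (k.+1 == n) by rewrite subr_eq0 eqz_nat eq_sym.
  have -> : `|Posz n|%N = n by [].
  case: eqP => [<-|_].
    have -> : (sgz k.+1%:Z)%:~R = 1 :> R by [].
    by rewrite sub0r !mulrN e3 /= mulr1 mul1r.
  by rewrite mulr0 mul0r subrr !mulr0 oppr0.
have -> : (Negz n + k.+1%:Z == 0) = (k.+1 == n.+1) by apply/idP/idP; lia.
have -> : (Negz n - k.+1%:Z == 0) = false by apply/negbTE; lia.
have -> : `|Negz n|%N = n.+1 by [].
have -> : sgz (Negz n) = -1 by [].
have e1 : (-1 : int)%:~R = -1 :> R by [].
case: eqP => _; first by rewrite e1 subr0 e3 /=; ring.
by rewrite mulr0 mul0r subrr !mulr0 oppr0.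
Qed.

Lemma delta_sum K n (X : nat -> R) :
  \sum_(i < K) ((i.+1 == n)%:R * X i.+1) = (0 < n <= K)%N%:R * X n.
Proof.
elim: K => [|K IH]; first by rewrite big_ord0; case: n => [|n]; rewrite mul0r.
rewrite big_ord_recr/= IH [(n <= K.+1)%N]leq_eqVlt ltnS.
rewrite [(K.+1 == n)%N]eq_sym; case: eqVneq => [->|n1]; last by rewrite mul0r addr0.
by rewrite ltnn /= mul0r add0r.
Qed.

Lemma sincos_le k j a : `|sincos k j a| <= (k.+1 == `|j|%N)%:R.
Proof.
rewrite normrN normrM -[leRHS]mulr1; apply: ler_pM => //; last exact: sin_max.
rewrite normrM [`|_%:R|]ger0_norm// -[leRHS]mul1r ler_wpM2r//.
by rewrite sgz_def; case: (j == 0) => /=; rewrite ?normr0//; case: (j < 0); rewrite /= ?normrN normr1.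
Qed.

Lemma sincos_sum K j a : \sum_(k < K) k.+2%:R * `|sincos k j a| <= `|j%:~R| + 1.
Proof.
apply: (@le_trans _ _ (\sum_(k < K) ((k.+1 == `|j|%N)%:R * k.+2%:R))).
  by apply: ler_sum => k _; rewrite mulrC ler_wpM2r// sincos_le.
rewrite (delta_sum K `|j|%N (fun i => i.+1%:R)) -intr_norm -natr1.
rewrite [`|j|%:~R](_ : _ = `|j|%N%:R); last by rewrite -abszE.
by rewrite ler_piMl// ?addr_ge0//; case: (_ && _).
Qed.

Lemma sincos_expand K j a th : (`|j| <= K)%N ->
  \sum_(k < K) sincos k j a * sin (k.+1%:R * th) = - (sin a * sin (j%:~R * th)).
Proof.
move=> jK.
have -> : \sum_(k < K) sincos k j a * sin (k.+1%:R * th) =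
  - ((sgz j)%:~R * sin a * \sum_(k < K) ((k.+1 == `|j|%N)%:R * sin (k.+1%:R * th))).
  rewrite mulr_sumr -sumrN; apply: eq_bigr => k _; rewrite /sincos; ring.
rewrite (delta_sum K `|j|%N (fun i => sin (i%:R * th))) jK andbT.
case: j {jK} => [[|n]|n].
- by rewrite sgz0 !mul0r sin0 mulr0.
- by rewrite absz_nat /= sgz_def/= !mul1r.
- have -> : sgz (Negz n) = -1 by [].
  have -> : `|Negz n|%N = n.+1 by [].
  have -> : sin ((Negz n)%:~R * th) = - sin (n.+1%:R * th).
    by rewrite NegzE intrN mulNr sinN.
  have e1 : (-1 : int)%:~R = -1 :> R by [].
  by rewrite e1 ltn0Sn /=; ring.
Qed.

Lemma unif_cont (f : R -> R) : (forall e, 0 < e ->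
  exists2 g : R -> R, continuous g & forall x, `|f x - g x| <= e) -> continuous f.
Proof.
move=> h x; apply/cvgrPdist_lt => e e0; have e3 : 0 < e / 3 by rewrite divr_gt0.
have [g gc fg] := h _ e3; move/cvgrPdist_lt: (gc x) => /(_ _ e3).
apply: filterS => y xy.
rewrite (_ : f x - f y = (f x - g x) + (g x - g y) - (f y - g y)); last by ring.
apply: le_lt_trans (ler_normB _ _) _.
apply: (@le_lt_trans _ _ (`|f x - g x| + `|g x - g y| + `|f y - g y|)).
  by rewrite lerD2r ler_normD.
have := fg x; have := fg y; lra.
Qed.

Lemma evE s th : ev s th 0 = \sum_(t <- s) t.1.1 * cos (t.2.1%:~R * th + t.1.2).
Proof. by apply: eq_bigr => t _; rewrite /tev mulr0 addr0. Qed.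

Lemma contD_fun (f g : R -> R) : continuous f -> continuous g -> continuous (fun x => f x + g x).
Proof. by move=> hf hg x; apply: cvgD; [exact: hf|exact: hg]. Qed.

Lemma contM_fun (f g : R -> R) : continuous f -> continuous g -> continuous (fun x => f x * g x).
Proof. by move=> hf hg x; apply: cvgM; [exact: hf|exact: hg]. Qed.

Lemma cont_cst (c : R) : continuous (fun _ : R => c).
Proof. by move=> x; exact: cvg_cst. Qed.

Lemma ev_cont_th s et : continuous (fun th => ev s th et).
Proof.
elim: s => [|t s IH].
  by rewrite (_ : (fun th => _) = fun _ => 0); [exact: cont_cst|apply/funext => th; rewrite /ev big_nil].
rewrite (_ : (fun th => _) = fun th => tev t th et + ev s th et); last first.
  by apply/funext => th; rewrite /ev big_cons.
apply: contD_fun => //; apply: contM_fun; first exact: cont_cst.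
move=> x; rewrite (_ : (fun th => cos _) = fun th => cos (t.2.1%:~R * th + (t.2.2%:~R * et + t.1.2))).
  exact: cos_cont.
by apply/funext => th; rewrite addrA.
Qed.

Lemma ev_cont_et s th : continuous (ev s th).
Proof.
elim: s => [|t s IH].
  by rewrite (_ : ev _ _ = fun _ => 0); [exact: cont_cst|apply/funext => et; rewrite /ev big_nil].
rewrite (_ : ev _ _ = fun et => tev t th et + ev s th et); last first.
  by apply/funext => et; rewrite /ev big_cons.
apply: contD_fun => //; apply: contM_fun; first exact: cont_cst.
move=> x; rewrite (_ : (fun et => cos _) = fun et => cos (t.2.2%:~R * et + (t.2.1%:~R * th + t.1.2))).
  exact: cos_cont.
by apply/funext => et; congr cos; ring.
Qed.

Lemma wiener_cont_th M f et : wiener M f -> continuous (fun th => f th et).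
Proof.
by move=> h; apply: unif_cont => e /h[s _ fs]; exists (fun th => ev s th et) => //; exact: ev_cont_th.
Qed.

Lemma wiener_cont_et M f th : wiener M f -> continuous (f th).
Proof.
by move=> h; apply: unif_cont => e /h[s _ fs]; exists (ev s th) => //; exact: ev_cont_et.
Qed.

Lemma sincoef_ev k s : sincoef k (fun th => ev s th 0) =
  \sum_(t <- s) t.1.1 * sincos k t.2.1 t.1.2.
Proof.
elim: s => [|t s IH].
  rewrite big_nil /sincoef; under eq_Rintegral do rewrite evE big_nil mul0r.
  by rewrite int_cst !mulr0.
rewrite big_cons -IH -sincoef_cos.
have cc : measurable_fun setT (fun th : R => cos (t.2.1%:~R * th + t.1.2)).
  by apply: cont_meas; exact: cos_cont.
rewrite -(sincoefZ k t.1.1 cc (fun x => cos_max _)).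
rewrite -(@sincoefD k _ _ (`|t.1.1| + wn s)).
- by congr sincoef; apply/funext => th; rewrite !evE big_cons.
- by apply: measurable_funM.
- move=> x; rewrite normrM; apply: le_trans (ler_wpM2l (normr_ge0 _) (cos_max _)) _.
  by rewrite mulr1 lerDl wn_ge0.
- by apply: cont_meas; exact: ev_cont_th.
- by move=> x; apply: le_trans (ev_le _ _ _) _; rewrite lerDr.
Qed.

Lemma sincoef_ev_sum K s : \sum_(k < K) k.+2%:R * `|sincoef k (fun th => ev s th 0)| <= wn s.
Proof.
apply: (@le_trans _ _ (\sum_(k < K) \sum_(t <- s) (`|t.1.1| * (k.+2%:R * `|sincos k t.2.1 t.1.2|)))).
  apply: ler_sum => k _; rewrite sincoef_ev.
  rewrite -[leRHS](_ : k.+2%:R * \sum_(t <- s) `|t.1.1 * sincos k t.2.1 t.1.2| = _).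
    by rewrite ler_wpM2l// ler_norm_sum.
  by rewrite mulr_sumr; apply: eq_bigr => t _; rewrite normrM mulrCA.
rewrite exchange_big/=; apply: ler_sum => t _; rewrite -mulr_sumr ler_wpM2l//.
exact: sincos_sum.
Qed.

(** k + 2 is the Wiener weight of the frequency k + 1. Uniform approximation moves each coefficient
    by at most twice the error, and only the [K] retained ones count, with total weight [W]. *)
Lemma sincoef_sum K M f : wiener M f ->
  \sum_(k < K) k.+2%:R * `|sincoef k (fun th => f th 0)| <= M.
Proof.
move=> h; have M0 := wiener_ge0 h; apply/ler_addgt0Pr => e e0.
pose W : R := \sum_(k < K) k.+2%:R * 2.
have W0 : 0 <= W by apply: sumr_ge0.
have c0 : 0 < W + 1 by rewrite ltr_wpDl.
have [s sM fs] := h _ (divr_gt0 e0 c0).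
apply: (@le_trans _ _ (\sum_(k < K) (k.+2%:R * `|sincoef k (fun th => ev s th 0)| + k.+2%:R * 2 * (e / (W + 1))))).
  apply: ler_sum => k _; rewrite -mulrA -mulrDr ler_wpM2l//.
  have h1 : measurable_fun setT (fun th => f th 0) by apply: cont_meas; exact: wiener_cont_th h.
  have h2 : measurable_fun setT (fun th => ev s th 0) by apply: cont_meas; exact: ev_cont_th.
  have b1 x : `|f x 0| <= M by exact: wiener_bound h.
  have b2 x : `|ev s x 0| <= M by apply: le_trans (ev_le _ _ _) _.
  rewrite -[sincoef k (fun th => f th 0)](subrK (sincoef k (fun th => ev s th 0))).
  rewrite -(sincoefB k h1 b1 h2 b2) addrC.
  apply: le_trans (ler_normD _ _) _; rewrite lerD2l; apply: sincoef_le => //.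
  exact: measurable_funB.
rewrite big_split/= -mulr_suml -/W lerD//.
  by apply: le_trans (sincoef_ev_sum _ _) _.
by rewrite mulrCA ler_piMr ?(ltW e0)// ler_pdivrMr// mul1r lerDl.
Qed.

Lemma minn_step n k : (minn n k + (n < k) <= minn n.+1 k)%N.
Proof. by rewrite /minn; case: (ltnP n k); case: (ltnP n.+1 k) => /=; lia. Qed.

(** An approximating sum [s] has small sine coefficients, but their number is not controlled. The
    first [K] are bounded by the error, all others together by M / (K + 2) thanks to the Wiener
    weight; the error goes to 0 first, then 1 / K. *)
Lemma sincoef_inj M (F : R -> R) : wiener M (fun th _ => F th) ->
  (forall th, F (- th) = - F th) -> (forall k, sincoef k F = 0) -> forall th, F th = 0.
Proof.
move=> h odd z th; have M0 := wiener_ge0 h.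
suff H K : `|F th| <= M / K.+2%:R.
  apply/eqP; rewrite -normr_le0; apply/ler_addgt0Pr => e e0; rewrite add0r.
  apply: le_trans (H (Num.truncn (M / e))) _.
  rewrite ler_pdivrMr ?ltr0n// -ler_pdivrMl// mulrC.
  by apply: le_trans (ltW (truncnS_gt _)) _; rewrite ler_nat.
apply/ler_addgt0Pr => e e0.
pose e' := e / (2 * K%:R + 1).
have c0 : 0 < 2 * K%:R + 1 :> R by rewrite ltr_wpDl// mulr_ge0.
have e'0 : 0 < e' by rewrite divr_gt0.
have [s sM fs] := h _ e'0.
pose A k := sincoef k (fun x => ev s x 0).
have A1 k : `|A k| <= 2 * e'.
  have hc : continuous F by apply: (wiener_cont_th (et := 0) h).
  have h1 : measurable_fun setT F by exact: cont_meas.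
  have h2 : measurable_fun setT (fun x => ev s x 0) by apply: cont_meas; exact: ev_cont_th.
  have b1 x : `|F x| <= M by exact: (wiener_bound x 0 h).
  have b2 x : `|ev s x 0| <= M by apply: le_trans (ev_le _ _ _) _.
  have -> : A k = - sincoef k (fun x => F x - ev s x 0).
    by rewrite (sincoefB k h1 b1 h2 b2) z sub0r opprK.
  by rewrite normrN; apply: sincoef_le; [exact: measurable_funB|move=> x; exact: fs].
(* The odd part of [s] at [th]: a finite sine sum with coefficients [A], still close to the odd
   function [F]. *)
pose p := (ev s th 0 - ev s (- th) 0) / 2.
have Fp : `|F th - p| <= e'.
  rewrite (_ : F th - p = ((F th - ev s th 0) - (F (- th) - ev s (- th) 0)) / 2); last first.
    by rewrite odd /p; field.
  rewrite normrM normfV (ger0_norm (ler0n R 2)) ler_pdivrMr//.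
  by apply: le_trans (ler_normB _ _) _; have := fs th 0; have := fs (- th) 0; lra.
pose N := \max_(t <- s) `|t.2.1|%N.
have pE : p = \sum_(k < N) A k * sin (k.+1%:R * th).
  under eq_bigr do rewrite /A sincoef_ev mulr_suml.
  rewrite exchange_big/= /p !evE -sumrB mulr_suml.
  rewrite !big_seq; apply: eq_bigr => t ts.
  under eq_bigr do rewrite -mulrA.
  rewrite -mulr_sumr sincos_expand; last by rewrite /N; exact: (leq_bigmax_seq _ ts).
  have -> : t.2.1%:~R * - th = - (t.2.1%:~R * th) by rewrite mulrN.
  set x := _ * th; rewrite !cosD cosN sinN; lra.
have pb : `|p| <= 2 * e' * K%:R + M / K.+2%:R.
  rewrite pE; apply: le_trans (ler_norm_sum _ _ _) _.
  apply: (@le_trans _ _ (\sum_(k < N) ((k < K)%N%:R * (2 * e') + (k.+2%:R * `|A k|) / K.+2%:R))).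
    apply: ler_sum => k _; rewrite normrM.
    apply: le_trans (ler_wpM2l (normr_ge0 _) (sin_max _)) _; rewrite mulr1.
    case: ltnP => kK.
      by rewrite mul1r; apply: le_trans (A1 k) _; rewrite lerDl divr_ge0 ?mulr_ge0.
    rewrite mul0r add0r ler_pdivlMr ?ltr0n// mulrC ler_wpM2r// ler_nat; lia.
  rewrite big_split/= -!mulr_suml lerD//.
    have e2 : 0 <= 2 * e' by apply: mulr_ge0 => //; exact: ltW.
    rewrite mulrC; apply: ler_wpM2l => //.
    have : \sum_(i < N) (i < K)%N%:R <= (minn N K)%:R :> R.
      move: (N) => n0; elim: n0 => [|n IHn]; first by rewrite big_ord0.
      rewrite big_ord_recr/=; apply: le_trans (lerD IHn (lexx _)) _.
      by rewrite -natrD ler_nat minn_step.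
    by move=> h1; apply: le_trans h1 _; rewrite ler_nat geq_minr.
  rewrite ler_wpM2r ?invr_ge0//; apply: le_trans (sincoef_ev_sum _ _) sM.
rewrite -[F th](subrK p); apply: le_trans (ler_normD _ _) _.
have <- : e' * (2 * K%:R + 1) = e by rewrite /e' divfK ?gt_eqF.
apply: le_trans (lerD Fp pb) _; rewrite le_eqVlt; apply/orP; left; apply/eqP; ring.
Qed.

End TrigIntegrals.

(** * Integration against the singular kernel *)

Section KernelIntegral.
Context {R : realType}.
Local Notation mu := (@lebesgue_measure R).
Variable be : R.
Hypothesis beP : 0 < be < 2^-1.
Local Notation kap := (kap be).
Implicit Types (M th : R).

Definition kint (f : R -> R -> R) th : R :=
  \int[mu]_(et in `[0, 2 * pi]) (f th et * kap et).

Let K0 : R := \int[mu]_(et in `[0, 2 * pi]) kap et.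

Let kintegrable M f th : wiener M f ->
  mu.-integrable `[0, 2 * pi] (EFin \o (fun et => f th et * kap et)).
Proof.
move=> h; apply: (kapM_int beP (K := M)).
  by apply: cont_meas; apply: wiener_cont_et h.
by move=> x; exact: wiener_bound h.
Qed.

Lemma kintB M1 M2 f g th : wiener M1 f -> wiener M2 g ->
  kint (fun x y => f x y - g x y) th = kint f th - kint g th.
Proof.
move=> hf hg; rewrite /kint -RintegralB//; [|exact: kintegrable hf|exact: kintegrable hg].
by apply: eq_Rintegral => t _; rewrite mulrBl.
Qed.

Lemma kintD M1 M2 f g th : wiener M1 f -> wiener M2 g ->
  kint (fun x y => f x y + g x y) th = kint f th + kint g th.
Proof.
move=> hf hg; rewrite /kint -RintegralD//; [|exact: kintegrable hf|exact: kintegrable hg].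
by apply: eq_Rintegral => t _; rewrite mulrDl.
Qed.

Lemma kintZ M c f th : wiener M f ->
  kint (fun x y => c * f x y) th = c * kint f th.
Proof.
move=> hf; rewrite /kint -RintegralZl//; last exact: kintegrable hf.
by apply: eq_Rintegral => t _; rewrite mulrA.
Qed.

Lemma kint_le (f : R -> R -> R) (e : R) th : measurable_fun setT (f th) ->
  (forall et, `|f th et| <= e) -> `|kint f th| <= K0 * e.
Proof.
move=> mf fe; have i1 := kapM_int beP mf fe.
apply: le_trans (le_normr_Rintegral _ i1) _ => //.
rewrite [leRHS]mulrC /K0 -RintegralZl//; last exact: kap_int.
apply: le_Rintegral => //.
- exact: integrable_norm.
- by apply: intZ => //; exact: kap_int.
- by move=> x _; rewrite normrM (ger0_norm (kap_ge0 _ _)) ler_wpM2r ?kap_ge0.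
Qed.

Let K0_ge0 : 0 <= K0.
Proof. by apply: Rintegral_ge0 => x _; exact: kap_ge0. Qed.

Let Kc (l : int) : R := \int[mu]_(et in `[0, 2 * pi]) (cos (l%:~R * et + 0) * kap et).
Let Ks (l : int) : R := \int[mu]_(et in `[0, 2 * pi]) (sin (l%:~R * et + 0) * kap et).

Let Kc_le l : `|Kc l| <= K0.
Proof.
rewrite -[K0]mulr1; apply: (@kint_le (fun _ et => cos (l%:~R * et + 0)) 1 0).
  by apply: cont_meas; exact: cos_cont.
by move=> et; exact: cos_max.
Qed.

Let Ks_le l : `|Ks l| <= K0.
Proof.
rewrite -[K0]mulr1; apply: (@kint_le (fun _ et => sin (l%:~R * et + 0)) 1 0).
  by apply: cont_meas; exact: sin_cont.
by move=> et; exact: sin_max.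
Qed.

(** Integrating cos (x + l et) against the kernel gives cos x times a cosine moment minus sin x
    times a sine moment; - sin is encoded as a cosine advanced by pi / 2. *)
Let kt (t : trig) : seq trig :=
  [:: ((t.1.1 * Kc t.2.2, t.1.2), (t.2.1, 0));
      ((t.1.1 * Ks t.2.2, t.1.2 + pi / 2), (t.2.1, 0))].

Let kint_tev (t : trig) th et : kint (tev t) th = ev (kt t) th et.
Proof.
rewrite /kint /ev /kt !big_cons big_nil /tev /= !mul0r !addr0 addrA cosDpihalf.
set x := _ * th + t.1.2.
have e y : t.1.1 * cos (t.2.1%:~R * th + t.2.2%:~R * y + t.1.2) * kap y =
  t.1.1 * cos x * (cos (t.2.2%:~R * y + 0) * kap y) +
  - (t.1.1 * sin x) * (sin (t.2.2%:~R * y + 0) * kap y).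
  have -> : t.2.1%:~R * th + t.2.2%:~R * y + t.1.2 = x + (t.2.2%:~R * y + 0).
    by rewrite /x; ring.
  by rewrite cosD; ring.
have i1 : mu.-integrable `[0, 2 * pi] (EFin \o (fun y => cos (t.2.2%:~R * y + 0) * kap y)).
  by apply: (kapM_int beP (K := 1)); [by apply: cont_meas; exact: cos_cont|move=> z; exact: cos_max].
have i2 : mu.-integrable `[0, 2 * pi] (EFin \o (fun y => sin (t.2.2%:~R * y + 0) * kap y)).
  by apply: (kapM_int beP (K := 1)); [by apply: cont_meas; exact: sin_cont|move=> z; exact: sin_max].
under eq_Rintegral do rewrite e.
rewrite RintegralD//; [|exact: intZ|exact: intZ].
by rewrite !RintegralZl// -/(Kc _) -/(Ks _); ring.
Qed.

Let kts (s : seq trig) := flatten [seq kt t | t <- s].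

Let kint_ev s th et : kint (ev s) th = ev (kts s) th et.
Proof.
elim: s => [|t s IH].
  rewrite /kint /kts; under eq_Rintegral do rewrite /ev big_nil mul0r.
  by rewrite int_cst mulr0 /ev big_nil.
have -> : kts (t :: s) = kt t ++ kts s by [].
rewrite ev_cat -IH -kint_tev.
have h1 : wiener (wn [:: t]) (tev t).
  by apply: wiener_ext (wiener_ev _) _ => x y; rewrite /ev big_seq1.
rewrite -(kintD _ h1 (wiener_ev s)); apply: eq_Rintegral => y _.
by rewrite /ev big_cons.
Qed.

Let wn_kts s : wn (kts s) <= 2 * K0 * wn s.
Proof.
rewrite /wn /kts big_flatten big_map mulr_sumr; apply: ler_sum => t _.
rewrite !big_cons big_nil /twt /= addr0 !normrM.
rewrite [leRHS](_ : _ = `|t.1.1| * K0 * (`|t.2.1%:~R| + 1) + `|t.1.1| * K0 * (`|t.2.1%:~R| + 1)); last by ring.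
by apply: lerD; rewrite ler_wpM2r ?addr_ge0// ler_wpM2l.
Qed.

(** On trigonometric sums each term yields two, with amplitudes multiplied by at most [K0], hence 2
    [K0]. Integrability of the kernel carries the uniform approximation through. *)
Lemma wiener_kint M f : wiener M f -> wiener (2 * K0 * M) (fun th _ => kint f th).
Proof.
move=> h e e0; have c0 : 0 < K0 + 1 by rewrite ltr_wpDl.
have [s sM fs] := h _ (divr_gt0 e0 c0).
exists (kts s) => [|th et].
  by apply: le_trans (wn_kts s) _; rewrite ler_wpM2l// mulr_ge0.
rewrite -kint_ev -(kintB th h (wiener_ev s)).
apply: le_trans (kint_le _ (fs th)) _.
  by apply: cont_meas => x; apply: cvgB; [exact: (wiener_cont_et (th := th) h)|exact: ev_cont_et].
by rewrite mulrCA ler_piMr ?(ltW e0)// ler_pdivrMr// mul1r lerDl.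
Qed.

End KernelIntegral.

(** * Weighted sequence spaces *)

Section WeightedSums.
Context {R : realType}.
Implicit Types (a b v : nat -> R) (r d e : R).

Definition wball v r b : Prop := forall K, \sum_(i < K) v i * `|b i| <= r.

Definition rsum a : R := limn (fun K => \sum_(i < K) a i).

Lemma sum_tail a K K' : (K <= K')%N ->
  \sum_(i < K') a i - \sum_(i < K) a i = \sum_(K <= i < K') a i.
Proof.
by move=> KK; rewrite -!(big_mkord xpredT a) (big_cat_nat (n := K))//= [LHS]addrAC subrr add0r.
Qed.

Lemma rsum_cvg v r a : wball v r a -> (forall i, 1 <= v i) ->
  (fun K => \sum_(i < K) a i) @ \oo --> rsum a.
Proof.
move=> ha v1; suff : cvgn (fun K => \sum_(i < K) a i) by [].
have e : (fun K => \sum_(i < K) a i) = series a.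
  by apply/funext => K; rewrite /series /= big_mkord.
have e2 : [normed series a] = fun K => \sum_(i < K) `|a i|.
  by apply/funext => K; rewrite -(big_mkord xpredT (fun i => `|a i|)).
rewrite e; apply: normed_cvg; rewrite e2; apply: nondecreasing_is_cvgn.
  by apply/nondecreasing_seqP => n; rewrite big_ord_recr/= lerDl.
exists r => _ [n _ <-]; apply: le_trans (ha n).
by apply: ler_sum => i _; rewrite ler_peMl.
Qed.

Lemma wball_ge0 v r b : wball v r b -> 0 <= r.
Proof. by move=> /(_ 0%N); rewrite big_ord0. Qed.

Lemma wball_le v r r' b : wball v r b -> r <= r' -> wball v r' b.
Proof. by move=> h rr K; apply: le_trans (h K) rr. Qed.

Lemma wballZ v r b (c : R) : wball v r b -> wball v (`|c| * r) (fun i => c * b i).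
Proof.
move=> h K; apply: le_trans (ler_wpM2l (normr_ge0 c) (h K)); rewrite mulr_sumr.
by rewrite le_eqVlt; apply/orP; left; apply/eqP; apply: eq_bigr => i _; rewrite normrM mulrCA.
Qed.

Lemma wballD v r r' b b' : (forall i, 0 <= v i) -> wball v r b -> wball v r' b' ->
  wball v (r + r') (fun i => b i + b' i).
Proof.
move=> v0 h h' K; apply: le_trans (lerD (h K) (h' K)); rewrite -big_split/=.
by apply: ler_sum => i _; rewrite -mulrDr ler_wpM2l// ler_normD.
Qed.

Lemma wballB v r r' b b' : (forall i, 0 <= v i) -> wball v r b -> wball v r' b' ->
  wball v (r + r') (fun i => b i - b' i).
Proof.
move=> v0 h h'; have := wballD v0 h (wballZ (-1) h'); rewrite normrN normr1 mul1r.
by move=> + K => /(_ K); under eq_bigr do rewrite mulN1r.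
Qed.

(** Fatou's lemma for weighted l^1, finitely many coordinates at a time. *)
Lemma wball_lim v r b (c : nat -> nat -> R) : (forall n, wball v r (c n)) ->
  (forall i, (fun n => c n i) @ \oo --> b i) -> wball v r b.
Proof.
move=> hc cb K.
have h : (fun n => \sum_(i < K) v i * `|c n i|) @ \oo --> \sum_(i < K) v i * `|b i|.
  elim: K => [|K IH].
    rewrite big_ord0 (_ : (fun n => _) = fun _ => 0); first exact: cvg_cst.
    by apply/funext => n; rewrite big_ord0.
  rewrite big_ord_recr/= (_ : (fun n => _) = fun n => \sum_(i < K) v i * `|c n i| + v K * `|c n K|).
    by apply: cvgD => //; apply: cvgMr; apply: cvg_norm; exact: cb.
  by apply/funext => n; rewrite big_ord_recr.
rewrite -(cvg_lim _ h)//; apply: limr_le; first by apply/cvg_ex; eexists; exact: h.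
by apply: nearW => n; exact: hc.
Qed.

Lemma wball_tail v r b e : (forall i, 0 <= v i) -> wball v r b -> 0 < e ->
  exists K, forall K', (K <= K')%N -> \sum_(K <= i < K') v i * `|b i| <= e.
Proof.
move=> v0 h e0; pose S K := \sum_(i < K) v i * `|b i|.
have nS : nondecreasing_seq S.
  by apply/nondecreasing_seqP => n; rewrite /S big_ord_recr/= lerDl mulr_ge0.
have cS : cvgn S by apply: nondecreasing_is_cvgn => //; exists r => _ [n _ <-]; exact: h.
have /cvgrPdist_le /(_ e e0) [K _ hK] := cS.
exists K => K' KK'; rewrite -sum_tail// -/(S K) -/(S K').
have := hK K (leqnn K); have := nondecreasing_cvgn_le nS cS K'.
have := nondecreasing_cvgn_le nS cS K => h1 h2; rewrite ger0_norm ?subr_ge0//; lra.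
Qed.

Lemma rsumB v r r' a b : wball v r a -> wball v r' b -> (forall i, 1 <= v i) ->
  rsum (fun i => a i - b i) = rsum a - rsum b.
Proof.
move=> ha hb v1; rewrite /rsum; under eq_fun do rewrite sumrB.
by apply/cvg_lim => //; apply: cvgB; [exact: rsum_cvg ha v1|exact: rsum_cvg hb v1].
Qed.

Lemma rsumD v r r' a b : wball v r a -> wball v r' b -> (forall i, 1 <= v i) ->
  rsum (fun i => a i + b i) = rsum a + rsum b.
Proof.
move=> ha hb v1; rewrite /rsum; under eq_fun do rewrite big_split.
by apply/cvg_lim => //; apply: cvgD; [exact: rsum_cvg ha v1|exact: rsum_cvg hb v1].
Qed.

Lemma rsumZ v r a (c : R) : wball v r a -> (forall i, 1 <= v i) ->
  rsum (fun i => c * a i) = c * rsum a.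
Proof.
move=> ha v1; rewrite /rsum; under eq_fun do rewrite -mulr_sumr.
by apply/cvg_lim => //; apply: cvgMr; exact: rsum_cvg ha v1.
Qed.

Lemma rsum_tail v a K e : (forall K', (K <= K')%N -> \sum_(K <= i < K') `|a i| <= e) ->
  wball v e a \/ (exists r, wball (fun _ => 1) r a) -> (forall i, 1 <= v i) ->
  `|rsum a - \sum_(i < K) a i| <= e.
Proof.
move=> ht hw v1.
have [r hr] : exists r, wball (fun _ => 1) r a.
  case: hw => // h; exists e => n; apply: le_trans (h n); apply: ler_sum => i _.
  by rewrite ler_wpM2r.
have h := rsum_cvg hr (fun _ => lexx 1).
have h2 : (fun K' => `|\sum_(i < K') a i - \sum_(i < K) a i|) @ \oo --> `|rsum a - \sum_(i < K) a i|.
  by apply: cvg_norm; apply: cvgB => //; exact: cvg_cst.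
rewrite -(cvg_lim _ h2)//; apply: limr_le; first by apply/cvg_ex; eexists; exact: h2.
near=> K'; rewrite sum_tail//; last by near: K'; exists K.
apply: le_trans (ler_norm_sum _ _ _) _; apply: ht; near: K'; exists K => //.
Unshelve. all: by end_near. Qed.

Lemma wball_coord v r b i : (forall i, 1 <= v i) -> wball v r b -> `|b i| <= r.
Proof.
move=> v1 h; have v0 k : 0 <= v k by rewrite (le_trans _ (v1 k)).
apply: le_trans (h i.+1); rewrite big_ord_recr/=.
by apply: ler_wpDl; [apply: sumr_ge0 => k _; rewrite mulr_ge0|rewrite ler_peMl].
Qed.

(** Banach's fixed point theorem on sequences: the iterates of 0 converge coordinatewise, and
    [wball_lim] turns this into norm estimates, which stands for completeness. *)
Lemma wball_contraction v (T : (nat -> R) -> nat -> R) r : (forall i, 1 <= v i) ->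
  0 <= r ->
  (forall z, wball v r z -> wball v r (T z)) ->
  (forall z z' d, wball v r z -> wball v r z' -> wball v d (fun i => z i - z' i) ->
     wball v (d / 2) (fun i => T z i - T z' i)) ->
  exists2 z, wball v r z & forall i, T z i = z i.
Proof.
move=> v1 r0 Tr Tc; have v0 i : 0 <= v i by rewrite (le_trans _ (v1 i)).
pose c n := iter n T (fun _ => 0).
have cr n : wball v r (c n).
  elim: n => [K|n IH]; last exact: Tr.
  by rewrite big1// => i _; rewrite normr0 mulr0.
have cd n : wball v (2 * r * 2^-1 ^+ n) (fun i => c n.+1 i - c n i).
  elim: n => [|n IH].
    by rewrite expr0 mulr1 mulr_natl mulr2n; exact: wballB.
  by rewrite exprSr mulrA; exact: (Tc (c n.+1) (c n)).
have cdm n k : wball v (4 * r * 2^-1 ^+ n) (fun i => c (n + k)%N i - c n i).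
  (* Subtracting the term at n + k strengthens the claim so that the induction on k telescopes the
     geometric series. *)
  suff h : wball v (4 * r * 2^-1 ^+ n - 4 * r * 2^-1 ^+ (n + k)) (fun i => c (n + k)%N i - c n i).
    by apply: wball_le h _; rewrite gerBl mulr_ge0 ?exprn_ge0 ?mulr_ge0 ?invr_ge0.
  elim: k => [|k IH].
    by rewrite addn0 subrr => K; rewrite big1// => i _; rewrite subrr normr0 mulr0.
  have := wballD v0 IH (cd (n + k)%N); rewrite addnS.
  move=> h K; move: (h K); under eq_bigr do rewrite addrC addrA subrK.
  by move=> /le_trans; apply; rewrite exprSr; lra.
have half0 : (fun n => 4 * r * 2^-1 ^+ n) @ \oo --> (0 : R).
  rewrite -[X in _ --> X](mulr0 (4 * r)); apply: cvgMr.
  by apply: cvg_expr; rewrite ger0_norm ?invr_ge0// invf_lt1 ?ltr1n.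
have cc i : cvgn (fun n => c n i).
  have e n : c n i = \sum_(k < n) (c k.+1 i - c k i).
    by elim: n => [|n IH]; [rewrite big_ord0|rewrite big_ord_recr/= -IH addrC subrK].
  have h : wball (fun _ => 1) (4 * r) (fun k => c k.+1 i - c k i).
    move=> n; apply: (@le_trans _ _ (4 * r - 4 * r * 2^-1 ^+ n)).
      elim: n => [|n IH]; first by rewrite big_ord0 expr0 mulr1 subrr.
      rewrite big_ord_recr/= mul1r; apply: le_trans (lerD IH (wball_coord i v1 (cd n))) _.
      by rewrite exprSr; lra.
    by rewrite gerBl mulr_ge0 ?exprn_ge0 ?mulr_ge0 ?invr_ge0.
  have := rsum_cvg h (fun _ => lexx 1) => h2.
  by apply/cvg_ex; eexists; under eq_fun do rewrite e; exact: h2.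
pose z i := limn (fun n => c n i).
have cz i : (fun n => c n i) @ \oo --> z i by exact: cc.
have zr : wball v r z := wball_lim cr cz.
have zc n : wball v (4 * r * 2^-1 ^+ n) (fun i => z i - c n i).
  apply: wball_lim (cdm n) _ => i; apply: cvgB; last exact: cvg_cst.
  rewrite (_ : (fun k => c (n + k)%N i) = fun k => c (k + n)%N i).
    by rewrite (@cvg_shiftn n R (fun k => c k i)); exact: cz.
  by apply/funext => k; rewrite addnC.
exists z => // i; apply/eqP; rewrite -subr_eq0 -normr_le0.
have h n : `|T z i - z i| <= 6 * r * 2^-1 ^+ n.
  have h1 := Tc z (c n) _ zr (cr n) (zc n).
  have h2 := wballB v0 h1 (zc n.+1).
  have := h2 i.+1; rewrite big_ord_recr/= => h3.
  have {}h3 : v i * `|T z i - c n.+1 i - (z i - c n.+1 i)| <= 4 * r * 2^-1 ^+ n / 2 + 4 * r * 2^-1 ^+ n.+1.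
    by apply: le_trans h3; rewrite lerDr sumr_ge0// => k _; rewrite mulr_ge0.
  rewrite (_ : T z i - z i = T z i - c n.+1 i - (z i - c n.+1 i)); last by ring.
  apply: le_trans (_ : _ <= v i * `|T z i - c n.+1 i - (z i - c n.+1 i)|) _.
    by rewrite ler_peMl.
  apply: le_trans h3 _; rewrite exprSr.
  have : 0 <= r * 2^-1 ^+ n by rewrite mulr_ge0 ?exprn_ge0 ?invr_ge0.
  lra.
have half1 : (fun n => 6 * r * 2^-1 ^+ n) @ \oo --> (0 : R).
  rewrite -[X in _ --> X](mulr0 (6 * r)); apply: cvgMr.
  by apply: cvg_expr; rewrite ger0_norm ?invr_ge0// invf_lt1 ?ltr1n.
rewrite -(cvg_lim _ half1)//; apply: limr_ge; first by apply/cvg_ex; eexists; exact: half1.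
by apply: nearW.
Qed.

(** A bound d on z - z' improves to d / 2 + e; iterating from 2 r gives 2 e in the limit. It serves
    for uniqueness, with e = 0, and for Lipschitz dependence on a parameter. *)
Lemma wball_contraction_stable v (T T' : (nat -> R) -> nat -> R) r e z z' :
  (forall i, 1 <= v i) -> wball v r z -> wball v r z' ->
  (forall d, wball v d (fun i => z i - z' i) -> wball v (d / 2) (fun i => T z i - T z' i)) ->
  (forall i, T z i = z i) -> (forall i, T' z' i = z' i) ->
  wball v e (fun i => T z' i - T' z' i) -> wball v (2 * e) (fun i => z i - z' i).
Proof.
move=> v1 zr zr' Tc Tz Tz' he; have v0 i : 0 <= v i by rewrite (le_trans _ (v1 i)).
have e0 := wball_ge0 he; have r0 := wball_ge0 zr.
have h n : wball v (2 * r * 2^-1 ^+ n + 2 * e) (fun i => z i - z' i).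
  elim: n => [|n IH].
    apply: wball_le (wballB v0 zr zr') _; rewrite expr0; lra.
  have := wballD v0 (Tc _ IH) he => h K; move: (h K).
  under eq_bigr do rewrite addrA subrK Tz Tz'.
  move=> /le_trans; apply; rewrite exprSr; lra.
move=> K; have half1 : (fun n => 2 * r * 2^-1 ^+ n + 2 * e) @ \oo --> (2 * e : R).
  rewrite -[X in _ --> X]add0r; apply: cvgD; last exact: cvg_cst.
  rewrite -[X in _ --> X](mulr0 (2 * r)); apply: cvgMr.
  by apply: cvg_expr; rewrite ger0_norm ?invr_ge0// invf_lt1 ?ltr1n.
rewrite -(cvg_lim _ half1)//; apply: limr_ge; first by apply/cvg_ex; eexists; exact: half1.
by apply: nearW => n; exact: h.
Qed.

End WeightedSums.

(** * Calculus of maps that are small to a given order *)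

Section SmallClass.
Context {R : realType}.
Variable v : nat -> R.
Hypothesis v1 : forall i, 1 <= v i.
Implicit Types (b : nat -> R) (r d : R) (A B : (nat -> R) -> R -> R -> R) (k : nat).

Let v0 i : 0 <= v i. Proof. by rewrite (le_trans _ (v1 i)). Qed.

(* maps from small sequences to the Wiener algebra vanishing to order [k] at 0,
   with the matching local Lipschitz bound *)
Definition small k A : Prop := exists C r0, [/\ 0 <= C, 0 < r0 <= 1 &
  forall r d b b', r <= r0 -> wball v r b -> wball v r b' ->
    wball v d (fun i => b i - b' i) ->
    wiener (C * r ^+ k) (A b) /\
    wiener (C * r ^+ k.-1 * d) (fun th et => A b th et - A b' th et)].

Lemma small_ext k A B : small k A -> (forall b th et, A b th et = B b th et) -> small k B.
Proof.
move=> [C [r0 [C0 hr H]]] AB; exists C, r0; split => // r d b b' rr hb hb' hd.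
have [h1 h2] := H _ _ _ _ rr hb hb' hd; split.
  by apply: wiener_ext h1 _ => th et; exact: AB.
by apply: wiener_ext h2 _ => th et; rewrite !AB.
Qed.

Lemma smallD k A B : small k A -> small k B -> small k (fun b th et => A b th et + B b th et).
Proof.
move=> [C [r0 [C0 /andP[r00 r01] H]]] [C' [r0' [C0' /andP[r00' r01'] H']]].
exists (C + C'), (Num.min r0 r0'); split; first exact: addr_ge0.
  by rewrite lt_min r00 r00'/= ge_min r01.
move=> r d b b'; rewrite le_min => /andP[rr rr'] hb hb' hd.
have [h1 h2] := H _ _ _ _ rr hb hb' hd; have [h1' h2'] := H' _ _ _ _ rr' hb hb' hd.
split; first by rewrite mulrDl; exact: wienerD.
by rewrite !mulrDl; apply: wiener_ext (wienerD h2 h2') _ => th et; ring.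
Qed.

Lemma smallZ k c A : small k A -> small k (fun b th et => c * A b th et).
Proof.
move=> [C [r0 [C0 hr H]]]; exists (`|c| * C), r0; split => //; first exact: mulr_ge0.
move=> r d b b' rr hb hb' hd; have [h1 h2] := H _ _ _ _ rr hb hb' hd.
split; first by rewrite -mulrA; exact: wienerZ.
apply: wiener_le (wiener_ext (wienerZ c h2) _) _ => [th et|]; first by rewrite mulrBr.
by rewrite !mulrA.
Qed.

Lemma smallF k (G : R -> R -> R) M A : wiener M G -> small k A ->
  small k (fun b th et => G th et * A b th et).
Proof.
move=> hG [C [r0 [C0 hr H]]]; have M0 := wiener_ge0 hG.
exists (M * C), r0; split => //; first exact: mulr_ge0.
move=> r d b b' rr hb hb' hd; have [h1 h2] := H _ _ _ _ rr hb hb' hd.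
split; first by rewrite -mulrA; exact: wienerM.
apply: wiener_le (wiener_ext (wienerM hG h2) _) _ => [th et|]; first by rewrite mulrBr.
by rewrite !mulrA.
Qed.

(** Orders are successors so that the predecessor in the Lipschitz bound is never truncated. The
    factor 2 pays for the two terms of A B - A' B'. *)
Lemma smallM j k A B : small j.+1 A -> small k.+1 B ->
  small (j + k).+2 (fun b th et => A b th et * B b th et).
Proof.
move=> [C [r0 [C0 /andP[r00 r01] H]]] [C' [r0' [C0' /andP[r00' r01'] H']]].
exists (2 * (C * C')), (Num.min r0 r0'); split; first by rewrite !mulr_ge0.
  by rewrite lt_min r00 r00'/= ge_min r01.
move=> r d b b'; rewrite le_min => /andP[rr rr'] hb hb' hd.
(* [H] speaks of pairs and bounds the first member only; the pair (b', b') at distance 0 extracts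
   the bound for b'. *)
have z0 : wball v 0 (fun i => b' i - b' i).
  by move=> K; rewrite big1// => i _; rewrite subrr normr0 mulr0.
have [h1 h2] := H _ _ _ _ rr hb hb' hd; have [h1' h2'] := H' _ _ _ _ rr' hb hb' hd.
have [g1 _] := H _ _ _ _ rr hb' hb' z0; have r_ge0 := wball_ge0 hb; have d_ge0 := wball_ge0 hd.
split.
  apply: wiener_le (wienerM h1 h1') _.
  rewrite (_ : (j + k).+2 = j.+1 + k.+1)%N; last by rewrite addnS addSn.
  rewrite exprD [leLHS](_ : _ = (C * C') * (r ^+ j.+1 * r ^+ k.+1)); last by ring.
  by rewrite -[leRHS]mulrA ler_peMl// ?ler1n// !mulr_ge0 ?exprn_ge0.
apply: wiener_le (wiener_ext (wienerD (wienerM h2 h1') (wienerM g1 h2')) _) _.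
  by move=> th et; ring.
rewrite /= (_ : (j + k).+1 = j + k.+1)%N; last by rewrite addnS.
rewrite exprD exprS le_eqVlt; apply/orP; left; apply/eqP; rewrite exprS; ring.
Qed.

Lemma small_weaken k A : small k.+2 A -> small k.+1 A.
Proof.
move=> [C [r0 [C0 /andP[r00 r01] H]]]; exists C, r0; split => //; first by rewrite r00.
move=> r d b b' rr hb hb' hd; have [h1 h2] := H _ _ _ _ rr hb hb' hd.
have r_ge0 := wball_ge0 hb; have d_ge0 := wball_ge0 hd.
have r1 : r <= 1 by exact: le_trans r01.
split; [apply: wiener_le h1 _|apply: wiener_le h2 _].
  by rewrite ler_wpM2l// exprSr ler_piMr ?exprn_ge0.
by rewrite ler_wpM2r// ler_wpM2l//= exprSr ler_piMr ?exprn_ge0.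
Qed.

(** The radius shrinks to 1 / (2 C + 1) to keep the argument below 1/2, where the binomial series
    was estimated. *)
Lemma small_pow_rem (be : R) A : 0 < be < 2^-1 -> small 1 A ->
  small 2 (fun b th et => (1 + A b th et) `^ (- be) - 1 + be * A b th et).
Proof.
move=> beP [C [r0 [C0 /andP[r00 r01] H]]].
have c1 : 0 < 2 * C + 1 by rewrite ltr_wpDl// mulr_ge0.
exists (6 * C ^+ 2), (Num.min r0 (2 * C + 1)^-1); split.
- by rewrite mulr_ge0 ?sqr_ge0.
- by rewrite lt_min r00 invr_gt0 c1/= ge_min r01.
move=> r d b b'; rewrite le_min => /andP[rr rr'] hb hb' hd.
have z0 : wball v 0 (fun i => b' i - b' i).
  by move=> K; rewrite big1// => i _; rewrite subrr normr0 mulr0.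
have [h1 h2] := H _ _ _ _ rr hb hb' hd; have [g1 _] := H _ _ _ _ rr hb' hb' z0.
have r_ge0 := wball_ge0 hb; have d_ge0 := wball_ge0 hd.
rewrite /= expr1 expr0 mulr1 in h1 h2 g1 *.
have Cr : C * r <= 2^-1.
  rewrite -(ler_pM2l (ltr0n R 2)) mulfV ?pnatr_eq0// mulrA.
  have : (2 * C + 1) * r <= 1 by rewrite mulrC -ler_pdivlMr// mul1r.
  lra.
split.
  by apply: wiener_le (wiener_pow_rem beP Cr h1) _; rewrite exprMn mulrA.
apply: wiener_le (wiener_pow_remB beP Cr h1 g1 h2) _.
by rewrite le_eqVlt; apply/orP; left; apply/eqP; ring.
Qed.

Definition lin (l : nat -> R -> R -> R) b th et : R := rsum (fun i => b i * l i th et).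

Lemma lin_wball (l : nat -> R -> R -> R) r b th et : (forall i, wiener (v i) (l i)) ->
  wball v r b -> wball (fun _ => 1) r (fun i => b i * l i th et).
Proof.
move=> hl hb K; apply: le_trans (hb K); apply: ler_sum => i _.
by rewrite mul1r normrM mulrC ler_wpM2r// (wiener_bound _ _ (hl i)).
Qed.

Lemma lin_tail (l : nat -> R -> R -> R) r b e : (forall i, wiener (v i) (l i)) ->
  wball v r b -> 0 < e -> exists K, forall K', (K <= K')%N -> forall th et,
    `|lin l b th et - \sum_(i < K') b i * l i th et| <= e.
Proof.
move=> hl hb e0; have [K hK] := wball_tail v0 hb e0; exists K => K' KK' th et.
have hh := lin_wball th et hl hb.
apply: (@rsum_tail _ (fun _ => 1)) => //; last by right; exists r.
move=> K2 KK2; apply: le_trans (hK K2 (leq_trans KK' KK2)).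
rewrite (big_cat_nat (n := K') (m := K))//=.
apply: le_trans (_ : _ <= \sum_(K' <= i < K2) v i * `|b i|) _.
  by apply: ler_sum => i _; rewrite normrM mulrC ler_wpM2r// (wiener_bound _ _ (hl i)).
by rewrite lerDr sumr_ge0// => i _; rewrite mulr_ge0.
Qed.

Lemma wiener_lin (l : nat -> R -> R -> R) r b : (forall i, wiener (v i) (l i)) ->
  wball v r b -> wiener r (lin l b).
Proof.
move=> hl hb; apply: wiener_lim => e e0; have [K hK] := lin_tail hl hb e0.
exists (fun th et => \sum_(i < K) b i * l i th et); last by move=> th et; exact: hK.
apply: wiener_le (wiener_sum (f := fun i th et => b i * l i th et) (M := fun i => `|b i| * v i) _) _.
  by move=> k _; apply: wienerZ; exact: hl.
by apply: le_trans (hb K); apply: ler_sum => i _; rewrite mulrC.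
Qed.

Lemma linB (l : nat -> R -> R -> R) r r' b b' th et : (forall i, wiener (v i) (l i)) ->
  wball v r b -> wball v r' b' ->
  lin l (fun i => b i - b' i) th et = lin l b th et - lin l b' th et.
Proof.
move=> hl hb hb'; rewrite -(rsumB (lin_wball th et hl hb) (lin_wball th et hl hb'))//.
by congr rsum; apply/funext => i; rewrite mulrBl.
Qed.

Lemma small_lin (l : nat -> R -> R -> R) : (forall i, wiener (v i) (l i)) -> small 1 (lin l).
Proof.
move=> hl; exists 1, 1; split; rewrite ?ltr01 ?lexx// => r d b b' rr hb hb' hd.
rewrite expr1 expr0 !mul1r; split; first exact: wiener_lin.
by apply: wiener_ext (wiener_lin hl hd) _ => th et; exact: (linB th et hl hb hb').
Qed.

End SmallClass.

(** * Action of the kernel on single Fourier modes *)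

Section KernelModes.
Context {R : realType}.
Local Notation mu := (@lebesgue_measure R).
Variable be : R.
Hypothesis beP : 0 < be < 2^-1.
Implicit Types (x th et : R) (l : int) (q k i n : nat).

Lemma kap_cos_int x l :
  mu.-integrable `[0, 2 * pi] (EFin \o (fun et => cos (x + l%:~R * et) * kap be et)).
Proof.
apply: (kapM_int beP (K := 1)); last by move=> y; exact: cos_max.
apply: cont_meas; rewrite (_ : (fun _ => _) = fun et => cos (l%:~R * et + x)); first exact: cos_cont.
by apply/funext => y; rewrite addrC.
Qed.

Lemma kap_sin0 l : \int[mu]_(et in `[0, 2 * pi]) (sin (l%:~R * et) * kap be et) = 0.
Proof.
have h k : \int[mu]_(et in `[0, 2 * pi]) (sin (k%:R * et) * kap be et) = 0.
  rewrite -[RHS](smom0 beP k) /cmom; apply: eq_Rintegral => y _.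
  by rewrite cosBpihalf.
case: l => n; first exact: h.
transitivity (\int[mu]_(et in `[0, 2 * pi]) (-1 * (sin (n.+1%:R * et) * kap be et))).
  apply: eq_Rintegral => y _.
  have -> : sin ((Negz n)%:~R * y) = - sin (n.+1%:R * y) by rewrite NegzE intrN mulNr sinN.
  by rewrite mulN1r mulNr.
rewrite RintegralZl ?h ?mulr0//.
have := kap_cos_int (- (pi / 2)) n.+1%:Z; apply: eq_integrable => // y _ /=.
by rewrite addrC cosBpihalf.
Qed.

Definition kcos l : R := \int[mu]_(et in `[0, 2 * pi]) (cos (l%:~R * et) * kap be et).

Lemma kcosN l : kcos (- l) = kcos l.
Proof. by apply: eq_Rintegral => y _; rewrite intrN mulNr cosN. Qed.

Lemma kcos_nat k : kcos k%:Z = 2 * pi * gam be k.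
Proof.
rewrite /gam mulrC divfK ?gt_eqF ?twopi_gt0// /kcos /cmom.
by apply: eq_Rintegral => y _; rewrite addr0.
Qed.

Lemma kap_cosD x l :
  \int[mu]_(et in `[0, 2 * pi]) (cos (x + l%:~R * et) * kap be et) = cos x * kcos l.
Proof.
have i1 : mu.-integrable `[0, 2 * pi] (EFin \o (fun y => cos (l%:~R * y) * kap be y)).
  by have := kap_cos_int 0 l; apply: eq_integrable => // y _ /=; rewrite add0r.
have i2 : mu.-integrable `[0, 2 * pi] (EFin \o (fun y => sin (l%:~R * y) * kap be y)).
  have := kap_cos_int (- (pi / 2)) l; apply: eq_integrable => // y _ /=.
  by rewrite addrC cosBpihalf.
transitivity (\int[mu]_(et in `[0, 2 * pi])
  (cos x * (cos (l%:~R * et) * kap be et) - sin x * (sin (l%:~R * et) * kap be et))).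
  by apply: eq_Rintegral => y _; rewrite cosD; ring.
rewrite RintegralB//; try exact: intZ.
by rewrite !RintegralZl// kap_sin0 mulr0 subr0.
Qed.

Lemma kint_cosmode (q l : nat) th a :
  kint be (fun th et => cos (q%:R * th + l%:R * et + a)) th = cos (q%:R * th + a) * (2 * pi * gam be l).
Proof.
rewrite -kcos_nat -kap_cosD; apply: eq_Rintegral => y _; congr (cos _ * _).
by rewrite -[(l%:Z)%:~R]/(l%:R) addrAC.
Qed.

Lemma kint_sinmode (q l : nat) th :
  kint be (fun th et => sin (q%:R * th + l%:R * et)) th = sin (q%:R * th) * (2 * pi * gam be l).
Proof.
rewrite -(cosBpihalf (q%:R * th)) -kint_cosmode; apply: eq_Rintegral => y _.
by rewrite cosBpihalf.
Qed.

(** Evenness of the kernel: on trigonometric sums it follows from the vanishing of the sine moments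
    and the parity of the cosine moments, and it extends by uniform approximation. *)
Lemma kint_refl M f th : wiener M f ->
  kint be (fun x y => f (- x) (- y)) th = kint be f (- th).
Proof.
move=> h; apply/eqP; rewrite -subr_eq0 -normr_le0; apply/ler_addgt0Pr => e e0.
rewrite add0r; set K0 : R := \int[mu]_(et in `[0, 2 * pi]) kap be et.
have K0_ge0 : 0 <= K0 by apply: Rintegral_ge0 => x _; exact: kap_ge0.
have c0 : 0 < 2 * K0 + 1 by rewrite ltr_wpDl// mulr_ge0.
have [s sM fs] := h _ (divr_gt0 e0 c0); set e' := e / _ in fs.
have es : kint be (fun x y => ev s (- x) (- y)) th = kint be (ev s) (- th).
  have i1 (t : trig) x l : mu.-integrable `[0, 2 * pi] (EFin \o (fun y => t.1.1 * (cos (x + l%:~R * y) * kap be y))).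
    by apply: intZ => //; exact: kap_cos_int.
  have e1 (t : trig) : \int[mu]_(y in `[0, 2 * pi]) (t.1.1 * (cos (t.2.1%:~R * - th + t.1.2 + (- t.2.2)%:~R * y) * kap be y)) =
    \int[mu]_(y in `[0, 2 * pi]) (t.1.1 * (cos (t.2.1%:~R * - th + t.1.2 + t.2.2%:~R * y) * kap be y)).
    by rewrite !RintegralZl//; [rewrite !kap_cosD kcosN|exact: kap_cos_int|exact: kap_cos_int].
  have sE (s0 : seq trig) : mu.-integrable `[0, 2 * pi] (EFin \o (fun y => ev s0 (- th) (- y) * kap be y)) /\
     mu.-integrable `[0, 2 * pi] (EFin \o (fun y => ev s0 (- th) y * kap be y)).
    split; apply: (kapM_int beP (K := wn s0)); try by move=> x; exact: ev_le.
      apply: cont_meas => x; apply: (cvg_comp _ _ (_ : (fun y => - y) @ x --> - x)).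
        by apply: cvgN; exact: cvg_id.
      exact: (ev_cont_et (th := - th)).
    by apply: cont_meas; exact: ev_cont_et.
  rewrite /kint; elim: (s) => [|t s0 IH].
    by apply: eq_Rintegral => y _; rewrite /ev !big_nil.
  have [j1 j2] := sE s0.
  transitivity (\int[mu]_(y in `[0, 2 * pi]) (t.1.1 * (cos (t.2.1%:~R * - th + t.1.2 + (- t.2.2)%:~R * y) * kap be y) + ev s0 (- th) (- y) * kap be y)).
    apply: eq_Rintegral => y _; rewrite /ev big_cons mulrDl /tev -mulrA; congr (_ * (cos _ * _) + _).
    by rewrite intrN; ring.
  rewrite RintegralD// e1 IH -RintegralD//; apply: eq_Rintegral => y _.
  rewrite [in RHS]/ev big_cons mulrDl /tev -[in RHS]mulrA; congr (_ * (cos _ * _) + _).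
  by ring.
rewrite (_ : _ - _ = (kint be (fun x y => f (- x) (- y)) th - kint be (fun x y => ev s (- x) (- y)) th) - (kint be f (- th) - kint be (ev s) (- th))); last first.
  by rewrite es; ring.
have mneg (g : R -> R) : continuous g -> measurable_fun setT (fun y : R => g (- y)).
  move=> gc; apply: cont_meas => x; apply: (cvg_comp _ _ (_ : (fun y => - y) @ x --> - x)).
    by apply: cvgN; exact: cvg_id.
  exact: gc.
have b1 : `|kint be f (- th) - kint be (ev s) (- th)| <= K0 * e'.
  rewrite -(kintB beP (- th) h (wiener_ev s)); apply: kint_le => //.
  apply: cont_meas => x; apply: cvgB; [exact: (wiener_cont_et h)|exact: ev_cont_et].
have b2 : `|kint be (fun x y => f (- x) (- y)) th - kint be (fun x y => ev s (- x) (- y)) th| <= K0 * e'.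
  rewrite /kint -RintegralB//.
  - under eq_Rintegral do rewrite -mulrBl.
    rewrite -/(kint be (fun x y => f (- x) (- y) - ev s (- x) (- y)) th).
    apply: kint_le => //; apply: measurable_funB; apply: mneg; [exact: (wiener_cont_et h)|exact: ev_cont_et].
  - apply: (kapM_int beP (K := M)); [apply: mneg; exact: (wiener_cont_et h)|move=> y; exact: wiener_bound h].
  - apply: (kapM_int beP (K := wn s)); [apply: mneg; exact: ev_cont_et|move=> y; exact: ev_le].
apply: le_trans (ler_normB _ _) _; apply: le_trans (lerD b2 b1) _.
rewrite (_ : K0 * e' + K0 * e' = e * (2 * K0 / (2 * K0 + 1))); last by rewrite /e'; ring.
by rewrite ler_piMr ?(ltW e0)// ler_pdivrMr// mul1r lerDl.
Qed.

Definition Phi i (f : R -> R -> R) : R := sincoef i (kint be f).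

Lemma kint_bdd M f : wiener M f -> exists K, measurable_fun setT (kint be f) /\
  forall x, `|kint be f x| <= K.
Proof.
move=> h; have hk := wiener_kint beP h; eexists; split.
  by apply: cont_meas; exact: (wiener_cont_th (et := 0) hk).
by move=> x; exact: (wiener_bound x 0 hk).
Qed.

Lemma PhiD i M1 M2 f g : wiener M1 f -> wiener M2 g ->
  Phi i (fun th et => f th et + g th et) = Phi i f + Phi i g.
Proof.
move=> hf hg; have [K1 [m1 k1]] := kint_bdd hf; have [K2 [m2 k2]] := kint_bdd hg.
rewrite /Phi -(sincoefD i (K := Num.max K1 K2) m1 _ m2)//.
- by congr sincoef; apply/funext => th; exact: kintD hf hg.
- by move=> x; rewrite le_max k1.
- by move=> x; rewrite le_max k2 orbT.
Qed.

Lemma PhiZ i M f (c : R) : wiener M f -> Phi i (fun th et => c * f th et) = c * Phi i f.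
Proof.
move=> hf; have [K1 [m1 k1]] := kint_bdd hf.
rewrite /Phi -(sincoefZ i c m1 k1).
by congr sincoef; apply/funext => th; exact: kintZ hf.
Qed.

Lemma PhiB i M1 M2 f g : wiener M1 f -> wiener M2 g ->
  Phi i (fun th et => f th et - g th et) = Phi i f - Phi i g.
Proof.
move=> hf hg; rewrite -[X in _ + X]mulN1r -(PhiZ _ _ hg) -(PhiD _ hf (wienerZ _ hg)).
by congr Phi; apply/funext => x; apply/funext => y; rewrite mulN1r.
Qed.

Definition PhiK : R := 2 * \int[mu]_(et in `[0, 2 * pi]) kap be et.

Lemma PhiK_ge0 : 0 <= PhiK.
Proof. by rewrite mulr_ge0//; apply: Rintegral_ge0 => x _; exact: kap_ge0. Qed.

Lemma Phi_sum K M f : wiener M f -> \sum_(i < K) i.+2%:R * `|Phi i f| <= PhiK * M.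
Proof. by move=> h; exact: (sincoef_sum K (wiener_kint beP h)). Qed.

Lemma Phi_le i M f e : wiener M f -> (forall th et, `|f th et| <= e) -> `|Phi i f| <= PhiK * e.
Proof.
move=> h he; have [K1 [m1 k1]] := kint_bdd h; rewrite /PhiK -mulrA.
apply: sincoef_le => // x; apply: kint_le => //.
by apply: cont_meas; exact: (wiener_cont_et h).
Qed.

Lemma Phi_sumf i n (M : nat -> R) (f : nat -> R -> R -> R) : (forall k, wiener (M k) (f k)) ->
  Phi i (fun th et => \sum_(k < n) f k th et) = \sum_(k < n) Phi i (f k).
Proof.
move=> h; elim: n => [|n IH].
  rewrite big_ord0 (_ : (fun th et => _) = fun th et => 0 * 0); last first.
    by apply/funext => x; apply/funext => y; rewrite big_ord0 mulr0.
  by rewrite (PhiZ i 0 wiener0) mul0r.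
rewrite big_ord_recr/= -IH -(PhiD _ (wiener_sum (fun k _ => h k)) (h n)).
by congr Phi; apply/funext => x; apply/funext => y; rewrite big_ord_recr.
Qed.

(** Truncate the sum of modes beyond [i]: all retained modes but the [i]-th are killed, and the tail
    is uniformly small while [Phi] is continuous for the sup norm. *)
Lemma Phi_lin (v : nat -> R) i (l : nat -> R -> R -> R) r b : (forall k, 1 <= v k) ->
  (forall k, wiener (v k) (l k)) -> wball v r b -> (forall k, k != i -> Phi i (l k) = 0) ->
  Phi i (lin l b) = b i * Phi i (l i).
Proof.
move=> v1 hl hb h0; apply/eqP; rewrite -subr_eq0 -normr_le0; apply/ler_addgt0Pr => e e0.
rewrite add0r; have c0 : 0 < PhiK + 1 by rewrite ltr_wpDl// PhiK_ge0.
have [K hK] := lin_tail v1 hl hb (divr_gt0 e0 c0).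
set e' := e / _ in hK; pose K' := maxn K i.+1.
have hlb k : wiener (`|b k| * v k) (fun th et => b k * l k th et) by apply: wienerZ.
have -> : b i * Phi i (l i) = Phi i (fun th et => \sum_(k < K') b k * l k th et).
  rewrite (Phi_sumf i K' hlb).
  have iK : (i < K')%N by rewrite leq_maxr.
  rewrite (bigD1 (Ordinal iK))//= (PhiZ i (b i) (hl i)) big1 ?addr0// => k ki.
  by rewrite (PhiZ i (b k) (hl k)) h0 ?mulr0.
have hs := wiener_sum (n := K') (fun k _ => hlb k).
rewrite -(PhiB i (wiener_lin v1 hl hb) hs).
apply: le_trans (Phi_le i (wienerB (wiener_lin v1 hl hb) hs) (e := e') _) _.
  by move=> th et; apply: hK; rewrite leq_maxl.
by rewrite /e' mulrCA ler_piMr ?(ltW e0)// ler_pdivrMr// mul1r lerDl.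
Qed.

Lemma sincoef_sin i k (c : R) : sincoef i (fun th => sin (k.+1%:R * th) * c) = (i == k)%:R * c.
Proof.
have e : (fun th => sin (k.+1%:R * th) * c) = fun th => c * cos (k.+1%:Z%:~R * th + (- (pi / 2))).
  by apply/funext => th; rewrite cosBpihalf mulrC.
rewrite e (sincoefZ i c (K := 1)); first last.
- by move=> x; exact: cos_max.
- by apply: cont_meas; exact: cos_cont.
rewrite sincoef_cos /sincos sinN sin_pihalf.
have -> : (sgz k.+1%:Z)%:~R = 1 :> R by [].
have -> : `|Posz k.+1|%N = k.+1 by [].
by rewrite eqSS mul1r mulrN1 opprK mulrC.
Qed.

End KernelModes.

(** * Linearization at the disc *)

Section ContourModes.
Context {R : realType}.
Variable m : nat.
Hypothesis m2 : (1 < m)%N.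
Implicit Types (th et r : R) (b : nat -> R) (i k q l : nat).

(* [phi(w) = w + sum_i b_i w^(- deg i)] with [deg i + 1 = mult i] a multiple of [m];
   the first variable of all functions below is [m] times the angle of [w], the second
   the angle from [w] to the integration point *)
Definition mult i : nat := (i.+1 * m)%N.
Definition deg i : nat := (mult i).-1.
(** [mult i] absorbs the factor [deg i] of phi' and the [deg i] terms of the difference quotient;
    [i.+2] is the Wiener weight of the frequency i + 1. *)
Definition wt i : R := (mult i)%:R * i.+2%:R.

Lemma multE i : mult i = (deg i).+1.
Proof. by rewrite /deg prednK// /mult muln_gt0/= ltnW. Qed.

Lemma deg_le i : (deg i)%:R <= (mult i)%:R :> R.
Proof. by rewrite ler_nat /deg leq_pred. Qed.

Lemma mult_ge1 i : 1 <= (mult i)%:R :> R.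
Proof. by rewrite multE ler1n. Qed.

Lemma wt_ge1 i : 1 <= wt i.
Proof. by rewrite /wt -[leLHS]mulr1 ler_pM ?ler01 ?mult_ge1// ler1n. Qed.

Lemma wt_ge0 i : 0 <= wt i.
Proof. exact: le_trans ler01 (wt_ge1 i). Qed.

(** Real and imaginary parts of four relative perturbations at the angle t, with th = m t: the point
    is e^(i t) (1 + P), its tangent i e^(i t) (1 + E), the tangent at the integration point i e^(i
    (t + et)) (1 + T), and the chord (e^(i (t + et)) - e^(i t)) (1 + G). Names in [m] are single
    modes, names in [c] their superpositions. *)
Definition mP1 i th et : R := cos (i.+1%:R * th).
Definition mP2 i th et : R := - sin (i.+1%:R * th).
Definition mE1 i th et : R := - (deg i)%:R * cos (i.+1%:R * th).
Definition mE2 i th et : R := (deg i)%:R * sin (i.+1%:R * th).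
Definition mT1 i th et : R := - (deg i)%:R * cos (i.+1%:R * th + (mult i)%:R * et).
Definition mT2 i th et : R := (deg i)%:R * sin (i.+1%:R * th + (mult i)%:R * et).
Definition mG1 i th et : R := - \sum_(j < deg i) cos (i.+1%:R * th + j.+1%:R * et).
Definition mG2 i th et : R := \sum_(j < deg i) sin (i.+1%:R * th + j.+1%:R * et).

Lemma wiener_cosmode q l : wiener (q.+1%:R : R) (fun th et => cos (q%:R * th + l%:R * et)).
Proof.
have := @wiener_ev R [:: ((1, 0), (q%:Z, l%:Z))].
rewrite /wn big_seq1 /twt/= normr1 mul1r -[(q%:Z)%:~R]/(q%:R) normr_nat natr1.
by move=> /wiener_ext; apply => th et; rewrite /ev big_seq1 /tev /= mul1r addr0.
Qed.

Lemma wiener_sinmode q l : wiener (q.+1%:R : R) (fun th et => sin (q%:R * th + l%:R * et)).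
Proof.
have := @wiener_ev R [:: ((1, - (pi / 2)), (q%:Z, l%:Z))].
rewrite /wn big_seq1 /twt/= normr1 mul1r -[(q%:Z)%:~R]/(q%:R) normr_nat natr1.
by move=> /wiener_ext; apply => th et; rewrite /ev big_seq1 /tev /= mul1r cosBpihalf.
Qed.

Lemma wiener_cosmode0 q : wiener (q.+1%:R : R) (fun th et => cos (q%:R * th)).
Proof.
by apply: wiener_ext (wiener_cosmode q 0) _ => th et; rewrite mul0r addr0.
Qed.

Lemma wiener_sinmode0 q : wiener (q.+1%:R : R) (fun th et => sin (q%:R * th)).
Proof.
by apply: wiener_ext (wiener_sinmode q 0) _ => th et; rewrite mul0r addr0.
Qed.

Let le_wt i (c : R) : c <= (mult i)%:R -> c * i.+2%:R <= wt i.
Proof. by move=> h; rewrite ler_wpM2r. Qed.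

Lemma wiener_mP1 i : wiener (wt i) (mP1 i).
Proof.
apply: wiener_le (wiener_cosmode0 i.+1) _.
by rewrite -[leLHS]mul1r le_wt// mult_ge1.
Qed.

Lemma wiener_mP2 i : wiener (wt i) (mP2 i).
Proof.
apply: wiener_le (wienerN (wiener_sinmode0 i.+1)) _.
by rewrite -[leLHS]mul1r le_wt// mult_ge1.
Qed.

Lemma wiener_mE1 i : wiener (wt i) (mE1 i).
Proof.
apply: wiener_le (wienerZ _ (wiener_cosmode0 i.+1)) _.
by rewrite normrN normr_nat le_wt// deg_le.
Qed.

Lemma wiener_mE2 i : wiener (wt i) (mE2 i).
Proof.
apply: wiener_le (wienerZ _ (wiener_sinmode0 i.+1)) _.
by rewrite normr_nat le_wt// deg_le.
Qed.

Lemma wiener_mT1 i : wiener (wt i) (mT1 i).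
Proof.
apply: wiener_le (wienerZ _ (wiener_cosmode i.+1 (mult i))) _.
by rewrite normrN normr_nat le_wt// deg_le.
Qed.

Lemma wiener_mT2 i : wiener (wt i) (mT2 i).
Proof.
apply: wiener_le (wienerZ _ (wiener_sinmode i.+1 (mult i))) _.
by rewrite normr_nat le_wt// deg_le.
Qed.

Lemma wiener_mG1 i : wiener (wt i) (mG1 i).
Proof.
apply: wiener_le (wienerN (wiener_sum (n := deg i) (fun j _ => wiener_cosmode i.+1 j.+1))) _.
by rewrite sumr_const card_ord -[leLHS]mulr_natl le_wt// deg_le.
Qed.

Lemma wiener_mG2 i : wiener (wt i) (mG2 i).
Proof.
apply: wiener_le (wiener_sum (n := deg i) (fun j _ => wiener_sinmode i.+1 j.+1)) _.
by rewrite sumr_const card_ord -[leLHS]mulr_natl le_wt// deg_le.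
Qed.

Definition cP1 := lin mP1. Definition cP2 := lin mP2.
Definition cE1 := lin mE1. Definition cE2 := lin mE2.
Definition cT1 := lin mT1. Definition cT2 := lin mT2.
Definition cG1 := lin mG1. Definition cG2 := lin mG2.

Variable be : R.
Hypothesis beP : 0 < be < 2^-1.

(* [crossp] is the cross product of the two tangents, [1 + stretch] the squared
   distance of the two points divided by [chord2 et] *)
Definition crossp b th et : R :=
  ((1 + cE1 b th et) * (1 + cT1 b th et) + cE2 b th et * cT2 b th et) * sin et +
  ((1 + cE1 b th et) * cT2 b th et - cE2 b th et * (1 + cT1 b th et)) * cos et.

Definition stretch b th et : R :=
  2 * cG1 b th et + cG1 b th et * cG1 b th et + cG2 b th et * cG2 b th et.

(** The integrand of the normal velocity with the singular factor [kap] divided out, so that only a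
    regular function is expanded. *)
Definition cJ b th et : R := crossp b th et * (1 + stretch b th et) `^ (- be).

(** First-order part of [cJ] - sin: the linear terms of [crossp], and -be times the linear part 2
    [cG1] of [stretch], multiplied by sin. *)
Definition cL b th et : R := sin et * (cE1 b th et + cT1 b th et) +
  cos et * (cT2 b th et - cE2 b th et) - 2 * be * (sin et * cG1 b th et).

Definition rem1 b th et : R := cJ b th et - sin et - cL b th et.
Definition rem2 b th et : R := cP1 b th et * cE2 b th et - cP2 b th et * cE1 b th et.

Notation small := (small wt).

Lemma wiener_sin_et : wiener (1 : R) (fun th et => sin et).
Proof.
apply: wiener_le (wiener_ext (wiener_sinmode 0 1) _) _ => // th et.
by rewrite mul0r add0r mul1r.
Qed.

Lemma wiener_cos_et : wiener (1 : R) (fun th et => cos et).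
Proof.
apply: wiener_le (wiener_ext (wiener_cosmode 0 1) _) _ => // th et.
by rewrite mul0r add0r mul1r.
Qed.

Let sE1 : small 1 cE1. Proof. exact: (small_lin wt_ge1 wiener_mE1). Qed.
Let sE2 : small 1 cE2. Proof. exact: (small_lin wt_ge1 wiener_mE2). Qed.
Let sT1 : small 1 cT1. Proof. exact: (small_lin wt_ge1 wiener_mT1). Qed.
Let sT2 : small 1 cT2. Proof. exact: (small_lin wt_ge1 wiener_mT2). Qed.
Let sG1 : small 1 cG1. Proof. exact: (small_lin wt_ge1 wiener_mG1). Qed.
Let sG2 : small 1 cG2. Proof. exact: (small_lin wt_ge1 wiener_mG2). Qed.

Lemma smallB k A B : small k A -> small k B -> small k (fun b th et => A b th et - B b th et).
Proof.
move=> hA hB; apply: small_ext (smallD hA (smallZ (-1) hB)) _ => b th et.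
by rewrite mulN1r.
Qed.

Lemma small_rem2 : small 2 rem2.
Proof.
apply: smallB; first exact: (smallM (small_lin wt_ge1 wiener_mP1) sE2).
exact: (smallM (small_lin wt_ge1 wiener_mP2) sE1).
Qed.

Lemma small_cL : small 1 cL.
Proof.
apply: smallB; first apply: smallD.
- by apply: smallF wiener_sin_et _; apply: smallD.
- by apply: smallF wiener_cos_et _; apply: smallB.
- by apply: smallZ; apply: smallF wiener_sin_et _.
Qed.

Lemma small_stretch : small 1 stretch.
Proof.
apply: smallD; first apply: smallD; first exact: smallZ.
- by apply: small_weaken; exact: (smallM sG1 sG1).
- by apply: small_weaken; exact: (smallM sG2 sG2).
Qed.

Let quad b th et : R := sin et * (cE1 b th et * cT1 b th et + cE2 b th et * cT2 b th et) +
  cos et * (cE1 b th et * cT2 b th et - cE2 b th et * cT1 b th et).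

Let small_quad : small 2 quad.
Proof.
apply: smallD; [apply: smallF wiener_sin_et _; apply: smallD|apply: smallF wiener_cos_et _; apply: smallB].
- exact: (smallM sE1 sT1).
- exact: (smallM sE2 sT2).
- exact: (smallM sE1 sT2).
- exact: (smallM sE2 sT1).
Qed.

(** Write [crossp] = sin + A and the power of 1 + [stretch] as 1 + B, with A and B of first order
    ([s2] and [s1]). What remains is the quadratic part of A, sin times the nonlinear part of B, and
    the product A B. *)
Lemma small_rem1 : small 2 rem1.
Proof.
have sP := small_pow_rem beP small_stretch.
have sQ : small 2 (fun b th et => cG1 b th et * cG1 b th et + cG2 b th et * cG2 b th et).
  by apply: smallD; [exact: (smallM sG1 sG1)|exact: (smallM sG2 sG2)].
have s1 := smallB (small_weaken sP) (smallZ be small_stretch).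
have s2 := smallD (smallD small_cL (smallZ (2 * be) (smallF wiener_sin_et sG1))) (small_weaken small_quad).
have s3 := smallD small_quad (smallD (smallF wiener_sin_et (smallB sP (smallZ be sQ))) (smallM s2 s1)).
apply: small_ext s3 _ => b th et.
rewrite /rem1 /cJ /cL /crossp /quad /=.
set z := (1 + stretch b th et) `^ (- be); rewrite /stretch.
move: (cE1 b th et) (cE2 b th et) (cT1 b th et) (cT2 b th et) (cG1 b th et) (cG2 b th et) (sin et) (cos et) z => e1 e2 t1 t2 g1 g2 s c z.
ring.
Qed.

Let mell i th et : R := sin et * (mE1 i th et + mT1 i th et) +
  cos et * (mT2 i th et - mE2 i th et) - 2 * be * (sin et * mG1 i th et).

(** The products 2 sin et cos (x + j et) telescope, so the [deg i] cosines of [mG1] collapse and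
    each mode of the linearization reduces to four pure sine modes. *)
Let mellE i th et : mell i th et =
  ((deg i)%:R + be) * (sin (i.+1%:R * th + (deg i)%:R * et) - sin (i.+1%:R * th + 1%:R * et)) +
  be * (sin (i.+1%:R * th + (mult i)%:R * et) - sin (i.+1%:R * th + 0%:R * et)).
Proof.
rewrite /mell /mE1 /mE2 /mT1 /mT2 /mG1; set x := _ * th.
have tel n : 2 * (sin et * \sum_(j < n) cos (x + j.+1%:R * et)) =
  sin (x + n.+1%:R * et) + sin (x + n%:R * et) - sin (x + 1%:R * et) - sin (x + 0%:R * et).
  elim: n => [|n IH]; first by rewrite big_ord0; ring.
  rewrite big_ord_recr/= !mulrDr IH.
  have -> : x + n.+2%:R * et = (x + n.+1%:R * et) + et by rewrite -[n.+2%:R]natr1; ring.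
  have -> : x + n%:R * et = (x + n.+1%:R * et) - et by rewrite -natr1; ring.
  move: (x + n.+1%:R * et) => y; rewrite (sinD y et) (sinB y et); ring.
have {}tel := tel (deg i); rewrite -multE in tel.
have -> : 2 * be * (sin et * - \sum_(j < deg i) cos (x + j.+1%:R * et)) =
  - (be * (2 * (sin et * \sum_(j < deg i) cos (x + j.+1%:R * et)))) by ring.
rewrite tel.
have -> : x + (deg i)%:R * et = (x + (mult i)%:R * et) - et by rewrite multE -natr1; ring.
have -> : x + 1%:R * et = x + et by rewrite mul1r.
move: (x + (mult i)%:R * et) => y; rewrite (sinD x et) (sinB y et); ring.
Qed.

(** Superposition by [lin] wants modes of norm at most [wt i]; [mell] is made of five pieces of that
    size, hence the factor 1/5, undone in [cLE]. *)
Let wiener_mell i : wiener (wt i) (fun th et => 5^-1 * mell i th et).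
Proof.
have h1 := wienerM wiener_sin_et (wienerD (wiener_mE1 i) (wiener_mT1 i)).
have h2 := wienerM wiener_cos_et (wienerB (wiener_mT2 i) (wiener_mE2 i)).
have h3 := wienerZ (2 * be) (wienerM wiener_sin_et (wiener_mG1 i)).
apply: wiener_le (wienerZ 5^-1 (wienerB (wienerD h1 h2) h3)) _.
have w0 := wt_ge0 i; have b := beP.
rewrite !mul1r !ger0_norm ?invr_ge0//; last by lra.
rewrite mulrC ler_pdivrMr//.
have : 2 * be * wt i <= 1 * wt i by rewrite ler_wpM2r//; lra.
lra.
Qed.

Lemma Phi_sinmode i k l : Phi be i (fun th et => sin (k.+1%:R * th + l%:R * et)) =
  (i == k)%:R * (2 * pi * gam be l).
Proof.
rewrite -sincoef_sin /Phi; congr sincoef; apply/funext => th.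
exact: kint_sinmode.
Qed.

(** The recurrence of [gam] at [deg k] and at 0 eliminates those two coefficients; what is left is
    the difference of [gam] that also defines [Omega_m]. *)
Let Phi_mell i k : Phi be i (mell k) =
  (i == k)%:R * (2 * pi * (mult k)%:R * (gam be (mult k) - gam be 1)).
Proof.
have -> : mell k = fun th et =>
  ((deg k)%:R + be) * (sin (k.+1%:R * th + (deg k)%:R * et) - sin (k.+1%:R * th + 1%:R * et)) +
  be * (sin (k.+1%:R * th + (mult k)%:R * et) - sin (k.+1%:R * th + 0%:R * et)).
  by apply/funext => th; apply/funext => et; exact: mellE.
have w l := wiener_sinmode k.+1 l.
rewrite (PhiD beP i (wienerZ _ (wienerB (w (deg k)) (w 1%N))) (wienerZ _ (wienerB (w (mult k)) (w 0%N)))).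
rewrite (PhiZ beP i _ (wienerB (w (deg k)) (w 1%N))) (PhiZ beP i _ (wienerB (w (mult k)) (w 0%N))).
rewrite (PhiB beP i (w (deg k)) (w 1%N)) (PhiB beP i (w (mult k)) (w 0%N)) !Phi_sinmode.
have r1 := gam_rec beP (deg k); have r2 := gam_rec beP 0.
rewrite -multE add0r in r1 r2; move: r1 r2.
have -> : (deg k)%:R = (mult k)%:R - 1 :> R by rewrite multE -natr1 addrK.
move: (gam be (mult k)) (gam be (deg k)) (gam be 1) (gam be 0) ((mult k)%:R : R) ((i == k)%:R : R) => gn gN g1 g0 n de r1 r2.
have e1 : (n - 1 + be) * gN = n * gn - be * gn by rewrite -r1; ring.
have e2 : be * g0 = g1 - be * g1 by rewrite -r2; ring.
rewrite [LHS](_ : _ = de * (2 * pi) * ((n - 1 + be) * gN - (n - 1 + be) * g1 + be * gn - be * g0)); last by ring.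
by rewrite e1 e2; ring.
Qed.

Let cLE r b th et : wball wt r b -> cL b th et = 5 * lin (fun i th et => 5^-1 * mell i th et) b th et.
Proof.
move=> hb.
have -> : lin (fun i th et => 5^-1 * mell i th et) b th et =
  rsum (fun i => 5^-1 * (sin et * (b i * mE1 i th et)) + 5^-1 * (sin et * (b i * mT1 i th et)) +
    (5^-1 * (cos et * (b i * mT2 i th et)) + - 5^-1 * (cos et * (b i * mE2 i th et))) +
    (- 5^-1 * (2 * be)) * (sin et * (b i * mG1 i th et))).
  by congr rsum; apply/funext => i; rewrite /mell; ring.
have w1 := lin_wball th et wiener_mE1 hb; have w2 := lin_wball th et wiener_mT1 hb.
have w3 := lin_wball th et wiener_mT2 hb; have w4 := lin_wball th et wiener_mE2 hb.
have w5 := lin_wball th et wiener_mG1 hb.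
have u1 := wballZ 5^-1 (wballZ (sin et) w1); have u2 := wballZ 5^-1 (wballZ (sin et) w2).
have u3 := wballZ 5^-1 (wballZ (cos et) w3); have u4 := wballZ (- 5^-1) (wballZ (cos et) w4).
have u5 := wballZ (- 5^-1 * (2 * be)) (wballZ (sin et) w5).
have p (i : nat) : 0 <= (1 : R) by [].
rewrite (rsumD (wballD p (wballD p u1 u2) (wballD p u3 u4)) u5)//.
rewrite (rsumD (wballD p u1 u2) (wballD p u3 u4))// (rsumD u1 u2)// (rsumD u3 u4)//.
rewrite !(rsumZ _ (wballZ _ w1))// !(rsumZ _ w1)// !(rsumZ _ (wballZ _ w2))// !(rsumZ _ w2)//.
rewrite !(rsumZ _ (wballZ _ w3))// !(rsumZ _ w3)// !(rsumZ _ (wballZ _ w4))// !(rsumZ _ w4)//.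
rewrite !(rsumZ _ (wballZ _ w5))// !(rsumZ _ w5)//.
by rewrite /cL /cE1 /cT1 /cT2 /cE2 /cG1 /lin; field.
Qed.

Lemma Phi_cL i r b : wball wt r b ->
  Phi be i (cL b) = b i * (2 * pi * (mult i)%:R * (gam be (mult i) - gam be 1)).
Proof.
move=> hb; have -> : cL b = fun th et => 5 * lin (fun i th et => 5^-1 * mell i th et) b th et.
  by apply/funext => th; apply/funext => et; exact: cLE hb.
have wl := wiener_lin wt_ge1 wiener_mell hb.
have hm k : Phi be i (fun th et => 5^-1 * mell k th et) = 5^-1 * Phi be i (mell k).
  have : wiener (5 * wt k) (mell k).
    apply: wiener_ext (wiener_le (wienerZ 5 (wiener_mell k)) _) _.
      by rewrite normr_nat.
    by move=> th et; rewrite mulrA mulfV ?mul1r ?pnatr_eq0.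
  exact: PhiZ.
rewrite (PhiZ beP i 5 wl) (Phi_lin beP (r := r) wt_ge1 wiener_mell hb).
  by rewrite hm Phi_mell eqxx mul1r; field.
by move=> k ki; rewrite hm Phi_mell eq_sym (negbTE ki) mul0r mulr0.
Qed.

(** The part of the linearization multiplied by the angular velocity: the tangent contributes
    [deg i] and the point 1, together [mult i]. *)
Lemma Phi_cE2P2 i r b : wball wt r b ->
  Phi be i (fun th et => cE2 b th et - cP2 b th et) = b i * (2 * pi * (mult i)%:R * gam be 0).
Proof.
move=> hb.
rewrite (PhiB beP i (wiener_lin wt_ge1 wiener_mE2 hb) (wiener_lin wt_ge1 wiener_mP2 hb)).
have s0 k : Phi be i (fun th et => sin (k.+1%:R * th)) = (i == k)%:R * (2 * pi * gam be 0).
  by rewrite -Phi_sinmode; congr Phi; apply/funext => th; apply/funext => et; rewrite mul0r addr0.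
have hE k : Phi be i (mE2 k) = (deg k)%:R * ((i == k)%:R * (2 * pi * gam be 0)).
  by rewrite -s0 -(PhiZ beP i _ (wiener_sinmode0 k.+1)).
have hP k : Phi be i (mP2 k) = - ((i == k)%:R * (2 * pi * gam be 0)).
  rewrite -s0 -mulN1r -(PhiZ beP i _ (wiener_sinmode0 k.+1)).
  by congr Phi; apply/funext => th; apply/funext => et; rewrite mulN1r.
rewrite (Phi_lin beP (r := r) wt_ge1 wiener_mE2 hb); last first.
  by move=> k ki; rewrite hE eq_sym (negbTE ki) mul0r mulr0.
rewrite (Phi_lin beP (r := r) wt_ge1 wiener_mP2 hb); last first.
  by move=> k ki; rewrite hP eq_sym (negbTE ki) mul0r oppr0.
rewrite hE hP eqxx mul1r multE -natr1; ring.
Qed.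

End ContourModes.

(** * Bifurcation from a simple eigenvalue *)

Section LyapunovSchmidt.
Context {R : realType}.
Variables (M lam : nat -> R) (rho : (nat -> R) -> R -> nat -> R) (om0 de K r1 : R).
Let q i : R := i.+2%:R.
Let w i : R := M i * q i.
Hypothesis M1 : forall i, 1 <= M i.
Hypothesis de0 : 0 < de.
Hypothesis lam_ge : forall i, de <= lam i.+1.
Hypothesis K0 : 0 <= K.
Hypothesis r1_gt0 : 0 < r1.
Hypothesis rho_bound : forall r b om, r <= r1 -> wball w r b -> `|om - om0| <= 1 ->
  wball q (K * r ^+ 2) (rho b om).
Hypothesis rho_lip : forall r d b b' om om', r <= r1 -> wball w r b -> wball w r b' ->
  wball w d (fun i => b i - b' i) -> `|om - om0| <= 1 -> `|om' - om0| <= 1 ->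
  wball q (K * (r * d + r ^+ 2 * `|om - om'|)) (fun i => rho b om i - rho b' om' i).

(* the unknown [z] packs the frequency shift into [z 0] and the rescaled modes
   [b i / s] into [z i], [i > 0]; [b 0 = s] is the parameter of the branch *)
Let v i : R := if i is 0%N then 1 else w i.
Definition rescale (s : R) (z : nat -> R) i : R := s * (if i is 0%N then 1 else z i).
(** The equation s M_i z_i (z_0 - lam_i) + rho_i = 0 divided by s, with x = rho / s and y_i = z_0
    z_i. For i > 0 it is solved for lam_i z_i. For i = 0, where the mode is normalized to 1 and
    lam_0 = 0, it determines z_0. *)
Let solve (x y : nat -> R) i : R :=
  if i is 0%N then - x 0%N / M 0%N else (x i / M i + y i) / lam i.
(** At s = 0 the quotient is 0 by convention, which is also its limit since [rho] is quadratic: the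
    branch starts at the trivial solution. *)
Let T s z := solve (fun i => rho (rescale s z) (om0 + z 0%N) i / s) (fun i => z 0%N * z i).

Let c0 : R := 1 + de^-1.
Let W : R := w 0%N + 1.

Let M_gt0 i : 0 < M i. Proof. exact: lt_le_trans ltr01 (M1 i). Qed.
Let q1 i : 1 <= q i. Proof. by rewrite ler1n. Qed.
Let q0 i : 0 <= q i. Proof. exact: le_trans ler01 (q1 i). Qed.
Let w1 i : 1 <= w i. Proof. by rewrite -[leLHS]mulr1 ler_pM ?ler01 ?M1 ?q1. Qed.
Let w0 i : 0 <= w i. Proof. exact: le_trans ler01 (w1 i). Qed.
Let v1 i : 1 <= v i. Proof. by case: i => //= i; exact: w1. Qed.
Let v0 i : 0 <= v i. Proof. exact: le_trans ler01 (v1 i). Qed.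
Let c0_ge1 : 1 <= c0. Proof. by rewrite lerDl invr_ge0 ltW. Qed.
Let c0_ge0 : 0 <= c0. Proof. exact: le_trans ler01 c0_ge1. Qed.
Let W1 : 1 <= W. Proof. by rewrite lerDr. Qed.
Let W0 : 0 <= W. Proof. exact: le_trans ler01 W1. Qed.
Let lam_gt0 i : 0 < lam i.+1. Proof. exact: lt_le_trans de0 (lam_ge i). Qed.

(** Division by [M i] turns the weight [q] of the remainder into the weight [w] of the unknown: here
    the lost derivative is recovered. *)
Let solve_le X Y x y : wball q X x -> wball v Y y ->
  wball v (c0 * X + de^-1 * Y) (solve x y).
Proof.
move=> hx hy n; apply: le_trans (lerD (ler_wpM2l c0_ge0 (hx n)) (ler_wpM2l _ (hy n))).
  2: by rewrite invr_ge0 ltW.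
rewrite !mulr_sumr -big_split/=; apply: ler_sum => -[[|i] _] _ /=.
  rewrite mul1r normrM normrN normfV (ger0_norm (ltW (M_gt0 0))).
  apply: (@le_trans _ _ (c0 * (q 0%N * `|x 0%N|))).
    rewrite ler_pdivrMr//; apply: (@le_trans _ _ (q 0%N * `|x 0%N|)); first by rewrite ler_peMl.
    have h : 0 <= q 0%N * `|x 0%N| by rewrite mulr_ge0.
    rewrite mulrAC ler_peMl// -[leLHS]mulr1; apply: ler_pM => //; exact: M1.
  by rewrite lerDl mulr_ge0// ?invr_ge0 ?(ltW de0)// mulr_ge0.
rewrite normrM normfV (ger0_norm (ltW (lam_gt0 i))).
apply: (@le_trans _ _ (w i.+1 * ((`|x i.+1| / M i.+1 + `|y i.+1|) / de))).
  rewrite ler_wpM2l//; apply: ler_pM => //; first by rewrite invr_ge0 ltW.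
    apply: le_trans (ler_normD _ _) _; rewrite lerD2r normrM normfV.
    by rewrite (ger0_norm (ltW (M_gt0 i.+1))).
  by rewrite lef_pV2// posrE.
have -> : w i.+1 * ((`|x i.+1| / M i.+1 + `|y i.+1|) / de) =
    de^-1 * (q i.+1 * `|x i.+1|) + de^-1 * (w i.+1 * `|y i.+1|).
  by rewrite /w; field; rewrite !gt_eqF.
by rewrite lerD2r ler_wpM2r ?mulr_ge0// lerDr.
Qed.

Let solveB x y x' y' i : solve x y i - solve x' y' i =
  solve (fun i => x i - x' i) (fun i => y i - y' i) i.
Proof. by case: i => [|i] /=; [ring|ring]. Qed.

Let rescale_ball s r z : r <= 1 -> wball v r z -> wball w (`|s| * W) (rescale s z).
Proof.
move=> r1' hz; apply: wballZ => n; apply: (@le_trans _ _ (w 0%N + r)); last by rewrite lerD2l.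
apply: (@le_trans _ _ (w 0%N + \sum_(i < n) v i * `|z i|)); last by rewrite lerD2l.
case: n => [|n]; first by rewrite !big_ord0 addr0.
rewrite !big_ord_recl/= normr1 mulr1 lerD2l.
by apply: ler_wpDl; [rewrite mulr_ge0|apply: ler_sum => i _].
Qed.

Let rescale_lip s d z z' : wball v d (fun i => z i - z' i) ->
  wball w (`|s| * d) (fun i => rescale s z i - rescale s z' i).
Proof.
move=> hz.
have h : wball w d (fun i => (if i is 0%N then 1 else z i) - (if i is 0%N then 1 else z' i)).
  move=> n; apply: le_trans (hz n); apply: ler_sum => -[[|i] _] _ //=.
  by rewrite subrr normr0 mulr0 mul1r.
move=> n; move: (wballZ s h n); under eq_bigr do rewrite mulrBr.
by [].
Qed.

Let rescale_param s s' r z : r <= 1 -> wball v r z ->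
  wball w (`|s - s'| * W) (fun i => rescale s z i - rescale s' z i).
Proof.
move=> rr hz n; have := rescale_ball (s - s') rr hz n.
by under eq_bigr do rewrite /rescale mulrBl.
Qed.

(** [r0] <= de / 8 limits the contribution of z_0 z_i to the contraction constant to 1/4; [a] limits
    that of the remainder to 1/4 and keeps the rescaled sequence inside the radius [r1]. *)
Let r0 : R := Num.min 1 (de / 8).
Let a : R := Num.min (r1 / W) (r0 / (8 * (c0 * (K + 1) * W ^+ 2))).

Let r0_gt0 : 0 < r0. Proof. by rewrite lt_min ltr01 divr_gt0. Qed.
Let r0_le1 : r0 <= 1. Proof. by rewrite ge_min lexx. Qed.
Let r0_de : de^-1 * r0 <= 8^-1.
Proof. by rewrite ler_pdivrMl// ge_min lexx orbT. Qed.

Let D0 : 0 < 8 * (c0 * (K + 1) * W ^+ 2).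
Proof.
rewrite mulr_gt0// mulr_gt0 ?exprn_gt0 ?(lt_le_trans ltr01 W1)//.
by rewrite mulr_gt0 ?(lt_le_trans ltr01 c0_ge1)// ltr_wpDl.
Qed.

Let a_gt0 : 0 < a.
Proof. by rewrite lt_min !divr_gt0// (lt_le_trans ltr01 W1). Qed.

Let small_s (s : R) : `|s| < a -> `|s| * W <= r1 /\ c0 * (K * (`|s| * W ^+ 2)) <= r0 / 8.
Proof.
rewrite lt_min => /andP[h1 h2]; split.
  by rewrite -ler_pdivlMr ?(lt_le_trans ltr01 W1)// ltW.
move: h2; rewrite ltr_pdivlMr// => /ltW h2.
rewrite ler_pdivlMr//; apply: le_trans h2.
rewrite [leRHS](_ : _ = `|s| * (8 * (c0 * (K + 1) * W ^+ 2))); last by [].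
have : 0 <= `|s| * (8 * (c0 * W ^+ 2)) by rewrite !mulr_ge0 ?exprn_ge0.
rewrite -subr_ge0 => h; rewrite -subr_ge0; apply: le_trans h _.
by rewrite subr0 le_eqVlt; apply/orP; left; apply/eqP; ring.
Qed.

Let z0_le r z : wball v r z -> `|z 0%N| <= r. Proof. by move=> h; exact: wball_coord v1 h. Qed.

Let wballV X (x : nat -> R) s : wball q X x -> wball q (`|s|^-1 * X) (fun i => x i / s).
Proof.
move=> h; have -> : (fun i => x i / s) = fun i => s^-1 * x i by apply/funext => i; rewrite mulrC.
by rewrite -normfV; exact: wballZ.
Qed.

Let div_sq (s X Y : R) : `|s|^-1 * (K * (`|s| * X * (`|s| * Y))) <= K * (`|s| * (X * Y)).
Proof.
have [->|s0] := eqVneq s 0; first by rewrite normr0 !(mul0r, mulr0).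
by rewrite le_eqVlt; apply/orP; left; apply/eqP; field; rewrite normr_eq0.
Qed.

Let omE z r : r <= r0 -> wball v r z -> `|om0 + z 0%N - om0| <= 1.
Proof.
by move=> rr /z0_le h; rewrite [om0 + _]addrC addrK (le_trans h)// (le_trans rr).
Qed.

Let quad_ball r z : wball v r z -> wball v (r * r) (fun i => z 0%N * z i).
Proof.
move=> hz; apply: wball_le (wballZ _ hz) _; rewrite ler_wpM2r ?(wball_ge0 hz)//.
exact: z0_le.
Qed.

Let quad_lip r d z z' : wball v r z -> wball v r z' -> wball v d (fun i => z i - z' i) ->
  wball v (2 * r * d) (fun i => z 0%N * z i - z' 0%N * z' i).
Proof.
move=> hz hz' hd.
have h := wballD v0 (wballZ (z 0%N) hd) (wballZ (z 0%N - z' 0%N) hz').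
have e : (fun i => z 0%N * z i - z' 0%N * z' i) =
    (fun i => z 0%N * (z i - z' i) + (z 0%N - z' 0%N) * z' i).
  by apply/funext => i; ring.
rewrite e; apply: wball_le h _.
have -> : 2 * r * d = r * d + d * r by ring.
apply: lerD; [apply: ler_wpM2r; [exact: wball_ge0 hd|exact: z0_le]|].
by apply: ler_wpM2r; [exact: wball_ge0 hz|exact: z0_le hd].
Qed.

Let T_ball s z : `|s| < a -> wball v r0 z -> wball v r0 (T s z).
Proof.
move=> /small_s[sr sc] hz.
have h1 := rho_bound sr (rescale_ball s r0_le1 hz) (omE (lexx _) hz).
apply: wball_le (solve_le (wballV s h1) (quad_ball hz)) _.
have e1 : `|s|^-1 * (K * (`|s| * W) ^+ 2) <= K * (`|s| * W ^+ 2) := div_sq s W W.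
have e2 := le_trans (ler_wpM2l c0_ge0 e1) sc.
have e3 : de^-1 * (r0 * r0) <= 8^-1 * r0 by rewrite mulrA ler_wpM2r ?(ltW r0_gt0)// r0_de.
apply: le_trans (lerD e2 e3) _; have := r0_gt0; lra.
Qed.

Let T_lip s z z' d : `|s| < a -> wball v r0 z -> wball v r0 z' ->
  wball v d (fun i => z i - z' i) -> wball v (d / 2) (fun i => T s z i - T s z' i).
Proof.
move=> /small_s[sr sc] hz hz' hd; have d0 := wball_ge0 hd.
have h1 := rho_lip sr (rescale_ball s r0_le1 hz) (rescale_ball s r0_le1 hz')
  (rescale_lip s hd) (omE (lexx _) hz) (omE (lexx _) hz').
have -> : (fun i => T s z i - T s z' i) = solve
   (fun i => (rho (rescale s z) (om0 + z 0%N) i - rho (rescale s z') (om0 + z' 0%N) i) / s)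
   (fun i => z 0%N * z i - z' 0%N * z' i).
  apply/funext => i; rewrite solveB; congr (solve _ _ i).
  by apply/funext => j; rewrite mulrBl.
apply: wball_le (solve_le (wballV s h1) (quad_lip hz hz' hd)) _.
have dz : `|om0 + z 0%N - (om0 + z' 0%N)| <= d.
  by rewrite opprD addrACA subrr add0r; exact: z0_le hd.
have e1 : `|s|^-1 * (K * (`|s| * W * (`|s| * d) + (`|s| * W) ^+ 2 * `|om0 + z 0%N - (om0 + z' 0%N)|))
   <= (K * (`|s| * W ^+ 2)) * (2 * d).
  rewrite mulrDr mulrDr; have f1 := div_sq s W d; have f2 := div_sq s W W.
  have f3 : `|s|^-1 * (K * ((`|s| * W) ^+ 2 * `|om0 + z 0%N - (om0 + z' 0%N)|)) <=
      K * (`|s| * W ^+ 2) * d.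
    rewrite [K * (_ * `|_ - _|)]mulrA [_^-1 * (_ * `|_ - _|)]mulrA; apply: ler_pM => //.
    by rewrite mulr_ge0 ?invr_ge0// mulr_ge0 ?sqr_ge0.
  apply: le_trans (lerD f1 f3) _.
  have : K * (`|s| * (W * d)) <= K * (`|s| * W ^+ 2) * d.
    rewrite -!mulrA ler_wpM2l// ler_wpM2l// mulrA ler_wpM2r// ler_peMl//.
  lra.
have e2 := ler_wpM2l c0_ge0 e1; rewrite [leRHS]mulrA in e2.
have e3 : c0 * (K * (`|s| * W ^+ 2)) * (2 * d) <= r0 / 8 * (2 * d).
  by rewrite ler_wpM2r// mulr_ge0.
have e4 : de^-1 * (2 * r0 * d) <= 8^-1 * (2 * d).
  rewrite (_ : de^-1 * (2 * r0 * d) = (de^-1 * r0) * (2 * d)); last by ring.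
  by rewrite ler_wpM2r// mulr_ge0.
have e5 : r0 / 8 * (2 * d) <= 1 / 8 * (2 * d).
  by rewrite ler_wpM2r ?mulr_ge0// ler_wpM2r// invr_ge0.
apply: le_trans (lerD (le_trans e2 (le_trans e3 e5)) e4) _; lra.
Qed.

Let L : R := 4 * (c0 * (K * W ^+ 2)).

(** The larger parameter comes first, so s = 0 forces s' = 0. The difference of quotients is (rho -
    rho') / s + (1 / s - 1 / s') rho', and the second term is harmless because rho' is quadratic in
    s' and |s'| <= |s|. *)
Let T_param s s' z : `|s| < a -> `|s'| <= `|s| -> wball v r0 z ->
  wball v (c0 * (2 * K * W ^+ 2 * `|s - s'|)) (fun i => T s z i - T s' z i).
Proof.
move=> /[dup] sa /small_s[sr sc] ss hz.
have h0 : wball v 0 (fun i => z 0%N * z i - z 0%N * z i).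
  by move=> n; rewrite big1// => i _; rewrite subrr normr0 mulr0.
suff h : wball q (2 * K * W ^+ 2 * `|s - s'|) (fun i =>
    rho (rescale s z) (om0 + z 0%N) i / s - rho (rescale s' z) (om0 + z 0%N) i / s').
  have := solve_le h h0; rewrite mulr0 addr0 => h2 n; move: (h2 n).
  by under eq_bigr do rewrite -solveB.
have [s0|s0] := eqVneq s 0.
  have -> : s' = 0 by apply/eqP; rewrite -normr_le0 (le_trans ss)// s0 normr0.
  move=> n; rewrite s0 subrr normr0 mulr0 big1// => i _.
  by rewrite invr0 !mulr0 subrr normr0 mulr0.
have ns0 : 0 < `|s| by rewrite normr_gt0.
have om1 := omE (lexx _) hz.
have b1 := rescale_ball s r0_le1 hz.
have b2 : wball w (`|s| * W) (rescale s' z).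
  by apply: wball_le (rescale_ball s' r0_le1 hz) _; rewrite ler_wpM2r.
have h1 := rho_lip sr b1 b2 (rescale_param s s' r0_le1 hz) om1 om1.
rewrite subrr normr0 mulr0 addr0 in h1.
have k1 := wballV s h1.
have sr' : `|s'| * W <= r1 by apply: le_trans sr; rewrite ler_wpM2r.
have h2 := rho_bound sr' (rescale_ball s' r0_le1 hz) om1.
have k2 := wballZ (s^-1 - s'^-1) h2.
have k := wballD q0 k1 k2.
have -> : (fun i => rho (rescale s z) (om0 + z 0%N) i / s - rho (rescale s' z) (om0 + z 0%N) i / s') =
  (fun i => (rho (rescale s z) (om0 + z 0%N) i - rho (rescale s' z) (om0 + z 0%N) i) / s +
    (s^-1 - s'^-1) * rho (rescale s' z) (om0 + z 0%N) i).
  by apply/funext => i; ring.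
apply: wball_le k _.
have e1 : `|s|^-1 * (K * (`|s| * W * (`|s - s'| * W))) = K * W ^+ 2 * `|s - s'|.
  by field; rewrite gt_eqF.
have e2 : `|s^-1 - s'^-1| * (K * (`|s'| * W) ^+ 2) <= K * W ^+ 2 * `|s - s'|.
  have [->|s'0] := eqVneq s' 0.
    by rewrite normr0 mul0r expr0n/= !mulr0 mulr_ge0// mulr_ge0 ?sqr_ge0.
  have -> : s^-1 - s'^-1 = (s' - s) / (s * s') by field; rewrite s0 s'0.
  rewrite normrM normfV normrM distrC.
  have n's0 : 0 < `|s'| by rewrite normr_gt0.
  have -> : `|s - s'| / (`|s| * `|s'|) * (K * (`|s'| * W) ^+ 2) = K * W ^+ 2 * `|s - s'| * (`|s'| / `|s|).
    by field; rewrite !gt_eqF.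
  by rewrite ler_piMr ?ler_pdivrMr ?mul1r// mulr_ge0// mulr_ge0 ?sqr_ge0.
rewrite e1; lra.
Qed.

Theorem bifurcation : exists (a L W : R) (b : R -> nat -> R) (om : R -> R),
  [/\ 0 < a, 0 <= L /\ 0 <= W,
   om 0 = om0 /\ (forall s, `|s| < a -> b s 0%N = s),
   (forall s, `|s| < a -> [/\ wball w (`|s| * W) (b s), `|om s - om0| <= 1 &
      (lam 0%N = 0 -> forall i, b s i * M i * (om s - om0 - lam i) + rho (b s) (om s) i = 0)]) &
   (forall s s', `|s| < a -> `|s'| < a ->
      wball w (L * `|s - s'|) (fun i => b s i - b s' i) /\ `|om s - om s'| <= L * `|s - s'|)].
Proof.
have /choice[z hz] s : exists z, `|s| < a -> wball v r0 z /\ forall i, T s z i = z i.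
  have [sa|sa] := pselect (`|s| < a); last by exists (fun _ => 0).
  have [z zr zT] := wball_contraction v1 (ltW r0_gt0) (fun z h => T_ball sa h)
    (fun z z' d hz hz' hd => T_lip sa hz hz' hd).
  by exists z.
have L0 : 0 <= L by rewrite !mulr_ge0// sqr_ge0.
have lip0 s s' : `|s| < a -> `|s'| <= `|s| -> wball v (L * `|s - s'|) (fun i => z s i - z s' i).
  move=> sa ss; have [zr zT] := hz _ sa; have [zr' zT'] := hz _ (le_lt_trans ss sa).
  apply: wball_le (wball_contraction_stable v1 zr zr' (fun d => T_lip sa zr zr') zT zT' (T_param sa ss zr')) _.
  by rewrite /L le_eqVlt; apply/orP; left; apply/eqP; ring.
have lip s s' : `|s| < a -> `|s'| < a -> wball v (L * `|s - s'|) (fun i => z s i - z s' i).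
  move=> sa s'a; have [ss|/ltW ss] := leP `|s'| `|s|; first exact: lip0.
  by move=> n; rewrite distrC; under eq_bigr do rewrite distrC; exact: lip0.
(* The zero sequence is a fixed point of [T 0] too, so stability with zero error identifies it with
   [z 0]. *)
have z00 i : z 0 i = 0.
  have a0 : `|0 : R| < a by rewrite normr0.
  have [zr zT] := hz _ a0.
  have zz : wball v r0 (fun _ => 0).
    by move=> n; rewrite big1 ?(ltW r0_gt0)// => j _; rewrite normr0 mulr0.
  have Tz j : T 0 (fun _ => 0) j = 0.
    by case: j => [|j]; rewrite /T /solve invr0 !mulr0 ?oppr0 ?mul0r// addr0 mul0r.
  have h0 : wball v 0 (fun i => T 0 (fun _ => 0) i - T 0 (fun _ => 0) i).
    by move=> n; rewrite big1// => j _; rewrite subrr normr0 mulr0.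
  have := wball_contraction_stable v1 zr zz (fun d => T_lip a0 zr zz) zT Tz h0.
  by rewrite mulr0 => /(wball_coord i v1); rewrite subr0 normr_le0 => /eqP.
exists a, (W + a * L + L), W, (fun s => rescale s (z s)), (fun s => om0 + z s 0%N).
have a0 := a_gt0; split => //.
- by split=> //; rewrite addr_ge0// addr_ge0// mulr_ge0// ltW.
- by split=> [|s _]; [rewrite z00 addr0|rewrite /rescale mulr1].
- move=> s sa; have [zr zT] := hz _ sa; split.
  + exact: rescale_ball r0_le1 zr.
  + exact: omE (lexx _) zr.
  + move=> lam0 i; rewrite [om0 + _]addrC addrK.
    have [s0|s0] := eqVneq s 0.
      rewrite s0 /rescale !mul0r add0r.
      have h0 : wball w 0 (fun i => 0 * (if i is 0%N then 1 else z 0 i)).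
        by move=> n; rewrite big1// => j _; rewrite mul0r normr0 mulr0.
      have om1 : `|z 0 0%N + om0 - om0| <= 1 by rewrite z00 add0r subrr normr0.
      have := rho_bound (ltW r1_gt0) h0 om1; rewrite expr0n/= mulr0.
      by move=> /(wball_coord i q1); rewrite normr_le0 => /eqP.
    case: i => [|i].
      rewrite lam0 subr0 {1}/rescale mulr1 -{1}(zT 0%N) /T /solve [z s 0%N + om0]addrC.
      by field; rewrite s0 gt_eqF.
    have := zT i.+1; rewrite {1}/T /solve => /(canRL (mulfVK _)) h.
    have {}h := h (lt0r_neq0 (lam_gt0 i)).
    rewrite /rescale -/(rescale s (z s)) [z s 0%N + om0]addrC.
    have -> : rho (rescale s (z s)) (om0 + z s 0%N) i.+1 =
        s * M i.+1 * (rho (rescale s (z s)) (om0 + z s 0%N) i.+1 / s / M i.+1 + z s 0%N * z s i.+1)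
        - s * M i.+1 * (z s 0%N * z s i.+1).
      by field; rewrite s0 gt_eqF.
    by rewrite h; ring.
- move=> s s' sa s'a; have [zr zT] := hz _ sa; have [zr' zT'] := hz _ s'a.
  have hl := lip _ _ sa s'a; have n0 := normr_ge0 (s - s').
  split.
    have h1 := wballD w0 (rescale_lip s hl) (rescale_param s s' r0_le1 zr').
    have e : (fun i => rescale s (z s) i - rescale s' (z s') i) =
       (fun i => rescale s (z s) i - rescale s (z s') i + (rescale s (z s') i - rescale s' (z s') i)).
      by apply/funext => i; ring.
    rewrite e; apply: wball_le h1 _.
    have : `|s| * (L * `|s - s'|) <= a * (L * `|s - s'|) by rewrite ler_wpM2r ?mulr_ge0// ltW.
    have : 0 <= L * `|s - s'| by rewrite mulr_ge0.
    have -> : (W + a * L + L) * `|s - s'| = `|s - s'| * W + a * (L * `|s - s'|) + L * `|s - s'| by ring.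
    by move=> p1 p2; rewrite [leLHS]addrC -addrA lerD2l; apply: le_trans p2 _; rewrite lerDl.
  rewrite opprD addrACA subrr add0r; apply: le_trans (z0_le hl) _.
  by rewrite ler_wpM2r// lerDr addr_ge0// mulr_ge0// ltW.
Qed.

End LyapunovSchmidt.

(** * The V-state equation as a bifurcation problem *)

Section Branch.
Context {R : realType}.
Variable m : nat.
Hypothesis m2 : (1 < m)%N.
Variable be : R.
Hypothesis beP : 0 < be < 2^-1.
Notation wt := (@wt R m).
Notation mu := (@lebesgue_measure R).
Let C : R := Calpha (2 * be).
Let g0 : R := gam be 0.
Let wt1 := @wt_ge1 R m m2.
Let wt0 := @wt_ge0 R m m2.

(* the defect of the V-state equation at the angle [th / m], integrated against [kap] *)
Definition defect Om b th et : R := C / (2 * pi) * cJ m be b th et +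
  Om / (2 * pi * g0) * ((1 + cP1 b th et) * cE2 m b th et - cP2 b th et * (1 + cE1 m b th et)).

Definition defect_rem b Om i : R :=
  C / (2 * pi) * Phi be i (rem1 m be b) + Om / (2 * pi * g0) * Phi be i (rem2 m b).

Let Oc (Om : R) := Om / (2 * pi * g0).

Let defectE Om b th et : defect Om b th et =
  C / (2 * pi) * (rem1 m be b th et + (sin et + cL m be b th et)) +
  Oc Om * (cE2 m b th et - cP2 b th et + rem2 m b th et).
Proof. by rewrite /defect /rem1 /rem2 /Oc; congr (_ * _ + _ * _); ring. Qed.

Let g0_gt0 : 0 < g0. Proof. exact: gam_gt0. Qed.

Let cLw b r : wball wt r b -> exists M, wiener M (cL m be b).
Proof.
move=> hb; have w l h := wiener_lin wt1 (l := l) h hb.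
have h1 := wienerM wiener_sin_et (wienerD (w _ (wiener_mE1 m)) (w _ (wiener_mT1 m))).
have h2 := wienerM wiener_cos_et (wienerB (w _ (wiener_mT2 m)) (w _ (wiener_mE2 m))).
have h3 := wienerZ (2 * be) (wienerM wiener_sin_et (w _ (wiener_mG1 m))).
by eexists; exact: wienerB (wienerD h1 h2) h3.
Qed.

Let Phi_sin i : Phi be i (fun _ et => sin et) = 0.
Proof.
rewrite /Phi (_ : kint be _ = fun th => sin (1%:R * th) * 0); first by rewrite sincoef_sin mulr0.
apply/funext => th; rewrite mulr0 -[RHS](kap_sin0 beP 1%:Z) /kint; apply: eq_Rintegral => x _.
by rewrite mul1r.
Qed.

Lemma Phi_defect Om b r M1 M2 i : wball wt r b ->
  wiener M1 (rem1 m be b) -> wiener M2 (rem2 m b) ->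
  Phi be i (defect Om b) =
  b i * (mult m i)%:R * (Om - Omega_m (2 * be) (mult m i)) + defect_rem b Om i.
Proof.
move=> hb h1 h2; have [ML hL] := cLw hb.
have hE2 := wiener_lin wt1 (wiener_mE2 m) hb; have hP2 := wiener_lin wt1 (wiener_mP2 m2) hb.
have e : defect Om b = fun th et => C / (2 * pi) * (rem1 m be b th et + (sin et + cL m be b th et)) +
  Oc Om * (cE2 m b th et - cP2 b th et + rem2 m b th et).
  by apply/funext => th; apply/funext => et; exact: defectE.
have w1 := wienerD h1 (wienerD wiener_sin_et hL).
have w2 := wienerD (wienerB hE2 hP2) h2.
rewrite e (PhiD beP i (wienerZ _ w1) (wienerZ _ w2)) (PhiZ beP i _ w1) (PhiZ beP i _ w2).
rewrite (PhiD beP i h1 (wienerD wiener_sin_et hL)) (PhiD beP i wiener_sin_et hL).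
rewrite (PhiD beP i (wienerB hE2 hP2) h2) Phi_sin (Phi_cE2P2 m2 beP i hb) (Phi_cL m2 beP i hb).
rewrite (Omega_mE beP) /defect_rem -/C /Oc -/g0.
have p0 : (pi : R) != 0 by rewrite gt_eqF ?pi_gt0.
have g0' : g0 != 0 by rewrite gt_eqF.
move: C g0 g0' (pi : R) p0 (Phi be i (rem1 m be b)) (Phi be i (rem2 m b)) (gam be (mult m i)) (gam be 1) => c g g' p p' x y z t.
by clear -g' p'; field; rewrite ?g' ?p'.
Qed.

Let lin_sign (c : R) (l : nat -> R -> R -> R) r b th et : (forall i, wiener (wt i) (l i)) ->
  wball wt r b -> (forall i, l i (- th) (- et) = c * l i th et) ->
  lin l b (- th) (- et) = c * lin l b th et.
Proof.
move=> hl hb h; rewrite /lin -(rsumZ c (lin_wball th et hl hb))//.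
by congr rsum; apply/funext => i; rewrite h; ring.
Qed.

Let negD (p q th et : R) : p * - th + q * - et = - (p * th + q * et).
Proof. ring. Qed.

(** Real coefficients make the curve symmetric about the real axis: reflecting both angles fixes the
    cosine modes and flips the sine modes. *)
Lemma defect_odd Om b r th et : wball wt r b -> defect Om b (- th) (- et) = - defect Om b th et.
Proof.
move=> hb.
have eP1 := @lin_sign 1 _ _ _ th et (wiener_mP1 m2) hb.
have eP2 := @lin_sign (-1) _ _ _ th et (wiener_mP2 m2) hb.
have eE1 := @lin_sign 1 _ _ _ th et (wiener_mE1 m) hb.
have eE2 := @lin_sign (-1) _ _ _ th et (wiener_mE2 m) hb.
have eT1 := @lin_sign 1 _ _ _ th et (wiener_mT1 m) hb.
have eT2 := @lin_sign (-1) _ _ _ th et (wiener_mT2 m) hb.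
have eG1 := @lin_sign 1 _ _ _ th et (wiener_mG1 m) hb.
have eG2 := @lin_sign (-1) _ _ _ th et (wiener_mG2 m) hb.
rewrite /defect /cJ /crossp /stretch /cP1 /cP2 /cE1 /cE2 /cT1 /cT2 /cG1 /cG2.
rewrite eP1 ?eP2 ?eE1 ?eE2 ?eT1 ?eT2 ?eG1 ?eG2; first last.
- by move=> i; rewrite /mP1 mulrN cosN mul1r.
- by move=> i; rewrite /mP2 mulrN sinN mulN1r.
- by move=> i; rewrite /mE1 mulrN cosN mul1r.
- by move=> i; rewrite /mE2 mulrN sinN mulN1r mulrN.
- by move=> i; rewrite /mT1 negD cosN mul1r.
- by move=> i; rewrite /mT2 negD sinN mulN1r mulrN.
- by move=> i; rewrite /mG1 mul1r; congr (- _); apply: eq_bigr => j _; rewrite negD cosN.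
- by move=> i; rewrite /mG2 mulN1r -sumrN; apply: eq_bigr => j _; rewrite negD sinN.
rewrite !mul1r !mulN1r !mulrNN sinN cosN; ring.
Qed.

Let lam i : R := Omega_m (2 * be) (mult m i) - Omega_m (2 * be) m.

Let lam0 : lam 0 = 0. Proof. by rewrite /lam /mult mul1n subrr. Qed.

Let lamE i : lam i = C * (gam be m - gam be (mult m i)).
Proof. by rewrite /lam !(Omega_mE beP) -/C; ring. Qed.

(** Decrease of [gam] makes the first nonzero [lam] a lower bound for all later ones, hence a
    uniform spectral gap. *)
Let lam_ge i : lam 1 <= lam i.+1.
Proof.
rewrite !lamE ler_wpM2l ?(ltW (Calpha_gt0 beP))// lerB// gam_le//.
by rewrite /mult leq_mul2r orbC.
Qed.

Let lam1_gt0 : 0 < lam 1.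
Proof.
rewrite lamE mulr_gt0 ?Calpha_gt0// subr_gt0.
apply: le_lt_trans (_ : _ <= gam be m.+1) _; last exact: gam_decr.
by apply: gam_le => //; rewrite /mult; lia.
Qed.

Let mult1 i : 1 <= (mult m i)%:R :> R := @mult_ge1 R m m2 i.

Let om0 : R := Omega_m (2 * be) m.

(** [Phi_sum] transfers the second-order Wiener bounds of [rem1] and [rem2] to the sine
    coefficients. The frequency enters linearly and only in front of [rem2], which explains the term
    r^2 |om - om'|. *)
Lemma defect_rem_small : exists K r1 : R, [/\ 0 <= K, 0 < r1,
  forall r b, r <= r1 -> wball wt r b -> exists M1 M2, wiener M1 (rem1 m be b) /\ wiener M2 (rem2 m b),
  forall r b om, r <= r1 -> wball wt r b -> `|om - om0| <= 1 ->
    wball (fun i => i.+2%:R) (K * r ^+ 2) (defect_rem b om) &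
  forall r d b b' om om', r <= r1 -> wball wt r b -> wball wt r b' ->
    wball wt d (fun i => b i - b' i) -> `|om - om0| <= 1 -> `|om' - om0| <= 1 ->
    wball (fun i => i.+2%:R) (K * (r * d + r ^+ 2 * `|om - om'|))
      (fun i => defect_rem b om i - defect_rem b' om' i)].
Proof.
have [C1 [r1 [C10 /andP[r10 _] H1]]] := small_rem1 m2 beP.
have [C2 [r2 [C20 /andP[r20 _] H2]]] := @small_rem2 R m m2.
pose q (i : nat) : R := i.+2%:R.
have [PK P0 wb] : exists2 PK, 0 <= PK &
    forall M f, wiener M f -> wball q (PK * M) (fun i => Phi be i f).
  by exists (PhiK be) => [|M f hf n]; [exact: PhiK_ge0|exact: Phi_sum].
have q0 i : 0 <= q i by [].
pose c1 := `|C / (2 * pi)|; pose c3 := `|Oc 1|.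
have c10 : 0 <= c1 by exact: normr_ge0.
have c30 : 0 <= c3 by exact: normr_ge0.
have z0 b : wball wt 0 (fun i => b i - b i).
  by move=> K; rewrite big1// => i _; rewrite subrr normr0 mulr0.
have [c2 c20 omc] : exists2 c2, 0 <= c2 & forall om, `|om - om0| <= 1 -> `|Oc om| <= c2.
  exists ((`|om0| + 1) * `|Oc 1|) => [|om h]; first by rewrite mulr_ge0// addr_ge0.
  rewrite /Oc normrM div1r ler_wpM2r//.
  by rewrite -[om](subrK om0) (le_trans (ler_normD _ _))// addrC lerD2l.
pose K := c1 * (PK * C1) + c2 * (PK * C2) + c3 * (PK * C2).
have K0 : 0 <= K by rewrite !addr_ge0// mulr_ge0// mulr_ge0.
exists K, (Num.min r1 r2); split => //; first by rewrite lt_min r10.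
- move=> r b; rewrite le_min => /andP[rr1 rr2] hb.
  have [h1 _] := H1 _ _ _ _ rr1 hb hb (z0 b); have [h2 _] := H2 _ _ _ _ rr2 hb hb (z0 b).
  by exists (C1 * r ^+ 2), (C2 * r ^+ 2).
- move=> r b om; rewrite le_min => /andP[rr1 rr2] hb hom.
  have [h1 _] := H1 _ _ _ _ rr1 hb hb (z0 b); have [h2 _] := H2 _ _ _ _ rr2 hb hb (z0 b).
  apply: wball_le (wballD q0 (wballZ (C / (2 * pi)) (wb _ _ h1)) (wballZ (Oc om) (wb _ _ h2))) _.
  have r20' : 0 <= r ^+ 2 by rewrite sqr_ge0.
  rewrite -/c1 /K !mulrDl -!mulrA -addrA lerD2l.
  apply: le_trans (_ : _ <= c2 * (PK * (C2 * r ^+ 2))) _.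
    by rewrite ler_wpM2r ?omc// mulr_ge0// mulr_ge0.
  by rewrite lerDl mulr_ge0// mulr_ge0// mulr_ge0.
- move=> r d b b' om om'; rewrite le_min => /andP[rr1 rr2] hb hb' hd hom hom'.
  have r_ge0 := wball_ge0 hb; have d_ge0 := wball_ge0 hd.
  have [h1 g1] := H1 _ _ _ _ rr1 hb hb' hd; have [h2 g2] := H2 _ _ _ _ rr2 hb hb' hd.
  have [h2' _] := H2 _ _ _ _ rr2 hb' hb' (z0 b'); have [h1' _] := H1 _ _ _ _ rr1 hb' hb' (z0 b').
  rewrite /= expr1 in g1 g2.
  have e : (fun i => defect_rem b om i - defect_rem b' om' i) = fun i =>
     C / (2 * pi) * Phi be i (fun th et => rem1 m be b th et - rem1 m be b' th et) +
     Oc om * Phi be i (fun th et => rem2 m b th et - rem2 m b' th et) +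
     (Oc om - Oc om') * Phi be i (rem2 m b').
    apply/funext => i; rewrite (PhiB beP i h1 h1') (PhiB beP i h2 h2') /defect_rem -/(Oc _) -/(Oc _).
    move: (Phi be i (rem1 m be b)) (Phi be i (rem2 m b)) (Phi be i (rem1 m be b')) (Phi be i (rem2 m b')).
    by move: (C / (2 * pi)) (Oc om) (Oc om') => x y z p1 p2 p3 p4; ring.
  rewrite e; apply: wball_le (wballD q0 (wballD q0 (wballZ _ (wb _ _ g1)) (wballZ _ (wb _ _ g2))) (wballZ _ (wb _ _ h2'))) _.
  have -> : `|Oc om - Oc om'| = c3 * `|om - om'| by rewrite /c3 /Oc -mulrBl normrM mulrC div1r.
  rewrite -/c1; have h3 : `|Oc om| * (PK * (C2 * r * d)) <= c2 * (PK * (C2 * r * d)).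
    by rewrite ler_wpM2r ?omc// mulr_ge0// mulr_ge0// mulr_ge0.
  have x0 : 0 <= r * d by rewrite mulr_ge0.
  have y0 : 0 <= r ^+ 2 * `|om - om'| by rewrite mulr_ge0 ?sqr_ge0.
  apply: le_trans (lerD (lerD (lexx _) h3) (lexx _)) _.
  have -> : c1 * (PK * (C1 * r * d)) + c2 * (PK * (C2 * r * d)) +
      c3 * `|om - om'| * (PK * (C2 * r ^+ 2)) =
    (c1 * (PK * C1) + c2 * (PK * C2)) * (r * d) +
    c3 * (PK * C2) * (r ^+ 2 * `|om - om'|) by ring.
  rewrite mulrDr; apply: lerD; apply: ler_wpM2r => //; rewrite /K.
    by rewrite lerDl mulr_ge0// mulr_ge0.
  by rewrite lerDr addr_ge0// mulr_ge0// mulr_ge0.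
Qed.

(** A function of [th] alone is multiplied by the mass 2 pi [g0] of the kernel; this is the
    normalization of the [Om] term in [defect]. *)
Let kint_th (f : R -> R) M th : wiener M (fun x _ => f x) -> kint be (fun x _ => f x) th = 2 * pi * g0 * f th.
Proof.
move=> hf; rewrite /kint /g0 -kcos_nat /kcos [RHS]mulrC -RintegralZl//; last first.
  by apply: eq_integrable (kap_cos_int beP 0 0) => // x _; rewrite /= add0r.
by apply: eq_Rintegral => x _; rewrite mul0r cos0 mul1r.
Qed.

Theorem vstate_branch (eta : R) : 0 < eta -> exists (a L : R) (b : R -> nat -> R) (Om : R -> R),
  [/\ 0 < a, 0 <= L,
   [/\ Om 0 = Omega_m (2 * be) m, forall i, b 0 i = 0 & forall s, `|s| < a -> b s 0%N = s],
   (forall s, `|s| < a -> wball wt eta (b s) /\ forall th,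
      C / (2 * pi) * kint be (cJ m be (b s)) th +
      Om s * ((1 + cP1 (b s) th 0) * cE2 m (b s) th 0 - cP2 (b s) th 0 * (1 + cE1 m (b s) th 0)) = 0) &
   (forall s s', `|s| < a -> `|s'| < a ->
      wball wt (L * `|s - s'|) (fun i => b s i - b s' i) /\ `|Om s - Om s'| <= L * `|s - s'|)].
Proof.
move=> eta0; have [K [r1 [K0 r10 Hw Hb Hl]]] := defect_rem_small.
pose r2 := Num.min r1 eta.
have r20 : 0 < r2 by rewrite lt_min r10.
have Hb2 r b om : r <= r2 -> wball wt r b -> `|om - om0| <= 1 ->
    wball (fun i => i.+2%:R) (K * r ^+ 2) (defect_rem b om).
  by rewrite le_min => /andP[rr _]; exact: Hb.
have Hl2 r d b b' om om' : r <= r2 -> wball wt r b -> wball wt r b' ->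
    wball wt d (fun i => b i - b' i) -> `|om - om0| <= 1 -> `|om' - om0| <= 1 ->
    wball (fun i => i.+2%:R) (K * (r * d + r ^+ 2 * `|om - om'|))
      (fun i => defect_rem b om i - defect_rem b' om' i).
  by rewrite le_min => /andP[rr _]; exact: Hl.
have [a [L [W [b [Om [a0 [L0 W0] [Om00 b0] H1 H2]]]]]] :=
  bifurcation mult1 lam1_gt0 lam_ge K0 r20 Hb2 Hl2.
pose a' := Num.min a (r2 / (W + 1)).
have W1 : 0 < W + 1 by rewrite ltr_wpDl.
have ha s : `|s| < a' -> `|s| < a /\ `|s| * W <= r2.
  rewrite lt_min => /andP[h]; rewrite ltr_pdivlMr// => /ltW h2; split => //.
  by apply: le_trans h2; rewrite ler_wpM2l// lerDl.
exists a', L, b, Om; split => //; first by rewrite lt_min a0 divr_gt0.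
- split => // [i|s /ha[sa _]]; last exact: b0.
  have [|h _ _] := H1 0; first by rewrite normr0.
  by apply/eqP; rewrite -normr_le0 (le_trans (wball_coord i wt1 h))// normr0 mul0r.
- move=> s /ha[sa sr]; have [hb hom heq] := H1 s sa.
  have hb2 := wball_le hb sr; have [r21 r22] : r2 <= r1 /\ r2 <= eta by rewrite !ge_min !lexx orbT.
  split; first exact: wball_le hb2 r22.
  have [M1 [M2 [w1 w2]]] := Hw _ _ r21 hb2.
  have [ML hL] := cLw hb2.
  have wJ : wiener (M1 + (1 + ML)) (cJ m be (b s)).
    apply: wiener_ext (wienerD w1 (wienerD wiener_sin_et hL)) _ => th et.
    by rewrite /rem1; ring.
  have wQ := wienerD (wienerB (wiener_lin wt1 (wiener_mE2 m) hb2) (wiener_lin wt1 (wiener_mP2 m2) hb2)) w2.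
  pose Q th := (1 + cP1 (b s) th 0) * cE2 m (b s) th 0 - cP2 (b s) th 0 * (1 + cE1 m (b s) th 0).
  have wQ' : wiener (r2 + r2 + M2) (fun th _ : R => Q th).
    apply: wiener_ext wQ _ => th et; rewrite /rem2 /Q /cP1 /cP2 /cE1 /cE2 /lin.
    by rewrite /mP1 /mP2 /mE1 /mE2; ring.
  have dE : defect (Om s) (b s) = fun th et => C / (2 * pi) * cJ m be (b s) th et + Oc (Om s) * Q th.
    by apply/funext => th; apply/funext => et.
  have wD : wiener (`|C / (2 * pi)| * (M1 + (1 + ML)) + `|Oc (Om s)| * (r2 + r2 + M2)) (defect (Om s) (b s)).
    by rewrite dE; apply: wienerD; apply: wienerZ.
  have kE th : kint be (defect (Om s) (b s)) th = C / (2 * pi) * kint be (cJ m be (b s)) th + Om s * Q th.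
    rewrite dE (kintD beP th (wienerZ _ wJ) (wienerZ _ wQ')) (kintZ beP _ th wJ) (kintZ beP _ th wQ').
    rewrite (kint_th th wQ') /Oc; congr (_ + _).
    have p0 : (pi : R) != 0 by rewrite gt_eqF ?pi_gt0.
    have g0' : g0 != 0 by rewrite gt_eqF.
    move: (pi : R) p0 g0 g0' (Q th) (Om s) => p p0 g g0' x y.
    by field; rewrite ?p0 ?g0'.
  move=> th; rewrite -/(Q th) -kE.
  (* The bifurcation equations annihilate every sine coefficient and oddness excludes cosines, so
     the integrated defect vanishes identically. *)
  apply: (sincoef_inj (wiener_kint beP wD)) => [x|k].
    rewrite -(kint_refl beP x wD).
    have -> : (fun x y => defect (Om s) (b s) (- x) (- y)) = fun x y => -1 * defect (Om s) (b s) x y.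
      by apply/funext => x'; apply/funext => y; rewrite (defect_odd _ _ _ hb2) mulN1r.
    by rewrite (kintZ beP _ x wD) mulN1r.
  have := Phi_defect (Om s) k hb2 w1 w2; rewrite /Phi => ->.
  have -> : Omega_m (2 * be) (mult m k) = om0 + lam k by rewrite -[LHS](subrK om0) addrC.
  have := heq lam0 k; rewrite (_ : Om s - om0 - lam k = Om s - (om0 + lam k))//.
  by move: (lam k) om0 (Om s) => x y z; rewrite opprD addrA.
- by move=> s s' /ha[sa _] /ha[s'a _]; exact: H2.
Qed.

End Branch.

(** * Product measures and rotations *)

Section Measurability.
Context {R : realType}.

Lemma floor_approx (t : R) :
  (fun n => (Num.floor (n.+1%:R * t))%:~R / n.+1%:R) @ \oo --> t.
Proof.
apply/cvgrPdist_le => e e0; near=> n.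
have n0 : 0 < n.+1%:R :> R by [].
have h : n.+1%:R^-1 < e by near: n; exact: (near_infty_natSinv_lt (PosNum e0)).
have /andP[h1 h2] := mathcomp.algebra.archimedean.Num.Theory.floor_itv (n.+1%:R * t).
apply: le_trans (ltW h).
have -> : t - (Num.floor (n.+1%:R * t))%:~R / n.+1%:R = (n.+1%:R * t - (Num.floor (n.+1%:R * t))%:~R) / n.+1%:R.
  by rewrite mulrBl mulrAC mulfV ?mul1r// pnatr_eq0.
rewrite normrM normfV (ger0_norm (ltW n0)) ler_piMl ?invr_ge0//.
rewrite intrD in h2; rewrite ger0_norm; lra.
Unshelve. all: by end_near. Qed.

Context d (T : measurableType d).

(* Caratheodory functions are jointly measurable: discretize the continuous variable *)
Lemma measurable_caratheodory (f : R -> T -> R) :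
  (forall p, continuous (f ^~ p)) -> (forall t, measurable_fun setT (f t)) ->
  measurable_fun setT (fun q : R * T => f q.1 q.2).
Proof.
move=> fc fm.
have fl (t : R) p : (fun n => f ((Num.floor (n.+1%:R * t))%:~R / n.+1%:R) p) @ \oo --> f t p.
  exact: (cvg_comp _ _ (@floor_approx t) (fc p t)).
apply: (@measurable_fun_cvg _ _ _ _ (fun n (q : R * T) => f ((Num.floor (n.+1%:R * q.1))%:~R / n.+1%:R) q.2)); last first.
  by move=> [t p] _; exact: fl.
move=> n _ Y mY; rewrite setTI.
pose S (k : int) : set (R * T) :=
  [set t : R | Num.floor (n.+1%:R * t) = k] `*` (f (k%:~R / n.+1%:R) @^-1` Y).
rewrite (_ : _ @^-1` Y = \bigcup_k S k); last first.
  apply/seteqP; split => [[t p] /= h|[t p] [k _ [/= <-]]//].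
  by exists (Num.floor (n.+1%:R * t)).
apply: countable_bigcupT_measurable => [|k]; first exact: countableP.
apply: measurableX; last by rewrite -[_ @^-1` _]setTI; exact: fm.
have -> : [set t : R | Num.floor (n.+1%:R * t) = k] = `[k%:~R / n.+1%:R, (k + 1)%:~R / n.+1%:R[%classic.
  apply/seteqP; split => t /=; rewrite in_itv/= ler_pdivrMr// ltr_pdivlMr// [t * _]mulrC.
    by move=> <-; exact: mathcomp.algebra.archimedean.Num.Theory.floor_itv.
  by move=> h; exact: mathcomp.algebra.archimedean.Num.Theory.floor_def.
exact: measurable_itv.
Qed.

End Measurability.

(** * Fubini for bounded functions on boxes of finite measure *)

Section BoundedFubini.
Context d1 d2 (T1 : measurableType d1) (T2 : measurableType d2) (R : realType).
Variable m1 : {sigma_finite_measure set T1 -> \bar R}.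
Variable m2 : {sigma_finite_measure set T2 -> \bar R}.
Variables (A : set T1) (B : set T2) (f : T1 * T2 -> R) (K : R).
Hypothesis mA : measurable A.
Hypothesis mB : measurable B.
Hypothesis fA : (m1 A < +oo)%E.
Hypothesis fB : (m2 B < +oo)%E.
Hypothesis mf : measurable_fun setT f.
Hypothesis fK : forall x y, A x -> B y -> `|f (x, y)| <= K.

Lemma integrable_bddP d (T : measurableType d) (m : {measure set T -> \bar R}) (D : set T)
    (g : T -> R) (L : R) : measurable D -> (m D < +oo)%E -> measurable_fun setT g ->
  (forall x, D x -> `|g x| <= L) -> m.-integrable D (EFin \o g).
Proof.
move=> mD fD mg gL; apply: measurable_bounded_integrable => //.
  by apply: measurable_funS mg.
exists L; split; first exact: num_real.
by move=> M LM x /= Dx; rewrite (le_trans _ (ltW LM))// gL.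
Qed.

Lemma measurable_section1 x : measurable_fun setT (fun y => f (x, y)).
Proof. by apply: measurableT_comp mf _; apply: measurable_fun_pair. Qed.

Lemma measurable_section2 y : measurable_fun setT (fun x => f (x, y)).
Proof. by apply: measurableT_comp mf _; apply: measurable_fun_pair. Qed.

Lemma product_measure1_lty : ((m1 \x m2)%E (A `*` B) < +oo)%E.
Proof. by rewrite product_measure1E// lte_mul_pinfty// ge0_fin_numE. Qed.

Lemma fubini_integrable : (m1 \x m2)%E.-integrable (A `*` B) (EFin \o f).
Proof.
apply: (@integrable_bddP _ _ _ _ _ K) => //; first exact: measurableX.
  exact: product_measure1_lty.
by move=> [x y] [/=]; exact: fK.
Qed.

(** Extension by zero, so that Fubini on the whole product applies; the partial integrals [FE] and
    [GE] are again extensions by zero. *)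
Let g : T1 * T2 -> \bar R := (EFin \o f) \_ (A `*` B).

Let ig : (m1 \x m2)%E.-integrable setT g.
Proof. by rewrite /g -integrable_mkcond; [exact: fubini_integrable|exact: measurableX]. Qed.

Let FE : fubini_F m2 g = (EFin \o fun x => \int[m2]_(y in B) f (x, y)) \_ A.
Proof.
apply/funext => x; rewrite /fubini_F !patchE; case: ifPn => [xA|/negP xA].
  rewrite /= /Rintegral fineK; last first.
    apply: integrable_fin_num => //.
    apply: (@integrable_bddP _ _ _ _ (fun y => f (x, y)) K) => //; first exact: measurable_section1.
    by move=> y By; apply: fK => //; rewrite inE in xA.
  rewrite [RHS]integral_mkcond; apply: eq_integral => y _.
  rewrite /g !patchE; congr (if _ then _ else _).
  by apply/idP/idP; rewrite !inE/=; [case|move=> ?; split => //; rewrite inE in xA].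
apply: integral0_eq => y _; rewrite /g patchE ifF//; apply/negP; rewrite inE => -[/= Ax _].
by apply: xA; rewrite inE.
Qed.

Let GE : fubini_G m1 g = (EFin \o fun y => \int[m1]_(x in A) f (x, y)) \_ B.
Proof.
apply/funext => y; rewrite /fubini_G !patchE; case: ifPn => [yB|/negP yB].
  rewrite /= /Rintegral fineK; last first.
    apply: integrable_fin_num => //.
    apply: (@integrable_bddP _ _ _ _ (fun x => f (x, y)) K) => //; first exact: measurable_section2.
    by move=> x Ax; apply: fK => //; rewrite inE in yB.
  rewrite [RHS]integral_mkcond; apply: eq_integral => x _.
  rewrite /g !patchE; congr (if _ then _ else _).
  by apply/idP/idP; rewrite !inE/=; [case|move=> ?; split => //; rewrite inE in yB].
apply: integral0_eq => x _; rewrite /g patchE ifF//; apply/negP; rewrite inE => -[/= _ By].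
by apply: yB; rewrite inE.
Qed.

Lemma fubini_int1 : m1.-integrable A (EFin \o fun x => \int[m2]_(y in B) f (x, y)).
Proof. by rewrite integrable_mkcond// -FE; exact: integrable_fubini_F. Qed.

Lemma fubini12 : \int[m1]_(x in A) (\int[m2]_(y in B) f (x, y)) = \int[(m1 \x m2)%E]_(z in A `*` B) f z.
Proof.
rewrite /Rintegral; congr fine; rewrite integral_mkcond -[X in (\int[_]_x X x)%E]/(_ \_ A).
by rewrite -FE integral12_prod_meas1// /g -integral_mkcond.
Qed.

Lemma fubini21 : \int[m2]_(y in B) (\int[m1]_(x in A) f (x, y)) = \int[(m1 \x m2)%E]_(z in A `*` B) f z.
Proof.
rewrite /Rintegral; congr fine; rewrite integral_mkcond -[X in (\int[_]_x X x)%E]/(_ \_ B).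
by rewrite -GE integral21_prod_meas1// /g -integral_mkcond.
Qed.

Lemma fubini_swap : \int[m1]_(x in A) (\int[m2]_(y in B) f (x, y)) =
  \int[m2]_(y in B) (\int[m1]_(x in A) f (x, y)).
Proof. by rewrite fubini12 fubini21. Qed.

End BoundedFubini.

Section SigmaFiniteProduct.
Context d1 d2 (T1 : measurableType d1) (T2 : measurableType d2) (R : realType).
Variable m1 : {sigma_finite_measure set T1 -> \bar R}.
Variable m2 : {sigma_finite_measure set T2 -> \bar R}.

Lemma product_measure1_sigma_finite : sigma_finite setT (m1 \x m2)%E.
Proof.
have /sigma_finiteP[F [TF ndF Foo]] := sigma_finiteT m1.
have /sigma_finiteP[G [TG ndG Goo]] := sigma_finiteT m2.
exists (fun n => F n `*` G n).
  rewrite -setXTT TF TG; apply/seteqP; split => -[x y]; last by move=> [n _ [/= ? ?]]; split; exists n.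
  move=> [/= [n _ Fnx] [k _ Gky]]; exists (maxn n k) => //; split.
  - by move: x Fnx; exact/subsetPset/ndF/leq_maxl.
  - by move: y Gky; exact/subsetPset/ndG/leq_maxr.
move=> k; have [mF fF] := Foo k; have [mG fG] := Goo k.
by split; [exact: measurableX|exact: product_measure1_lty].
Qed.

(* the library registers this structure for products of subprobabilities only *)
Definition sfprod : {sigma_finite_measure set (T1 * T2)%type -> \bar R} :=
  HB.pack (m1 \x m2)%E (Measure_isSigmaFinite.Build _ _ _ (m1 \x m2)%E product_measure1_sigma_finite).

End SigmaFiniteProduct.

(** * Measure-preserving maps *)

Section MeasurePreserving.
Context d (X : measurableType d) (R : realType).
Variable m : {measure set X -> \bar R}.

Definition preserves (phi : X -> X) : Prop :=
  measurable_fun setT phi /\ forall A, measurable A -> m (phi @^-1` A) = m A.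

Lemma preserves_comp phi psi : preserves phi -> preserves psi -> preserves (phi \o psi).
Proof.
move=> [mp hp] [mq hq]; split; first exact: measurableT_comp.
move=> A mA; rewrite comp_preimage hq ?hp//.
by rewrite -[_ @^-1` _]setTI; exact: mp.
Qed.

(** Positive and negative parts are transported separately through the image measure, so the
    identity holds for every measurable [f]. *)
Lemma preserves_int phi (f : X -> \bar R) D : preserves phi -> measurable D ->
  measurable_fun setT f ->
  (\int[m]_(x in phi @^-1` D) f (phi x) = \int[m]_(x in D) f x)%E.
Proof.
move=> [mp hp] mD mf.
have h (g : X -> \bar R) : measurable_fun setT g -> (forall x, 0 <= g x)%E ->
    (\int[m]_(x in phi @^-1` D) g (phi x) = \int[m]_(x in D) g x)%E.
  move=> mg g0; rewrite -(ge0_integral_pushforward mp m mD (f := g)).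
  - by apply: eq_measure_integral => A mA _; exact: hp.
  - exact: measurable_funS mg.
  - by move=> x _; exact: g0.
have h1 := h _ (measurable_funepos mf) (funepos_ge0 _); have h2 := h _ (measurable_funeneg mf) (funeneg_ge0 _).
rewrite [RHS]integralE -h1 -h2 [LHS]integralE -[fun x => f (phi x)]/(f \o phi).
by rewrite funepos_comp funeneg_comp.
Qed.

End MeasurePreserving.

Section LebesguePreserving.
Context {R : realType}.
Notation mu := (@lebesgue_measure R).

Lemma preserves_shift (c : R) : preserves mu (fun x : R => x + c).
Proof.
have mp : measurable_fun setT (fun x : R => x + c) by exact: measurable_funD.
split => // A mA.
pose nu := measure_function_pushforward__canonical__measure_function_Measure mu (f := fun x : measurableTypeR R => x + c : measurableTypeR R) mp.
rewrite -[LHS]/(nu A); symmetry; apply: lebesgue_measure_unique => // Y [[a b] _ <-] /=.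
rewrite /pushforward (_ : _ @^-1` _ = `]a - c, b - c]%classic); last first.
  by apply/seteqP; split => x /=; rewrite !in_itv/= ltrBlDr lerBrDr.
by rewrite !lebesgue_measure_itv/= !lte_fin ltrD2r; case: ifP => // _; rewrite -!EFinD; congr EFin; ring.
Qed.

Lemma int_shift (f : R -> \bar R) (c : R) (D : set R) : measurable D -> measurable_fun setT f ->
  (\int[mu]_(x in [set x | D (x + c)%R]) f (x + c)%R = \int[mu]_(x in D) f x)%E.
Proof.
by move=> mD mf; exact: (@preserves_int _ (measurableTypeR R) R mu _ f D (preserves_shift c)).
Qed.

Notation mu2 := (mu \x mu)%E.

Lemma mu2_swap A : measurable A -> mu2 A = (\int[mu]_y mu (ysection A y))%E.
Proof.
move=> mA; have := indic_fubini_tonelli mu mu mA.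
by rewrite (indic_fubini_tonelli_FE mu mA) (indic_fubini_tonelli_GE mu mA).
Qed.

(** By Tonelli: each horizontal slice is merely translated. *)
Lemma preserves_shear1 (a : R) : preserves mu2 (fun z : R * R => (z.1 + a * z.2, z.2)).
Proof.
have mp : measurable_fun setT (fun z : R * R => (z.1 + a * z.2, z.2)).
  apply: measurable_fun_pair; last exact: measurable_snd.
  apply: measurable_funD; first exact: measurable_fst.
  by apply: measurable_funM => //; exact: measurable_snd.
split => // A mA.
have mB : measurable ((fun z : R * R => (z.1 + a * z.2, z.2)) @^-1` A).
  by rewrite -[_ @^-1` _]setTI; exact: mp.
apply: etrans (mu2_swap mB) _; apply: etrans _ (esym (mu2_swap mA)); apply: eq_integral => y _.
have [_ /(_ (ysection A y)) <-] := preserves_shift (a * y); last exact: measurable_ysection.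
by congr (mu _); apply/seteqP; split => x; rewrite /ysection /= !in_setE.
Qed.

Lemma preserves_shear2 (a : R) : preserves mu2 (fun z : R * R => (z.1, z.2 + a * z.1)).
Proof.
have mp : measurable_fun setT (fun z : R * R => (z.1, z.2 + a * z.1)).
  apply: measurable_fun_pair; first exact: measurable_fst.
  apply: measurable_funD; first exact: measurable_snd.
  by apply: measurable_funM => //; exact: measurable_fst.
split => // A mA; rewrite /product_measure1; apply: eq_integral => x _ /=.
have [_ /(_ (xsection A x)) <-] := preserves_shift (a * x); last exact: measurable_xsection.
by congr (mu _); apply/seteqP; split => y; rewrite /xsection /= !in_setE.
Qed.

Definition rotate (t : R) (z : R * R) : R * R :=
  (cos t * z.1 - sin t * z.2, sin t * z.1 + cos t * z.2).

Lemma rotateD s t z : rotate (s + t) z = rotate s (rotate t z).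
Proof. by rewrite /rotate /= cosD sinD; congr (_, _); ring. Qed.

Lemma rotate0 z : rotate 0 z = z.
Proof. by case: z => x y; rewrite /rotate /= cos0 sin0; congr (_, _); ring. Qed.

(* a rotation is a product of three shears unless its sine vanishes *)
Lemma preserves_rotate t : preserves mu2 (rotate t).
Proof.
have h s : sin s != 0 -> preserves mu2 (rotate s).
  move=> s0; have e : rotate s = (fun z : R * R => (z.1 + (cos s - 1) / sin s * z.2, z.2)) \o
      ((fun z : R * R => (z.1, z.2 + sin s * z.1)) \o (fun z : R * R => (z.1 + (cos s - 1) / sin s * z.2, z.2))).
    apply/funext => -[x y]; rewrite /rotate /=; congr (_, _).
      have := cos2Dsin2 s => c1; have {}c1 : sin s * sin s = 1 - cos s ^+ 2 by rewrite -expr2 -c1; ring.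
      apply: (mulfI s0); apply/eqP; rewrite -subr_eq0; apply/eqP.
      rewrite [LHS](_ : _ = - y * (sin s * sin s + cos s ^+ 2 - 1)); first by rewrite c1; ring.
      by field.
    by field.
  by rewrite e; apply: preserves_comp; [exact: preserves_shear1|apply: preserves_comp;
    [exact: preserves_shear2|exact: preserves_shear1]].
(* When sin t = 0 a quarter turn is split off, and both factors have nonzero sine. *)
have [s0|s0] := eqVneq (sin t) 0; last exact: h.
have e : rotate t = rotate (t - pi / 2) \o rotate (pi / 2).
  by apply/funext => z /=; rewrite -rotateD subrK.
rewrite e; apply: preserves_comp; apply: h; last by rewrite sin_pihalf oner_eq0.
rewrite -[_ - _]opprB sinN oppr_eq0 sinB sin_pihalf cos_pihalf mul1r mul0r subr0.
by apply/eqP => c0; have := cos2Dsin2 t; rewrite c0 s0 expr0n/= addr0 => /eqP; rewrite eq_sym oner_eq0.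
Qed.

(** The shift is reduced modulo 2 pi to some c in the period, and the piece pushed beyond 2 pi is
    moved back by one period. Nonnegative functions come first, then positive and negative parts. *)
Lemma int_period_shift (f : R -> \bar R) (a : R) : measurable_fun setT f ->
  (forall x, f (x + 2 * pi) = f x) ->
  (\int[mu]_(x in `[0%R, (2 * pi)%R]) f (x + a)%R = \int[mu]_(x in `[0%R, (2 * pi)%R]) f x)%E.
Proof.
move=> mf pf; have p0 := @twopi_gt0 R.
have key (g : R -> \bar R) c : measurable_fun setT g -> (forall x, 0 <= g x)%E ->
   (forall x, g (x + 2 * pi) = g x) -> 0 <= c < 2 * pi ->
   (\int[mu]_(x in `[0%R, (2 * pi)%R[) g (x + c)%R = \int[mu]_(x in `[0%R, (2 * pi)%R[) g x)%E.
  move=> mg g0 pg /andP[c0 c2].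
  have s1 : (\int[mu]_(x in `[0%R, (2 * pi)%R[) g (x + c)%R = \int[mu]_(x in `[c, (2 * pi + c)%R[) g x)%E.
    rewrite -(@int_shift _ c `[c, (2 * pi + c)%R[%classic)//.
    by congr (integral _ _ _); apply/seteqP; split => x /=; rewrite !in_itv/= lerDr ltrD2r.
  have s2 : (\int[mu]_(x in `[0%R, c[) g x = \int[mu]_(x in `[(2 * pi)%R, (2 * pi + c)%R[) g x)%E.
    rewrite -(@int_shift _ (2 * pi) `[(2 * pi)%R, (2 * pi + c)%R[%classic)//.
    under [RHS]eq_integral do rewrite pg.
    by congr (integral _ _ _); apply/seteqP; split => x /=; rewrite !in_itv/= lerDr [2 * pi + c]addrC ltrD2r.
  rewrite s1.
  rewrite (@itv_bndbnd_setU _ _ (BLeft c) (BLeft (2 * pi)) (BLeft (2 * pi + c))) ?bnd_simp ?lerDl// ?(ltW c2)//.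
  rewrite (@itv_bndbnd_setU _ _ (BLeft 0) (BLeft c) (BLeft (2 * pi))) ?bnd_simp// ?(ltW c2)//.
  have dj (x y z : R) : [disjoint `[x, y[%classic & `[y, z[%classic].
    apply/disj_set2P; rewrite -subset0 => w [/=]; rewrite !in_itv/= => /andP[_ h1] /andP[h2 _].
    by move: (lt_le_trans h1 h2); rewrite ltxx.
  rewrite !ge0_integral_setU//; try exact: dj; try exact: measurable_funS mg.
  by rewrite addeC s2.
have perZ (g : R -> \bar R) : (forall x, g (x + 2 * pi) = g x) -> forall (k : int) x, g (x + k%:~R * (2 * pi)) = g x.
  move=> pg; have pn n x : g (x + n%:R * (2 * pi)) = g x.
    elim: n x => [|n IH] x; first by rewrite mul0r addr0.
    by rewrite -natr1 mulrDl mul1r addrA pg IH.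
  by case=> n x; [exact: pn|rewrite NegzE mulrNz mulNr -[LHS](pn n.+1) subrK].
pose k := Num.floor (a / (2 * pi)); pose c := a - k%:~R * (2 * pi).
have hc : 0 <= c < 2 * pi.
  have /andP[h1 h2] := mathcomp.algebra.archimedean.Num.Theory.floor_itv (a / (2 * pi)).
  rewrite ler_pdivlMr// in h1; rewrite ltr_pdivrMr// intrD mulrDl mul1r -ltrBlDl in h2.
  by rewrite subr_ge0 h1.
have mg i : measurable_fun [set` i : interval R] f by exact: measurable_funS mf.
have key2 (g : R -> \bar R) : measurable_fun setT g -> (forall x, 0 <= g x)%E ->
   (forall x, g (x + 2 * pi) = g x) ->
   (\int[mu]_(x in `[0%R, (2 * pi)%R]) g (x + a)%R = \int[mu]_(x in `[0%R, (2 * pi)%R]) g x)%E.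
  move=> mg0 g0 pg; have ms : measurable_fun setT (fun x : R => x + a) by exact: measurable_funD.
  have m1 : measurable_fun `[0, 2 * pi[ (fun x => g (x + a)).
    by apply: (@measurable_funS _ _ _ _ setT) => //; exact: (measurableT_comp mg0 ms).
  have m2 : measurable_fun `[0, 2 * pi[ g by exact: measurable_funS mg0.
  rewrite -(integral_itv_bndo_bndc m1) -(integral_itv_bndo_bndc m2).
  rewrite -(key g c)//; apply: eq_integral => x _.
  have -> : x + a = x + c + k%:~R * (2 * pi) by rewrite /c; ring.
  exact: perZ.
have h1 := key2 _ (measurable_funepos mf) (funepos_ge0 _) _.
have h2 := key2 _ (measurable_funeneg mf) (funeneg_ge0 _) _.
have e : f \o (fun x => x + 2 * pi) = f by apply/funext => x; exact: pf.
have q1 x : funepos f (x + 2 * pi) = funepos f x by have := congr1 (fun g => funepos g x) e; rewrite funepos_comp.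
have q2 x : funeneg f (x + 2 * pi) = funeneg f x by have := congr1 (fun g => funeneg g x) e; rewrite funeneg_comp.
rewrite [RHS]integralE -(h1 q1) -(h2 q2) [LHS]integralE -[fun x => f (x + a)]/(f \o (fun x => x + a)).
by rewrite funepos_comp funeneg_comp.
Qed.

Lemma Rint_period_shift (f : R -> R) (a : R) : measurable_fun setT f ->
  (forall x, f (x + 2 * pi) = f x) ->
  \int[mu]_(x in `[0, 2 * pi]) f (x + a) = \int[mu]_(x in `[0, 2 * pi]) f x.
Proof.
move=> mf pf; rewrite /Rintegral (@int_period_shift (EFin \o f))//; first exact/measurable_EFinP.
by move=> x; rewrite /= pf.
Qed.

End LebesguePreserving.

(** * Green formula on symmetric domains *)

Section JointContinuity.
Context {R : realType}.
Implicit Types (T : topologicalType).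

Lemma contP T (U V : topologicalType) (f : T -> U) (g : T -> V) : continuous f -> continuous g ->
  continuous (fun x => (f x, g x)).
Proof.
move=> hf hg x A [[P Q] /= [hP hQ] PQ].
have hx : nbhs x (f @^-1` P `&` g @^-1` Q) by apply: filterI; [exact: hf|exact: hg].
by apply: filterS hx => y [Py Qy]; exact: PQ.
Qed.

Lemma contC (T U V : topologicalType) (f : T -> U) (g : U -> V) : continuous f -> continuous g ->
  continuous (fun x => g (f x)).
Proof. by move=> hf hg x; apply: cvg_comp; [exact: hf|exact: hg]. Qed.

Lemma contM T (f g : T -> R) : continuous f -> continuous g -> continuous (fun x => f x * g x).
Proof. by move=> hf hg x; apply: cvgM; [exact: hf|exact: hg]. Qed.

Lemma contD T (f g : T -> R) : continuous f -> continuous g -> continuous (fun x => f x + g x).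
Proof. by move=> hf hg x; apply: cvgD; [exact: hf|exact: hg]. Qed.

Lemma contN T (f : T -> R) : continuous f -> continuous (fun x => - f x).
Proof. by move=> hf x; apply: cvgN; exact: hf. Qed.

Lemma contB T (f g : T -> R) : continuous f -> continuous g -> continuous (fun x => f x - g x).
Proof. by move=> hf hg x; apply: cvgB; [exact: hf|exact: hg]. Qed.

Lemma contK T (U : topologicalType) (c : U) : continuous (fun _ : T => c).
Proof. by move=> x; exact: cvg_cst. Qed.

Lemma cont1 (T U : topologicalType) : continuous (fun z : T * U => z.1).
Proof. by move=> x; exact: cvg_fst. Qed.

Lemma cont2 (T U : topologicalType) : continuous (fun z : T * U => z.2).
Proof. by move=> x; exact: cvg_snd. Qed.

Lemma contI T : continuous (fun x : T => x).
Proof. by move=> x; exact: cvg_id. Qed.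

Lemma cont_sec1 (H : R * R -> R) (y : R) : continuous H -> continuous (fun x : R => H (x, y)).
Proof.
move=> hH; apply: (contC (f := fun x : R => (x, y)) _ hH).
by apply: contP => x; [exact: cvg_id|exact: cvg_cst].
Qed.

Lemma cont_sec2 (H : R * R -> R) (x : R) : continuous H -> continuous (fun y : R => H (x, y)).
Proof.
move=> hH; apply: (contC (f := fun y : R => (x, y)) _ hH).
by apply: contP => y; [exact: cvg_cst|exact: cvg_id].
Qed.

Lemma cont_meas2 (H : R * R -> R) : continuous H -> measurable_fun setT H.
Proof.
move=> hH; have -> : H = fun q => (fun x y => H (x, y)) q.1 q.2 by apply/funext => -[x y].
apply: (@measurable_caratheodory R _ _ (fun x y => H (x, y))) => [y|x].
  exact: cont_sec1.
by apply: cont_meas; exact: cont_sec2.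
Qed.

Lemma cont_box (H : R * R -> R) (a b c d : R) : continuous H -> exists2 K, 0 <= K &
  forall x y, a <= x <= b -> c <= y <= d -> `|H (x, y)| <= K.
Proof.
move=> hH; have : bounded_set (H @` (`[a, b]%classic `*` `[c, d]%classic)).
  apply: compact_bounded; apply: continuous_compact; first exact: continuous_subspaceT.
  by apply: compact_setX; exact: segment_compact.
move=> /pinfty_ex_gt0[K K0 hK]; exists K; first exact: ltW.
by move=> x y hx hy; apply: hK; exists (x, y) => //=; split; rewrite /= in_itv.
Qed.

Notation mu := (@lebesgue_measure R).

Lemma cont_param (H : R * R -> R) (a b : R) : continuous H ->
  continuous (fun t => \int[mu]_(l in `[a, b]) H (t, l)).
Proof.
move=> hH t0; have [K K0 hK] := cont_box (t0 - 1) (t0 + 1) a b hH.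
have mab : (mu `[a, b] < +oo)%E by rewrite lebesgue_measure_itv/=; case: ifP => _; rewrite ?ltry.
have ms t : measurable_fun setT (fun l => H (t, l)).
  by apply: cont_meas; exact: cont_sec2.
have tI (t : R) : `]t0 - 1, t0 + 1[%classic t -> t0 - 1 <= t <= t0 + 1.
  by rewrite /= in_itv/= => /andP[h1 h2]; rewrite !ltW.
have lI (l : R) : `[a, b]%classic l -> a <= l <= b by rewrite /= in_itv.
have := @continuity_under_integral R _ _ mu (fun t l => H (t, l)) `[a, b]%classic _ (t0 - 1) (t0 + 1) _ _ (fun _ => K).
move=> h; apply: h => //.
- by move=> t /tI ht; apply: (integrable_bdd (K := K)) => // l; exact: hK.
- apply/aeW => l _ x _; exact: cont_sec1.
- by apply: (integrable_bdd (K := K)) => // l _; rewrite ger0_norm.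
- by move=> t /tI ht; apply/aeW => l /lI; exact: hK.
- by rewrite inE/= in_itv/= ltrBlDr !ltrDl ltr01.
Qed.

Lemma Rint_cont (f : R -> R) (a b : R) : continuous f -> mu.-integrable `[a, b] (EFin \o f).
Proof.
move=> hf; have [K K0 hK] := cont_box 0 0 a b (contC (@cont2 _ _) hf).
apply: (@integrable_bddP _ _ _ _ _ _ K) => //; last by move=> x; rewrite /= in_itv/= => /(hK 0); apply; rewrite lexx.
  by rewrite /= lebesgue_measure_itv/=; case: ifP => _; rewrite ?ltry.
exact: cont_meas.
Qed.

Lemma Rftc (F f : R -> R) (a b : R) : a <= b -> (forall x, hasD F x (f x)) -> continuous f ->
  \int[mu]_(x in `[a, b]) f x = F b - F a.
Proof. by move=> ab hF hf; rewrite /Rintegral (ftc_cc ab (fun x _ => hF x) (fun x _ => hf x)). Qed.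

Lemma hasD_derive1 (F f : R -> R) : (forall x, hasD F x (f x)) -> F^`() = f.
Proof. by move=> h; apply/funext => x; rewrite derive1E; have [_ ->] := h x. Qed.

Let LR (F f : R -> R) a b : (forall x, hasD F x (f x)) -> derivable_oo_LRcontinuous F a b.
Proof.
move=> h; have c := dcontT h; split.
- by move=> x _; have [] := h x.
- exact: (cvg_at_right_filter (c a)).
- exact: (cvg_at_left_filter (c b)).
Qed.

Lemma subst_dec (F f G : R -> R) (a b : R) : a <= b -> (forall x, hasD F x (f x)) -> continuous f ->
  {in `[a, b]%R &, {homo F : x y /~ x < y}} -> {within `[F b, F a], continuous G} ->
  \int[mu]_(x in `[F b, F a]) G x = \int[mu]_(x in `[a, b]) (G (F x) * - f x).
Proof.
move=> ab hF hf mF hG; rewrite /Rintegral; congr fine.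
rewrite (integration_by_substitution_decreasing ab mF) ?(hasD_derive1 hF)//.
- by apply/cvg_ex; exists (f a); exact: (cvg_at_right_filter (hf a)).
- by apply/cvg_ex; exists (f b); exact: (cvg_at_left_filter (hf b)).
- exact: LR hF.
Qed.

Lemma subst_scale (G : R -> R) (c : R) : 0 < c -> continuous G ->
  \int[mu]_(x in `[- c, c]) G x = c * \int[mu]_(x in `[-1, 1]) G (x * c).
Proof.
move=> c0 hG; have hF x : hasD (fun l => l * c) x c.
  by apply: deq; [apply: dM; [apply: dI|apply: dC]|rewrite /=; ring].
have hc : continuous (fun _ : R => c) by exact: contK.
have cG : continuous (fun x : R => G (x * c)).
  by apply: (contC _ hG); apply: contM => x; [exact: cvg_id|exact: cvg_cst].
rewrite -RintegralZl//; last exact: Rint_cont.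
have m1 : -1 <= 1 :> R by lra.
have := @integration_by_substitution_increasing R (fun l => l * c) G (-1) 1 m1.
rewrite mulN1r mul1r (hasD_derive1 hF) => h; rewrite /Rintegral h.
- by congr fine; apply: eq_integral => x _; rewrite /= mulrC.
- by move=> x y _ _ xy; rewrite ltr_pM2r.
- by move=> x _; exact: hc.
- by apply/cvg_ex; exists c; exact: (cvg_at_right_filter (hc (-1))).
- by apply/cvg_ex; exists c; exact: (cvg_at_left_filter (hc 1)).
- exact: LR hF.
- exact: continuous_subspaceT.
Qed.

Lemma int_fold (f : R -> R) : continuous f -> (forall x, f (x + 2 * pi) = f x) ->
  \int[mu]_(t in `[0, 2 * pi]) f t = \int[mu]_(t in `[0, pi]) (f t + f (- t)).
Proof.
move=> hf pf; have p0 := pi_gt0 R; have mf := cont_meas hf.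
rewrite -(Rint_period_shift (- pi) mf pf).
have e : \int[mu]_(t in `[0, 2 * pi]) f (t + - pi) = \int[mu]_(t in `[- pi, pi]) f t.
  rewrite /Rintegral -(@int_shift R (EFin \o f) (- pi) `[- pi, pi]%classic)//.
    by congr (fine (integral _ _ _)); apply/seteqP; split => x /=; rewrite !in_itv/=; lra.
  exact/measurable_EFinP.
have cfN : continuous (fun t => f (- t)) by apply: contC hf; apply: contN; exact: contI.
have ef : \int[mu]_(t in `[- pi, 0]) f t = \int[mu]_(t in `[0, pi]) f (- t).
  rewrite /Rintegral -[X in `[- pi, X]%classic]oppr0 integration_by_substitution_oppr ?(ltW p0)//.
  exact: continuous_subspaceT.
have l1 : - pi <= 0 :> R by lra.
have := @Rintegral_itvB R f (BLeft (- pi)) (BRight pi) 0 (Rint_cont _ _ hf).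
rewrite !bnd_simp l1 (ltW p0) => /(_ isT isT) h.
rewrite e RintegralD//; [|exact: Rint_cont..].
rewrite -ef addrC -[LHS](subrK (\int[mu]_(t in `[- pi, 0]) f t)) h addrC; congr (_ + _).
by rewrite Rintegral_itv_obnd_cbnd//; apply: integrableS (Rint_cont 0 pi hf) => //; apply: subset_itvr; rewrite bnd_simp.
Qed.

(* a continuously differentiable function of two variables, presented by its
   chain rule along differentiable curves *)
Definition C1fun (F F1 F2 : R * R -> R) : Prop := [/\ continuous F, continuous F1, continuous F2 &
  forall (x y : R -> R) x' y' t, hasD x t x' -> hasD y t y' ->
    hasD (fun s => F (x s, y s)) t (F1 (x t, y t) * x' + F2 (x t, y t) * y')].

End JointContinuity.

(* a domain symmetric about the real axis, each vertical slice of which is an interval: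
   (f1, f2) parametrizes the boundary and (g1, g2) is its derivative *)
Record patch (R : realType) (f1 f2 g1 g2 : R -> R) (D : set (R * R)) : Prop := Patch {
  p_df1 : forall t, hasD f1 t (g1 t);
  p_df2 : forall t, hasD f2 t (g2 t);
  p_cg1 : continuous g1;
  p_cg2 : continuous g2;
  p_f1N : forall t, f1 (- t) = f1 t;
  p_f2N : forall t, f2 (- t) = - f2 t;
  p_g1N : forall t, g1 (- t) = - g1 t;
  p_g2N : forall t, g2 (- t) = g2 t;
  p_f1P : forall t, f1 (t + 2 * pi) = f1 t;
  p_f2P : forall t, f2 (t + 2 * pi) = f2 t;
  p_g1P : forall t, g1 (t + 2 * pi) = g1 t;
  p_g2P : forall t, g2 (t + 2 * pi) = g2 t;
  p_f20 : f2 0 = 0;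
  p_f2pi : f2 pi = 0;
  p_f2_gt0 : forall t : R, 0 < t < pi -> 0 < f2 t;
  p_f1_dec : {in `[0, pi]%R &, {homo f1 : x y /~ x < y}};
  p_mD : measurable D;
  p_sliceD : forall t y : R, 0 <= t <= pi -> D (f1 t, y) <-> `|y| < f2 t;
  p_D1 : forall x y, D (x, y) -> f1 pi <= x <= f1 0;
  p_gb : exists G : R, forall t, `|g1 t| <= G /\ `|g2 t| <= G }.

Section Green.
Context {R : realType}.
Notation mu := (@lebesgue_measure R).
Notation mu2 := (mu \x mu)%E.
Variables (f1 f2 g1 g2 : R -> R) (D : set (R * R)).
Hypothesis hP : patch f1 f2 g1 g2 D.
Let df1 := p_df1 hP.
Let df2 := p_df2 hP.
Let cg1 := p_cg1 hP.
Let cg2 := p_cg2 hP.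
Let f1N := p_f1N hP.
Let f2N := p_f2N hP.
Let g1N := p_g1N hP.
Let g2N := p_g2N hP.
Let f1P := p_f1P hP.
Let f2P := p_f2P hP.
Let g1P := p_g1P hP.
Let g2P := p_g2P hP.
Let f20 := p_f20 hP.
Let f2pi := p_f2pi hP.
Let f2_gt0 := p_f2_gt0 hP.
Let f1_dec := p_f1_dec hP.
Let mD := p_mD hP.
Let sliceD := p_sliceD hP.
Let D1 := p_D1 hP.

Let p0 : 0 < pi :> R := pi_gt0 R.
Let cf1 : continuous f1 := dcontT df1.
Let cf2 : continuous f2 := dcontT df2.

Let f2_ge0 (t : R) : 0 <= t <= pi -> 0 <= f2 t.
Proof.
move=> /andP[]; rewrite le_eqVlt => /predU1P[<-|t0]; first by rewrite f20.
rewrite le_eqVlt => /predU1P[->|tpi]; first by rewrite f2pi.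
by rewrite ltW// f2_gt0// t0.
Qed.

Let inv_ex (x : R) : exists t : R, f1 pi <= x <= f1 0 -> 0 <= t <= pi /\ f1 t = x.
Proof.
have [hx|hx] := pselect (f1 pi <= x <= f1 0); last by exists 0.
have f10 : f1 pi <= f1 0 by case/andP: hx => a b; exact: le_trans a b.
have [|t ht e] := @IVT R f1 0 pi x (ltW p0) (continuous_subspaceT cf1).
  by rewrite min_r// max_l.
by exists t => _; move: ht; rewrite in_itv/=.
Qed.

Let invf : R -> R := projT1 (choice inv_ex).
Let invP (x : R) : f1 pi <= x <= f1 0 -> 0 <= invf x <= pi /\ f1 (invf x) = x.
Proof. exact: (projT2 (choice inv_ex)). Qed.

Let f1_mono : {in `[0, pi]%R &, {mono f1 : x y /~ x <= y}}.
Proof. exact: le_nmono_in. Qed.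

Let f1_inj (s t : R) : 0 <= s <= pi -> 0 <= t <= pi -> f1 s = f1 t -> s = t.
Proof.
move=> hs ht e; have hs' : s \in `[0, pi]%R by rewrite in_itv.
have ht' : t \in `[0, pi]%R by rewrite in_itv.
by apply/eqP; rewrite eq_le -(f1_mono hs' ht') -(f1_mono ht' hs') e lexx.
Qed.

Let f1_itv (t : R) : 0 <= t <= pi -> f1 pi <= f1 t <= f1 0.
Proof.
by move=> /[dup] /andP[t0 tp] ht; rewrite !f1_mono ?in_itv/= ?lexx ?(ltW p0)//= tp.
Qed.

Let invK (t : R) : 0 <= t <= pi -> invf (f1 t) = t.
Proof. by move=> ht; have [h1 h2] := invP (f1_itv ht); exact: f1_inj. Qed.

Let inv0 : invf (f1 0) = 0. Proof. by rewrite invK// lexx ltW. Qed.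
Let invpi : invf (f1 pi) = pi. Proof. by rewrite invK// lexx ltW. Qed.

Let inv_cont : {within `[f1 pi, f1 0], continuous invf}.
Proof.
apply: segment_dec_surj_continuous => [x y|].
  rewrite !in_itv/= => /invP[hx ex] /invP[hy ey].
  by rewrite -{2}ex -{2}ey f1_mono ?in_itv.
rewrite inv0 invpi => t /=; rewrite in_itv/= => ht; exists (f1 t); last exact: invK.
by rewrite /= in_itv/= f1_itv.
Qed.

Let M_ex : exists2 M, 0 <= M & forall t : R, 0 <= t <= pi -> f2 t <= M.
Proof.
have [K K0 hK] := cont_box 0 0 0 pi (contC (@cont2 _ _) cf2).
exists K => // t ht; apply: le_trans (ler_norm _) _; apply: (hK 0) => //.
by rewrite lexx.
Qed.

Let cH1 (H : R * R -> R) x : continuous H -> continuous (fun y => H (x, y)).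
Proof. exact: cont_sec2. Qed.

Definition lens (H : R * R -> R) (z : R * R) : R := H (f1 z.1, z.2 * f2 z.1).

Let clens H : continuous H -> continuous (lens H).
Proof.
move=> hH; apply: contC hH; apply: contP; first exact: contC (@cont1 _ _) cf1.
by apply: contM; [exact: cont2|exact: contC (@cont1 _ _) cf2].
Qed.

Lemma patch_bdd : exists2 M : R, 0 <= M & forall x y, D (x, y) -> `|x| <= M /\ `|y| <= M.
Proof.
have [M M0 hM] := M_ex; exists (M + `|f1 pi| + `|f1 0|); first by rewrite !addr_ge0.
move=> x y /[dup] /D1 hx; have [ht e] := invP hx; rewrite -{1}e => /(sliceD y ht)/ltW h2.
have h3 := hM _ ht; have n1 := normr_ge0 (f1 pi); have n2 := normr_ge0 (f1 0).
have h4 := ler_norm (f1 0); have := ler_norm (- f1 pi); rewrite normrN => h5.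
have /andP[h6 h7] := hx; clear hx e ht.
by split; [rewrite ler_norml; apply/andP; split|]; lra.
Qed.

Lemma patch_fin : (mu2 D < +oo)%E.
Proof.
have [M M0 hM] := patch_bdd.
have fin : (mu `[(- M)%R, M]%classic < +oo)%E.
  by rewrite /= lebesgue_measure_itv/=; case: ifP => _; rewrite ?ltry.
apply: le_lt_trans (product_measure1_lty (m1 := mu) (m2 := mu) (measurable_itv _) (measurable_itv _) fin fin).
apply: le_measure; rewrite ?inE//; first by apply: measurableX; exact: measurable_itv.
by move=> [x y] /hM[h1 h2]; split; rewrite /= in_itv/= -ler_norml.
Qed.

Lemma patch_int (H : R * R -> R) : continuous H -> mu2.-integrable D (EFin \o H).
Proof.
move=> hH; have [M M0 hM] := patch_bdd; have [K K0 hK] := cont_box (- M) M (- M) M hH.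
apply: (@integrable_bddP _ _ _ _ _ _ K) => //; [exact: patch_fin|exact: cont_meas2|].
by move=> [x y] /hM[h1 h2]; apply: hK; rewrite -ler_norml.
Qed.

(* the map (t, l) |-> (f1 t, l f2 t) sends [0, pi] x [-1, 1] onto the closure of D *)
Lemma area_formula (H : R * R -> R) : continuous H ->
  \int[mu2]_(z in D) H z =
  \int[mu]_(t in `[0, pi]) (\int[mu]_(l in `[-1, 1]) (- g1 t * f2 t * lens H (t, l))).
Proof.
move=> hH; have [M M0 hM] := M_ex.
pose A := `[f1 pi, f1 0]%classic : set R; pose B := `[- M, M]%classic : set R.
pose h (z : R * R) := H z * \1_D z.
have mh : measurable_fun setT h by apply: measurable_funM; [exact: cont_meas2|exact: measurable_indic].
have [K K0 hK] := cont_box (f1 pi) (f1 0) (- M) M hH.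
have hb x y : A x -> B y -> `|h (x, y)| <= K.
  rewrite /A /B /= !in_itv/= => hx hy; rewrite /h normrM indicE.
  by apply: le_trans (hK x y hx hy); rewrite ler_piMr//; case: (_ \in D); rewrite ?normr1 ?normr0.
have fin (a b : R) : (mu `[a, b]%classic < +oo)%E.
  by rewrite /= lebesgue_measure_itv/=; case: ifP => _; rewrite ?ltry.
have DAB : D `<=` A `*` B.
  move=> [x y] /[dup] /D1 hx; rewrite /A /B; have [ht e] := invP hx; rewrite -{1}e => /sliceD.
  move=> /(_ ht); rewrite ltr_norml => /andP[h1 h2].
  have := hM _ ht => h3; split; rewrite /= in_itv//= (le_trans _ (ltW h1)) ?lerN2//=.
  exact: le_trans (ltW h2) h3.
have e1 : \int[mu2]_(z in D) H z = \int[mu2]_(z in A `*` B) h z.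
  rewrite /Rintegral; congr fine; rewrite integral_mkcond [RHS]integral_mkcond.
  apply: eq_integral => z _; rewrite !patchE /h indicE.
  case: (boolP (z \in D)) => zD; last by rewrite mulr0; case: ifP.
  by rewrite mulr1 mem_set//; apply: DAB; rewrite inE in zD.
have e4 := fubini12 (m1 := mu) (m2 := mu) (measurable_itv _) (measurable_itv _) (fin (f1 pi) (f1 0)) (fin (- M) M) mh hb.
apply: etrans e1 (etrans (esym e4) _).
pose J t := f2 t * \int[mu]_(l in `[-1, 1]) lens H (t, l).
have cJ : continuous J by apply: contM => //; apply: cont_param; exact: clens.
(* The slice over [f1 t] is the interval between - f2 t and f2 t; rescaling it to [-1, 1] produces
   the factor [f2 t], and it is empty when f2 t = 0. *)
have IJ t : 0 <= t <= pi -> \int[mu]_(y in B) h (f1 t, y) = J t.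
  move=> ht; have f2t := f2_ge0 ht.
  have e2 : \int[mu]_(y in B) h (f1 t, y) = \int[mu]_(y in `]- f2 t, f2 t[) H (f1 t, y).
    rewrite /Rintegral; congr fine; rewrite integral_mkcond [RHS]integral_mkcond.
    apply: eq_integral => y _; rewrite !patchE /h indicE.
    have eD : ((f1 t, y) \in D) = (y \in `]- f2 t, f2 t[%classic).
      by apply/idP/idP; rewrite !inE/= in_itv/= -ltr_norml => /(sliceD y ht).
    rewrite eD; case: ifP => [yB|yB]; first by case: ifP => _; rewrite ?mulr1 ?mulr0.
    rewrite ifF//; apply/negbTE/negP; rewrite inE/= in_itv/= => /andP[h1 h2].
    move/negbT/negP: yB; apply; rewrite inE /B/= in_itv/=.
    have := hM _ ht => h3; apply/andP; split; lra.
  rewrite e2 /J; move: f2t; rewrite le_eqVlt => /predU1P[<-|f2t].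
    by rewrite oppr0 mul0r set_itvoo0 Rintegral_set0.
  rewrite /lens /= -(subst_scale f2t (@cH1 H (f1 t) hH)) /Rintegral; congr fine; symmetry.
  apply: integral_itv_bndoo; apply/measurable_EFinP; apply: measurable_funTS; apply: cont_meas; exact: cH1.
pose G := J \o invf.
have cG : {within A, continuous G} by apply: within_continuous_comp => // x _; exact: cJ.
have e3 : \int[mu]_(x in A) (\int[mu]_(y in B) h (x, y)) = \int[mu]_(x in A) G x.
  apply: eq_Rintegral => x; rewrite inE /A/= in_itv/= => hx.
  by have [ht e] := invP hx; rewrite /G /= -IJ// e.
rewrite e3 (subst_dec (ltW p0) df1 cg1 f1_dec cG).
apply: eq_Rintegral => t; rewrite inE/= in_itv/= => ht; rewrite /G /= invK// /J.
rewrite [RHS]RintegralZl//; first by rewrite [LHS]mulrC mulrA.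
by apply: Rint_cont; exact: cont_sec2 (clens hH).
Qed.

Definition oint (F : R -> R) : R := \int[mu]_(t in `[0, 2 * pi]) F t.

Let cbd (F : R * R -> R) : continuous F -> continuous (fun t => F (f1 t, f2 t)).
Proof. by move=> hF; apply: contC hF; exact: contP. Qed.

Let dlens_l (F F1 F2 : R * R -> R) t l : C1fun F F1 F2 ->
  hasD (fun s => lens F (t, s)) l (lens F2 (t, l) * f2 t).
Proof.
move=> [_ _ _ h]; rewrite /lens /=; apply: deq.
  apply: (h (fun _ => f1 t) (fun s => s * f2 t)); first exact: dC.
  by apply: dM; [exact: dI|exact: dC].
by rewrite /=; ring.
Qed.

Let dlens_t (F F1 F2 : R * R -> R) t l : C1fun F F1 F2 ->
  hasD (fun s => lens F (s, l)) t (lens F1 (t, l) * g1 t + lens F2 (t, l) * (l * g2 t)).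
Proof.
move=> [_ _ _ h]; rewrite /lens /=; apply: deq.
  apply: (h f1 (fun s => l * f2 s)); first exact: df1.
  by apply: dM; [exact: dC|exact: df2].
by rewrite /=; ring.
Qed.

(** In the coordinates (t, l) the l-derivative of [lens F] is [lens F2] times f2, so the inner
    integral is a difference of boundary values; l = 1 and l = -1 are the points of the curve at t
    and - t. *)
Lemma green_y F F1 F2 : C1fun F F1 F2 ->
  \int[mu2]_(z in D) F2 z = - oint (fun t => F (f1 t, f2 t) * g1 t).
Proof.
move=> /[dup] hF [cF cF1 cF2 _]; rewrite area_formula// /oint int_fold; last 2 first.
- by apply: contM => //; exact: cbd.
- by move=> t; rewrite f1P f2P g1P.
rewrite -[RHS]mulN1r -RintegralZl//; last first.
  apply: Rint_cont; apply: contD; first by apply: contM => //; exact: cbd.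
  apply: (contC (g := fun t => F (f1 t, f2 t) * g1 t)); first by apply: contN; exact: contI.
  by apply: contM => //; exact: cbd.
apply: eq_Rintegral => t _.
rewrite (Rftc (F := fun l => - g1 t * lens F (t, l))).
- by rewrite /lens/= f1N f2N g1N mulN1r mul1r; ring.
- by lra.
- move=> l; apply: deq; first by apply: dM; [exact: dC|exact: dlens_l hF].
  by rewrite /=; ring.
- apply: contM; first exact: contK.
  exact: cont_sec2 (clens cF2).
Qed.

(** The integrand is Q - P with P the t-derivative of f2 times [lens F] and Q the l-derivative of l
    g2 times [lens F]. P integrates to 0 because f2 vanishes at 0 and pi; Q gives the boundary
    term. *)
Lemma green_x F F1 F2 : C1fun F F1 F2 ->
  \int[mu2]_(z in D) F1 z = oint (fun t => F (f1 t, f2 t) * g2 t).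
Proof.
move=> /[dup] hF [cF cF1 cF2 _]; rewrite area_formula// /oint int_fold; last 2 first.
- by apply: contM => //; exact: cbd.
- by move=> t; rewrite f1P f2P g2P.
pose P (z : R * R) := g2 z.1 * lens F z + f2 z.1 * (lens F1 z * g1 z.1 + lens F2 z * (z.2 * g2 z.1)).
pose Q (z : R * R) := g2 z.1 * lens F z + z.2 * g2 z.1 * (lens F2 z * f2 z.1).
have c1 (g : R -> R) : continuous g -> continuous (fun z : R * R => g z.1).
  by move=> hg; exact: (contC (@cont1 _ _) hg).
have cP : continuous P.
  apply: contD; apply: contM; try exact: c1; try exact: clens.
  apply: contD; apply: contM; try exact: c1; try exact: clens.
  by apply: contM; [exact: cont2|exact: c1].
have cQ : continuous Q.
  apply: contD; apply: contM; try exact: c1; try exact: clens.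
    by apply: contM; [exact: cont2|exact: c1].
  by apply: contM; [exact: clens|exact: c1].
have PQ t l : - g1 t * f2 t * lens F1 (t, l) = Q (t, l) - P (t, l) by rewrite /P /Q /=; ring.
have cl (H : R * R -> R) t : continuous H -> continuous (fun l => H (t, l)) by exact: cH1.
have ct (H : R * R -> R) l : continuous H -> continuous (fun t => H (t, l)) by exact: cont_sec1.
have fin (a b : R) : (mu `[a, b]%classic < +oo)%E.
  by rewrite /= lebesgue_measure_itv/=; case: ifP => _; rewrite ?ltry.
have i0 : \int[mu]_(t in `[0, pi]) (\int[mu]_(l in `[-1, 1]) P (t, l)) = 0.
  have [K K0 hK] := cont_box 0 pi (-1) 1 cP.
  have hb x y : `[0, pi]%classic x -> `[-1, 1]%classic y -> `|P (x, y)| <= K.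
    by rewrite /= !in_itv/=; exact: hK.
  have e4 := fubini_swap (m1 := mu) (m2 := mu) (measurable_itv _) (measurable_itv _) (fin 0 pi) (fin (-1) 1) (cont_meas2 cP) hb.
  apply: etrans e4 _.
  under eq_Rintegral => l _.
    rewrite (Rftc (F := fun t => f2 t * lens F (t, l)) (ltW p0)); first last.
    - exact: ct.
    - by move=> t; apply: deq; [apply: dM; [exact: df2|exact: dlens_t hF]|rewrite /P/=].
    rewrite f20 f2pi !mul0r subrr; over.
  by rewrite Rintegral_cst//= mul0r.
under eq_Rintegral => t _.
  under eq_Rintegral => l _ do rewrite PQ.
  rewrite RintegralB//; [|by apply: Rint_cont; exact: cl..].
  over.
have cpar (H : R * R -> R) : continuous H -> continuous (fun t : R => \int[mu]_(l in `[-1, 1]) H (t, l)) by exact: cont_param.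
rewrite RintegralB//; [|by apply: Rint_cont; exact: cpar..].
rewrite i0 subr0; apply: eq_Rintegral => t _.
rewrite (Rftc (F := fun l => l * g2 t * lens F (t, l))).
- by rewrite /lens/= f1N f2N g2N !mulN1r !mul1r; ring.
- by lra.
- move=> l; apply: deq.
    by apply: dM; [apply: dM; [exact: dI|exact: dC]|exact: dlens_l hF].
  by rewrite /Q/=; ring.
- exact: cl.
Qed.

End Green.

(** * Regularized Riesz kernels and boundary potentials *)

Section RieszKernel.
Context {R : realType}.
Implicit Types (x y w h : R * R) (T : topologicalType).

Definition dist2 x y : R := (x.1 - y.1) ^+ 2 + (x.2 - y.2) ^+ 2.

Lemma dist2_ge0 x y : 0 <= dist2 x y.
Proof. by rewrite addr_ge0 ?sqr_ge0. Qed.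

Lemma dist2C x y : dist2 x y = dist2 y x.
Proof. by rewrite /dist2; ring. Qed.

Definition kern (p : R) x y : R := dist2 x y `^ (- p).
Definition kernd (p de : R) x y : R := (dist2 x y + de ^+ 2) `^ (- p).
(** Normalized so that the gradient of [kernd] in x is [kernd'] times x - y. *)
Definition kernd' (p de : R) x y : R := - p * (dist2 x y + de ^+ 2) `^ (- p - 1) * 2.

Lemma dist2d_gt0 (de : R) x y : 0 < de -> 0 < dist2 x y + de ^+ 2.
Proof. by move=> d0; rewrite ltr_wpDl ?dist2_ge0// exprn_gt0. Qed.

Lemma kerndC p de x y : kernd p de x y = kernd p de y x.
Proof. by rewrite /kernd dist2C. Qed.

Lemma kernd_ge0 p de x y : 0 <= kernd p de x y.
Proof. exact: powR_ge0. Qed.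

Lemma kernd_le p de x y : 0 < p -> 0 < de -> kernd p de x y <= (de ^+ 2) `^ (- p).
Proof.
move=> p0 d0; rewrite /kernd !powRN lef_pV2 ?posrE ?powR_gt0 ?exprn_gt0 ?dist2d_gt0//.
by apply: ler_powR2; rewrite ?(ltW p0) ?sqr_ge0 ?lerDr ?dist2_ge0.
Qed.

Lemma cont_dist2 T (x y : T -> R * R) : continuous x -> continuous y ->
  continuous (fun t => dist2 (x t) (y t)).
Proof.
move=> hx hy; rewrite /dist2.
have s (f : T -> R) : continuous f -> continuous (fun t => f t ^+ 2).
  by move=> hf; rewrite (_ : (fun t => _) = fun t => f t * f t)//; exact: contM.
by apply: contD; apply: s; apply: contB; [exact: (contC hx (@cont1 _ _))|exact: (contC hy (@cont1 _ _))|exact: (contC hx (@cont2 _ _))|exact: (contC hy (@cont2 _ _))].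
Qed.

Lemma cont_powR T (f : T -> R) (a : R) : (forall t, 0 < f t) -> continuous f ->
  continuous (fun t => f t `^ a).
Proof.
move=> f0 hf t; apply: (cvg_comp f (fun u : R => u `^ a) (hf t)).
have h : hasD (fun u : R => u `^ a) (f t) (a * f t `^ (a - 1) * 1).
  by apply: dpow; [exact: f0|exact: dI].
exact: dcont h.
Qed.

Lemma cont_kernd T (p de : R) (x y : T -> R * R) : 0 < de -> continuous x -> continuous y ->
  continuous (fun t => kernd p de (x t) (y t)).
Proof.
move=> d0 hx hy; apply: cont_powR; first by move=> t; exact: dist2d_gt0.
by apply: contD; [exact: cont_dist2|exact: contK].
Qed.

Lemma cont_kernd' T (p de : R) (x y : T -> R * R) : 0 < de -> continuous x -> continuous y ->
  continuous (fun t => kernd' p de (x t) (y t)).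
Proof.
move=> d0 hx hy; rewrite /kernd'; apply: contM; last exact: contK.
apply: contM; first exact: contK; apply: cont_powR; first by move=> t; exact: dist2d_gt0.
by apply: contD; [exact: cont_dist2|exact: contK].
Qed.

Lemma dsqr (f : R -> R) t a : hasD f t a -> hasD (fun s => f s ^+ 2) t (a * f t + f t * a).
Proof. by move=> h; apply: deq; [exact: (dM h h)|ring]. Qed.

Lemma dkernd p de (x1 x2 y1 y2 : R -> R) a1 a2 b1 b2 t : 0 < de ->
  hasD x1 t a1 -> hasD x2 t a2 -> hasD y1 t b1 -> hasD y2 t b2 ->
  hasD (fun s => kernd p de (x1 s, x2 s) (y1 s, y2 s)) t
    (kernd' p de (x1 t, x2 t) (y1 t, y2 t) * ((x1 t - y1 t) * (a1 - b1) + (x2 t - y2 t) * (a2 - b2))).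
Proof.
move=> d0 hx1 hx2 hy1 hy2; rewrite /kernd /kernd' /dist2 /=; apply: deq.
  apply: dpow; first exact: (@dist2d_gt0 de (x1 t, x2 t) (y1 t, y2 t)).
  apply: dD; last exact: dC.
  by apply: dD; apply: dsqr; (apply: dD; [eassumption|apply: dN; eassumption]).
by rewrite /=; ring.
Qed.

Lemma C1_kernd p de w : 0 < de -> C1fun (fun x => kernd p de x w)
  (fun x => kernd' p de x w * (x.1 - w.1)) (fun x => kernd' p de x w * (x.2 - w.2)).
Proof.
move=> d0; have cI : continuous (fun x : R * R => x) by move=> x; exact: cvg_id.
have cw : continuous (fun _ : R * R => w) by move=> x; exact: cvg_cst.
split.
- exact: cont_kernd.
- by apply: contM; [exact: cont_kernd'|apply: contB; [exact: cont1|exact: contK]].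
- by apply: contM; [exact: cont_kernd'|apply: contB; [exact: cont2|exact: contK]].
- move=> x y x' y' t hx hy; case: w {cw} => w1 w2; apply: deq.
    by apply: (dkernd (y1 := fun _ => w1) (y2 := fun _ => w2) _ d0 hx hy); exact: dC.
  by rewrite /=; ring.
Qed.

Lemma C1M F F1 F2 G G1 G2 : C1fun F F1 F2 -> C1fun G G1 G2 ->
  C1fun (fun x : R * R => F x * G x) (fun x => F1 x * G x + F x * G1 x) (fun x => F2 x * G x + F x * G2 x).
Proof.
move=> [c c1 c2 h] [k k1 k2 g]; split.
- exact: contM.
- by apply: contD; exact: contM.
- by apply: contD; exact: contM.
- move=> x y x' y' t hx hy; apply: deq; first by apply: dM; [exact: (h _ _ _ _ _ hx hy)|exact: (g _ _ _ _ _ hx hy)].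
  by rewrite /=; ring.
Qed.

Lemma C1_fst : C1fun (fun x : R * R => x.1) (fun _ => 1) (fun _ => 0).
Proof.
split; [exact: cont1|exact: contK|exact: contK|].
by move=> x y x' y' t hx hy; apply: deq; [exact: hx|rewrite /=; ring].
Qed.

Lemma C1_snd : C1fun (fun x : R * R => x.2) (fun _ => 0) (fun _ => 1).
Proof.
split; [exact: cont2|exact: contK|exact: contK|].
by move=> x y x' y' t hx hy; apply: deq; [exact: hy|rewrite /=; ring].
Qed.

Lemma C1B_cst F F1 F2 (c : R) : C1fun F F1 F2 -> C1fun (fun x : R * R => F x - c) F1 F2.
Proof.
move=> [k k1 k2 h]; split => //; first by apply: contB => //; exact: contK.
move=> x y x' y' t hx hy; apply: deq; first by apply: dD; [exact: (h _ _ _ _ _ hx hy)|exact: dC].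
by rewrite /=; ring.
Qed.

Lemma kernd'_le p de x w : 0 < p -> 0 < de ->
  `|kernd' p de x w * (x.1 - w.1)| <= p * (de ^+ 2) `^ (- p) / de /\
  `|kernd' p de x w * (x.2 - w.2)| <= p * (de ^+ 2) `^ (- p) / de.
Proof.
move=> p0 d0; have D0 := dist2d_gt0 x w d0.
have k0 := powR_ge0 (dist2 x w + de ^+ 2) (- p).
have kl := kernd_le x w p0 d0; rewrite /kernd in kl.
have key (z : R) : 2 * de * `|z| <= dist2 x w + de ^+ 2 -> `|kernd' p de x w * z| <= p * (de ^+ 2) `^ (- p) / de.
  have e1 : (dist2 x w + de ^+ 2) `^ (- p - 1) = (dist2 x w + de ^+ 2) `^ (- p) * (dist2 x w + de ^+ 2)^-1.
    by rewrite powRD ?powR_inv1 ?(ltW D0)// (gt_eqF D0) implybT.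
  move=> hz; rewrite /kernd' e1.
  have -> : - p * ((dist2 x w + de ^+ 2) `^ (- p) * (dist2 x w + de ^+ 2)^-1) * 2 * z =
    - (p * (dist2 x w + de ^+ 2) `^ (- p) * (2 * z / (dist2 x w + de ^+ 2))) by ring.
  rewrite normrN !normrM (ger0_norm (ltW p0)) (ger0_norm k0) normfV (ger0_norm (ltW D0)) normr_nat.
  rewrite ler_pM ?mulr_ge0 ?(ltW p0) ?invr_ge0 ?(ltW D0)//; first by rewrite ler_wpM2l// ltW.
  by rewrite ler_pdivrMr// ler_pdivlMl// mulrCA mulrA.
have sq (z : R) : 2 * de * `|z| <= z ^+ 2 + de ^+ 2.
  rewrite -[z ^+ 2]real_normK ?num_real// -subr_ge0.
  by rewrite (_ : _ - _ = (`|z| - de) ^+ 2) ?sqr_ge0//; ring.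
split; apply: key; apply: le_trans (sq _) _; rewrite lerD2r /dist2.
  by rewrite lerDl sqr_ge0.
by rewrite lerDr sqr_ge0.
Qed.

Lemma kernd_lip p de x h w : 0 < p -> 0 < de ->
  `|kernd p de (x.1 + h.1, x.2 + h.2) w - kernd p de x w| <= p * (de ^+ 2) `^ (- p) / de * (`|h.1| + `|h.2|).
Proof.
move=> p0 d0.
have dl (c e s : R) : hasD (fun s => c + s * e) s e.
  by apply: deq; [apply: dD; [exact: dC|apply: dM; [exact: dI|exact: dC]]|rewrite /=; ring].
have [_ _ _ hD] := C1_kernd p w d0.
have := @mean_value R (fun s => kernd p de (x.1 + s * h.1, x.2 + s * h.2) w) _
  (p * (de ^+ 2) `^ (- p) / de * (`|h.1| + `|h.2|)) 0 1 (fun s _ => hD _ _ _ _ s (dl _ _ s) (dl _ _ s)).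
rewrite !mul1r !mul0r !addr0 subr0 normr1 mulr1 -surjective_pairing; apply => s _.
apply: le_trans (ler_normD _ _) _; rewrite (normrM _ h.1) (normrM _ h.2) [leRHS]mulrDr.
have [b1 b2] := kernd'_le (x.1 + s * h.1, x.2 + s * h.2) w p0 d0.
by apply: lerD; apply: ler_wpM2r.
Qed.

(** Put e = de^2 and u = D / (D + e). The difference is D^(-p) (1 - u^p) <= D^(-p) (1 - u), and 1 -
    u = e / (D + e) <= (e / D)^g. The rate e^g is paid for by raising the exponent from p to p +
    g. *)
Lemma kernd_close p g de x y : 0 < p < 1 -> 0 < g < 1 -> 0 < dist2 x y ->
  `|kern p x y - kernd p de x y| <= (de ^+ 2) `^ g * kern (p + g) x y.
Proof.
move=> /andP[p0 p1] /andP[g0 g1] D0; rewrite /kern /kernd; set D := dist2 x y; set e := de ^+ 2.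
have e0 : 0 <= e by exact: sqr_ge0.
have De : 0 < D + e by rewrite ltr_wpDr.
have ne u : 0 < u -> (u : R) != 0 by move=> ?; rewrite gt_eqF.
pose u := D / (D + e).
have u0 : 0 < u by rewrite divr_gt0.
have u1 : u <= 1 by rewrite ler_pdivrMr// mul1r lerDl.
have eD : (D + e) `^ (- p) = D `^ (- p) * u `^ p.
  have Du : D `^ p = (D + e) `^ p * u `^ p.
    by rewrite -powRM ?(ltW De) ?(ltW u0)//; congr (_ `^ p); rewrite mulrC divfK// ne.
  by rewrite !powRN Du invfM -mulrA mulVf ?mulr1// gt_eqF// powR_gt0.
rewrite eD -{1}[D `^ (- p)]mulr1 -mulrBr normrM ger0_norm ?powR_ge0//.
have upu : u <= u `^ p by rewrite -{1}[u]powRr1 ?(ltW u0)//; apply: ger_powR; rewrite ?u0 ?u1 ?(ltW p1).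
have up1 : u `^ p <= 1 by have := ler_powR2 (ltW p0) (ltW u0) u1; rewrite powR1.
rewrite ger0_norm ?subr_ge0//.
have -> : D `^ (- (p + g)) = D `^ (- p) * D `^ (- g) by rewrite opprD powRD// ne ?implybT.
rewrite mulrCA ler_wpM2l ?powR_ge0//.
apply: le_trans (_ : _ <= 1 - u) _; first by rewrite lerD2l lerN2.
have -> : 1 - u = e / (D + e) by rewrite /u; field; exact: ne.
apply: le_trans (_ : _ <= (e / (D + e)) `^ g) _.
  have [->|en0] := eqVneq e 0; first by rewrite mul0r powR_ge0.
  have v0 : 0 < e / (D + e) by rewrite divr_gt0// lt_def en0.
  rewrite -{1}[e / (D + e)]powRr1 ?(ltW v0)//; apply: ger_powR; rewrite ?(ltW g1)// v0/=.
  by rewrite ler_pdivrMr// mul1r lerDr ltW.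
rewrite powRM ?invr_ge0 ?(ltW De)// ler_wpM2l ?powR_ge0// powRN -[X in X `^ g]powR_inv1 ?(ltW De)// -powRrM mulN1r powRN.
by rewrite lef_pV2 ?posrE ?powR_gt0//; apply: ler_powR2; rewrite ?(ltW g0) ?(ltW D0) ?lerDl.
Qed.

End RieszKernel.

(** * Potentials carried by the boundary curve *)

Section BoundaryPotential.
Context {R : realType}.
Notation mu := (@lebesgue_measure R).
Notation mu2 := (mu \x mu)%E.
Variables (f1 f2 g1 g2 : R -> R) (D : set (R * R)).
Hypothesis hP : patch f1 f2 g1 g2 D.
Variables (c0 be : R).
Hypothesis beP : 0 < be < 2^-1.
Hypothesis c0_gt0 : 0 < c0.
(* every point of the plane is seen from the boundary like a point of the unit circle *)
Hypothesis chordP : forall x, exists t0, forall t, c0 * chord2 (t - t0) <= dist2 x (f1 t, f2 t).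

Let cf1 : continuous f1 := dcontT (p_df1 hP).
Let cf2 : continuous f2 := dcontT (p_df2 hP).
Let cf : continuous (fun t => (f1 t, f2 t)) := contP cf1 cf2.

Definition pot (g : R -> R) x : R := oint (fun t => kern be x (f1 t, f2 t) * g t).
Definition potd (g : R -> R) de x : R := oint (fun t => kernd be de x (f1 t, f2 t) * g t).

(** The period is recentred at the parameter singled out by [chordP] and opened, so that the chord
    is positive throughout. *)
Let int_shift01 (F : R -> R) t0 : measurable_fun setT F -> (forall x, F (x + 2 * pi) = F x) ->
  oint F = \int[mu]_(t in `]0, 2 * pi[) F (t + t0).
Proof.
move=> mF pF; rewrite /oint -(Rint_period_shift t0 mF pF) /Rintegral; congr fine.
apply: integral_itv_bndoo; apply/measurable_EFinP; apply: measurable_funTS.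
by apply: measurableT_comp mF _; exact: measurable_funD.
Qed.

Let kap_oint p : 0 < p < 2^-1 -> mu.-integrable `]0, 2 * pi[ (EFin \o kap p).
Proof.
by move=> hp; apply: integrableS (kap_int hp) => //; apply: subset_itvW.
Qed.

(** Half of the room below the threshold 1/2, so the raised exponent be + ge is still integrable. *)
Let ge : R := (2^-1 - be) / 2.
Let ge_prop : [/\ 0 < ge < 1, 0 < be < 1 & 0 < be + ge < 2^-1].
Proof. by have b := beP; rewrite /ge; split; lra. Qed.

Lemma kern_meas p x : measurable_fun setT (fun t => kern p x (f1 t, f2 t)).
Proof.
apply: (measurableT_comp (measurable_powR (- p))); apply: cont_meas.
by apply: (cont_dist2 (x := fun _ => x)) => //; exact: contK.
Qed.

Let kern_per p x t : kern p x (f1 (t + 2 * pi), f2 (t + 2 * pi)) = kern p x (f1 t, f2 t).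
Proof. by rewrite (p_f1P hP) (p_f2P hP). Qed.

Lemma kern_chord p x t0 t : 0 < p -> (forall t, c0 * chord2 (t - t0) <= dist2 x (f1 t, f2 t)) ->
  0 < t < 2 * pi -> 0 < dist2 x (f1 (t + t0), f2 (t + t0)) /\
  kern p x (f1 (t + t0), f2 (t + t0)) <= c0 `^ (- p) * kap p t.
Proof.
move=> p0 h t2; have c := chord2_gt0 t2; have := h (t + t0); rewrite addrK => h1.
have c1 : 0 < c0 * chord2 t by rewrite mulr_gt0.
have D0 := lt_le_trans c1 h1; split => //.
rewrite /kern /kap -powRM ?(ltW c0_gt0) ?(ltW c)// !powRN lef_pV2 ?posrE ?powR_gt0//.
by apply: ler_powR2; rewrite ?(ltW p0) ?(ltW c1).
Qed.

Let cst : R := c0 `^ (- (be + ge)) * \int[mu]_(t in `]0, 2 * pi[) kap (be + ge) t.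

Lemma pot_integrable g (G : R) x : continuous g -> (forall t, `|g t| <= G) ->
  (forall t, g (t + 2 * pi) = g t) ->
  exists t0, mu.-integrable `]0, 2 * pi[ (EFin \o (fun t => kern be x (f1 (t + t0), f2 (t + t0)) * g (t + t0))) /\
    pot g x = \int[mu]_(t in `]0, 2 * pi[) (kern be x (f1 (t + t0), f2 (t + t0)) * g (t + t0)).
Proof.
move=> cg gG pg; have [t0 ht0] := chordP x; exists t0; have b := beP; have be0 : 0 < be by lra.
have mk : measurable_fun setT (fun t => kern be x (f1 t, f2 t) * g t).
  by apply: measurable_funM; [exact: kern_meas|exact: cont_meas].
split; last by rewrite /pot (int_shift01 t0)// => t; rewrite kern_per pg.
apply: (@integrable_dom R _ _ (fun t => G * c0 `^ (- be) * kap be t)) => //.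
- have ms : measurable_fun setT (fun t : R => t + t0) by exact: measurable_funD.
  exact: (measurableT_comp mk ms).
- by apply: intZ => //; exact: kap_oint.
- move=> t; rewrite /= in_itv/= => ht; have [_ h] := kern_chord be0 ht0 ht.
  rewrite normrM ger0_norm ?powR_ge0// mulrC -mulrA; apply: ler_pM => //; exact: powR_ge0.
Qed.

Lemma kern_integrable g (G : R) x : continuous g -> (forall t, `|g t| <= G) ->
  (forall t, g (t + 2 * pi) = g t) ->
  mu.-integrable `[0, 2 * pi] (EFin \o (fun t => kern be x (f1 t, f2 t) * g t)).
Proof.
move=> cg gG pg; have [t0 [h _]] := pot_integrable x cg gG pg.
have mk : measurable_fun setT (fun t => kern be x (f1 t, f2 t) * g t).
  by apply: measurable_funM; [exact: kern_meas|exact: cont_meas].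
have mk' : measurable_fun setT (EFin \o (fun t => kern be x (f1 t, f2 t) * g t)) by exact/measurable_EFinP.
have mE := measurableT_comp (@abse_measurable R setT) mk'.
apply/integrableP; split; first exact: measurable_funTS mk'.
rewrite -(@int_period_shift _ (fun t => `|(kern be x (f1 t, f2 t) * g t)%:E|%E) t0) //; last first.
  by move=> t; rewrite (kern_per be x) pg.
rewrite integral_itv_bndoo; first by case/integrableP: h.
by apply: measurable_funTS; apply: measurableT_comp mE _; exact: measurable_funD.
Qed.

Lemma potd_close g (G : R) : continuous g -> (forall t, `|g t| <= G) ->
  (forall t, g (t + 2 * pi) = g t) ->
  forall x de, 0 < de -> `|pot g x - potd g de x| <= G * cst * (de ^+ 2) `^ ge.
Proof.
move=> cg gG pg x de d0; have [t0 ht0] := chordP x.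
have [ge1 be1 bge] := ge_prop.
have mk : measurable_fun setT (fun t => kern be x (f1 t, f2 t) * g t).
  by apply: measurable_funM; [exact: kern_meas|exact: cont_meas].
have ck : continuous (fun t => kernd be de x (f1 t, f2 t) * g t).
  by apply: contM => //; apply: (cont_kernd (x := fun _ => x)) => //; exact: contK.
have md := cont_meas ck.
have ms : measurable_fun setT (fun t : R => t + t0) by exact: measurable_funD.
have be0 : 0 < be by have b := beP; lra.
have bg0 : 0 < be + ge by case/andP: bge.
rewrite /pot /potd (int_shift01 t0 mk)//; last by move=> t; rewrite kern_per pg.
rewrite (int_shift01 t0 md)//; last by move=> t; rewrite (p_f1P hP) (p_f2P hP) pg.
have i1 : mu.-integrable `]0, 2 * pi[ (EFin \o (fun t => kern be x (f1 (t + t0), f2 (t + t0)) * g (t + t0))).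
  apply: (@integrable_dom R _ _ (fun t => G * c0 `^ (- be) * kap be t)) => //.
  - exact: (measurableT_comp mk ms).
  - by apply: intZ => //; exact: kap_oint.
  - move=> t; rewrite /= in_itv/= => ht; have [_ h] := kern_chord be0 ht0 ht.
    rewrite normrM ger0_norm ?powR_ge0// mulrC -mulrA; apply: ler_pM => //; exact: powR_ge0.
have i2 : mu.-integrable `]0, 2 * pi[ (EFin \o (fun t => kernd be de x (f1 (t + t0), f2 (t + t0)) * g (t + t0))).
  apply: integrableS (Rint_cont 0 (2 * pi) _) => //; first exact: subset_itvW.
  by apply: (contC _ ck); apply: contD => t; [exact: cvg_id|exact: cvg_cst].
rewrite -RintegralB//.
have G0 : 0 <= G := le_trans (normr_ge0 _) (gG 0).
have i3 := integrableB _ i1 i2.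
apply: le_trans (le_normr_Rintegral _ (i3 _)) _ => //.
rewrite [leRHS](_ : _ = \int[mu]_(t in `]0, 2 * pi[) (G * c0 `^ (- (be + ge)) * (de ^+ 2) `^ ge * kap (be + ge) t)); last first.
  by rewrite RintegralZl//; [rewrite /cst; ring|exact: kap_oint].
apply: le_Rintegral => //.
- by apply: integrable_norm => //; exact: i3.
- by apply: intZ => //; exact: kap_oint.
- move=> t; rewrite /= in_itv/= => ht; have [D0 h] := kern_chord bg0 ht0 ht.
  rewrite -mulrBl normrM; apply: le_trans (ler_pM _ _ (kernd_close de be1 ge1 D0) (gG _)) _ => //.
  have -> : G * c0 `^ (- (be + ge)) * (de ^+ 2) `^ ge * kap (be + ge) t =
    (de ^+ 2) `^ ge * (c0 `^ (- (be + ge)) * kap (be + ge) t) * G by ring.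
  by rewrite ler_wpM2r// ler_wpM2l ?powR_ge0.
Qed.

Let cst_ge0 : 0 <= cst.
Proof. by rewrite mulr_ge0 ?powR_ge0//; apply: Rintegral_ge0 => t _; exact: kap_ge0. Qed.

Lemma potd_unif g (G : R) : continuous g -> (forall t, `|g t| <= G) ->
  (forall t, g (t + 2 * pi) = g t) ->
  forall e, 0 < e -> exists2 d0, 0 < d0 & forall x de, 0 < de <= d0 -> `|pot g x - potd g de x| <= e.
Proof.
move=> cg gG pg e e0; have G0 : 0 <= G := le_trans (normr_ge0 _) (gG 0).
have [/andP[gg0 _] _ _] := ge_prop; set K := G * cst.
have K0 : 0 <= K by rewrite mulr_ge0.
pose y := e / (K + 1); have y0 : 0 < y by rewrite divr_gt0// ltr_wpDl.
exists (y `^ ((2 * ge)^-1)); first exact: powR_gt0.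
move=> x de /andP[d0 dy]; apply: le_trans (potd_close cg gG pg x d0) _.
have h : (de ^+ 2) `^ ge <= y.
  have dl := ler_powR2 (mulr_ge0 (ler0n R 2) (ltW gg0)) (ltW d0) dy.
  have e1 : (de ^+ 2) `^ ge = de `^ (2 * ge).
    by rewrite -[2 * ge]/(2%:R * ge) powRrM powR_mulrn ?ltW.
  by rewrite e1; apply: le_trans dl _; rewrite -powRrM mulVf ?powRr1 ?(ltW y0)// mulf_neq0 ?gt_eqF.
apply: le_trans (ler_wpM2l K0 h) _; rewrite /y mulrCA ler_piMr ?(ltW e0)//.
by rewrite ler_pdivrMr ?mul1r ?lerDl// ltr_wpDl.
Qed.

Lemma potd_lip g (G : R) : continuous g -> (forall t, `|g t| <= G) ->
  forall de x h, 0 < de -> `|potd g de (x.1 + h.1, x.2 + h.2) - potd g de x| <=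
    2 * pi * (be * (de ^+ 2) `^ (- be) / de * G) * (`|h.1| + `|h.2|).
Proof.
move=> cg gG de x h d0; have be0 : 0 < be by have b := beP; lra.
have ck x' : continuous (fun t => kernd be de x' (f1 t, f2 t) * g t).
  by apply: contM => //; apply: (cont_kernd (x := fun _ => x')) => //; exact: contK.
rewrite /potd /oint -RintegralB//; [|exact: Rint_cont..].
have i3 := integrableB _ (Rint_cont 0 (2 * pi) (ck (x.1 + h.1, x.2 + h.2))) (Rint_cont 0 (2 * pi) (ck x)).
apply: le_trans (le_normr_Rintegral _ (i3 _)) _ => //.
rewrite -mulrA -int_cst; apply: le_Rintegral => //.
- by apply: integrable_norm => //; exact: i3.
- by apply: Rint_cont; exact: contK.
- move=> t _; rewrite -mulrBl normrM mulrAC; apply: ler_pM => //; exact: kernd_lip.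
Qed.

(** A uniform limit of the Lipschitz functions [potd]. The uniformity, on and off the curve, comes
    from [chordP]. *)
Lemma pot_cont g (G : R) : continuous g -> (forall t, `|g t| <= G) ->
  (forall t, g (t + 2 * pi) = g t) -> continuous (pot g).
Proof.
move=> cg gG pg x; apply/cvgrPdist_le => e e0.
have e3 : 0 < e / 3 by rewrite divr_gt0.
have [de d0 hd] := potd_unif cg gG pg e3.
have hd' x' := hd x' de; rewrite d0 lexx in hd'.
set L := 2 * pi * (be * (de ^+ 2) `^ (- be) / de * G).
have L0 : 0 <= L.
  have b : 0 <= be by have b := beP; lra.
  by rewrite !mulr_ge0 ?powR_ge0 ?invr_ge0 ?pi_ge0 ?(ltW d0)// (le_trans (normr_ge0 _) (gG 0)).
pose r := e / 3 / (2 * L + 1); have r0 : 0 < r by rewrite divr_gt0// ltr_wpDl// mulr_ge0.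
near=> y.
have n1 : `|x.1 - y.1| <= r.
  by near: y; move/cvgrPdist_le : (@cont1 R R x) => /(_ r r0).
have n2 : `|x.2 - y.2| <= r.
  by near: y; move/cvgrPdist_le : (@cont2 R R x) => /(_ r r0).
have hl := potd_lip cg gG x (y.1 - x.1, y.2 - x.2) d0.
have e1 (a b : R) : a + (b - a) = b by ring.
rewrite /= !e1 -surjective_pairing -/L [`|y.1 - x.1|]distrC [`|y.2 - x.2|]distrC in hl.
have h3 : L * (`|x.1 - y.1| + `|x.2 - y.2|) <= e / 3.
  apply: le_trans (ler_wpM2l L0 (lerD n1 n2)) _.
  have -> : L * (r + r) = e / 3 * (2 * L / (2 * L + 1)) by rewrite /r; ring.
  by rewrite ler_piMr ?(ltW e3)// ler_pdivrMr ?mul1r ?lerDl// ltr_wpDl// mulr_ge0.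
have := hd' x isT; have := hd' y isT; have := le_trans hl h3.
move: (pot g x) (pot g y) (potd g de x) (potd g de y) => a b c d; rewrite !ler_norml; lra.
Unshelve. all: by end_near. Qed.

End BoundaryPotential.

(** * Stream function and weak formulation *)

Section JointContinuity3.
Context {R : realType}.

Lemma cont_meas3 (H : R * (R * R) -> R) : continuous H -> measurable_fun setT H.
Proof.
move=> hH; have -> : H = fun q => (fun x y => H (x, y)) q.1 q.2 by apply/funext => -[x y].
apply: (@measurable_caratheodory R _ _ (fun x y => H (x, y))) => [y|x].
  by apply: (contC (f := fun x : R => (x, y)) _ hH); apply: contP; [exact: contI|exact: contK].
by apply: cont_meas2; apply: (contC (f := fun y : R * R => (x, y)) _ hH); apply: contP; [exact: contK|exact: contI].
Qed.

Lemma cont_box3 (H : R * (R * R) -> R) (a b M : R) : continuous H -> exists2 K, 0 <= K &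
  forall t x y, a <= t <= b -> `|x| <= M -> `|y| <= M -> `|H (t, (x, y))| <= K.
Proof.
move=> hH; have : bounded_set (H @` (`[a, b]%classic `*` (`[- M, M]%classic `*` `[- M, M]%classic))).
  apply: compact_bounded; apply: continuous_compact; first exact: continuous_subspaceT.
  by apply: compact_setX; [exact: segment_compact|apply: compact_setX; exact: segment_compact].
move=> /pinfty_ex_gt0[K K0 hK]; exists K; first exact: ltW.
move=> t x y ht hx hy; apply: hK; exists (t, (x, y)) => //=.
by split; [|split]; rewrite /= in_itv//= -ler_norml.
Qed.

End JointContinuity3.

(** * The area potential as a limit of regularized ones *)

Section AreaPotential.
Context {R : realType}.
Notation mu := (@lebesgue_measure R).
Notation mu2 := (mu \x mu)%E.
Variables (f1 f2 g1 g2 : R -> R) (D : set (R * R)).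
Hypothesis hP : patch f1 f2 g1 g2 D.
Variables (c0 be : R).
Hypothesis beP : 0 < be < 2^-1.
Hypothesis c0_gt0 : 0 < c0.
Hypothesis chordP : forall x, exists t0, forall t, c0 * chord2 (t - t0) <= dist2 x (f1 t, f2 t).

Let cf1 : continuous f1 := dcontT (p_df1 hP).
Let cf2 : continuous f2 := dcontT (p_df2 hP).
Let cf : continuous (fun t => (f1 t, f2 t)) := contP cf1 cf2.
Let cg1 := p_cg1 hP. Let cg2 := p_cg2 hP.
Let mD := p_mD hP.
Let be0 : 0 < be. Proof. by have b := beP; lra. Qed.
Notation V1 := (pot f1 f2 be g1). Notation V2 := (pot f1 f2 be g2).
Notation V1d := (potd f1 f2 be g1). Notation V2d := (potd f1 f2 be g2).
Notation intD := (fun F : R * R -> R => \int[mu2]_(y in D) F y).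

Definition psi x : R := \int[mu2]_(y in D) kern be x y.
Definition psid de x : R := \int[mu2]_(y in D) kernd be de x y.

Let cont_kd de x : 0 < de -> continuous (fun y => kernd be de x y).
Proof. by move=> d0; apply: (cont_kernd (x := fun _ => x)) => //; [exact: contK|exact: contI]. Qed.

Let GB : exists G : R, forall t, `|g1 t| <= G /\ `|g2 t| <= G. Proof. exact: p_gb hP. Qed.

(** For u >= 1 the kernel is at most 1; for u < 1 it is at most u^(-1/2) <= 1 / |z|, as be < 1/2. *)
Let kernd_mul_le de x y : 0 < de ->
  kernd be de x y * `|x.1 - y.1| <= 1 + `|x.1 - y.1| /\ kernd be de x y * `|x.2 - y.2| <= 1 + `|x.2 - y.2|.
Proof.
move=> d0; rewrite /kernd; set u := dist2 x y + de ^+ 2.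
have u0 : 0 < u := dist2d_gt0 x y d0.
have key (z : R) : z ^+ 2 <= u -> u `^ (- be) * `|z| <= 1 + `|z|.
  move=> zu; have [u1|u1] := leP 1 u.
    apply: ler_wpDl => //; apply: ler_piMl => //.
    have := ler_powR u1 (_ : - be <= 0); rewrite powRr0; apply; rewrite oppr_le0 ltW//.
  apply: ler_wpDr => //.
  have h1 : u `^ (- be) <= u `^ (- 2^-1).
    by apply: ger_powR; rewrite ?u0 ?(ltW u1)// lerN2; have b := beP; lra.
  apply: le_trans (ler_wpM2r (normr_ge0 z) h1) _.
  rewrite powRN powR12_sqrt ?(ltW u0)// ler_pdivrMl ?sqrtr_gt0// mulr1.
  by rewrite -sqrtr_sqr ler_wsqrtr.
by split; apply: key; rewrite /u /dist2 -addrA ?lerDl ?addr_ge0 ?sqr_ge0// addrCA lerDl addr_ge0 ?sqr_ge0.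
Qed.

Let C1_kd de x : 0 < de -> C1fun (fun y => kernd be de x y)
  (fun y => kernd' be de y x * (y.1 - x.1)) (fun y => kernd' be de y x * (y.2 - x.2)).
Proof.
move=> d0; have -> : (fun y => kernd be de x y) = fun y => kernd be de y x.
  by apply/funext => y; exact: kerndC.
exact: C1_kernd.
Qed.

(** Green's formula for the field kernd (y - x): its divergence is 2 kernd (1 - be D / (D + de^2))
    >= kernd, while its boundary values stay bounded as de goes to 0. Integrability of the singular
    kernel over D follows, for x in D as well. *)
Lemma psid_bound x : exists K, forall de, 0 < de -> psid de x <= K.
Proof.
have [G hG] := GB; have G0 : 0 <= G by have [h _] := hG 0; exact: le_trans (normr_ge0 _) h.
exists (oint (fun t => (1 + `|x.1 - f1 t|) * G + (1 + `|x.2 - f2 t|) * G)) => de d0.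
have hF := C1M (C1_kd x d0) (C1B_cst x.1 (@C1_fst R)).
have hH := C1M (C1_kd x d0) (C1B_cst x.2 (@C1_snd R)).
have [_ cF1 _ _] := hF; have [_ _ cH2 _] := hH.
have e1 := green_x hP hF; have e2 := green_y hP hH.
apply: le_trans (_ : _ <= oint (fun t => kernd be de x (f1 t, f2 t) * (f1 t - x.1) * g2 t) -
   oint (fun t => kernd be de x (f1 t, f2 t) * (f2 t - x.2) * g1 t)) _.
  rewrite -e1 -e2 -RintegralD//; [|exact: (patch_int hP)..].
  have i1 := patch_int hP (@cont_kd de x d0).
  have i2 := patch_int hP (contD cF1 cH2).
  rewrite /psid; apply: le_Rintegral; [exact: mD|exact: i1|exact: i2|move=> y _; rewrite !mulr1].
  have D0 := dist2d_gt0 x y d0.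
  have -> : kernd' be de y x * (y.1 - x.1) * (y.1 - x.1) + kernd be de x y +
     (kernd' be de y x * (y.2 - x.2) * (y.2 - x.2) + kernd be de x y) =
     2 * kernd be de x y + kernd' be de y x * dist2 x y by rewrite /dist2; ring.
  have -> : kernd' be de y x * dist2 x y = - (2 * be * kernd be de x y * (dist2 x y / (dist2 x y + de ^+ 2))).
    rewrite /kernd' /kernd [dist2 y x]dist2C powRD ?(gt_eqF D0) ?implybT// powR_inv1 ?(ltW D0)//; ring.
  have r1 : dist2 x y / (dist2 x y + de ^+ 2) <= 1 by rewrite ler_pdivrMr// mul1r lerDl sqr_ge0.
  have k0 := kernd_ge0 be de x y.
  have r2 : 2 * be * kernd be de x y * (dist2 x y / (dist2 x y + de ^+ 2)) <= 2 * be * kernd be de x y.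
    by rewrite ler_piMr// mulr_ge0// mulr_ge0// ltW.
  have r3 : 2 * be * kernd be de x y <= kernd be de x y by rewrite ler_piMl//; have b := beP; lra.
  by have r4 := le_trans r2 r3; rewrite [2 * kernd _ _ _ _]mulr_natl mulr2n -addrA lerDl subr_ge0.
have ck : continuous (fun t => kernd be de x (f1 t, f2 t)).
  by apply: (cont_kernd (x := fun _ => x)) => //; exact: contK.
have c1 (f : R -> R) z : continuous f -> continuous (fun t => f t - z).
  by move=> hf; apply: contB => //; exact: contK.
have ca (f : R -> R) z : continuous f -> continuous (fun t => (1 + `|z - f t|) * G).
  move=> hf; apply: contM; last exact: contK; apply: contD; first exact: contK.
  by move=> t; apply: cvg_norm; apply: cvgB; [exact: cvg_cst|exact: hf].
have cA : continuous (fun t => kernd be de x (f1 t, f2 t) * (f1 t - x.1) * g2 t).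
  by apply: contM => //; apply: contM => //; exact: c1.
have cB : continuous (fun t => kernd be de x (f1 t, f2 t) * (f2 t - x.2) * g1 t).
  by apply: contM => //; apply: contM => //; exact: c1.
rewrite /oint -RintegralB//; [|exact: Rint_cont..].
apply: le_Rintegral => //.
- by apply: Rint_cont; exact: contB.
- by apply: Rint_cont; apply: contD; exact: ca.
move=> t _; have [k1 k2] := kernd_mul_le x (f1 t, f2 t) d0; have [b1 b2] := hG t.
apply: le_trans (ler_norm _) _; apply: le_trans (ler_normB _ _) _; rewrite !normrM (ger0_norm (kernd_ge0 _ _ _ _)).
by apply: lerD; apply: ler_pM; rewrite ?mulr_ge0 ?kernd_ge0//; rewrite distrC.
Qed.

Lemma psid_cvg x : (fun n => psid n.+1%:R^-1 x) @ \oo --> psi x.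
Proof.
pose de n : R := n.+1%:R^-1; have d0 n : 0 < de n by rewrite invr_gt0.
(* The point x is removed because there [kern] is 0 by convention whereas [kernd] blows up;
   elsewhere the regularized kernels increase to [kern]. *)
pose D' := D `\` [set x].
have eX : [set x] = [set x.1] `*` [set x.2].
  by apply/seteqP; split => [y /= ->//|[y1 y2] [/= -> ->]]; rewrite -surjective_pairing.
have mx : measurable [set x].
  by rewrite eX; apply: measurableX; exact: measurable_set1.
have mD' : measurable D' by apply: measurableD.
have m0 : mu2 [set x] = 0%E.
  rewrite eX product_measure1E; [|exact: measurable_set1..].
  by rewrite [X in (X * _)%E](_ : _ = 0%E) ?mul0e//; exact: lebesgue_measure_set1.
have mk : measurable_fun setT (fun y => kern be x y).
  apply: (measurableT_comp (measurable_powR (- be))); apply: cont_meas2.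
  by apply: (cont_dist2 (x := fun _ => x)); [exact: contK|exact: contI].
have md n : measurable_fun setT (fun y => kernd be (de n) x y) by apply: cont_meas2; exact: cont_kd.
have e1 : (\int[mu2]_(y in D) (kern be x y)%:E = \int[mu2]_(y in D') (kern be x y)%:E)%E.
  apply: ge0_negligible_integral => //.
  - by apply: measurable_funTS; exact/measurable_EFinP.
  - by move=> y _; rewrite lee_fin powR_ge0.
have e2 n : (\int[mu2]_(y in D) (kernd be (de n) x y)%:E = \int[mu2]_(y in D') (kernd be (de n) x y)%:E)%E.
  apply: ge0_negligible_integral => //.
  - by apply/measurable_EFinP; apply: measurable_funTS; exact: md.
  - by move=> y _; rewrite lee_fin powR_ge0.
have D0 y : D' y -> 0 < dist2 x y.
  move=> [_ /= yx]; rewrite lt_def dist2_ge0 andbT; apply/negP => /eqP h; apply: yx.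
  have := h; rewrite /dist2 => /eqP; rewrite paddr_eq0 ?sqr_ge0// !sqrf_eq0 !subr_eq0 => /andP[/eqP a /eqP b].
  by rewrite [x]surjective_pairing [y]surjective_pairing a b.
have kc y : D' y -> (fun n => kernd be (de n) x y) @ \oo --> kern be x y.
  move=> /D0 hD; rewrite /kernd /kern.
  have cd : (fun n => dist2 x y + de n ^+ 2) @ \oo --> dist2 x y.
    rewrite -[X in _ --> X]addr0; apply: cvgD; first exact: cvg_cst.
    have h : de @ \oo --> (0 : R) by exact: cvg_harmonic.
    by rewrite -[X in _ --> X](mulr0 0); apply: (cvgM h h).
  have hd : hasD (fun u : R => u `^ (- be)) (dist2 x y) (- be * dist2 x y `^ (- be - 1) * 1).
    by apply: dpow; [exact: hD|exact: dI].
  by apply: (cvg_comp _ (fun u : R => u `^ (- be)) cd); exact: dcont hd.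
have mono : forall y, D' y -> {homo (fun n => (kernd be (de n) x y)%:E) : n m / (n <= m)%N >-> (n <= m)%E}.
  move=> y Dy n m nm; rewrite lee_fin /kernd !powRN lef_pV2 ?posrE ?powR_gt0 ?dist2d_gt0//.
  apply: ler_powR2; rewrite ?(ltW be0) ?(ltW (dist2d_gt0 x y (d0 m)))// lerD2l.
  by rewrite ler_sqr ?nnegrE ?(ltW (d0 _))// /de lef_pV2 ?posrE// ler_nat ltnS.
have mE n : measurable_fun D' (EFin \o (fun y => kernd be (de n) x y)).
  by apply/measurable_EFinP; apply: measurable_funTS; exact: md.
have := @cvg_monotone_convergence _ _ R mu2 D' mD' (fun n y => (kernd be (de n) x y)%:E)
  mE _ mono.
have -> : (\int[mu2]_(y in D') limn (fun n => (kernd be (de n) x y)%:E) = \int[mu2]_(y in D) (kern be x y)%:E)%E.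
  rewrite e1; apply: eq_integral => y; rewrite inE => /kc h.
  apply: cvg_lim => //; apply: cvg_EFin; last exact: h.
  by apply: nearW.
have ed n : (\int[mu2]_(y in D') (kernd be (de n) x y)%:E = (psid (de n) x)%:E)%E.
  by rewrite -e2 /psid /Rintegral fineK//; apply: integrable_fin_num => //; exact: (patch_int hP (@cont_kd (de n) x (d0 n))).
rewrite (_ : (fun n => _) = fun n => (psid (de n) x)%:E); last by apply/funext => n; exact: ed.
move=> /(_ (fun n y _ => powR_ge0 _ _)) hc.
have [K hK] := psid_bound x.
have fin : (\int[mu2]_(y in D) (kern be x y)%:E)%E \is a fin_num.
  rewrite ge0_fin_numE; last by apply: integral_ge0 => y _; rewrite lee_fin powR_ge0.
  apply: le_lt_trans (_ : _ <= K%:E)%E (ltry K).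
  have cvh : cvgn (fun n => (psid (de n) x)%:E) by apply/cvg_ex; eexists; exact: hc.
  rewrite -(cvg_lim _ hc)//; apply: lime_le => //.
  by apply: nearW => n; rewrite lee_fin hK.
rewrite -(fineK fin) in hc; exact: (fine_cvg hc).
Qed.

End AreaPotential.

Lemma Rint_diff_le d (T : measurableType d) (R : realType) (m : {measure set T -> \bar R}) (A : set T)
    (F G K : T -> R) (e : R) : measurable A -> m.-integrable A (EFin \o F) -> m.-integrable A (EFin \o G) ->
  m.-integrable A (EFin \o K) -> (forall x, A x -> `|F x - G x| <= e * K x) ->
  `|\int[m]_(x in A) F x - \int[m]_(x in A) G x| <= e * \int[m]_(x in A) K x.
Proof.
move=> mA iF iG iK h; rewrite -RintegralB// -RintegralZl//.
have i3 := integrableB mA iF iG.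
apply: le_trans (le_normr_Rintegral mA i3) _; apply: le_Rintegral => //.
  by apply: integrable_norm => //; exact: i3.
by have := integrableZl mA e iK; apply: eq_integrable => // x _; rewrite /= EFinM.
Qed.

Lemma dist_half (R : realType) (v w u e : R) : `|v - w| <= e / 2 -> `|v - u| <= e / 2 -> `|w - u| <= e.
Proof. by rewrite !ler_norml; lra. Qed.

(** * Gradient of the area potential and weak stationarity *)

Section WeakSteady.
Context {R : realType}.
Notation mu := (@lebesgue_measure R).
Notation mu2 := (mu \x mu)%E.
Variables (f1 f2 g1 g2 : R -> R) (D : set (R * R)).
Hypothesis hP : patch f1 f2 g1 g2 D.
Variables (c0 be : R).
Hypothesis beP : 0 < be < 2^-1.
Hypothesis c0_gt0 : 0 < c0.
Hypothesis chordP : forall x, exists t0, forall t, c0 * chord2 (t - t0) <= dist2 x (f1 t, f2 t).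

Let cf1 : continuous f1 := dcontT (p_df1 hP).
Let cf2 : continuous f2 := dcontT (p_df2 hP).
Let cf : continuous (fun t => (f1 t, f2 t)) := contP cf1 cf2.
Let cg1 := p_cg1 hP. Let cg2 := p_cg2 hP.
Let mD := p_mD hP.
Notation V1 := (pot f1 f2 be g1). Notation V2 := (pot f1 f2 be g2).
Notation V1d := (potd f1 f2 be g1). Notation V2d := (potd f1 f2 be g2).
Notation psi := (psi D be). Notation rpsi := (psid D be).

Let be0 : 0 < be. Proof. by have b := beP; lra. Qed.

Lemma patch_swap (H : R * (R * R) -> R) (a b : R) : continuous H ->
  [/\ mu.-integrable `[a, b] (EFin \o fun t => \int[mu2]_(y in D) H (t, y)),
      mu2.-integrable D (EFin \o fun y => \int[mu]_(t in `[a, b]) H (t, y)) &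
      \int[mu]_(t in `[a, b]) (\int[mu2]_(y in D) H (t, y)) =
      \int[mu2]_(y in D) (\int[mu]_(t in `[a, b]) H (t, y))].
Proof.
move=> hH; have [M M0 hM] := patch_bdd hP; have [K K0 hK] := cont_box3 a b M hH.
have hb t y : `[a, b]%classic t -> D y -> `|H (t, y)| <= K.
  by case: y => y1 y2; rewrite /= in_itv/= => ht /hM[]; exact: hK.
have mab : measurable `[a, b]%classic := measurable_itv `[a, b]%R.
have fab : (mu `[a, b]%classic < +oo)%E by rewrite lebesgue_measure_itv/=; case: ifP => _; exact: ltry.
have fD := patch_fin hP; have mH := cont_meas3 hH.
pose nu := sfprod mu mu.
split.
- exact: (fubini_int1 (m1 := mu) (m2 := nu) mab mD fab fD mH hb).
- have ms : measurable_fun setT (fun q : (R * R) * R => H (q.2, q.1)).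
    by apply: (measurableT_comp mH); apply: measurable_fun_pair; [exact: measurable_snd|exact: measurable_fst].
  exact: (fubini_int1 (m1 := nu) (m2 := mu) mD mab fD fab ms (fun y t hy ht => hb t y ht hy)).
- exact: (fubini_swap (m1 := mu) (m2 := nu) mab mD fab fD mH hb).
Qed.

Let pint (H : R * R -> R) : continuous H -> mu2.-integrable D (EFin \o H) := patch_int hP (H := H).

Let pintZ (c : R) (H : R * R -> R) : continuous H -> \int[mu2]_(y in D) (c * H y) = c * \int[mu2]_(y in D) H y.
Proof. by move=> hH; rewrite RintegralZl//; exact: pint. Qed.

Let pintD (H H' : R * R -> R) : continuous H -> continuous H' ->
  \int[mu2]_(y in D) (H y + H' y) = \int[mu2]_(y in D) H y + \int[mu2]_(y in D) H' y.
Proof. by move=> hH hH'; rewrite RintegralD//; exact: pint. Qed.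

Let C1_kd de x : 0 < de -> C1fun (fun y => kernd be de x y)
  (fun y => kernd' be de y x * (y.1 - x.1)) (fun y => kernd' be de y x * (y.2 - x.2)).
Proof.
move=> d0; have -> : (fun y => kernd be de x y) = fun y => kernd be de y x.
  by apply/funext => y; exact: kerndC.
exact: C1_kernd.
Qed.

(** The gradient is integrated along the segment. Differentiating in x is minus differentiating in
    y, and Green's formula turns the area integrals of the y-derivatives into [V2d] and - [V1d]. *)
Lemma psid_diff de x (h1 h2 : R) : 0 < de ->
  mu.-integrable `[0, 1] (EFin \o fun t => - h1 * V2d de (x.1 + t * h1, x.2 + t * h2) + h2 * V1d de (x.1 + t * h1, x.2 + t * h2)) /\
  rpsi de (x.1 + h1, x.2 + h2) - rpsi de x =
  \int[mu]_(t in `[0, 1]) (- h1 * V2d de (x.1 + t * h1, x.2 + t * h2) + h2 * V1d de (x.1 + t * h1, x.2 + t * h2)).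
Proof.
move=> d0; pose X t := (x.1 + t * h1, x.2 + t * h2).
pose A t (y : R * R) := kernd' be de y (X t) * (y.1 - (X t).1).
pose B t (y : R * R) := kernd' be de y (X t) * (y.2 - (X t).2).
have cX1 : continuous (fun t => (X t).1).
  by apply: contD; [exact: contK|apply: contM; [exact: contI|exact: contK]].
have cX2 : continuous (fun t => (X t).2).
  by apply: contD; [exact: contK|apply: contM; [exact: contI|exact: contK]].
have cX := contP cX1 cX2.
have c1 := @cont1 R (R * R)%type; have c2 := @cont2 R (R * R)%type.
have cA : continuous (fun q : R * (R * R) => A q.1 q.2).
  rewrite /A; apply: contM.
    by apply: (cont_kernd' (x := fun q : R * (R * R) => q.2) (y := fun q => X q.1)) => //; exact: (contC c1 cX).
  by apply: contB; [exact: (contC c2 (@cont1 _ _))|exact: (contC c1 cX1)].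
have cB : continuous (fun q : R * (R * R) => B q.1 q.2).
  rewrite /B; apply: contM.
    by apply: (cont_kernd' (x := fun q : R * (R * R) => q.2) (y := fun q => X q.1)) => //; exact: (contC c1 cX).
  by apply: contB; [exact: (contC c2 (@cont2 _ _))|exact: (contC c1 cX2)].
have cH : continuous (fun q : R * (R * R) => - h1 * A q.1 q.2 + - h2 * B q.1 q.2).
  by apply: contD; (apply: contM; [exact: contK|]).
have cs (t : R) : continuous (fun y : R * R => (t, y)) by apply: contP; [exact: contK|exact: contI].
have inner t : \int[mu2]_(y in D) (- h1 * A t y + - h2 * B t y) = - h1 * V2d de (X t) + h2 * V1d de (X t).
  have cAt : continuous (A t) := contC (cs t) cA.
  have cBt : continuous (B t) := contC (cs t) cB.
  rewrite pintD; [|by apply: contM => //; exact: contK..].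
  rewrite !pintZ// (green_x hP (C1_kd (X t) d0)) (green_y hP (C1_kd (X t) d0)) mulrNN.
  by rewrite /potd.
have [i1 _ e1] := patch_swap 0 1 cH.
have ei : (fun t => \int[mu2]_(y in D) (- h1 * A t y + - h2 * B t y)) =
  (fun t => - h1 * V2d de (X t) + h2 * V1d de (X t)) by apply/funext.
rewrite /= ei in i1 e1; split; first exact: i1.
apply: etrans (esym e1).
have ck z : continuous (fun y => kernd be de z y) by have [] := C1_kd z d0.
rewrite /psid -RintegralB//; [|exact: pint..].
apply: eq_Rintegral => y _.
have cHy : continuous (fun t => - h1 * A t y + - h2 * B t y).
  by apply: (contC (f := fun t : R => (t, y)) _ cH); apply: contP; [exact: contI|exact: contK].
rewrite (Rftc (F := fun t => kernd be de (X t) y) _ _ cHy)//.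
  by rewrite /X !mul1r !mul0r !addr0 -surjective_pairing.
move=> t; apply: deq.
  have dX (a h : R) : hasD (fun s : R => a + s * h) t h.
    apply: deq; first by apply: dD; [exact: dC|apply: dM; [exact: dI|exact: dC]].
    by rewrite /=; ring.
  have := @dkernd R be de _ _ (fun _ => y.1) (fun _ => y.2) _ _ _ _ t d0 (dX x.1 h1) (dX x.2 h2) (dC _ _) (dC _ _).
  by rewrite -surjective_pairing; apply.
rewrite /A /B -[(x.1 + t * h1, x.2 + t * h2)]/(X t) /kernd' [dist2 y _]dist2C /=; ring.
Qed.

Lemma cont_ball (F : R * R -> R) x (e : R) : continuous F -> 0 < e -> exists2 d, 0 < d &
  forall y1 y2, `|y1 - x.1| < d -> `|y2 - x.2| < d -> `|F (y1, y2) - F x| <= e.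
Proof.
move=> /(_ x) /cvgrPdist_le h e0; have /nbhs_ballP[d /= d0 hd] := h e e0.
exists d => // y1 y2 h1 h2; rewrite distrC; apply: (hd (y1, y2)).
by split; rewrite /= /ball/= distrC.
Qed.

Let G : R := projT1 (cid (p_gb hP)).
Let G1 t : `|g1 t| <= G. Proof. by have [] := projT2 (cid (p_gb hP)) t. Qed.
Let G2 t : `|g2 t| <= G. Proof. by have [] := projT2 (cid (p_gb hP)) t. Qed.

Let cV1 : continuous V1.
Proof. exact: (pot_cont hP beP c0_gt0 chordP cg1 G1 (p_g1P hP)). Qed.
Let cV2 : continuous V2.
Proof. exact: (pot_cont hP beP c0_gt0 chordP cg2 G2 (p_g2P hP)). Qed.

Lemma Vd_unif (e : R) : 0 < e -> exists2 d0, 0 < d0 & forall x de, 0 < de <= d0 ->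
  `|V1 x - V1d de x| <= e /\ `|V2 x - V2d de x| <= e.
Proof.
move=> e0.
have [a a0 ha] := potd_unif hP beP c0_gt0 chordP cg1 G1 (p_g1P hP) e0.
have [b b0 hb] := potd_unif hP beP c0_gt0 chordP cg2 G2 (p_g2P hP) e0.
exists (Num.min a b); first by rewrite lt_min a0.
by move=> x de; rewrite le_min => /and3P[d0 da db]; split; [apply: ha|apply: hb]; rewrite d0.
Qed.

(** The gradient of [psi] is (- V2, V1). The radius d depends only on the continuity of V1 and V2 at
    x, so the expansion of the regularized potentials passes to the limit. *)
Lemma psi_expand x (e : R) : 0 < e -> exists2 d, 0 < d & forall h1 h2, `|h1| < d -> `|h2| < d ->
  `|psi (x.1 + h1, x.2 + h2) - psi x - (- h1 * V2 x + h2 * V1 x)| <= e * (`|h1| + `|h2|).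
Proof.
move=> e0; have e2 : 0 < e / 2 by rewrite divr_gt0.
have [d0 d00 hd0] := Vd_unif e2.
have [r1 r10 hr1] := cont_ball x cV1 e2; have [r2 r20 hr2] := cont_ball x cV2 e2.
exists (Num.min r1 r2); first by rewrite lt_min r10.
move=> h1 h2; rewrite !lt_min => /andP[a1 a2] /andP[b1 b2].
set c := (X in _ - X); set S := e * _.
pose u n := rpsi n.+1%:R^-1 (x.1 + h1, x.2 + h2) - rpsi n.+1%:R^-1 x - c.
have cu : u @ \oo --> psi (x.1 + h1, x.2 + h2) - psi x - c.
  apply: cvgB; last exact: cvg_cst.
  by apply: cvgB; exact: (psid_cvg hP beP).
apply: (cvgr_to_le (cvg_norm cu)).
have hh : (fun n : nat => n.+1%:R^-1 : R) @ \oo --> (0 : R) by exact: cvg_harmonic.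
move/cvgrPdist_le : hh => /(_ d0 d00); apply: filterS => n.
rewrite sub0r normrN ger0_norm ?invr_ge0// => nd.
have dn : 0 < (n.+1%:R^-1 : R) <= d0 by rewrite nd invr_gt0 ltr0n.
have /andP[dn0 _] := dn.
rewrite /u; have [i1 ->] := psid_diff x h1 h2 dn0.
have ic : mu.-integrable `[0, 1] (EFin \o fun _ : R => c) by apply: Rint_cont; exact: contK.
have iS : mu.-integrable `[0, 1] (EFin \o fun _ : R => `|h1| + `|h2|) by apply: Rint_cont; exact: contK.
have i01 (z : R) : \int[mu]_(t in `[0, 1]) z = z.
  by rewrite Rintegral_cst//= lebesgue_measure_itv/= lte_fin ltr01 -EFinD /= subr0 mulr1.
rewrite -(i01 c) /S -[X in e * X]i01; apply: Rint_diff_le; [exact: measurable_itv|exact: i1|exact: ic|exact: iS|move=> t].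
rewrite /= in_itv/= => /andP[t0 t1].
have th (h r : R) : `|h| < r -> `|t * h| < r.
  by move=> hr; rewrite normrM (ger0_norm t0); apply: le_lt_trans hr; exact: ler_piMl.
have q y z r (_ : `|t * z| < r) : `|y + t * z - y| < r by rewrite addrC addKr.
have [u1 u2] := hd0 (x.1 + t * h1, x.2 + t * h2) _ dn.
have w1 := hr1 (x.1 + t * h1) (x.2 + t * h2) (q _ _ _ (th _ _ a1)) (q _ _ _ (th _ _ b1)).
have w2 := hr2 (x.1 + t * h1) (x.2 + t * h2) (q _ _ _ (th _ _ a2)) (q _ _ _ (th _ _ b2)).
rewrite /c.
have := dist_half u1 w1; have := dist_half u2 w2.
move: (V1d _ _) (V2d _ _) (V1 x) (V2 x) => p q' r s z1 z2.
have -> : - h1 * q' + h2 * p - (- h1 * s + h2 * r) = h2 * (p - r) - h1 * (q' - s) by ring.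
apply: le_trans (ler_normB _ _) _; rewrite !normrM mulrDr addrC [e * `|h1|]mulrC [e * `|h2|]mulrC.
by apply: lerD; apply: ler_wpM2l.
Qed.

Section Weak.
Variables (ch ch1 ch2 : R * R -> R).
Hypothesis hch : C1fun ch ch1 ch2.

Let cch : continuous ch. Proof. by have [] := hch. Qed.
Let cch1 : continuous ch1. Proof. by have [] := hch. Qed.
Let cch2 : continuous ch2. Proof. by have [] := hch. Qed.

Let oint_swap (K : R * R -> R) : continuous K ->
  mu.-integrable `[0, 2 * pi] (EFin \o fun t => oint (fun e => K (e, t))) /\
  oint (fun e => oint (fun t => K (e, t))) = oint (fun t => oint (fun e => K (e, t))).
Proof.
move=> hK; have [L L0 hL] := cont_box 0 (2 * pi) 0 (2 * pi) hK.
have hb t y : `[0, 2 * pi]%classic t -> `[0, 2 * pi]%classic y -> `|K (t, y)| <= L.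
  by rewrite /= !in_itv/=; exact: hL.
have mab : measurable `[0, 2 * pi : R]%classic := measurable_itv `[0, 2 * pi]%R.
have fab : (mu `[0%R, (2 * pi)%R]%classic < +oo)%E by rewrite lebesgue_measure_itv/=; case: ifP => _; exact: ltry.
have mK := cont_meas2 hK; split; last exact: (fubini_swap (m1 := mu) (m2 := mu) mab mab fab fab mK hb).
have ms : measurable_fun setT (fun q : R * R => K (q.2, q.1)).
  by apply: (measurableT_comp mK); apply: measurable_fun_pair; [exact: measurable_snd|exact: measurable_fst].
exact: (fubini_int1 (m1 := mu) (m2 := mu) mab mab fab fab ms (fun y t hy ht => hb t y ht hy)).
Qed.

Let intoZ (c : R) (F : R -> R) : continuous F -> oint (fun t => c * F t) = c * oint F.
Proof. by move=> hF; rewrite /oint RintegralZl//; exact: Rint_cont. Qed.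

Let intoD (F F' : R -> R) : continuous F -> continuous F' -> oint (fun t => F t + F' t) = oint F + oint F'.
Proof. by move=> hF hF'; rewrite /oint RintegralD//; exact: Rint_cont. Qed.

Let flux de x t : R := kernd' be de x (f1 t, f2 t) * ((x.1 - f1 t) * g1 t + (x.2 - f2 t) * g2 t).

(** [flux] is the derivative of - kernd along the closed curve; its zero integral says that the
    regularized velocity is divergence free. *)
Let oint_flux de x : 0 < de -> continuous (flux de x) /\ oint (flux de x) = 0.
Proof.
move=> d0; have cx (z : R) (f : R -> R) : continuous f -> continuous (fun t => z - f t).
  by move=> hf; apply: contB => //; exact: contK.
have cfl : continuous (flux de x).
  apply: contM; first by apply: (cont_kernd' (x := fun _ => x)) => //; exact: contK.
  by apply: contD; apply: contM => //; exact: cx.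
split=> //; rewrite /oint (Rftc (F := fun t => - kernd be de x (f1 t, f2 t)) _ _ cfl).
- by rewrite -[2 * pi]add0r (p_f1P hP) (p_f2P hP) subrr.
- by rewrite mulr_ge0// pi_ge0.
move=> t; apply: deq.
  have := @dkernd R be de (fun _ => x.1) (fun _ => x.2) _ _ _ _ _ _ t d0 (dC _ _) (dC _ _) (p_df1 hP t) (p_df2 hP t).
  by rewrite -surjective_pairing => h; apply: dN; exact: h.
by rewrite /flux; ring.
Qed.

(** For each boundary point apply Green's formula to ch times the kernel centred there, weighted by
    the tangent, then integrate over that point. In one order the flux term disappears, in the other
    a double boundary integral is left. *)
Lemma weak_vel_reg de : 0 < de ->
  [/\ mu2.-integrable D (EFin \o fun x => V1d de x * ch1 x + V2d de x * ch2 x),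
   mu.-integrable `[0, 2 * pi] (EFin \o fun t => ch (f1 t, f2 t) *
     (V1d de (f1 t, f2 t) * g2 t - V2d de (f1 t, f2 t) * g1 t)) &
  \int[mu2]_(x in D) (V1d de x * ch1 x + V2d de x * ch2 x) =
    oint (fun t => ch (f1 t, f2 t) * (V1d de (f1 t, f2 t) * g2 t - V2d de (f1 t, f2 t) * g1 t))].
Proof.
move=> d0; pose f t := (f1 t, f2 t); have cf' : continuous f := cf.
pose W1 t x := kernd' be de x (f t) * (x.1 - (f t).1) * ch x + kernd be de x (f t) * ch1 x.
pose W2 t x := kernd' be de x (f t) * (x.2 - (f t).2) * ch x + kernd be de x (f t) * ch2 x.
have hW t : C1fun (fun x => kernd be de x (f t) * ch x) (W1 t) (W2 t) := C1M (C1_kernd be (f t) d0) hch.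
have c1 := @cont1 R (R * R)%type; have c2 := @cont2 R (R * R)%type.
have ck' : continuous (fun q : R * (R * R) => kernd' be de q.2 (f q.1)).
  by apply: (cont_kernd' (x := fun q : R * (R * R) => q.2) (y := fun q => f q.1)) => //; exact: (contC c1 cf').
have ck : continuous (fun q : R * (R * R) => kernd be de q.2 (f q.1)).
  by apply: (cont_kernd (x := fun q : R * (R * R) => q.2) (y := fun q => f q.1)) => //; exact: (contC c1 cf').
have cW1 : continuous (fun q : R * (R * R) => W1 q.1 q.2).
  apply: contD; last by apply: contM => //; exact: (contC c2 cch1).
  apply: contM; last exact: (contC c2 cch); apply: contM => //.
  by apply: contB; [exact: (contC c2 (@cont1 _ _))|exact: (contC c1 cf1)].
have cW2 : continuous (fun q : R * (R * R) => W2 q.1 q.2).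
  apply: contD; last by apply: contM => //; exact: (contC c2 cch2).
  apply: contM; last exact: (contC c2 cch); apply: contM => //.
  by apply: contB; [exact: (contC c2 (@cont2 _ _))|exact: (contC c1 cf2)].
pose H (q : R * (R * R)) := g1 q.1 * W1 q.1 q.2 + g2 q.1 * W2 q.1 q.2.
have cH : continuous H.
  by apply: contD; apply: contM => //; [exact: (contC c1 cg1)|exact: (contC c1 cg2)].
have [_ i2 eH] := patch_swap 0 (2 * pi) cH.
pose K (q : R * R) := kernd be de (f q.2) (f q.1) * ch (f q.2) * (g1 q.1 * g2 q.2 - g2 q.1 * g1 q.2).
have e1 := @cont1 R R; have e2 := @cont2 R R.
have cK : continuous K.
  apply: contM.
    apply: contM; last by apply: (contC (f := fun q : R * R => f q.2) (g := ch)) => //; exact: (contC e2 cf').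
    by apply: (cont_kernd (x := fun q : R * R => f q.2) (y := fun q => f q.1)) => //; [exact: (contC e2 cf')|exact: (contC e1 cf')].
  by apply: contB; apply: contM; solve [exact: (contC e1 cg1)|exact: (contC e1 cg2)|exact: (contC e2 cg1)|exact: (contC e2 cg2)].
have [i3 eK] := oint_swap cK.
have kft x : continuous (fun t => kernd be de x (f t)) by apply: (cont_kernd (x := fun _ => x)) => //; exact: contK.
have inx x : \int[mu]_(t in `[0, 2 * pi]) H (t, x) = V1d de x * ch1 x + V2d de x * ch2 x.
  have [cfl fl0] := oint_flux x d0.
  rewrite -/(oint _) (_ : (fun t => H (t, x)) = fun t => ch x * flux de x t +
    (ch1 x * (kernd be de x (f t) * g1 t) + ch2 x * (kernd be de x (f t) * g2 t))); last first.
    by apply/funext => t; rewrite /H /W1 /W2 /flux /= -/(f t); ring.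
  have ckg1 : continuous (fun t => kernd be de x (f t) * g1 t) by exact: contM.
  have ckg2 : continuous (fun t => kernd be de x (f t) * g2 t) by exact: contM.
  rewrite intoD; last 2 first.
  - by apply: contM => //; exact: contK.
  - by apply: contD; (apply: contM; [exact: contK|]).
  rewrite intoD; [|by apply: contM; [exact: contK|exact: ckg1]|by apply: contM; [exact: contK|exact: ckg2]].
  rewrite (intoZ _ cfl) (intoZ _ ckg1) (intoZ _ ckg2) fl0 mulr0 add0r [ch1 x * _]mulrC [ch2 x * _]mulrC.
  by [].
have int t : \int[mu2]_(x in D) H (t, x) = oint (fun th => K (t, th)).
  have [_ cA cB _] := hW t.
  rewrite /H /= pintD; [|by apply: contM => //; exact: contK..].
  rewrite !pintZ// (green_x hP (hW t)) (green_y hP (hW t)) mulrN -mulNr.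
  have cth : continuous (fun th => kernd be de (f th) (f t) * ch (f th)).
    apply: contM; last exact: (contC cf' cch).
    by apply: (cont_kernd (y := fun _ => f t)) => //; exact: contK.
  rewrite -!intoZ; [|by apply: contM..].
  rewrite -intoD; [|by apply: contM; [exact: contK|exact: contM]..].
  by congr (oint _); apply/funext => th; rewrite /K /=; ring.
have inK th : oint (fun t => K (t, th)) = ch (f th) * (V1d de (f th) * g2 th - V2d de (f th) * g1 th).
  rewrite (_ : (fun t => K (t, th)) = fun t => ch (f th) * g2 th * (kernd be de (f th) (f t) * g1 t) +
    (- (ch (f th) * g1 th)) * (kernd be de (f th) (f t) * g2 t)); last by apply/funext => t; rewrite /K /=; ring.
  have ckg1 : continuous (fun t => kernd be de (f th) (f t) * g1 t) by exact: contM.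
  have ckg2 : continuous (fun t => kernd be de (f th) (f t) * g2 t) by exact: contM.
  rewrite intoD; [|by apply: contM => //; exact: contK..].
  by rewrite !intoZ//; rewrite -/(potd f1 f2 be g1 de (f th)) -/(potd f1 f2 be g2 de (f th)); ring.
have einx : (fun x => \int[mu]_(t in `[0, 2 * pi]) H (t, x)) = fun x => V1d de x * ch1 x + V2d de x * ch2 x.
  by apply/funext.
have eint : (fun t => \int[mu2]_(x in D) H (t, x)) = fun t => oint (fun th => K (t, th)) by apply/funext.
have einK : (fun th => oint (fun t => K (t, th))) =
  fun th => ch (f th) * (V1d de (f th) * g2 th - V2d de (f th) * g1 th) by apply/funext.
rewrite einx in i2 eH; rewrite eint in eH; rewrite einK in i3 eK; split.
- exact: i2.
- exact: i3.
- exact: (etrans (esym eH) eK).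
Qed.

Lemma weak_vel : \int[mu2]_(x in D) (V1 x * ch1 x + V2 x * ch2 x) =
  oint (fun t => ch (f1 t, f2 t) * (V1 (f1 t, f2 t) * g2 t - V2 (f1 t, f2 t) * g1 t)).
Proof.
pose A x := V1 x * ch1 x + V2 x * ch2 x.
pose B t := ch (f1 t, f2 t) * (V1 (f1 t, f2 t) * g2 t - V2 (f1 t, f2 t) * g1 t).
have cA : continuous A by apply: contD; exact: contM.
have cB : continuous B.
  apply: contM; first exact: (contC cf cch).
  by apply: contB; apply: contM => //; [exact: (contC cf cV1)|exact: (contC cf cV2)].
pose KA x := `|ch1 x| + `|ch2 x|.
pose KB t := `|ch (f1 t, f2 t)| * (`|g2 t| + `|g1 t|).
have cn (T : topologicalType) (F : T -> R) : continuous F -> continuous (fun x => `|F x|).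
  by move=> hF x; apply: cvg_norm; exact: hF.
have cKA : continuous KA by apply: contD; exact: cn.
have cKB : continuous KB.
  by apply: contM; [apply: cn; exact: (contC cf cch)|apply: contD; exact: cn].
pose L := \int[mu2]_(x in D) KA x + oint KB.
have L0 : 0 <= L.
  apply: addr_ge0; apply: Rintegral_ge0 => x _; rewrite ?addr_ge0// mulr_ge0// addr_ge0//.
have key e : 0 < e -> `|\int[mu2]_(x in D) A x - oint B| <= e * L.
  move=> e0; have [d d0 hd] := Vd_unif e0; have dd : 0 < d <= d by rewrite d0 lexx.
  have [i1 i2 eq] := weak_vel_reg d0.
  rewrite -(subrKA (oint (fun t => ch (f1 t, f2 t) * (V1d d (f1 t, f2 t) * g2 t - V2d d (f1 t, f2 t) * g1 t)))).
  apply: le_trans (ler_normD _ _) _; rewrite /L mulrDr; apply: lerD.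
    rewrite -eq; apply: Rint_diff_le; [exact: mD|exact: pint|exact: i1|exact: pint|move=> x _].
    have [a b] := hd x d dd; rewrite /= /A /KA.
    have -> : V1 x * ch1 x + V2 x * ch2 x - (V1d d x * ch1 x + V2d d x * ch2 x) =
      (V1 x - V1d d x) * ch1 x + (V2 x - V2d d x) * ch2 x.
      by move: (V1 x) (V2 x) (V1d d x) (V2d d x) => ? ? ? ?; ring.
    by apply: le_trans (ler_normD _ _) _; rewrite !normrM mulrDr; apply: lerD; exact: ler_wpM2r.
  rewrite distrC; apply: Rint_diff_le; [exact: measurable_itv|exact: Rint_cont|exact: i2|exact: Rint_cont|].
  move=> t _; have [a b] := hd (f1 t, f2 t) d dd; rewrite /= /B /KB.
  move: (V1 _) (V2 _) (V1d _ _) (V2d _ _) (ch (f1 t, f2 t)) a b => p q p' q' c a b.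
  have -> : c * (p * g2 t - q * g1 t) - c * (p' * g2 t - q' * g1 t) =
    c * ((p - p') * g2 t - (q - q') * g1 t) by ring.
  rewrite normrM mulrCA; apply: ler_wpM2l => //.
  by apply: le_trans (ler_normB _ _) _; rewrite !normrM mulrDr; apply: lerD; exact: ler_wpM2r.
apply/eqP; rewrite -subr_eq0 -normr_le0 -[X in _ <= X]addr0; apply/ler_addgt0Pr => e e0.
have y0 : 0 < e / (L + 1) by rewrite divr_gt0// ltr_wpDl.
rewrite addr0 add0r; apply: le_trans (key _ y0) _.
by rewrite -mulrA ler_piMr ?(ltW e0)// ler_pdivrMl ?mulr1 ?lerDl// ltr_wpDl.
Qed.

(** The rotation field is divergence free, so only the boundary term is left. *)
Lemma weak_rot : \int[mu2]_(y in D) (- y.2 * ch1 y + y.1 * ch2 y) =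
  - oint (fun t => ch (f1 t, f2 t) * (f1 t * g1 t + f2 t * g2 t)).
Proof.
have h1 := green_x hP (C1M (@C1_snd R) hch); have h2 := green_y hP (C1M (@C1_fst R) hch).
have cc : continuous (fun t => ch (f1 t, f2 t)) := contC cf cch.
have a1 : continuous (fun y : R * R => y.2 * ch1 y) by apply: contM => //; exact: cont2.
have a2 : continuous (fun y : R * R => y.1 * ch2 y) by apply: contM => //; exact: cont1.
have -> : (fun y : R * R => - y.2 * ch1 y + y.1 * ch2 y) = fun y => - 1 * (0 * ch y + y.2 * ch1 y) + (0 * ch y + y.1 * ch2 y).
  by apply/funext => y; ring.
have z (F : R * R -> R) : continuous F -> continuous (fun y => 0 * ch y + F y).
  by move=> hF; apply: contD => //; apply: contM => //; exact: contK.
rewrite pintD; last 2 first.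
- by apply: contM; [exact: contK|exact: z].
- exact: z.
rewrite pintZ; last exact: z.
rewrite h1 h2 /= mulN1r -opprD -intoD; last 2 first.
- by apply: contM => //; exact: contM.
- by apply: contM => //; exact: contM.
by congr (- oint _); apply/funext => t; ring.
Qed.

(* the boundary equation makes the patch stationary in the frame rotating at speed [om] *)
Lemma weak_steady (c om : R) :
  (forall t, c * (V1 (f1 t, f2 t) * g2 t - V2 (f1 t, f2 t) * g1 t) + om * (f1 t * g1 t + f2 t * g2 t) = 0) ->
  \int[mu2]_(y in D) ((c * V1 y + om * y.2) * ch1 y + (c * V2 y - om * y.1) * ch2 y) = 0.
Proof.
move=> he; have cA : continuous (fun x => V1 x * ch1 x + V2 x * ch2 x) by apply: contD; exact: contM.
have cB : continuous (fun y : R * R => - y.2 * ch1 y + y.1 * ch2 y).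
  by apply: contD; apply: contM => //; [apply: contN; exact: cont2|exact: cont1].
rewrite (_ : (fun y : R * R => _) = fun y => c * (V1 y * ch1 y + V2 y * ch2 y) + (- om) * (- y.2 * ch1 y + y.1 * ch2 y)).
  rewrite pintD; [|by apply: contM => //; exact: contK..].
  have cc : continuous (fun t => ch (f1 t, f2 t)) := contC cf cch.
  rewrite !pintZ// weak_vel weak_rot mulrNN -!intoZ; last 2 first.
  - by apply: contM => //; apply: contD; exact: contM.
  - by apply: contM => //; apply: contB; apply: contM => //; [exact: (contC cf cV1)|exact: (contC cf cV2)].
  rewrite -intoD; last 2 first.
  - by apply: contM; [exact: contK|apply: contM => //; apply: contB; apply: contM => //; [exact: (contC cf cV1)|exact: (contC cf cV2)]].
  - by apply: contM; [exact: contK|apply: contM => //; apply: contD; exact: contM].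
  rewrite (_ : (fun t => _) = fun=> 0); first by rewrite /oint int_cst mulr0.
  apply/funext => t; have := he t; move: (V1 _) (V2 _) => p q h.
  by rewrite mulrCA [om * (_ * _)]mulrCA -mulrDr h mulr0.
by apply/funext => y; ring.
Qed.

End Weak.

End WeakSteady.

(** * Differentiability from expansions, and chain rules *)

Section Differentials.
Context {R : realType}.

(** The remainder is measured in the l^1 norm but the plane carries the max norm; this accounts for
    e / 2. *)
Lemma diff_expand (F : R * R -> R) x (A B : R) :
  (forall e, 0 < e -> exists2 d, 0 < d & forall h1 h2, `|h1| < d -> `|h2| < d ->
    `|F (x.1 + h1, x.2 + h2) - F x - (h1 * A + h2 * B)| <= e * (`|h1| + `|h2|)) ->
  [/\ differentiable F x, 'D_(1 : R, 0 : R) F x = A & 'D_(0 : R, 1 : R) F x = B].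
Proof.
move=> hF; pose d (h : R * R) : R := h.1 * A + h.2 * B.
have lin_d : linear d by move=> k u v; rewrite /d /= /GRing.scale /=; ring.
pose dM := GRing.isLinear.Build _ _ _ _ _ lin_d.
pose dL : {linear (R * R)%type -> R} := HB.pack d dM.
have cd : continuous dL.
  have cd : continuous d by apply: contD; apply: contM; solve [exact: cont1|exact: cont2|exact: contK].
  exact: cd.
have ex : F \o shift x = cst (F x) + dL +o_ (nbhs (0 : R * R)) id.
  apply/eqaddoP => e e0; have [r r0 hr] := hF (e / 2) (divr_gt0 e0 (ltr0n R 2)).
  apply/nbhs_ballP; exists r => // -[h1 h2] [/=]; rewrite /ball/= !sub0r !normrN => a b.
  have -> : (F \o shift x - (cst (F x) + dL)) (h1, h2) = F (x.1 + h1, x.2 + h2) - F x - (h1 * A + h2 * B).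
    rewrite -[LHS]/(F ((h1, h2) + x) - (F x + d (h1, h2))) opprD addrA; congr (F _ - _ - _).
    by rewrite -[LHS]/(h1 + x.1, h2 + x.2) addrC [h2 + _]addrC.
  apply: le_trans (hr _ _ a b) _.
  have m1 : `|h1| <= `|(h1, h2)| by rewrite prod_normE /= le_max lexx.
  have m2 : `|h2| <= `|(h1, h2)| by rewrite prod_normE /= le_max lexx orbT.
  by rewrite -mulrA; apply: ler_wpM2l; [exact: ltW|rewrite ler_pdivrMl//; lra].
have e1 := diff_unique cd ex.
have dF : differentiable F x by apply/diff_locallyP; rewrite e1.
split=> //; rewrite deriveE// e1 -[LHS]/(d _) /d /=; ring.
Qed.

Lemma hasD_diff (a : R -> R) t a' : hasD a t a' -> differentiable a t /\ 'd a t 1 = a'.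
Proof.
move=> [ha <-]; have df : differentiable a t by exact/derivable1_diffP.
by split=> //; rewrite -deriveE.
Qed.

Lemma chain3 (ps : R * (R * R) -> R) (a b c : R -> R) a' b' c' t :
  differentiable ps (a t, (b t, c t)) -> hasD a t a' -> hasD b t b' -> hasD c t c' ->
  hasD (fun s => ps (a s, (b s, c s))) t
    ('D_(1 : R, (0 : R, 0 : R)) ps (a t, (b t, c t)) * a' +
     'D_(0 : R, (1 : R, 0 : R)) ps (a t, (b t, c t)) * b' +
     'D_(0 : R, (0 : R, 1 : R)) ps (a t, (b t, c t)) * c').
Proof.
move=> dps /hasD_diff[da ea] /hasD_diff[db eb] /hasD_diff[dc ec].
have dbc := differentiable_pair db dc; have dg := differentiable_pair da dbc.
have dcomp := differentiable_comp dg dps.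
split; first exact/derivable1_diffP.
rewrite deriveE// diff_comp// /= diff_pair// diff_pair// ea eb ec !deriveE//.
have -> : (a', (b', c')) = a' *: ((1 : R), ((0 : R), (0 : R))) +
   b' *: ((0 : R), ((1 : R), (0 : R))) + c' *: ((0 : R), ((0 : R), (1 : R))).
  rewrite -[RHS]/(a' * 1 + b' * 0 + c' * 0, (a' * 0 + b' * 1 + c' * 0, a' * 0 + b' * 0 + c' * 1)).
  by rewrite !mulr0 !mulr1 !addr0 !add0r.
rewrite !linearD !linearZ /= /GRing.scale /=.
by congr (_ + _ + _); rewrite mulrC.
Qed.

Lemma derive_supp (V : normedModType R) (ps : V -> R) (r : R) (v p : V) :
  (forall q, r < `|q| -> ps q = 0) -> v != 0 -> r < `|p| -> 'D_v ps p = 0.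
Proof.
move=> h v0 rp; rewrite (@near_eq_derive _ _ _ ps (cst 0) p v)//.
  by rewrite derive_cst.
have op : open [set q : V | r < `|q|].
  rewrite (_ : [set q | _] = (fun q : V => `|q|) @^-1` [set u | r < u])//.
  by apply: open_comp; [move=> q _; exact: norm_continuous|exact: open_gt].
apply: filterS (open_nbhs_nbhs (conj op rp)) => q /= /h -> //.
Qed.

End Differentials.

(** * From the rotating frame to the weak formulation *)

Section RotatingPatch.
Context {R : realType}.
Notation mu := (@lebesgue_measure R).
Notation mu2 := (mu \x mu)%E.
Variables (f1 f2 g1 g2 : R -> R) (D : set (R * R)).
Hypothesis hP : patch f1 f2 g1 g2 D.
Variables (c0 alpha : R).
Hypothesis alP : 0 < alpha < 1.
Hypothesis c0_gt0 : 0 < c0.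
Hypothesis chordP : forall x, exists t0, forall t, c0 * chord2 (t - t0) <= dist2 x (f1 t, f2 t).
Variables (DC : set ((R[i])^o)) (om : R).
Hypothesis DCE : forall y, DC (toC y) <-> D y.

Let be := alpha / 2.
Let beP : 0 < be < 2^-1.
Proof. by have b := alP; rewrite /be; lra. Qed.
Let mD := p_mD hP.
Notation V1 := (pot f1 f2 be g1). Notation V2 := (pot f1 f2 be g2).
Let c : R := Calpha alpha / (2 * pi).

Hypothesis boundary : forall t,
  c * (V1 (f1 t, f2 t) * g2 t - V2 (f1 t, f2 t) * g1 t) + om * (f1 t * g1 t + f2 t * g2 t) = 0.

Let rot_setE a (y : R * R) : rot_set DC 0 a (toC y) <-> D (rotate (- a) y).
Proof.
rewrite -DCE /rot_set /=; suff -> : 0 + expi (- a) * (toC y - 0) = toC (rotate (- a) y) by [].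
by rewrite subr0 add0r /expi /toC /rotate /=; apply/eqP; rewrite eq_complex /= [X in _ == X + _]mulrC; apply/andP; split; apply/eqP; ring.
Qed.

Let setE a : [set y : R * R | rot_set DC 0 a (toC y)] = rotate (- a) @^-1` D.
Proof. by apply/seteqP; split => y /=; rewrite rot_setE. Qed.

Let dist2_rot a (x y : R * R) : dist2 (rotate a x) (rotate a y) = dist2 x y.
Proof.
have h := cos2Dsin2 a; rewrite /dist2 /rotate /=.
transitivity ((cos a ^+ 2 + sin a ^+ 2) * ((x.1 - y.1) ^+ 2 + (x.2 - y.2) ^+ 2)); first ring.
by rewrite h mul1r.
Qed.

(** Rotations preserve area and distances, so the potential of the rotated patch is the fixed one at
    the back-rotated point; the power alpha of a distance is the power [be] of its square. *)
Lemma stream_rot a : stream alpha (rot_set DC 0 a) = fun x => c * psi D be (rotate (- a) x).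
Proof.
apply/funext => x; rewrite /stream -/c; congr (_ * _); rewrite /psi /Rintegral; congr fine.
have mk : measurable_fun setT (fun y => (kern be (rotate (- a) x) y)%:E).
  apply/measurable_EFinP; apply: (measurableT_comp (measurable_powR (- be))); apply: cont_meas2.
  by apply: (cont_dist2 (x := fun _ => rotate (- a) x)); [exact: contK|exact: contI].
rewrite -(preserves_int (preserves_rotate (- a)) mD mk) setE.
apply: eq_integral => y _; congr EFin.
rewrite /kern dist2_rot /cmod /= -/(dist2 x y) powRN div1r; congr (_^-1).
rewrite -powR12_sqrt ?dist2_ge0// -powRrM; congr (_ `^ _); rewrite /be; lra.
Qed.

Let al0 : 0 < be. Proof. by case/andP: beP. Qed.

Definition vel_rot1 a x : R := c * (cos a * V1 (rotate (- a) x) - sin a * V2 (rotate (- a) x)).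
Definition vel_rot2 a x : R := c * (sin a * V1 (rotate (- a) x) + cos a * V2 (rotate (- a) x)).

Lemma stream_diff a x : [/\ differentiable (stream alpha (rot_set DC 0 a)) x,
  vel1 alpha (rot_set DC 0 a) x = vel_rot1 a x & vel2 alpha (rot_set DC 0 a) x = vel_rot2 a x].
Proof.
rewrite /vel1 /vel2 stream_rot; set z := rotate (- a) x.
suff [h1 h2 h3] : [/\ differentiable (fun x => c * psi D be (rotate (- a) x)) x,
    'D_(1 : R, 0 : R) (fun x => c * psi D be (rotate (- a) x)) x = - vel_rot2 a x &
    'D_(0 : R, 1 : R) (fun x => c * psi D be (rotate (- a) x)) x = vel_rot1 a x].
  by rewrite h2 h3 opprK; split.
apply: diff_expand => e e0.
have C0 : 0 < 2 * `|c| + 1 by rewrite ltr_wpDl// mulr_ge0.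
have [d d0 hd] := psi_expand hP beP c0_gt0 chordP z (divr_gt0 e0 C0).
exists (d / 2); first by rewrite divr_gt0.
move=> h1 h2 a1 a2; pose k := rotate (- a) (h1, h2).
have cb : `|cos (- a)| <= 1 by rewrite ler_norml cos_geN1 cos_le1.
have sb : `|sin (- a)| <= 1 by rewrite ler_norml sin_geN1 sin_le1.
have kb : `|k.1| <= `|h1| + `|h2| /\ `|k.2| <= `|h1| + `|h2|.
  split; rewrite /k /rotate /=.
    by apply: le_trans (ler_normB _ _) _; rewrite !normrM; apply: lerD; exact: ler_piMl.
  by apply: le_trans (ler_normD _ _) _; rewrite !normrM; apply: lerD; exact: ler_piMl.
have hs : `|h1| + `|h2| < d by lra.
have := hd k.1 k.2 (le_lt_trans kb.1 hs) (le_lt_trans kb.2 hs).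
have -> : (z.1 + k.1, z.2 + k.2) = rotate (- a) (x.1 + h1, x.2 + h2).
  by rewrite /z /k /rotate /=; congr (_, _); ring.
have -> : - k.1 * V2 z + k.2 * V1 z = h1 * (- (sin a * V1 z + cos a * V2 z)) + h2 * (cos a * V1 z - sin a * V2 z).
  by rewrite /k /rotate /= cosN sinN; ring.
rewrite /vel_rot1 /vel_rot2 -/z; move: (psi _ _ _) (psi _ _ _) (V1 z) (V2 z) => q p v w hb.
have -> : c * p - c * q - (h1 * - (c * (sin a * v + cos a * w)) + h2 * (c * (cos a * v - sin a * w))) =
  c * (p - q - (h1 * (- (sin a * v + cos a * w)) + h2 * (cos a * v - sin a * w))) by ring.
rewrite normrM; apply: le_trans (ler_wpM2l (normr_ge0 c) hb) _.
have [k1 k2] := kb; have S0 : 0 <= `|h1| + `|h2| by rewrite addr_ge0.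
have kk : `|k.1| + `|k.2| <= 2 * (`|h1| + `|h2|) by lra.
have e1 : 0 <= e / (2 * `|c| + 1) by rewrite divr_ge0// ltW.
apply: le_trans (ler_wpM2l (normr_ge0 c) (ler_wpM2l e1 kk)) _.
have -> : `|c| * (e / (2 * `|c| + 1) * (2 * (`|h1| + `|h2|))) =
  e * (`|h1| + `|h2|) * (2 * `|c| / (2 * `|c| + 1)) by ring.
by rewrite ler_piMr ?mulr_ge0 ?(ltW e0)// ler_pdivrMr ?mul1r ?lerDl.
Qed.

Let G : R := projT1 (cid (p_gb hP)).
Let G1 t : `|g1 t| <= G. Proof. by have [] := projT2 (cid (p_gb hP)) t. Qed.
Let G2 t : `|g2 t| <= G. Proof. by have [] := projT2 (cid (p_gb hP)) t. Qed.
Let cV1 : continuous V1.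
Proof. exact: (pot_cont hP beP c0_gt0 chordP (p_cg1 hP) G1 (p_g1P hP)). Qed.
Let cV2 : continuous V2.
Proof. exact: (pot_cont hP beP c0_gt0 chordP (p_cg2 hP) G2 (p_g2P hP)). Qed.

Section TestFunction.
Variables ps p0 p1 p2 : R * (R * R) -> R.
Hypothesis dps : forall (a b c : R -> R) a' b' c' t, hasD a t a' -> hasD b t b' -> hasD c t c' ->
  hasD (fun s => ps (a s, (b s, c s))) t
    (p0 (a t, (b t, c t)) * a' + p1 (a t, (b t, c t)) * b' + p2 (a t, (b t, c t)) * c').
Hypothesis cps : continuous ps.
Hypothesis cp0 : continuous p0.
Hypothesis cp1 : continuous p1.
Hypothesis cp2 : continuous p2.
Variable T : R.
Hypothesis T0 : 0 < T.
Hypothesis suppT : forall p, T <= `|p| -> [/\ ps p = 0, p0 p = 0, p1 p = 0 & p2 p = 0].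

Let rot t (y : R * R) := (t, rotate (om * t) y).

Let cs : continuous (fun t : R => sin (om * t)).
Proof. by move=> t; apply: dcont; apply: dsin; apply: dM; [exact: dC|exact: dI]. Qed.
Let cc : continuous (fun t : R => cos (om * t)).
Proof. by move=> t; apply: dcont; apply: dcos; apply: dM; [exact: dC|exact: dI]. Qed.

Let crotate (f : R -> R) : continuous (fun t => sin (f t)) -> continuous (fun t => cos (f t)) ->
  continuous (fun q : R * (R * R) => rotate (f q.1) q.2).
Proof.
move=> hs hc; have e1 := @cont1 R (R * R)%type; have e2 := @cont2 R (R * R)%type.
have e21 : continuous (fun q : R * (R * R) => q.2.1) := contC e2 (@cont1 _ _).
have e22 : continuous (fun q : R * (R * R) => q.2.2) := contC e2 (@cont2 _ _).
have s1 : continuous (fun q : R * (R * R) => sin (f q.1)) := contC e1 hs.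
have k1 : continuous (fun q : R * (R * R) => cos (f q.1)) := contC e1 hc.
by apply: contP; [apply: contB|apply: contD]; exact: contM.
Qed.

Let crot : continuous (fun q : R * (R * R) => rot q.1 q.2).
Proof. by apply: contP; [exact: cont1|exact: (crotate (f := fun t => om * t))]. Qed.

(** The test function seen from the frame rotating with the patch. In its time derivative [chit] the
    motion of the frame appears as transport along (- y2, y1). *)
Let chi t y := ps (rot t y).
Let chi1 t y := cos (om * t) * p1 (rot t y) + sin (om * t) * p2 (rot t y).
Let chi2 t y := - sin (om * t) * p1 (rot t y) + cos (om * t) * p2 (rot t y).
Let chit t y := p0 (rot t y) + om * (- y.2 * chi1 t y + y.1 * chi2 t y).

Let C1chi t : C1fun (chi t) (chi1 t) (chi2 t).
Proof.
have cr : continuous (rot t).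
  apply: (contC (f := fun y : R * R => (t, y)) _ crot).
  by apply: contP; [exact: contK|exact: contI].
split.
- exact: contC cr cps.
- by apply: contD; (apply: contM; [exact: contK|]); [exact: (contC cr cp1)|exact: (contC cr cp2)].
- by apply: contD; (apply: contM; [exact: contK|]); [exact: (contC cr cp1)|exact: (contC cr cp2)].
- move=> x y x' y' s hx hy; apply: deq.
    apply: (dps (a := fun _ => t) (b := fun s => cos (om * t) * x s - sin (om * t) * y s)
      (c := fun s => sin (om * t) * x s + cos (om * t) * y s)).
    + exact: dC.
    + by apply: dD; [apply: dM; [exact: dC|exact: hx]|apply: dN; apply: dM; [exact: dC|exact: hy]].
    + by apply: dD; (apply: dM; [exact: dC|]); [exact: hx|exact: hy].
  rewrite /chi1 /chi2 /rot /rotate /=.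
  by move: (p0 _) (p1 _) (p2 _) => q0 q1 q2; ring.
Qed.

Let dchi t y : hasD (fun s => chi s y) t (chit t y).
Proof.
have dl : hasD (fun s : R => om * s) t om.
  by apply: deq; [apply: dM; [exact: dC|exact: dI]|rewrite /=; ring].
apply: deq.
  apply: (dps (a := fun s => s) (b := fun s => cos (om * s) * y.1 - sin (om * s) * y.2)
      (c := fun s => sin (om * s) * y.1 + cos (om * s) * y.2)).
  - exact: dI.
  - by apply: dD; [apply: dM; [exact: (dcos dl)|exact: dC]|apply: dN; apply: dM; [exact: (dsin dl)|exact: dC]].
  - by apply: dD; (apply: dM; [|exact: dC]); [exact: (dsin dl)|exact: (dcos dl)].
rewrite /chit /chi1 /chi2 /rot /rotate /=.
by move: (p0 _) (p1 _) (p2 _) => q0 q1 q2; ring.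
Qed.

Let e21 : continuous (fun q : R * (R * R) => q.2.1) := contC (@cont2 R (R * R)%type) (@cont1 _ _).
Let e22 : continuous (fun q : R * (R * R) => q.2.2) := contC (@cont2 R (R * R)%type) (@cont2 _ _).
Let s1 : continuous (fun q : R * (R * R) => sin (om * q.1)) := contC (@cont1 R (R * R)%type) cs.
Let k1 : continuous (fun q : R * (R * R) => cos (om * q.1)) := contC (@cont1 R (R * R)%type) cc.

Let cchit : continuous (fun q : R * (R * R) => chit q.1 q.2).
Proof.
have a1 : continuous (fun q : R * (R * R) => p1 (rot q.1 q.2)) := contC crot cp1.
have a2 : continuous (fun q : R * (R * R) => p2 (rot q.1 q.2)) := contC crot cp2.
have b1 : continuous (fun q : R * (R * R) => chi1 q.1 q.2) by rewrite /chi1; apply: contD; exact: contM.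
have b2 : continuous (fun q : R * (R * R) => chi2 q.1 q.2).
  by rewrite /chi2; apply: contD; apply: contM => //; exact: contN.
rewrite /chit; apply: contD; first exact: (contC crot cp0).
apply: contM; first exact: contK.
by apply: contD; apply: contM => //; exact: contN.
Qed.

Let J (q : R * (R * R)) : R :=
  p0 q + vel_rot1 (om * q.1) q.2 * p1 q + vel_rot2 (om * q.1) q.2 * p2 q.

Let cJ : continuous J.
Proof.
have cr : continuous (fun q : R * (R * R) => rotate (- (om * q.1)) q.2).
  apply: (crotate (f := fun t => - (om * t))).
    by rewrite (_ : (fun t => _) = fun t => - sin (om * t)); [exact: contN|apply/funext => t; rewrite sinN].
  by rewrite (_ : (fun t => _) = fun t => cos (om * t)) //; apply/funext => t; rewrite cosN.
have v1 : continuous (fun q : R * (R * R) => V1 (rotate (- (om * q.1)) q.2)) := contC cr cV1.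
have v2 : continuous (fun q : R * (R * R) => V2 (rotate (- (om * q.1)) q.2)) := contC cr cV2.
rewrite /J /vel_rot1 /vel_rot2; apply: contD; first apply: contD => //.
  by apply: contM => //; apply: contM; [exact: contK|apply: contB; exact: contM].
by apply: contM => //; apply: contM; [exact: contK|apply: contD; exact: contM].
Qed.

(** Taking the frame's rotation out of [chit] leaves the velocity relative to the rotating frame,
    whose contribution integrates to 0 by [weak_steady]. *)
Let JE t y : J (rot t y) = chit t y + ((c * V1 y + om * y.2) * chi1 t y + (c * V2 y - om * y.1) * chi2 t y).
Proof.
have e : rotate (- (om * t)) (rotate (om * t) y) = y by rewrite -rotateD addNr rotate0.
rewrite /J /vel_rot1 /vel_rot2 /rot /= e /chit -/(rot t y) /chi1 /chi2.
move: (V1 y) (V2 y) (p0 _) (p1 _) (p2 _) (cos2Dsin2 (om * t)) => ? ? ? ? ? ?; ring.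
Qed.

(** Only a total time derivative is left on the fixed set D; integrated over [0, T] it gives minus
    the initial value, as the test function vanishes at T. *)
Lemma slice_balance : \int[mu]_(t in `[0, T]) (\int[mu2]_(y in D) J (rot t y)) =
  - \int[mu2]_(y in D) ps (0, y).
Proof.
have cJt t : continuous (fun y => J (rot t y)).
  apply: (contC (f := fun y : R * R => (t, y)) (g := fun q => J (rot q.1 q.2))).
    by apply: contP; [exact: contK|exact: contI].
  exact: contC crot cJ.
have ct t : continuous (chit t).
  by apply: (contC (f := fun y : R * R => (t, y)) _ cchit); apply: contP; [exact: contK|exact: contI].
have inner t : \int[mu2]_(y in D) J (rot t y) = \int[mu2]_(y in D) chit t y.
  have [_ b1 b2 _] := C1chi t.
  have cw : continuous (fun y => (c * V1 y + om * y.2) * chi1 t y + (c * V2 y - om * y.1) * chi2 t y).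
    apply: contD; apply: contM => //.
      by apply: contD; (apply: contM; [exact: contK|]) => //; exact: cont2.
    by apply: contB; (apply: contM; [exact: contK|]) => //; exact: cont1.
  rewrite (_ : (fun y => _) = fun y => chit t y + ((c * V1 y + om * y.2) * chi1 t y + (c * V2 y - om * y.1) * chi2 t y)); last first.
    by apply/funext => y; exact: JE.
  rewrite RintegralD//; [|exact: (patch_int hP (ct t))|exact: (patch_int hP cw)].
  by rewrite (weak_steady hP beP c0_gt0 chordP (C1chi t) boundary) addr0.
rewrite (_ : (fun t => _) = fun t => \int[mu2]_(y in D) chit t y); last by apply/funext.
have [_ _ ->] := patch_swap hP 0 T cchit.
have cp0y : continuous (fun y => ps (0, y)).
  by apply: (contC (f := fun y : R * R => (0, y)) _ cps); apply: contP; [exact: contK|exact: contI].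
rewrite -mulN1r -RintegralZl//; last exact: (patch_int hP cp0y).
apply: eq_Rintegral => y _.
have cty : continuous (fun t => chit t y).
  by apply: (contC (f := fun t : R => (t, y)) _ cchit); apply: contP; [exact: contI|exact: contK].
apply: etrans (Rftc (F := fun t => chi t y) (ltW T0) (fun t => dchi t y) cty) _.
rewrite /chi /rot mulr0 rotate0 mulN1r.
have hT : T <= `|(T, rotate (om * T) y)| by rewrite prod_normE /= le_max ler_norm.
by have [-> _ _ _] := suppT hT; rewrite sub0r.
Qed.

Let J_supp p : T <= `|p| -> J p = 0.
Proof. by move=> /suppT[_ h0 h1 h2]; rewrite /J h0 h1 h2 !mulr0 !addr0. Qed.

Let ind (q : R * (R * R)) : R := \1_D (rotate (- (om * q.1)) q.2).
Let I q := ind q * J q.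
Let B : set (R * R) := `[- T, T]%classic `*` `[- T, T]%classic.

Let BP x : ~ B x -> T <= `|x|.
Proof.
case: x => x1 x2 h; rewrite leNgt; apply/negP => hx; apply: h; move: hx.
rewrite prod_normE /= gt_max => /andP[a b].
by split; rewrite /= in_itv/= -ler_norml ltW.
Qed.

Let le_norm2 (t : R) (x : R * R) : `|x| <= `|(t, x)|.
Proof. by rewrite [leRHS]prod_normE /= le_max lexx orbT. Qed.

Let norm_le1 (t : R) (x : R * R) : `|t| <= `|(t, x)|.
Proof. by rewrite prod_normE /= le_max lexx. Qed.

Let mind : measurable_fun setT ind.
Proof.
have cr : continuous (fun q : R * (R * R) => rotate (- (om * q.1)) q.2).
  apply: (crotate (f := fun t => - (om * t))).
    by rewrite (_ : (fun t => _) = fun t => - sin (om * t)); [exact: contN|apply/funext => t; rewrite sinN].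
  by rewrite (_ : (fun t => _) = fun t => cos (om * t)) //; apply/funext => t; rewrite cosN.
apply: (measurableT_comp (measurable_indic mD)).
rewrite (_ : (fun q => _) = fun q : R * (R * R) => ((rotate (- (om * q.1)) q.2).1, (rotate (- (om * q.1)) q.2).2)).
  by apply: measurable_fun_pair; apply: cont_meas3; [exact: (contC cr (@cont1 _ _))|exact: (contC cr (@cont2 _ _))].
by apply/funext => q; rewrite -surjective_pairing.
Qed.

Let mI : measurable_fun setT I.
Proof. by apply: measurable_funM; [exact: mind|exact: cont_meas3]. Qed.

Let ind_le1 q : `|ind q| <= 1.
Proof. by rewrite /ind indicE; case: (_ \in _); rewrite ?normr1 ?normr0. Qed.

Let slice t : 0 <= t <= T -> \int[mu2]_(x in B) I (t, x) = \int[mu2]_(y in D) J (rot t y).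
Proof.
move=> ht; rewrite /Rintegral; congr fine.
have cJt : continuous (fun y => J (rot t y)).
  apply: (contC (f := fun y : R * R => (t, y)) (g := fun q => J (rot q.1 q.2))).
    by apply: contP; [exact: contK|exact: contI].
  exact: contC crot cJ.
have mJ : measurable_fun setT (fun y => (J (rot t y))%:E) by apply/measurable_EFinP; exact: cont_meas2.
apply: etrans (preserves_int (preserves_rotate (- (om * t))) mD mJ).
rewrite integral_mkcond [RHS]integral_mkcond; apply: eq_integral => x _; rewrite !patchE.
have e : rot t (rotate (- (om * t)) x) = (t, x) by rewrite /rot -rotateD addrN rotate0.
case: ifPn => [_|xB].
  rewrite e /I /ind /= indicE.
  case: ifPn => hx; first by rewrite (_ : _ \in D) ?mul1r//; move: hx; rewrite !inE.
  by rewrite (_ : _ \in D = false) ?mul0r//; apply/negP; move/negP: hx => h1 h2; apply: h1; move: h2; rewrite !inE.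
case: ifP => // _; rewrite e J_supp//; apply: le_trans (le_norm2 t x); apply: BP => Bx.
by move/negP: xB; apply; rewrite inE.
Qed.

Lemma weak_form :
  (\int[leb3]_(p in [set p : R * (R * R) | (0 <= p.1)%R])
     (\1_[set y : R * R | rot_set DC 0 (om * p.1) (toC y)] p.2 *
       (p0 p + vel1 alpha (rot_set DC 0 (om * p.1)) p.2 * p1 p + vel2 alpha (rot_set DC 0 (om * p.1)) p.2 * p2 p))%:E
   + \int[leb2]_x (\1_[set y : R * R | rot_set DC 0 (om * 0) (toC y)] x * ps (0, x))%:E = 0)%E.
Proof.
have indE t x : \1_[set y : R * R | rot_set DC 0 (om * t) (toC y)] x = ind (t, x) :> R.
  rewrite /ind !indicE (_ : (x \in _) = (rotate (- (om * t)) x \in D))//.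
  by apply/idP/idP; rewrite !inE /= rot_setE.
pose nu := sfprod mu mu.
have [K K0 hK] := cont_box3 0 T T cJ.
have hb t x : `[0, T]%classic t -> B x -> `|I (t, x)| <= K.
  rewrite /= in_itv/= => ht; case: x => x1 x2 [/=]; rewrite !in_itv/= -!ler_norml => h1 h2.
  by rewrite normrM; apply: le_trans (hK _ _ _ ht h1 h2); apply: ler_piMl.
have mT : measurable `[0, T]%classic := measurable_itv `[0, T]%R.
have mTT : measurable `[- T, T]%classic := measurable_itv `[- T, T]%R.
have fT : (mu `[0%R, T]%classic < +oo)%E by rewrite lebesgue_measure_itv/=; case: ifP => _; exact: ltry.
have fTT : (mu `[(- T)%R, T]%classic < +oo)%E by rewrite lebesgue_measure_itv/=; case: ifP => _; exact: ltry.
have mB : measurable B by exact: measurableX.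
have fB : (nu B < +oo)%E by exact: product_measure1_lty.
(* The integrand vanishes off a box, which makes Fubini for bounded functions applicable. *)
have -> : (\int[leb3]_(p in [set p : R * (R * R) | (0 <= p.1)%R])
     (\1_[set y : R * R | rot_set DC 0 (om * p.1) (toC y)] p.2 *
       (p0 p + vel1 alpha (rot_set DC 0 (om * p.1)) p.2 * p1 p + vel2 alpha (rot_set DC 0 (om * p.1)) p.2 * p2 p))%:E
   = \int[(mu \x nu)]_(p in `[0%R, T]%classic `*` B) (I p)%:E)%E.
  have e3 : leb3 = (mu \x nu)%E :> (set (R * (R * R)) -> \bar R) by [].
  rewrite e3.
  rewrite integral_mkcond.
  rewrite [RHS]integral_mkcond.
  congr (integral _ _ _).
  apply/funext => -[t x].
  rewrite !patchE.
  cbn [fst snd].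
  rewrite indE.
  have [_ -> ->] := stream_diff (om * t) x; rewrite -[_ * _]/(I (t, x)).
  case: ifPn => [|h0].
    rewrite inE /= => t0; case: ifPn => // /negP h.
    rewrite /I J_supp ?mulr0//; have [tT|tT] := leP t T; last first.
      by apply: le_trans (norm_le1 t x); rewrite ger0_norm// ltW.
    apply: le_trans (le_norm2 t x); apply: BP => Bx; apply: h; rewrite inE; split => //=.
    by rewrite in_itv/= t0.
  case: ifPn => //; rewrite inE => -[/=]; rewrite in_itv/= => /andP[t0 _] _.
  by move/negP: h0 => []; rewrite inE.
have -> : (\int[(mu \x nu)]_(p in `[0%R, T]%classic `*` B) (I p)%:E = (- \int[mu2]_(y in D) ps (0%R, y))%:E)%E.
  have iI := fubini_integrable (m1 := mu) (m2 := nu) mT mB fT fB mI hb.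
  apply: etrans (esym (fineK (integrable_fin_num _ iI))) _; first exact: measurableX.
  congr EFin; apply: etrans (esym (fubini12 (m1 := mu) (m2 := nu) mT mB fT fB mI hb)) _.
  rewrite -slice_balance; apply: eq_Rintegral => t; rewrite inE /= in_itv/= => ht.
  exact: slice.
have cp0y : continuous (fun y => ps (0, y)).
  by apply: (contC (f := fun y : R * R => (0, y)) _ cps); apply: contP; [exact: contK|exact: contI].
have -> : (\int[leb2]_x (\1_[set y : R * R | rot_set DC 0 (om * 0) (toC y)] x * ps (0, x))%:E =
   (\int[mu2]_(y in D) ps (0%R, y))%:E)%E.
  have iD := patch_int hP cp0y.
  rewrite /Rintegral fineK; last by apply: integrable_fin_num; [exact: mD|exact: iD].
  have e2 : leb2 = mu2 :> (set (R * R) -> \bar R) by [].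
  rewrite e2 [RHS]integral_mkcond; congr (integral _ _ _); apply/funext => x.
  rewrite patchE indE /ind /= mulr0 oppr0 rotate0 indicE.
  by case: ifPn => hx; rewrite ?mul1r// mul0r.
by rewrite -EFinD addNr.
Qed.

End TestFunction.

Lemma rotating_patch_solution : patch_solution alpha (fun t => rot_set DC 0 (om * t)).
Proof.
split=> [t x|ps]; first by have [] := stream_diff (om * t) x.
move=> [dps [c0' [c1 [c2 [r hr]]]]].
(* Strictly larger than the support radius, so the derivatives of the test function vanish from T on
   as well. *)
pose T := Num.max r 0 + 1.
have T0 : 0 < T by rewrite /T ltr_wpDl// le_max lexx orbT.
have rT : r < T by rewrite /T; apply: le_lt_trans (ltr_pwDr _ (lexx _)) => //; rewrite le_max lexx.
apply: (weak_form _ _ c0' c1 c2 T0).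
- move=> a b c' a' b' d' t ha hb hc; exact: chain3.
- by move=> p; exact: differentiable_continuous.
- move=> p Tp; have rp := lt_le_trans rT Tp.
  split; first exact: hr.
  + by apply: (derive_supp hr) => //; rewrite -pair_eqE /= /pair_eq /= oner_eq0.
  + by apply: (derive_supp hr) => //; rewrite -pair_eqE /= /pair_eq /= -pair_eqE /pair_eq /= oner_eq0 andbF.
  + by apply: (derive_supp hr) => //; rewrite -pair_eqE /= /pair_eq /= -pair_eqE /pair_eq /= oner_eq0 !andbF.
Qed.


End RotatingPatch.

(** * Complex plane and power sums *)

Section ComplexPlane.
Context {R : realType}.
Local Notation C := ((R[i])^o).
Implicit Types z w : C.
Local Notation Re := complex.Re.
Local Notation Im := complex.Im.

Lemma normC_cmod z : `|z| = Rc (cmod z). Proof. by rewrite normc_def. Qed.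
Lemma cmod_ge0 z : 0 <= cmod z. Proof. exact: sqrtr_ge0. Qed.
Lemma cmodM z w : cmod (z * w) = cmod z * cmod w.
Proof. by have := congr1 (@complex.Re R) (normrM z w); rewrite !normC_cmod /= mul0r subr0. Qed.
Lemma cmod_Rc (x : R) : cmod (Rc x) = `|x|.
Proof. by rewrite /cmod /= expr0n /= addr0 sqrtr_sqr. Qed.
Lemma cmod0 : cmod (0 : C) = 0. Proof. by rewrite [LHS](cmod_Rc 0) normr0. Qed.
Lemma cmod1 : cmod (1 : C) = 1. Proof. by rewrite [LHS](cmod_Rc 1) normr1. Qed.
Lemma cmod_eq0 z : cmod z = 0 -> z = 0.
Proof. by move=> h; apply: normr0_eq0; rewrite normC_cmod h. Qed.
Lemma cmodV z : cmod z^-1 = (cmod z)^-1.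
Proof.
have [->|z0] := eqVneq z 0; first by rewrite invr0 cmod0 invr0.
have c0 : cmod z != 0 by apply: contra z0 => /eqP/cmod_eq0 ->.
by apply: (mulfI c0); rewrite -cmodM !mulfV ?cmod1.
Qed.
Lemma cmodN z : cmod (- z) = cmod z. Proof. by case: z => x y; rewrite /cmod /= !sqrrN. Qed.
Lemma cmodC z w : cmod (z - w) = cmod (w - z). Proof. by rewrite -cmodN opprB. Qed.
Lemma cmodD z w : cmod (z + w) <= cmod z + cmod w.
Proof.
have : `|z + w| <= `|z| + `|w| by exact: ler_normD.
by rewrite !normC_cmod /Rc lecE /= => /andP[_].
Qed.
Lemma cmodB z w : cmod (z - w) <= cmod z + cmod w.
Proof. by apply: le_trans (cmodD _ _) _; rewrite cmodN. Qed.
Lemma cmod_tri z w u : cmod (z - u) <= cmod (z - w) + cmod (w - u).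
Proof. by have := cmodD (z - w) (w - u); rewrite subrKA. Qed.
Lemma cmodX z n : cmod (z ^+ n) = cmod z ^+ n.
Proof. by elim: n => [|n IH]; rewrite ?cmod1// !exprS cmodM IH. Qed.
Lemma cmod_conj z : cmod (cconj z) = cmod z.
Proof. by case: z => x y; rewrite /cmod /= sqrrN. Qed.
Lemma cmod_expi t : cmod (expi t) = 1 :> R.
Proof. by rewrite /cmod /= cos2Dsin2 sqrtr1. Qed.
Lemma Re_le z : `|Re z| <= cmod z.
Proof. by rewrite /cmod -sqrtr_sqr ler_wsqrtr// lerDl sqr_ge0. Qed.
Lemma Im_le z : `|Im z| <= cmod z.
Proof. by rewrite /cmod -sqrtr_sqr ler_wsqrtr// lerDr sqr_ge0. Qed.
Lemma cmod_sqr z : cmod z ^+ 2 = Re z ^+ 2 + Im z ^+ 2.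
Proof. by rewrite sqr_sqrtr// addr_ge0 ?sqr_ge0. Qed.
Lemma cmod_le_l1 z : cmod z <= `|Re z| + `|Im z|.
Proof.
rewrite -ler_sqr ?nnegrE ?cmod_ge0 ?addr_ge0// cmod_sqr sqrrD !real_normK ?num_real//.
by rewrite -addrA [_ *+ 2 + _]addrC addrA lerDl mulrn_wge0// mulr_ge0.
Qed.
Lemma ceq z w : Re z = Re w -> Im z = Im w -> z = w.
Proof. by case: z => ? ?; case: w => ? ? /= -> ->. Qed.
Lemma ReD z w : Re (z + w) = Re z + Re w. Proof. by case: z => ? ?; case: w. Qed.
Lemma ImD z w : Im (z + w) = Im z + Im w. Proof. by case: z => ? ?; case: w. Qed.
Lemma ReN z : Re (- z) = - Re z. Proof. by case: z. Qed.
Lemma ImN z : Im (- z) = - Im z. Proof. by case: z. Qed.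
Lemma ReM z w : Re (z * w) = Re z * Re w - Im z * Im w. Proof. by case: z => ? ?; case: w. Qed.
Lemma ImM z w : Im (z * w) = Re z * Im w + Im z * Re w. Proof. by case: z => ? ?; case: w => ? ?. Qed.
Lemma Re_sum (I : Type) (s : seq I) (F : I -> C) : Re (\sum_(i <- s) F i) = \sum_(i <- s) Re (F i).
Proof. by elim: s => [|i s IH]; rewrite ?big_nil// !big_cons ReD IH. Qed.
Lemma Im_sum (I : Type) (s : seq I) (F : I -> C) : Im (\sum_(i <- s) F i) = \sum_(i <- s) Im (F i).
Proof. by elim: s => [|i s IH]; rewrite ?big_nil// !big_cons ImD IH. Qed.
Lemma cmod_sum (I : Type) (s : seq I) (F : I -> C) : cmod (\sum_(i <- s) F i) <= \sum_(i <- s) cmod (F i).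
Proof.
elim: s => [|i s IH]; rewrite ?big_nil ?cmod0// !big_cons.
by apply: le_trans (cmodD _ _) _; rewrite lerD2l.
Qed.

Lemma cconjM z w : cconj (z * w) = cconj z * cconj w.
Proof. by apply: ceq; rewrite /cconj /= ?ReM ?ImM /= ; ring. Qed.
Lemma cconjD z w : cconj (z + w) = cconj z + cconj w.
Proof. by apply: ceq; rewrite /cconj /= ?ReD ?ImD//= opprD. Qed.
Lemma cconjN z : cconj (- z) = - cconj z.
Proof. by apply: ceq; rewrite /cconj /= ?ReN ?ImN. Qed.
Lemma cconjK z : cconj (cconj z) = z.
Proof. by apply: ceq; rewrite /cconj /= ?opprK. Qed.
Lemma cconjX z n : cconj (z ^+ n) = cconj z ^+ n.
Proof.
elim: n => [|n IH]; first by apply: ceq; rewrite /cconj /= ?oppr0.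
by rewrite !exprS cconjM IH.
Qed.
Lemma mul_cconj z : z * cconj z = Rc (cmod z ^+ 2).
Proof. by rewrite cmod_sqr; apply: ceq; rewrite ?ReM ?ImM /=; ring. Qed.
Lemma RcM (x y : R) : Rc (x * y) = Rc x * Rc y :> C.
Proof. by apply: ceq; rewrite ?ReM ?ImM /=; ring. Qed.
Lemma RcD (x y : R) : Rc (x + y) = Rc x + Rc y :> C.
Proof. by apply: ceq; rewrite ?ReD ?ImD /= ?addr0. Qed.
Lemma RcN (x : R) : Rc (- x) = - Rc x :> C.
Proof. by apply: ceq; rewrite ?ReN ?ImN /= ?oppr0. Qed.
Lemma Rc0 : Rc 0 = 0 :> C. Proof. by []. Qed.
Lemma Rc1 : Rc 1 = 1 :> C. Proof. by []. Qed.
Lemma RcV (x : R) : Rc x^-1 = (Rc x)^-1 :> C.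
Proof.
have [->|x0] := eqVneq x 0; first by rewrite invr0 Rc0 invr0.
have xC : Rc x != 0 :> C by rewrite eq_complex /= negb_and x0.
by apply: (mulfI xC); rewrite -RcM !mulfV.
Qed.
Lemma cmod_gt0 z : z != 0 -> 0 < cmod z.
Proof. by move=> z0; rewrite lt_def cmod_ge0 andbT; apply: contra z0 => /eqP/cmod_eq0 ->. Qed.
Lemma cmod1_neq0 z : 1 <= cmod z -> z != 0.
Proof. by apply: contraTneq => ->; rewrite cmod0 -ltNge. Qed.
Lemma invC_unit z : cmod z = 1 -> z^-1 = cconj z.
Proof.
move=> z1; have z0 : z != 0 by rewrite cmod1_neq0// z1.
by apply: (mulfI z0); rewrite mulfV// mul_cconj z1 expr1n.
Qed.

Lemma expiD (s t : R) : expi (s + t) = expi s * expi t :> C.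
Proof. by apply: ceq; rewrite ?ReM ?ImM /= ?cosD ?sinD; ring. Qed.
Lemma expi0 : expi 0 = 1 :> C. Proof. by rewrite /expi cos0 sin0. Qed.
Lemma expiN (t : R) : expi (- t) = cconj (expi t) :> C.
Proof. by rewrite /expi /cconj /= cosN sinN. Qed.
Lemma expiX (t : R) n : expi t ^+ n = expi (n%:R * t) :> C.
Proof.
elim: n => [|n IH]; first by rewrite mul0r expi0.
by rewrite exprS IH -expiD -natr1 mulrDl mul1r addrC.
Qed.
Lemma expi2pi (t : R) : expi (t + 2 * pi) = expi t :> C.
Proof.
have e : 2 * pi = pi *+ 2 :> R by rewrite mulr_natl.
by rewrite /expi e cosD2pi sinD2pi.
Qed.

Lemma expi2pin n (t : R) : expi (t + n%:R * (2 * pi)) = expi t :> C.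
Proof.
elim: n => [|n IH]; first by rewrite mul0r addr0.
by rewrite -natr1 mulrDl mul1r addrA expi2pi.
Qed.

Lemma polar z : exists t, z = Rc (cmod z) * expi t.
Proof.
have [->|z0] := eqVneq z 0; first by exists 0; rewrite cmod0 Rc0 mul0r.
have r0 := cmod_gt0 z0; set r := cmod z in r0 *.
have h : (Re z / r) ^+ 2 + (Im z / r) ^+ 2 = 1.
  by rewrite !expr_div_n -mulrDl -cmod_sqr mulfV// expf_neq0// gt_eqF.
have c1 : -1 <= Re z / r <= 1.
  by rewrite -ler_norml -(@ler_sqr R) ?nnegrE// expr1n real_normK ?num_real// -h lerDl sqr_ge0.
have s2 : sin (acos (Re z / r)) = `|Im z / r|.
  by rewrite sin_acos// -sqrtr_sqr; congr Num.sqrt; rewrite -h addrC addKr.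
have eR : Re z = r * (Re z / r) by rewrite mulrCA mulfV ?mulr1// gt_eqF.
have eI : Im z = r * (Im z / r) by rewrite mulrCA mulfV ?mulr1// gt_eqF.
have [i0|i0] := leP 0 (Im z / r).
  exists (acos (Re z / r)); apply: ceq; rewrite ?ReM ?ImM /= mul0r ?subr0 ?addr0.
    by rewrite acosK ?itv_boundlr /= ?in_itv.
  by rewrite s2 ger0_norm.
exists (- acos (Re z / r)); apply: ceq; rewrite ?ReM ?ImM /= mul0r ?subr0 ?addr0 ?cosN ?sinN.
  by rewrite acosK ?itv_boundlr /= ?in_itv.
by rewrite s2 ltr0_norm// opprK.
Qed.

Lemma unit_expi z : cmod z = 1 -> exists t, z = expi t.
Proof. by move=> z1; have [t ht] := polar z; exists t; rewrite ht z1 Rc1 mul1r. Qed.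

Lemma chord_expi (s t : R) : cmod (expi s - expi t) ^+ 2 = chord2 (s - t).
Proof.
rewrite cmod_sqr !ReD !ImD !ReN !ImN /= /chord2 cosB.
by have := cos2Dsin2 s; have := cos2Dsin2 t; lra.
Qed.

(** The inequality cos <= 1 integrated twice from 0. *)
Lemma chord2_le (x : R) : chord2 x <= x ^+ 2.
Proof.
wlog x0 : x / 0 <= x => [h|].
  have [/h//|/ltW x0] := leP 0 x; have := h (- x); rewrite oppr_ge0 sqrrN /chord2 cosN; exact.
have dF (s : R) : hasD (fun t => t ^+ 2 - chord2 t) s (2 * (s - sin s)).
  apply: deq; first by apply: dD; [exact: (dsqr (dI s))|apply: dN; apply: dD; [exact: dC|apply: dN; apply: dM; [exact: dC|exact: (dcos (dI s))]]].
  by rewrite /=; ring.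
have dG (s : R) : hasD (fun t => t - sin t) s (1 - cos s).
  by apply: deq; [apply: dD; [exact: dI|apply: dN; exact: (dsin (dI s))]|rewrite /=; ring].
have mono (F f : R -> R) : F 0 = 0 -> (forall s, hasD F s (f s)) -> (forall s, 0 <= s -> 0 <= f s) ->
    forall s, 0 <= s -> 0 <= F s.
  move=> F0 hF f0 s s0; have [c hc e] : exists2 c, c \in `[0, s]%R & F s - F 0 = f c * (s - 0).
    exact: (@MVT_segment R F f 0 s s0 (fun c _ => hF c) (continuous_subspaceT (dcontT hF))).
  rewrite F0 subr0 in e; rewrite e mulr_ge0 ?subr_ge0//; apply: f0.
  by move: hc; rewrite in_itv/= => /andP[].
have h1 (s : R) : 0 <= s -> 0 <= s - sin s.
  by apply: (mono _ _ _ dG); [rewrite sin0 subr0|move=> u _; rewrite subr_ge0 cos_le1].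
rewrite -subr_ge0; apply: (mono _ _ _ dF) => //.
  by rewrite /chord2 cos0; ring.
by move=> s /h1 h; rewrite mulr_ge0.
Qed.

Lemma expi_lip (s t : R) : cmod (expi s - expi t) <= `|s - t|.
Proof.
by rewrite -ler_sqr ?nnegrE ?cmod_ge0// chord_expi real_normK ?num_real// chord2_le.
Qed.

(* the norm of R[i] takes values in R[i]; neighborhoods are described by real radii *)
Lemma nbhsC z (A : set C) : nbhs z A <-> exists2 e : R, 0 < e & forall w, cmod (w - z) < e -> A w.
Proof.
split.
  move=> /nbhs_ballP[e /= e0 h]; move: e0; rewrite ltcE /= => /andP[/eqP i0 r0].
  exists (Re e) => // w hw; apply: h; rewrite -ball_normE /= normC_cmod /Rc ltcE /= i0 eqxx /=.
  by rewrite cmodC.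
move=> [e e0 h]; apply/nbhs_ballP; exists (Rc e) => /=; first by rewrite ltcE /= eqxx.
by move=> w; rewrite -ball_normE /= normC_cmod /Rc ltcE /= eqxx /= => hw; apply: h; rewrite cmodC.
Qed.

Lemma cvgC T (F : set_system T) (FF : Filter F) (f : T -> C) l :
  (forall e : R, 0 < e -> F [set t | cmod (f t - l) < e]) -> f @ F --> l.
Proof. by move=> h A /nbhsC[e e0 hA]; apply: filterS (h e e0) => t; exact: hA. Qed.

Lemma contCP (T : topologicalType) (f : T -> C) x :
  (forall e : R, 0 < e -> \forall t \near x, cmod (f t - f x) < e) -> {for x, continuous f}.
Proof. by move=> h; apply: cvgC => e e0; exact: h. Qed.

Lemma lip_contC (L : R) (f : C -> C) : (forall z w, cmod (f z - f w) <= L * cmod (z - w)) -> continuous f.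
Proof.
move=> h z; apply: contCP => e e0; apply/nbhsC.
have L0 : 0 < `|L| + 1 by rewrite ltr_wpDl.
exists (e / (`|L| + 1)); first exact: divr_gt0.
move=> w hw; apply: le_lt_trans (h w z) _; apply: le_lt_trans (_ : _ <= (`|L| + 1) * cmod (w - z)) _.
  by apply: ler_wpM2r; [exact: cmod_ge0|apply: le_trans (ler_norm _) _; rewrite lerDl].
by rewrite mulrC -ltr_pdivlMr.
Qed.

Lemma lip_cont_re (L : R) (f : C -> R) : (forall z w, `|f z - f w| <= L * cmod (z - w)) -> continuous f.
Proof.
move=> h z A /nbhs_ballP[e /= e0 hA]; apply/nbhsC.
have L0 : 0 < `|L| + 1 by rewrite ltr_wpDl.
exists (e / (`|L| + 1)); first exact: divr_gt0.
move=> w hw; apply: hA; rewrite /ball/=; apply: le_lt_trans (h z w) _; apply: le_lt_trans (_ : _ <= (`|L| + 1) * cmod (w - z)) _.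
  by rewrite cmodC; apply: ler_wpM2r; [exact: cmod_ge0|apply: le_trans (ler_norm _) _; rewrite lerDl].
by rewrite mulrC -ltr_pdivlMr.
Qed.

Lemma cont_toC : continuous (@toC R).
Proof.
move=> p; apply: contCP => e e0; have e2 : 0 < e / 2 by rewrite divr_gt0.
apply/nbhs_ballP; exists (e / 2) => // q [/=]; rewrite /ball/= => a b.
apply: le_lt_trans (cmod_le_l1 _) _; rewrite /toC !ReD !ImD !ReN !ImN /= -!(distrC p.1) -!(distrC p.2); lra.
Qed.

Lemma cmod_cont : continuous (@cmod R).
Proof.
apply: (@lip_cont_re 1) => z w; rewrite mul1r.
have h1 := cmod_tri z w 0; have h2 := cmod_tri w z 0; rewrite !subr0 [cmod (w - z)]cmodC in h1 h2.
by rewrite ler_norml; lra.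
Qed.

Lemma limC_le (u : nat -> C) (l : C) (M : R) : u @ \oo --> l -> (forall K, cmod (u K) <= M) -> cmod l <= M.
Proof.
move=> ul uM; have h : (fun K => cmod (u K)) @ \oo --> cmod l by apply: (cvg_comp _ _ ul); exact: cmod_cont.
by apply: (cvgr_to_le h); apply: nearW.
Qed.

Lemma cvg_components (u : nat -> C) (x y : R) : (fun n => Re (u n)) @ \oo --> x ->
  (fun n => Im (u n)) @ \oo --> y -> u @ \oo --> (Complex x y : C).
Proof.
move=> hx hy; apply: cvgC => e e0; have e2 : 0 < e / 2 by rewrite divr_gt0.
move/cvgrPdist_lt : hx => /(_ _ e2) hx; move/cvgrPdist_lt : hy => /(_ _ e2) hy.
apply: filterS2 hx hy => n hx hy; apply: le_lt_trans (cmod_le_l1 _) _.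
rewrite ReD ImD ReN ImN /= -(distrC x) -(distrC y); lra.
Qed.

Lemma powC_lip n z w : cmod z <= 1 -> cmod w <= 1 -> cmod (z ^+ n - w ^+ n) <= n%:R * cmod (z - w).
Proof.
move=> hz hw; elim: n => [|n IH]; first by rewrite !expr0 subrr cmod0 mul0r.
have -> : z ^+ n.+1 - w ^+ n.+1 = z * (z ^+ n - w ^+ n) + (z - w) * w ^+ n by rewrite !exprS; ring.
apply: le_trans (cmodD _ _) _; rewrite !cmodM cmodX -natr1 mulrDl mul1r; apply: lerD.
  by apply: le_trans IH; apply: ler_piMl => //; exact: cmod_ge0.
by apply: ler_piMr; rewrite ?cmod_ge0// exprn_ile1 ?cmod_ge0.
Qed.

Lemma mulC_cont (a : C) : continuous (fun z : C => a * z).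
Proof. by apply: (@lip_contC (cmod a)) => z w; rewrite -mulrBr cmodM. Qed.

End ComplexPlane.

(* locked, since unfolding the limits below makes conversion tests diverge *)
HB.lock Definition psum (R : realType) (e : nat -> nat) (c : nat -> R) (z : (R[i])^o) : (R[i])^o :=
  Complex (rsum (fun i => c i * complex.Re (z ^+ e i))) (rsum (fun i => c i * complex.Im (z ^+ e i))).

Section PowerSum.
Context {R : realType}.
Local Notation C := ((R[i])^o).
Implicit Types z w : C.
Local Notation Re := complex.Re.
Local Notation Im := complex.Im.
Section Exponents.
Variable e : nat -> nat.
Implicit Types c : nat -> R.

(** 1 bounds the size of a power on the closed disc, the exponent its Lipschitz constant. *)
Let wgt i : R := 1 + (e i)%:R.
Let wgt1 i : 1 <= wgt i. Proof. by rewrite lerDl. Qed.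

Lemma psum_cvg c r z : wball wgt r c -> cmod z <= 1 ->
  (fun K => \sum_(i < K) Rc (c i) * z ^+ e i) @ \oo --> psum e c z.
Proof.
move=> hc hz.
have zi i : cmod (z ^+ e i) <= 1 by rewrite cmodX exprn_ile1// cmod_ge0.
have hb (f : nat -> R) : (forall i, `|f i| <= 1) -> wball (fun _ => 1) r (fun i => c i * f i).
  move=> hf K; apply: le_trans (hc K); apply: ler_sum => i _; rewrite mul1r normrM mulrC.
  by apply: ler_pM => //; exact: le_trans (hf i) (wgt1 i).
rewrite psum.unlock; apply: cvg_components.
  rewrite (_ : (fun n => _) = fun K => \sum_(i < K) c i * Re (z ^+ e i)).
    by apply: (rsum_cvg (v := fun _ => 1) (r := r)) => //; apply: hb => i; exact: le_trans (Re_le _) (zi i).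
  by apply/funext => K; rewrite Re_sum; apply: eq_bigr => i _; rewrite ReM /= mul0r subr0.
rewrite (_ : (fun n => _) = fun K => \sum_(i < K) c i * Im (z ^+ e i)).
  by apply: (rsum_cvg (v := fun _ => 1) (r := r)) => //; apply: hb => i; exact: le_trans (Im_le _) (zi i).
by apply/funext => K; rewrite Im_sum; apply: eq_bigr => i _; rewrite ImM /= mul0r addr0.
Qed.

Let psum_eq c r z l : wball wgt r c -> cmod z <= 1 ->
  (fun K => \sum_(i < K) Rc (c i) * z ^+ e i) @ \oo --> l -> psum e c z = l.
Proof. by move=> hc hz hl; apply: (cvg_unique _ (psum_cvg hc hz) hl). Qed.

Lemma psum_lip c r z w : wball wgt r c -> cmod z <= 1 -> cmod w <= 1 ->
  cmod (psum e c z - psum e c w) <= r * cmod (z - w).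
Proof.
move=> hc hz hw; apply: (limC_le (cvgB (psum_cvg hc hz) (psum_cvg hc hw))) => K.
rewrite -[X in cmod X]/(\sum_(i < K) Rc (c i) * z ^+ e i - \sum_(i < K) Rc (c i) * w ^+ e i) -sumrB.
apply: le_trans (cmod_sum _ _) _; apply: le_trans (ler_wpM2r (cmod_ge0 _) (hc K)).
rewrite mulr_suml; apply: ler_sum => i _; rewrite -mulrBr cmodM cmod_Rc mulrAC mulrC.
apply: ler_wpM2r => //; apply: le_trans (powC_lip _ hz hw) _; apply: ler_wpM2r; first exact: cmod_ge0.
by rewrite lerDr.
Qed.

Lemma psum_le c r z : wball wgt r c -> cmod z <= 1 -> cmod (psum e c z) <= r.
Proof.
move=> hc hz; apply: (limC_le (psum_cvg hc hz)) => K.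
apply: le_trans (cmod_sum _ _) _; apply: le_trans (hc K); apply: ler_sum => i _.
rewrite cmodM cmod_Rc mulrC; apply: ler_wpM2r => //; rewrite cmodX.
by apply: le_trans (wgt1 i); rewrite exprn_ile1 ?cmod_ge0.
Qed.

Lemma psum_conj c r z : wball wgt r c -> cmod z <= 1 -> psum e c (cconj z) = cconj (psum e c z).
Proof.
move=> hc hz; apply: (psum_eq hc); first by rewrite cmod_conj.
have cj : continuous (@cconj R).
  by apply: (@lip_contC _ 1) => u v; rewrite mul1r -cconjN -cconjD cmod_conj.
have h := cvg_comp _ _ (psum_cvg hc hz) (cj (psum e c z)).
rewrite (_ : (fun K => _) = @cconj R \o (fun K => \sum_(i < K) Rc (c i) * z ^+ e i)) //.
apply/funext => K /=; apply: (big_ind2 (fun u v : C => u = cconj v)) => [|u v u' v' -> ->|i _].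
- by apply: ceq; rewrite /cconj /= ?oppr0.
- by rewrite cconjD.
- rewrite cconjM cconjX; congr (_ * _); by apply: ceq; rewrite /cconj /= ?oppr0.
Qed.

Lemma psumB c c' r r' z : wball wgt r c -> wball wgt r' c' -> cmod z <= 1 ->
  psum e (fun i => c i - c' i) z = psum e c z - psum e c' z.
Proof.
move=> hc hc' hz.
have w0 i : 0 <= wgt i by exact: le_trans (wgt1 i).
apply: (psum_eq (wballB w0 hc hc') hz).
rewrite (_ : (fun K => _) = (fun K => \sum_(i < K) Rc (c i) * z ^+ e i) \- (fun K => \sum_(i < K) Rc (c' i) * z ^+ e i)).
  exact: cvgB (psum_cvg hc hz) (psum_cvg hc' hz).
apply/funext => K; rewrite /= -sumrB; apply: eq_bigr => i _.
by rewrite RcD RcN mulrBl.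
Qed.

Lemma psum_rot c r z w l : wball wgt r c -> cmod z <= 1 -> cmod w <= 1 -> (forall i, w ^+ e i = l) ->
  psum e c (w * z) = l * psum e c z.
Proof.
move=> hc hz hw wl; apply: (psum_eq hc).
  by rewrite cmodM; apply: mulr_ile1; rewrite ?cmod_ge0.
have h := cvg_comp _ _ (psum_cvg hc hz) (@mulC_cont _ l (psum e c z)).
rewrite (_ : (fun K => _) = (fun x => l * x) \o (fun K => \sum_(i < K) Rc (c i) * z ^+ e i)) //.
by apply/funext => K /=; rewrite mulr_sumr; apply: eq_bigr => i _; rewrite exprMn wl mulrCA.
Qed.

(** Real coefficients make the sum commute with conjugation, so the Lipschitz bound between z and
    its conjugate compares imaginary parts. *)
Lemma psum_im c r z : wball wgt r c -> cmod z <= 1 -> `|Im (psum e c z)| <= r * `|Im z|.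
Proof.
move=> hc hz; have hz' : cmod (cconj z) <= 1 by rewrite cmod_conj.
have h := psum_lip hc hz hz'; rewrite (psum_conj hc hz) in h.
have key (u : C) : cmod (u - cconj u) = 2 * `|Im u|.
  have -> : u - cconj u = Complex 0 (2 * Im u) by apply: ceq; rewrite ?ReD ?ImD ?ReN ?ImN /=; ring.
  by rewrite /cmod /= expr0n add0r sqrtr_sqr normrM ger0_norm.
rewrite !key mulrCA in h; lra.
Qed.


End Exponents.

Lemma psum_shift (e : nat -> nat) (c : nat -> R) r z : wball (fun i => 1 + (e i).+1%:R) r c -> cmod z <= 1 ->
  psum (fun i => (e i).+1) c z = z * psum e c z.
Proof.
move=> hc hz; have hc' : wball (fun i => 1 + (e i)%:R) r c.
  by move=> K; apply: le_trans (hc K); apply: ler_sum => i _; rewrite ler_wpM2r// lerD2l ler_nat.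
apply: (cvg_unique _ (psum_cvg hc hz)).
  by [].
have h := cvg_comp _ _ (psum_cvg hc' hz) (@mulC_cont _ z (psum e c z)).
rewrite (_ : (fun K => _) = (fun x => z * x) \o (fun K => \sum_(i < K) Rc (c i) * z ^+ e i)) //.
by apply/funext => K /=; rewrite mulr_sumr; apply: eq_bigr => i _; rewrite exprS mulrCA.
Qed.



End PowerSum.

(** * Exterior conformal map *)

Section ConformalMap.
Context {R : realType}.
Local Notation C := ((R[i])^o).
Local Notation Re := complex.Re.
Local Notation Im := complex.Im.
Variable m : nat.
Hypothesis m2 : (1 < m)%N.
Notation mult := (mult m). Notation deg := (deg m).

Definition phi (b : nat -> R) (z : C) : C := z + psum deg b z^-1.
Definition dphi (b : nat -> R) (z : C) : C := 1 - psum mult (fun i => b i * (deg i)%:R) z^-1.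

Variables (eta : R) (b : nat -> R).
Hypothesis hb : wball (wt m) eta b.

(** Since M_i^2 <= m [wt i], this bounds the sum of M_i^2 |b_i|, and with it phi'' on |w| >= 1. *)
Definition kap1 : R := eta * m%:R.

Let hsq c q : (forall i, `|c i| * (1 + (q i)%:R) <= (mult i)%:R ^+ 2 * `|b i|) ->
  wball (fun i => 1 + (q i)%:R) kap1 c.
Proof.
move=> h K; apply: le_trans (_ : _ <= m%:R * \sum_(i < K) wt m i * `|b i|) _.
  rewrite mulr_sumr; apply: ler_sum => i _; rewrite mulrC; apply: le_trans (h i) _; rewrite mulrA.
  apply: ler_wpM2r => //; rewrite /wt expr2 [leRHS]mulrCA; apply: ler_wpM2l => //.
  by rewrite -natrM ler_nat -[mult i]/(i.+1 * m)%N mulnC leq_mul.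
by rewrite /kap1 mulrC; apply: ler_wpM2r.
Qed.

Lemma wball_deg : wball (fun i => 1 + (deg i)%:R) kap1 b.
Proof.
apply: hsq => i; rewrite mulrC; apply: ler_wpM2r => //; rewrite nat1r -multE// expr2.
by apply: ler_peMl => //; exact: mult_ge1.
Qed.

Lemma wball_deg2 : wball (fun i => 1 + (deg i)%:R) kap1 (fun i => b i * (deg i)%:R).
Proof.
apply: hsq => i; rewrite normrM normr_nat -mulrA mulrC; apply: ler_wpM2r => //.
by rewrite nat1r -multE// expr2; apply: ler_wpM2r => //; exact: deg_le.
Qed.

Lemma wball_mult : wball (fun i => 1 + (mult i)%:R) kap1 (fun i => b i * (deg i)%:R).
Proof.
apply: hsq => i; rewrite normrM normr_nat -mulrA mulrC; apply: ler_wpM2r => //.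
have e : (mult i)%:R = (deg i)%:R + 1 :> R by rewrite multE// natr1.
have := ler0n R (deg i); rewrite e; nra.
Qed.

Lemma inv_le1 (z : C) : 1 <= cmod z -> cmod z^-1 <= 1.
Proof. by move=> z1; rewrite cmodV invf_le1// (lt_le_trans ltr01). Qed.

Lemma inv_sub (z w : C) : 1 <= cmod z -> 1 <= cmod w -> z^-1 - w^-1 = - (z^-1 * w^-1 * (z - w)).
Proof.
move=> /cmod1_neq0 z0 /cmod1_neq0 w0; rewrite mulrBr mulrAC mulVf// mul1r -mulrA mulVf// mulr1.
by rewrite opprB.
Qed.

Lemma inv_lip (z w : C) : 1 <= cmod z -> 1 <= cmod w -> cmod (z^-1 - w^-1) <= cmod (z - w).
Proof.
move=> z1 w1; rewrite inv_sub// cmodN !cmodM; apply: ler_piMl; first exact: cmod_ge0.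
by apply: mulr_ile1; rewrite ?cmod_ge0 ?inv_le1.
Qed.

(** A Taylor bound by algebraic induction: the exterior of the disc is not convex, so the segment
    from z to w may leave it. *)
Lemma powinv_quad n (z w : C) : 1 <= cmod z -> 1 <= cmod w ->
  cmod (w^-1 ^+ n - z^-1 ^+ n + n%:R * z^-1 ^+ n.+1 * (w - z)) <= n%:R ^+ 2 * cmod (w - z) ^+ 2.
Proof.
move=> z1 w1; set u := w^-1; set v := z^-1; set d := w - z.
have uv : v - u = u * v * d by rewrite -opprB inv_sub// opprK.
have u1 : cmod u <= 1 by exact: inv_le1.
have v1 : cmod v <= 1 by exact: inv_le1.
elim: n => [|n IH]; first by rewrite !expr0 subrr !mul0r addr0 cmod0 expr0n mul0r.
have -> : u ^+ n.+1 - v ^+ n.+1 + n.+1%:R * v ^+ n.+2 * d =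
  u * (u ^+ n - v ^+ n + n%:R * v ^+ n.+1 * d) + n.+1%:R * v ^+ n.+1 * d * (v - u) + (v ^+ n * (u - v) + v ^+ n.+1 * u * d).
  by rewrite -natr1 !exprS; ring.
have -> : v ^+ n * (u - v) + v ^+ n.+1 * u * d = 0 by rewrite -opprB uv exprS; ring.
rewrite addr0; apply: le_trans (cmodD _ _) _; rewrite !cmodM.
have A : cmod u * cmod (u ^+ n - v ^+ n + n%:R * v ^+ n.+1 * d) <= n%:R ^+ 2 * cmod d ^+ 2.
  by apply: le_trans IH; apply: ler_piMl => //; exact: cmod_ge0.
have B : cmod n.+1%:R * cmod (v ^+ n.+1) * cmod d * cmod (v - u) <= n.+1%:R * cmod d ^+ 2.
  have -> : cmod (n.+1%:R : C) = n.+1%:R.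
    have -> : n.+1%:R = Rc n.+1%:R :> C by rewrite /Rc -[RHS]/(real_complex R _) rmorph_nat.
    by rewrite cmod_Rc normr_nat.
  rewrite expr2 -!mulrA; apply: ler_wpM2l => //.
  have dv : cmod (v - u) <= cmod d.
    by rewrite uv !cmodM; apply: ler_piMl; rewrite ?cmod_ge0// mulr_ile1 ?cmod_ge0.
  apply: le_trans (_ : _ <= cmod d * cmod (v - u)) _.
    by apply: ler_piMl; rewrite ?mulr_ge0 ?cmod_ge0// cmodX exprn_ile1 ?cmod_ge0.
  by apply: ler_wpM2l => //; exact: cmod_ge0.
apply: le_trans (lerD A B) _; rewrite -mulrDl; apply: ler_wpM2r; first exact: sqr_ge0.
by rewrite -natrX -natrD -natrX ler_nat; lia.
Qed.

Lemma phi_quad (z w : C) : 1 <= cmod z -> 1 <= cmod w ->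
  cmod (phi b w - phi b z - dphi b z * (w - z)) <= kap1 * cmod (w - z) ^+ 2.
Proof.
move=> z1 w1; have u1 := inv_le1 w1; have v1 := inv_le1 z1.
have -> : phi b w - phi b z - dphi b z * (w - z) = psum deg b w^-1 - psum deg b z^-1 +
   (w - z) * psum mult (fun i => b i * (deg i)%:R) z^-1.
  by rewrite /phi /dphi; move: (psum _ _ _) (psum _ _ _) (psum _ _ _) => p q r; ring.
have c2 := cvg_comp _ _ (psum_cvg wball_mult v1) (@mulC_cont R (w - z) _).
apply: (limC_le (cvgD (cvgB (psum_cvg wball_deg u1) (psum_cvg wball_deg v1)) c2)) => K.
rewrite -[X in cmod X]/(\sum_(i < K) Rc (b i) * w^-1 ^+ deg i - \sum_(i < K) Rc (b i) * z^-1 ^+ deg i +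
  (w - z) * \sum_(i < K) Rc (b i * (deg i)%:R) * z^-1 ^+ mult i).
rewrite mulr_sumr -sumrB -big_split /=; apply: le_trans (cmod_sum _ _) _.
apply: le_trans (ler_wpM2r (sqr_ge0 _) (wball_deg2 K)); rewrite mulr_suml; apply: ler_sum => i _.
have -> : Rc (b i) * w^-1 ^+ deg i - Rc (b i) * z^-1 ^+ deg i + (w - z) * (Rc (b i * (deg i)%:R) * z^-1 ^+ mult i) =
  Rc (b i) * (w^-1 ^+ deg i - z^-1 ^+ deg i + (deg i)%:R * z^-1 ^+ (deg i).+1 * (w - z)).
  have -> : (deg i)%:R = Rc (deg i)%:R :> C by rewrite /Rc -[RHS]/(real_complex R _) rmorph_nat.
  by rewrite RcM multE//; ring.
rewrite cmodM cmod_Rc; apply: le_trans (ler_wpM2l (normr_ge0 _) (powinv_quad _ z1 w1)) _.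
rewrite mulrA; apply: ler_wpM2r; first exact: sqr_ge0.
rewrite normrM normr_nat mulrC expr2 -mulrA [`|b i| * _]mulrC mulrA [leRHS]mulrA; apply: ler_wpM2r => //.
by apply: ler_wpM2r => //; rewrite lerDr.
Qed.

Lemma dphi_lip (z w : C) : 1 <= cmod z -> 1 <= cmod w ->
  cmod (dphi b z - dphi b w) <= kap1 * cmod (z - w).
Proof.
move=> z1 w1; rewrite /dphi opprB addrC addrA subrK.
apply: le_trans (psum_lip wball_mult (inv_le1 w1) (inv_le1 z1)) _.
apply: ler_wpM2l; first exact: wball_ge0 wball_mult.
by rewrite [leRHS]cmodC; exact: inv_lip.
Qed.

Lemma dphi_close (z : C) : 1 <= cmod z -> cmod (dphi b z - 1) <= kap1.
Proof.
by move=> z1; rewrite /dphi addrAC subrr add0r cmodN; apply: (psum_le wball_mult); exact: inv_le1.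
Qed.

Lemma phi_derivable (z : C) : 1 < cmod z -> derivable (phi b) z 1.
Proof.
move=> z1; apply/cvg_ex; exists (dphi b z); apply: cvgC => e e0.
have k0 : 0 < kap1 + 1 by rewrite ltr_wpDl// (wball_ge0 wball_deg).
pose d := Num.min (cmod z - 1) (e / (kap1 + 1)).
have d0 : 0 < d by rewrite lt_min subr_gt0 z1 divr_gt0.
apply/nbhsC; exists d => // h; rewrite subr0 lt_min => /andP[h1 h2] /= h0.
have w1 : 1 <= cmod (h *: 1 + z).
  have := cmod_tri z (h *: 1 + z) 0; rewrite !subr0 opprD addrCA subrr addr0 cmodN.
  by rewrite -[h *: 1]/(h * 1) mulr1; lra.
have := phi_quad (ltW z1) w1; rewrite addrK -[h *: 1]/(h * 1) mulr1 => hq.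
have hc : 0 < cmod h by exact: cmod_gt0.
have -> : h^-1 *: (phi b (h + z) - phi b z) - dphi b z = h^-1 * (phi b (h + z) - phi b z - dphi b z * h).
  by rewrite [RHS]mulrBr mulrCA mulVf// mulr1.
rewrite cmodM cmodV -ltr_pdivlMl ?invr_gt0// invrK; apply: le_lt_trans hq _.
rewrite expr2 mulrCA ltr_pM2l//; apply: le_lt_trans (_ : _ <= (kap1 + 1) * cmod h) _.
  by apply: ler_wpM2r; [exact: cmod_ge0|rewrite lerDl].
by rewrite mulrC -ltr_pdivlMr.
Qed.

(** Makes the filter in [derT] proper, so that its limit is the derivative. *)
Lemma unit_closure (w : C) : unitT w -> closure [set tau | unitT tau /\ tau <> w] w.
Proof.
move=> w1 B /nbhsC[e e0 hB]; pose h := Num.min (e / 2) 1.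
have h0 : 0 < h by rewrite lt_min ltr01 divr_gt0.
have he : h < e by rewrite gt_min; apply/orP; left; lra.
have h1 : h <= 1 by rewrite ge_min lexx orbT.
have e1 : w * expi h - w = w * (expi h - expi 0) by rewrite expi0 mulrBr mulr1.
exists (w * expi h); split; last first.
  by apply: hB; rewrite e1 cmodM w1 mul1r; apply: le_lt_trans (expi_lip _ _) _; rewrite subr0 gtr0_norm.
split; first by rewrite /unitT /= cmodM w1 cmod_expi mulr1.
move=> /eqP; rewrite -subr_eq0 e1 => /eqP h2; have : cmod (w * (expi h - expi 0)) ^+ 2 = 0.
  by rewrite h2 cmod0 expr0n.
rewrite cmodM w1 mul1r chord_expi subr0 => /eqP; apply/negP; rewrite gt_eqF// chord2_gt0// h0 /=.
by have := pi_ge2 R; lra.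
Qed.

Lemma phi_has_derT (w : C) : unitT w -> has_derT (phi b) w (dphi b w).
Proof.
move=> w1; apply: cvgC => e e0; have k0 : 0 < kap1 + 1 by rewrite ltr_wpDl// (wball_ge0 wball_deg).
apply/nbhsC; exists (e / (kap1 + 1)); first exact: divr_gt0.
move=> t ht /= [t1 tw]; have tw0 : t - w != 0 by rewrite subr_eq0; apply/eqP.
have := phi_quad (_ : 1 <= cmod w) (_ : 1 <= cmod t); rewrite w1 t1 lexx => /(_ isT isT) hq.
have hc := cmod_gt0 tw0.
have -> : (phi b t - phi b w) / (t - w) - dphi b w = (t - w)^-1 * (phi b t - phi b w - dphi b w * (t - w)).
  by rewrite [RHS]mulrBr mulrCA mulVf// mulr1 mulrC.
rewrite cmodM cmodV -ltr_pdivlMl ?invr_gt0// invrK; apply: le_lt_trans hq _.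
rewrite expr2 mulrCA ltr_pM2l//; apply: le_lt_trans (_ : _ <= (kap1 + 1) * cmod (t - w)) _.
  by apply: ler_wpM2r; [exact: cmod_ge0|rewrite lerDl].
by rewrite mulrC -ltr_pdivlMr.
Qed.

Lemma derT_phi (w : C) : unitT w -> derT (phi b) w = dphi b w.
Proof.
move=> w1; apply: cvg_lim => //; last exact: phi_has_derT.
by apply: within_nbhs_proper; exact: unit_closure.
Qed.

End ConformalMap.

(** * Extension to the plane and topology of the domain *)

Section PlaneMap.
Context {R : realType}.
Local Notation C := ((R[i])^o).
Local Notation Re := complex.Re.
Local Notation Im := complex.Im.
Implicit Types z w x : C.
Variable m : nat.
Hypothesis m2 : (1 < m)%N.
Notation mult := (mult m). Notation deg := (deg m).
Variables (eta : R) (b : nat -> R).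
Hypothesis hb : wball (wt m) eta b.
Notation k := (kap1 m eta).
Hypothesis k8 : k <= 8^-1.
Let hdeg := wball_deg m2 hb.
Let k0 : 0 <= k. Proof. exact: wball_ge0 hdeg. Qed.

(* the reflection across the unit circle, folded onto the closed disc; it is 1-Lipschitz *)
Definition fold (z : C) : C := if cmod z <= 1 then cconj z else z^-1.

Lemma fold_le1 z : cmod (fold z) <= 1.
Proof.
rewrite /fold; case: (leP (cmod z) 1) => [|h]; first by rewrite cmod_conj.
by apply: inv_le1; exact: ltW.
Qed.

Lemma fold_inv z : 1 <= cmod z -> fold z = z^-1.
Proof.
move=> z1; rewrite /fold; case: (leP (cmod z) 1) => // h; have e : cmod z = 1 by apply/eqP; rewrite eq_le h.
by rewrite invC_unit.
Qed.

(** The inverse of w is q times its conjugate, q = |w|^(-2). The claim becomes polynomial and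
    reduces to (1 + q) |w|^2 = |w|^2 + 1 >= 2 |w|, which dominates twice the scalar product of z and
    w. *)
Let fold_lip_mix z w : cmod z <= 1 -> 1 < cmod w -> cmod (cconj z - w^-1) <= cmod (z - w).
Proof.
move=> z1 w1; have w0 : w != 0 by apply: cmod1_neq0; exact: ltW.
have n0 : 0 < cmod w ^+ 2 by rewrite exprn_gt0// (lt_trans ltr01).
have -> : w^-1 = Rc (cmod w ^+ 2)^-1 * cconj w.
  apply: (mulfI w0); rewrite mulfV// mulrCA mul_cconj -RcM mulVf ?Rc1// gt_eqF//.
set rho := cmod w in w1 n0 *; set q := (rho ^+ 2)^-1.
have q0 : 0 < q by rewrite invr_gt0.
have q1 : q <= 1 by rewrite invf_le1// exprn_ege1// ltW.
have qe : q * rho ^+ 2 = 1 by rewrite /q mulVf// gt_eqF.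
rewrite -ler_sqr ?nnegrE ?cmod_ge0// !cmod_sqr !ReD !ImD !ReN !ImN ReM ImM /= !mul0r subr0 addr0.
have hw : Re w ^+ 2 + Im w ^+ 2 = rho ^+ 2 by rewrite -cmod_sqr.
have hd : Re z * Re w + Im z * Im w <= rho.
  have h : `|Re (z * cconj w)| <= rho.
    by apply: le_trans (Re_le _) _; rewrite cmodM cmod_conj; apply: ler_piMl => //; rewrite (le_trans ler01)// ltW.
  by rewrite ReM /= mulrN opprK in h; exact: le_trans (ler_norm _) h.
rewrite -subr_ge0.
have -> : (Re z - Re w) ^+ 2 + (Im z - Im w) ^+ 2 - ((Re z - q * Re w) ^+ 2 + (- Im z - q * - Im w) ^+ 2) =
  (1 - q) * ((1 + q) * (Re w ^+ 2 + Im w ^+ 2) - 2 * (Re z * Re w + Im z * Im w)) by ring.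
rewrite hw; apply: mulr_ge0; first by rewrite subr_ge0.
rewrite mulrDl qe mul1r; have := sqr_ge0 (rho - 1); rewrite sqrrB expr1n mulr1 -mulr_natl; lra.
Qed.

Lemma fold_lip z w : cmod (fold z - fold w) <= cmod (z - w).
Proof.
rewrite /fold; case: (leP (cmod z) 1) => z1; case: (leP (cmod w) 1) => w1.
- by rewrite -cconjN -cconjD cmod_conj.
- exact: fold_lip_mix.
- by rewrite cmodC [leRHS]cmodC; exact: fold_lip_mix.
- by apply: inv_lip; exact: ltW.
Qed.

Definition emap (z : C) : C := z + psum deg b (fold z).

Lemma emap_phi z : 1 <= cmod z -> emap z = phi m b z.
Proof. by move=> z1; rewrite /emap fold_inv. Qed.

Let pert z w : cmod (psum deg b (fold z) - psum deg b (fold w)) <= k * cmod (z - w).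
Proof.
apply: le_trans (psum_lip hdeg (fold_le1 z) (fold_le1 w)) _.
by apply: ler_wpM2l => //; exact: fold_lip.
Qed.

Lemma emap_lo z w : cmod (z - w) <= 2 * cmod (emap z - emap w).
Proof.
have -> : emap z - emap w = (z - w) + (psum deg b (fold z) - psum deg b (fold w)).
  by rewrite /emap opprD addrACA.
have h := cmodB ((z - w) + (psum deg b (fold z) - psum deg b (fold w))) (psum deg b (fold z) - psum deg b (fold w)).
rewrite addrK in h; have p := pert z w.
have q : k * cmod (z - w) <= 8^-1 * cmod (z - w) by apply: ler_wpM2r => //; exact: cmod_ge0.
have := cmod_ge0 (z - w); move: h p q; move: (cmod (z - w)) (cmod _) (cmod _) (k * _) => ? ? ? ?; lra.
Qed.

Lemma emap_hi z w : cmod (emap z - emap w) <= 2 * cmod (z - w).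
Proof.
rewrite /emap opprD addrACA; apply: le_trans (cmodD _ _) _; have p := pert z w.
have q : k * cmod (z - w) <= 8^-1 * cmod (z - w) by apply: ler_wpM2r => //; exact: cmod_ge0.
have := cmod_ge0 (z - w); move: p q; move: (cmod (z - w)) (cmod _) (k * _) => ? ? ?; lra.
Qed.

Lemma emap_inj : injective emap.
Proof.
move=> z w h; have := emap_lo z w; rewrite h subrr cmod0 mulr0 => h0.
by apply/eqP; rewrite -subr_eq0; apply/eqP; apply: cmod_eq0; apply/eqP; rewrite eq_le h0 cmod_ge0.
Qed.

(** Fixed point of z -> x - psum (fold z). A complex number is coded by a sequence with two entries
    to reuse [wball_contraction]; passing from the modulus to the l^1 norm at most doubles, which
    the constant 1/8 affords. *)
Lemma emap_surj x : exists z, emap z = x.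
Proof.
pose pt (u : nat -> R) : C := Complex (u 0%N) (u 1%N).
pose F z := x - psum deg b (fold z).
pose T (u : nat -> R) i : R := if i is 0%N then Re (F (pt u)) else if i is 1%N then Im (F (pt u)) else 0.
pose r := cmod x + 1 + (cmod x + 1).
have c0 := cmod_ge0 x.
have supp (v : nat -> R) (y : R) : (forall i, v i.+2 = 0) -> `|v 0%N| + `|v 1%N| <= y -> wball (fun _ => 1) y v.
  move=> v0 h [|[|K]]; rewrite ?big_ord0 ?big_ord1 ?mul1r.
  - by apply: le_trans h; rewrite addr_ge0.
  - by apply: le_trans h; rewrite lerDl.
  - rewrite !big_ord_recl big1 /= ?mul1r ?addr0// => i _; rewrite /bump /= !add1n v0 normr0 mulr0//.
have back (v : nat -> R) y : wball (fun _ => 1) y v -> `|v 0%N| + `|v 1%N| <= y.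
  by move=> /(_ 2); rewrite !big_ord_recl big_ord0 /= !mul1r addr0.
have l1 (z : C) y : cmod z <= y -> `|Re z| + `|Im z| <= y + y.
  by move=> h; apply: lerD; apply: le_trans h; [exact: Re_le|exact: Im_le].
have Fd z w : cmod (F z - F w) <= k * cmod (z - w).
  by rewrite /F opprD opprK addrACA subrr add0r -cmodN opprD opprK; exact: pert.
have ptB u v : pt u - pt v = pt (fun i => u i - v i) by [].
have [z hz fz] : exists2 z, wball (fun _ => 1) r z & forall i, T z i = z i.
  apply: wball_contraction => //; first by rewrite /r; lra.
    move=> u _; apply: supp => //; apply: l1; apply: le_trans (cmodB _ _) _; rewrite lerD2l.
    by apply: le_trans (psum_le hdeg (fold_le1 _)) _; apply: le_trans k8 _; lra.
  move=> u v d _ _ /back hd; apply: supp => [i|]; first by rewrite subrr.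
  have h : cmod (F (pt u) - F (pt v)) <= d / 4.
    apply: le_trans (Fd _ _) _; have hc : cmod (pt u - pt v) <= d.
      by rewrite ptB; apply: le_trans (cmod_le_l1 _) _; rewrite /=; exact: hd.
    have d0 : 0 <= d := le_trans (cmod_ge0 _) hc.
    by apply: le_trans (ler_pM k0 (cmod_ge0 _) k8 hc) _; lra.
  by have := l1 _ _ h; rewrite ReD ImD ReN ImN /=; lra.
exists (pt z); have e : pt z = F (pt z).
  by apply: ceq; [rewrite -[RHS]/(T z 0%N) fz|rewrite -[RHS]/(T z 1%N) fz].
by rewrite /emap {1}e /F subrK.
Qed.

Definition einv x : C := projT1 (cid (emap_surj x)).

Lemma einvK x : emap (einv x) = x.
Proof. exact: projT2 (cid (emap_surj x)). Qed.

Lemma emapK z : einv (emap z) = z.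
Proof. by apply: emap_inj; rewrite einvK. Qed.

Lemma einv_cont : continuous einv.
Proof. by apply: (@lip_contC _ 2) => x y; rewrite -{2}[x]einvK -{2}[y]einvK; exact: emap_lo. Qed.

Lemma emap_cont : continuous emap.
Proof. by apply: (@lip_contC _ 2) => z w; exact: emap_hi. Qed.

Lemma emap_conj z : emap (cconj z) = cconj (emap z).
Proof.
rewrite /emap cconjD -(psum_conj hdeg (fold_le1 z)); congr (_ + psum _ _ _).
rewrite /fold cmod_conj; case: (leP (cmod z) 1) => [_|h]; first by rewrite cconjK.
have z0 : z != 0 by apply: cmod1_neq0; exact: ltW.
have c0 : cconj z != 0 by apply: cmod1_neq0; rewrite cmod_conj ltW.
apply: (mulfI c0); rewrite mulfV// -cconjM mulfV//.
by apply: ceq; rewrite /cconj /= ?oppr0.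
Qed.

Lemma emap_rot z : emap (expi (2 * pi / m%:R) * z) = expi (2 * pi / m%:R) * emap z.
Proof.
set om := expi _; have o1 : cmod om = 1 by exact: cmod_expi.
have fr : fold (om * z) = cconj om * fold z.
  rewrite /fold cmodM o1 mul1r; case: (leP (cmod z) 1) => _; first by rewrite cconjM.
  by rewrite invfM (invC_unit o1).
rewrite /emap mulrDr fr; congr (_ + _).
apply: (psum_rot hdeg (fold_le1 z)); first by rewrite cmod_conj o1.
have m0 : m%:R != 0 :> R by rewrite pnatr_eq0 -lt0n ltnW.
(* deg i = (i + 1) m - 1, so this power of the inverse rotation is the rotation itself after i + 1
   full turns. *)
move=> i; rewrite -expiN expiX -(expi2pin i.+1); congr expi.
have e : (deg i)%:R = i.+1%:R * m%:R - 1 :> R by rewrite -natrM -/(mult i) multE// -natr1 addrK.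
by rewrite e; move: (pi : R) (i.+1%:R : R) => p q; field.
Qed.

Let D : set C := [set x | ~ exists z, 1 <= cmod z /\ phi m b z = x].

Lemma domainE : D = [set x | cmod (einv x) < 1].
Proof.
apply/seteqP; split => x /= h.
  rewrite ltNge; apply/negP => h1; apply: h; exists (einv x); split => //.
  by rewrite -emap_phi// einvK.
by move=> [z [z1 e]]; move: h; rewrite -e -emap_phi// emapK ltNge z1.
Qed.

Lemma cmod_einv_cont : continuous (fun x => cmod (einv x)).
Proof. exact: (contC einv_cont (@cmod_cont R)). Qed.

Lemma domain_open : open D.
Proof.
rewrite domainE (_ : [set x | _] = (fun x => cmod (einv x)) @^-1` [set u | u < 1])//.
by apply: open_comp; [move=> x _; exact: cmod_einv_cont|exact: open_lt].
Qed.

Lemma domain_emap z : cmod z < 1 -> D (emap z).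
Proof. by rewrite domainE /= emapK. Qed.

Lemma domain_bounded x : D x -> cmod x <= 2.
Proof.
rewrite domainE /= => h; rewrite -[x]einvK /emap; apply: le_trans (cmodD _ _) _.
have h2 := psum_le hdeg (fold_le1 (einv x)); have := ltW h; have := k8; lra.
Qed.

(* straight segments in the disc, transported by [emap] *)
Let seg x y (u : R) : C := emap (Rc (1 - u) * einv x + Rc u * einv y).

Let seg_in x y u : 0 <= u <= 1 -> D x -> D y -> D (seg x y u).
Proof.
move=> /andP[u0 u1]; rewrite {1 2}domainE /= => hx hy; apply: domain_emap.
apply: le_lt_trans (cmodD _ _) _; rewrite !cmodM !cmod_Rc (ger0_norm u0) ger0_norm ?subr_ge0//.
have [->|un] := eqVneq u 0; first by rewrite subr0 mul1r mul0r addr0.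
have A : (1 - u) * cmod (einv x) <= 1 - u by apply: ler_piMr; [rewrite subr_ge0|exact: ltW].
have B : u * cmod (einv y) < u by rewrite gtr_pMr// lt_def un.
move: A B; move: ((1 - u) * _) (u * _) => p q; lra.
Qed.

Let Rc_cont : continuous (@Rc R).
Proof.
move=> x; apply: cvgC => e e0; move/cvgrPdist_lt : (@cvg_id _ (nbhs x)) => /(_ e e0).
apply: filterS => y hy; have e1 : Rc y - Rc x = Rc (y - x) :> C by rewrite RcD RcN.
by rewrite /= e1 cmod_Rc distrC.
Qed.

Let contCM (T : topologicalType) (f g : T -> C) : continuous f -> continuous g -> continuous (fun t => f t * g t).
Proof. by move=> hf hg t; apply: cvgM; [exact: hf|exact: hg]. Qed.

Let contCD (T : topologicalType) (f g : T -> C) : continuous f -> continuous g -> continuous (fun t => f t + g t).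
Proof. by move=> hf hg t; apply: cvgD; [exact: hf|exact: hg]. Qed.

Let seg_cont x y : continuous (seg x y).
Proof.
apply: (contC (g := emap)); last exact: emap_cont.
apply: contCD; apply: contCM; [|exact: contK| |exact: contK].
  by apply: (contC (g := @Rc R)); [apply: contB; [exact: contK|exact: contI]|exact: Rc_cont].
exact: Rc_cont.
Qed.

Lemma domain_connected : connected D.
Proof.
have D0 : D (emap 0) by apply: domain_emap; rewrite cmod0.
have -> : D = \bigcup_(y in D) (seg (emap 0) y @` `[0, 1]%classic).
  apply/seteqP; split => [y Dy|y [z Dz [u /=]]]; last first.
    by rewrite in_itv/= => hu <-; exact: seg_in.
  exists y => //; exists 1; first by rewrite /= in_itv/= ler01 lexx.
  by rewrite /seg subrr Rc0 Rc1 mul0r mul1r add0r einvK.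
apply: bigcup_connected.
  exists (emap 0) => y Dy; exists 0; first by rewrite /= in_itv/= ler01 lexx.
  by rewrite /seg subr0 Rc0 Rc1 mul0r mul1r addr0 einvK.
move=> y Dy; apply: connected_continuous_connected; first exact: segment_connected.
by apply: continuous_subspaceT; exact: seg_cont.
Qed.

Lemma domain_bounded_domain : bounded_domain D.
Proof.
split; first exact: domain_open.
split; first by exists (emap 0); apply: domain_emap; rewrite cmod0.
split; first exact: domain_connected.
by exists 2; exact: domain_bounded.
Qed.

Lemma domain_simply_connected : simply_connected D.
Proof.
split; first exact: domain_connected.
move=> gam cg g01 gD.
(* The loop is continuous only within [0, 1]; clamping its parameter makes it, and the homotopy,
   continuous everywhere. *)
pose cl (t : R) : R := if t <= 0 then 0 else if t <= 1 then t else 1.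
have cl_in t : 0 <= cl t <= 1.
  by rewrite /cl; case: (leP t 0) => t0; [|case: (leP t 1) => t1]; apply/andP; split; lra.
have cl_id t : 0 <= t <= 1 -> cl t = t.
  by move=> /andP[t0 t1]; rewrite /cl t1; case: leP => // h; apply/eqP; rewrite eq_le t0 h.
have cl_lip (s t : R) : `|cl s - cl t| <= `|s - t|.
  have h1 := ler_norm (s - t); have h2 := ler_norm (t - s); rewrite [`|t - s|]distrC in h2.
  rewrite ler_norml /cl; move: h1 h2; move: (`|s - t|) => q h1 h2.
  by case: (leP s 0) => ?; case: (leP t 0) => ?; case: (leP s 1) => ?; case: (leP t 1) => ?;
    apply/andP; split; lra.
have cgc : continuous (fun t => gam (cl t)).
  move=> t; apply: contCP => e e0.
  have /subspace_continuousP/(_ (cl t)) := cg; rewrite /= in_itv/= cl_in => /(_ isT) h.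
  have hn : nbhs (gam (cl t)) [set z | cmod (z - gam (cl t)) < e] by apply/nbhsC; exists e.
  have /nbhs_ballP[d /= d0 hd] := h _ hn.
  apply/nbhs_ballP; exists d => //= s hs; apply: hd; last by rewrite /= in_itv/= cl_in.
  by rewrite /ball/= in hs *; exact: le_lt_trans (cl_lip _ _) hs.
have h0 : cl 0 = 0 by rewrite /cl lexx.
have h1 : cl 1 = 1 by rewrite /cl lexx lt_geF// ltr01.
exists (fun p => seg (gam (cl p.2)) (gam 0) p.1); split; last split; last split.
- apply: continuous_subspaceT; apply: (contC (g := emap)); last exact: emap_cont.
  apply: contCD; apply: contCM; last exact: contK.
  + apply: (contC (g := @Rc R)); last exact: Rc_cont.
    by apply: contB; [exact: contK|exact: cont1].
  + apply: (contC (g := einv)); last exact: einv_cont.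
    by apply: (contC (f := snd)) cgc; exact: cont2.
  + by apply: (contC (g := @Rc R)); [exact: cont1|exact: Rc_cont].
- move=> t ht; split; rewrite /seg /=; first by rewrite subr0 Rc0 Rc1 mul0r mul1r addr0 einvK cl_id.
  by rewrite subrr Rc0 Rc1 mul0r mul1r add0r einvK.
- by move=> u hu /=; rewrite h0 h1 g01.
- by move=> u t hu ht /=; apply: seg_in => //; apply: gD; rewrite ?cl_in// lexx ler01.
Qed.

Lemma domain_sym : m_fold_symmetric m D.
Proof.
exists 0 => x; rewrite add0r subr0 domainE /=.
have o1 : cmod (expi (2 * pi / m%:R) : C) = 1 by exact: cmod_expi.
by rewrite -{2}[x]einvK -emap_rot emapK cmodM o1 mul1r.
Qed.

Lemma domain_boundary : topo_boundary D = phi m b @` (@unitT R).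
Proof.
have cl x : closure D x <-> cmod (einv x) <= 1.
  split=> [hx|hx].
    have cD : closed [set x | cmod (einv x) <= 1].
      rewrite (_ : [set x | _] = (fun x => cmod (einv x)) @^-1` [set u | u <= 1])//.
      by apply: closed_comp; [move=> y _; exact: cmod_einv_cont|exact: closed_le].
    apply: cD; apply: closure_subset hx; rewrite domainE => y /= h; exact: ltW.
  (* Approach along the radius: u z is within e / 4 of z, and [emap] at most doubles distances. *)
  move=> B /nbhsC[e e0 hB]; pose z := einv x; pose u := Num.max 0 (1 - e / 4).
  have u0 : 0 <= u by rewrite le_max lexx.
  have u1 : u < 1 by rewrite gt_max ltr01 /=; lra.
  have ue : 1 - u <= e / 4 by have : 1 - e / 4 <= u by [rewrite le_max lexx orbT]; lra.
  exists (emap (Rc u * z)); split.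
    apply: domain_emap; rewrite cmodM cmod_Rc ger0_norm//.
    by apply: le_lt_trans u1; apply: ler_piMr.
  apply: hB; rewrite -[x]einvK; apply: le_lt_trans (emap_hi _ _) _.
  rewrite -/z -[X in _ - X]mul1r -mulrBl cmodM -Rc1 -RcN -RcD cmod_Rc distrC ger0_norm ?subr_ge0 ?ltW//.
  have : (1 - u) * cmod z <= e / 4 by apply: le_trans ue; apply: ler_piMr => //; rewrite subr_ge0 ltW.
  move: (_ * cmod z) => q; lra.
have Di x : D x -> interior D x.
  by move=> Dx; apply: open_nbhs_nbhs; split => //; exact: domain_open.
rewrite /topo_boundary; apply/seteqP; split => x.
  move=> [/cl h1 h2]; have e : cmod (einv x) = 1.
    apply/eqP; rewrite eq_le h1 /= leNgt; apply/negP => h3; apply: h2; apply: Di.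
    by rewrite domainE.
  by exists (einv x) => //; rewrite -emap_phi ?einvK// e.
move=> [w w1 <-]; rewrite /unitT /= in w1; rewrite -emap_phi ?w1//; split.
  by apply/cl; rewrite emapK w1.
by move=> /interior_subset; rewrite domainE /= emapK w1 ltxx.
Qed.

End PlaneMap.

Section RealHelpers.
Context {R : realType}.

Lemma dquad (r : R -> R) t (L : R) : (forall h, `|r (t + h) - r t| <= L * h ^+ 2) -> hasD r t 0.
Proof.
move=> h; have hc : (fun u : R => u^-1 *: (r (u *: 1 + t) - r t)) @ 0^' --> (0 : R).
  apply/cvgrPdist_le => e e0; have L0 : 0 < `|L| + 1 by rewrite ltr_wpDl.
  apply/nbhs_ballP; exists (e / (`|L| + 1)); first exact: divr_gt0.
  move=> u; rewrite /ball/= sub0r normrN => hu u0.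
  rewrite sub0r normrN -[u *: 1]/(u * 1) mulr1 -[u^-1 *: _]/(u^-1 * _) normrM normfV.
  have n0 : 0 < `|u| by rewrite normr_gt0.
  rewrite ler_pdivrMl// [u + t]addrC; apply: le_trans (h u) _.
  apply: le_trans (_ : _ <= (`|L| + 1) * `|u| ^+ 2) _.
    rewrite real_normK ?num_real//; apply: ler_wpM2r; first exact: sqr_ge0.
    by apply: le_trans (ler_norm _) _; rewrite lerDl.
  rewrite expr2 mulrCA ler_pM2l// mulrC -ler_pdivlMr//; exact: ltW.
by split; [apply/cvg_ex; exists 0|exact: cvg_lim hc].
Qed.

Lemma lip_cont (f : R -> R) (L : R) : (forall s t, `|f s - f t| <= L * `|s - t|) -> continuous f.
Proof.
move=> h t; apply/cvgrPdist_le => e e0; have L0 : 0 < `|L| + 1 by rewrite ltr_wpDl.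
apply/nbhs_ballP; exists (e / (`|L| + 1)); first exact: divr_gt0.
move=> s; rewrite /ball/= => hs; apply: le_trans (h t s) _.
apply: le_trans (_ : _ <= (`|L| + 1) * `|t - s|) _.
  by apply: ler_wpM2r => //; apply: le_trans (ler_norm _) _; rewrite lerDl.
rewrite mulrC -ler_pdivlMr//; exact: ltW.
Qed.

End RealHelpers.

(** * The boundary curve and the vertical slices of the domain *)

Section PatchOfMap.
Context {R : realType}.
Local Notation C := ((R[i])^o).
Local Notation Re := complex.Re.
Local Notation Im := complex.Im.
Implicit Types z w : C.
Variable m : nat.
Hypothesis m2 : (1 < m)%N.
Notation mult := (mult m). Notation deg := (deg m).
Variables (eta : R) (b : nat -> R).
Hypothesis hb : wball (wt m) eta b.
Notation k := (kap1 m eta).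
Hypothesis k8 : k <= 8^-1.
Let hdeg := wball_deg m2 hb.
Let k0 : 0 <= k. Proof. exact: wball_ge0 hdeg. Qed.
Let cs (t : R) : cos t ^+ 2 + sin t ^+ 2 = 1 := cos2Dsin2 t.

Definition curve (t : R) : C := phi m b (expi t).
Definition dcurve (t : R) : C := 'i * expi t * dphi m b (expi t).
Notation f1 := (fun t => Re (curve t)). Notation f2 := (fun t => Im (curve t)).
Notation g1 := (fun t => Re (dcurve t)). Notation g2 := (fun t => Im (dcurve t)).

Let e1 (t : R) : cmod (expi t : C) <= 1. Proof. by rewrite cmod_expi. Qed.
Let e1' (t : R) : 1 <= cmod (expi t : C). Proof. by rewrite cmod_expi. Qed.
Let invE (t : R) : (expi t : C)^-1 = expi (- t).
Proof. by rewrite expiN invC_unit ?cmod_expi. Qed.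

Lemma curveE t : curve t = expi t + psum deg b (expi (- t)).
Proof. by rewrite /curve /phi invE. Qed.

Lemma dcurveE t : dcurve t = 'i * (expi t - psum deg (fun i => b i * (deg i)%:R) (expi (- t))).
Proof.
rewrite /dcurve /dphi -mulrA mulrBr mulr1 invE; congr (_ * (_ - _)).
have h : wball (fun i => 1 + (deg i).+1%:R) k (fun i => b i * (deg i)%:R).
  by move=> K; apply: le_trans (wball_mult m2 hb K); apply: ler_sum => i _; rewrite multE.
have -> : psum mult (fun i => b i * (deg i)%:R) (expi (- t)) = psum (fun i => (deg i).+1) (fun i => b i * (deg i)%:R) (expi (- t)).
  by congr psum; apply/funext => i; rewrite multE.
by rewrite (psum_shift h)// mulrA -expiD addrN expi0 mul1r.
Qed.

Let emapE z : emap m b z = z + psum deg b (fold z). Proof. by []. Qed.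

Lemma curve_emap t : curve t = emap m b (expi t).
Proof. exact: (esym (emap_phi m b (e1' t))). Qed.

Let curveN t : curve (- t) = cconj (curve t).
Proof. by rewrite !curve_emap expiN (emap_conj m2 hb). Qed.

Let dcurveN t : dcurve (- t) = - cconj (dcurve t).
Proof.
have hK := psum_conj (wball_deg2 m2 hb) (e1 (- t)).
rewrite -expiN opprK in hK; rewrite !dcurveE opprK hK.
move: (psum _ _ _) => p; rewrite expiN; move: (expi t) => q; apply: ceq; rewrite /cconj !(ReM, ImM, ReN, ImN, ReD, ImD) /=; ring.
Qed.

Let curveP t : curve (t + 2 * pi) = curve t. Proof. by rewrite /curve expi2pi. Qed.
Let dcurveP t : dcurve (t + 2 * pi) = dcurve t. Proof. by rewrite /dcurve expi2pi. Qed.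

Let quad t h : cmod (curve (t + h) - curve t - dphi m b (expi t) * (expi (t + h) - expi t)) <= k * h ^+ 2.
Proof.
apply: le_trans (phi_quad m2 hb (e1' t) (e1' (t + h))) _; apply: ler_wpM2l => //.
have -> : h ^+ 2 = `|t + h - t| ^+ 2 by rewrite addrC addKr real_normK ?num_real.
by rewrite ler_sqr ?nnegrE ?cmod_ge0//; exact: expi_lip.
Qed.

(** Up to a quadratic error the curve moves like l e^(i s) with l = [dphi] at t, whose derivative is
    explicit. *)
Let df t : hasD f1 t (g1 t) /\ hasD f2 t (g2 t).
Proof.
set l := dphi m b (expi t).
have lin (p q : R) : hasD (fun s => p * cos s + q * sin s) t (- p * sin t + q * cos t).
  apply: deq; first by apply: dD; (apply: dM; [exact: dC|]); [exact: (dcos (dI t))|exact: (dsin (dI t))].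
  by rewrite /=; ring.
have r1 : hasD (fun s => Re (curve s) - Re (l * expi s)) t 0.
  apply: (@dquad _ _ _ k) => h; apply: le_trans (quad t h); rewrite -/l.
  have -> : Re (curve (t + h)) - Re (l * expi (t + h)) - (Re (curve t) - Re (l * expi t)) =
     Re (curve (t + h) - curve t - l * (expi (t + h) - expi t)).
    rewrite mulrBr; move: (curve (t + h)) (curve t) (l * expi (t + h)) (l * expi t) => A B P Q.
    by rewrite !(ReD, ReN); ring.
  exact: Re_le.
have r2 : hasD (fun s => Im (curve s) - Im (l * expi s)) t 0.
  apply: (@dquad _ _ _ k) => h; apply: le_trans (quad t h); rewrite -/l.
  have -> : Im (curve (t + h)) - Im (l * expi (t + h)) - (Im (curve t) - Im (l * expi t)) =
     Im (curve (t + h) - curve t - l * (expi (t + h) - expi t)).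
    rewrite mulrBr; move: (curve (t + h)) (curve t) (l * expi (t + h)) (l * expi t) => A B P Q.
    by rewrite !(ImD, ImN); ring.
  exact: Im_le.
split.
  have := dD r1 (lin (Re l) (- Im l)).
  rewrite (_ : (fun s => _) = f1); last by apply/funext => s; rewrite ReM /=; ring.
  move=> h; apply: deq h _; rewrite /dcurve -/l !ReM !ImM /=; ring.
have := dD r2 (lin (Im l) (Re l)).
rewrite (_ : (fun s => _) = f2); last by apply/funext => s; rewrite ImM /=; ring.
move=> h; apply: deq h _; rewrite /dcurve -/l !ImM !ReM /=; ring.
Qed.

Let df1 t : hasD f1 t (g1 t). Proof. by have [] := df t. Qed.
Let df2 t : hasD f2 t (g2 t). Proof. by have [] := df t. Qed.

Let dcurve_le t : cmod (dcurve t) <= 2.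
Proof.
rewrite /dcurve !cmodM cmod_expi mulr1.
have -> : cmod ('i%C : C) = 1 by rewrite /cmod /= expr0n expr1n add0r sqrtr1.
rewrite mul1r; have h := dphi_close m2 hb (e1' t).
have := cmodD (dphi m b (expi t) - 1) 1; rewrite subrK cmod1; have := k8; lra.
Qed.

Let dcurve_lip s t : cmod (dcurve s - dcurve t) <= 2 * `|s - t|.
Proof.
rewrite !dcurveE -mulrBr cmodM.
have -> : cmod ('i%C : C) = 1 by rewrite /cmod /= expr0n expr1n add0r sqrtr1.
have step (A P B Q : C) : A - P - (B - Q) = (A - B) + (Q - P) by ring.
rewrite mul1r step; apply: le_trans (cmodD _ _) _.
have h1 := expi_lip s t; have h2 := psum_lip (wball_deg2 m2 hb) (e1 (- t)) (e1 (- s)).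
have h3 := expi_lip (- t) (- s).
have h4 : k * cmod (expi (- t) - expi (- s) : C) <= 8^-1 * `|s - t|.
  apply: ler_pM; [exact: k0|exact: cmod_ge0|exact: k8|apply: le_trans h3 _].
  by rewrite opprK addrC.
by have := normr_ge0 (s - t); lra.
Qed.

Let cg1 : continuous g1.
Proof.
apply: (@lip_cont _ _ 2) => s t; apply: le_trans (dcurve_lip s t).
by rewrite -ReN -ReD; exact: Re_le.
Qed.

Let cg2 : continuous g2.
Proof.
apply: (@lip_cont _ _ 2) => s t; apply: le_trans (dcurve_lip s t).
by rewrite -ImN -ImD; exact: Im_le.
Qed.

(** The perturbation of an imaginary part is at most r sin t, so it cannot overcome sin t even near
    0 and pi. Positivity of f2 and monotonicity of f1 rest on this. *)
Let sin_bd (c : nat -> R) (r t : R) : 0 < t < pi -> wball (fun i => 1 + (deg i)%:R) r c -> r <= 8^-1 ->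
  `|Im (psum deg c (expi (- t)))| < sin t.
Proof.
move=> /andP[t0 tp] hc r8; have s0 : 0 < sin t by rewrite sin_gt0_pi// t0 tp.
apply: le_lt_trans (psum_im hc (e1 _)) _; rewrite /= sinN normrN gtr0_norm//.
have : r * sin t <= 8^-1 * sin t by apply: ler_wpM2r => //; exact: ltW.
lra.
Qed.

Let f2_gt0 (t : R) : 0 < t < pi -> 0 < f2 t.
Proof.
move=> ht /=; rewrite curveE ImD /=; have := sin_bd ht hdeg k8; rewrite ltr_norml; lra.
Qed.

Let g1_lt0 (t : R) : 0 < t < pi -> g1 t < 0.
Proof.
move=> ht /=; rewrite dcurveE ReM ReD ImD ReN ImN /= mul0r add0r mul1r.
have := sin_bd ht (wball_deg2 m2 hb) k8; rewrite ltr_norml; lra.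
Qed.

Let f1_dec : {in `[0, pi]%R &, {homo f1 : x y /~ x < y}}.
Proof.
move=> x y; rewrite !in_itv/= => /andP[x0 xp] /andP[y0 yp] yx.
have [c hc e] := @MVT R f1 g1 y x yx (fun c _ => df1 c) (continuous_subspaceT (dcontT df1)).
have c0 : 0 < c < pi.
  by move: hc; rewrite in_itv/= => /andP[c1 c2]; rewrite (le_lt_trans y0 c1) (lt_le_trans c2 xp).
by have /= g0 := g1_lt0 c0; rewrite -subr_lt0 e nmulr_rlt0// subr_gt0.
Qed.

Let f20 : f2 0 = 0.
Proof. by have := congr1 (@complex.Im R) (curveN 0); rewrite oppr0 /=; lra. Qed.

Let f2pi : f2 pi = 0.
Proof.
have := congr1 (@complex.Im R) (curveN pi); rewrite -(curveP (- pi)) (_ : - pi + 2 * pi = pi :> R) /=; last ring.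
lra.
Qed.

Let f2_ge0 (t : R) : 0 <= t <= pi -> 0 <= f2 t.
Proof.
move=> /andP[t0 tp]; have [->|tn0] := eqVneq t 0; first by rewrite f20.
have [->|tnp] := eqVneq t pi; first by rewrite f2pi.
by apply/ltW/f2_gt0; rewrite !lt_def tn0 t0 eq_sym tnp tp.
Qed.

Let f1_inj (s t : R) : 0 <= s <= pi -> 0 <= t <= pi -> f1 s = f1 t -> s = t.
Proof.
have mem (u : R) : 0 <= u <= pi -> u \in `[0, pi]%R by rewrite in_itv.
move=> /mem hs /mem ht /= e; have [h|h|//] := ltgtP s t.
- by have /= := f1_dec ht hs h; rewrite e ltxx.
- by have /= := f1_dec hs ht h; rewrite e ltxx.
Qed.

Let f1_itv (t : R) : 0 <= t <= pi -> f1 pi <= f1 t <= f1 0.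
Proof.
move=> /[dup] ht /andP[t0 tp]; have p0 := pi_ge0 R; apply/andP; split.
  have [->//|h] := eqVneq t pi; apply/ltW/f1_dec; rewrite ?in_itv/= ?p0 ?lexx ?ht//.
  by rewrite lt_def eq_sym h.
have [->//|h] := eqVneq t 0; apply/ltW/f1_dec; rewrite ?in_itv/= ?p0 ?lexx ?ht//.
by rewrite lt_def h.
Qed.

Let D2 : set (R * R) := [set y | [set x : C | ~ exists z, 1 <= cmod z /\ phi m b z = x] (toC y)].
(** The modulus of the preimage under [emap]: below 1 in the domain, equal to 1 on the curve. *)
Let rho p : R := cmod (einv m2 hb k8 (toC p)).

Let D2E p : D2 p <-> rho p < 1.
Proof. by rewrite /D2 /= -[X in X <-> _]/([set x : C | ~ exists z, 1 <= cmod z /\ phi m b z = x] (toC p)) (domainE m2 hb k8). Qed.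

Let crho : continuous rho.
Proof.
move=> p; apply: (cvg_comp (@toC R) (fun x => cmod (einv m2 hb k8 x)) (@cont_toC R p)).
exact: cmod_einv_cont.
Qed.

Let rho_sym x y : rho (x, - y) = rho (x, y).
Proof.
rewrite /rho -[toC (x, - y)]/(cconj (toC (x, y))) -{1}[toC (x, y)](einvK m2 hb k8).
by rewrite -(emap_conj m2 hb) emapK cmod_conj.
Qed.

Let rho_big p : rho p <= 1 -> cmod (toC p) <= 2.
Proof.
rewrite /rho => h; rewrite -[toC p](einvK m2 hb k8) emapE; apply: le_trans (cmodD _ _) _.
have h2 := psum_le hdeg (fold_le1 (einv m2 hb k8 (toC p))); have := k8; lra.
Qed.

Let rho_zero x y : rho (x, y) = 1 -> exists t, [/\ 0 <= t <= pi, f1 t = x & `|y| = f2 t].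
Proof.
rewrite /rho; set w := einv _ _ _ _ => w1; have wE : emap m b w = toC (x, y) by rewrite einvK.
have cw : -1 <= Re w <= 1 by rewrite -ler_norml -w1 Re_le.
pose t := acos (Re w); have ht : 0 <= t <= pi by rewrite acos_ge0// acos_lepi.
have ct : cos t = Re w by rewrite acosK ?in_itv.
have st : sin t = `|Im w|.
  by rewrite sin_acos// -sqrtr_sqr; congr Num.sqrt; rewrite -[1](expr1n _ 2) -w1 cmod_sqr addrC addKr.
exists t; have hy : Im (curve t) >= 0 := f2_ge0 ht.
have [i0|i0] := leP 0 (Im w).
  have ew : w = expi t by apply: ceq; rewrite /= ?ct ?st ?ger0_norm.
  have e : curve t = toC (x, y) by rewrite curve_emap -ew.
  by split=> //; rewrite e ?e//= ger0_norm//; move: hy; rewrite e.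
have ew : w = cconj (expi t) by apply: ceq; rewrite /= ?ct ?st ?ltr0_norm ?opprK.
have e : curve t = toC (x, - y) by rewrite curve_emap -[expi t]cconjK -ew (emap_conj m2 hb) wE.
split=> //; rewrite e//= -normrN ger0_norm//; move: hy; rewrite e.
exact.
Qed.

Let ivt x (y Y : R) : y <= Y -> Num.min (rho (x, y)) (rho (x, Y)) <= 1 <= Num.max (rho (x, y)) (rho (x, Y)) ->
  exists2 c, y <= c <= Y & rho (x, c) = 1.
Proof.
move=> yY h; have cc : {within `[y, Y], continuous (fun c => rho (x, c))}.
  by apply: continuous_subspaceT; apply: (contC _ crho); apply: contP; [exact: contK|exact: contI].
by have [c hc e] := IVT yY cc h; exists c => //; move: hc; rewrite in_itv.
Qed.

(** The region where rho <= 1 lies in the disc of radius 2, so climbing by 3 leaves it; starting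
    from a value at most 1, rho would have to take the value 1 on the way. *)
Let out_up x y : (forall y', y <= y' -> rho (x, y') = 1 -> False) -> 0 <= y -> 1 < rho (x, y).
Proof.
move=> h y0; rewrite ltNge; apply/negP => h1.
have big : 1 <= rho (x, y + 3).
  rewrite leNgt; apply/negP => /ltW/rho_big h3.
  by have := le_trans (Im_le _) h3; rewrite /= ger0_norm; lra.
have yY : y <= y + 3 by lra.
have [|c /andP[c1 _] hc] := @ivt x _ _ yY; last exact: h c1 hc.
by rewrite ge_min h1 le_max big orbT.
Qed.

Let slice_out (t y : R) : 0 <= t <= pi -> 0 <= y -> f2 t <= y -> 1 <= rho (f1 t, y).
Proof.
move=> ht y0; rewrite le_eqVlt => /predU1P[<-|hy].
  have e : toC (f1 t, f2 t) = emap m b (expi t) by rewrite -curve_emap; case: (curve t).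
  by rewrite /rho e emapK cmod_expi.
apply/ltW/out_up => // y' yy' /rho_zero[s [hs e1s e2s]]; have st := f1_inj hs ht e1s.
by move: e2s; rewrite st ger0_norm; lra.
Qed.

(** By symmetry [emap] preserves the real axis, so (f1 t, 0) is the image of some real c in [-1, 1];
    |c| = 1 would put it on the curve and force f2 t = 0. *)
Let axis_in (t : R) : 0 <= t <= pi -> 0 < f2 t -> rho (f1 t, 0) < 1.
Proof.
move=> ht f2t; pose u (r : R) := Re (emap m b (Rc r)).
have cu : continuous u.
  apply: (@lip_cont _ _ 2) => r s; rewrite /u -ReN -ReD; apply: le_trans (Re_le _) _.
  apply: le_trans (emap_hi m2 hb k8 _ _) _; rewrite (_ : Rc r - Rc s = Rc (r - s)) ?cmod_Rc//.
  by rewrite RcD RcN.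
have u1 : u 1 = f1 0 by rewrite /u curve_emap expi0.
have um1 : u (-1) = f1 pi.
  have ep : expi pi = Rc (-1) :> C by rewrite /expi cospi sinpi.
  by rewrite /u -ep -curve_emap.
have [c hc e] : exists2 c, c \in `[-1, 1]%R & u c = f1 t.
  apply: IVT; [lra|by apply: continuous_subspaceT; exact: cu|].
  have /andP[h1 h2] := f1_itv ht; rewrite u1 um1 ge_min le_max.
  by apply/andP; split; apply/orP; [left|right].
have ec : emap m b (Rc c) = toC (f1 t, 0).
  apply: ceq; first by rewrite -/(u c) e.
  have := congr1 (@complex.Im R) (emap_conj m2 hb (Rc c)).
  rewrite (_ : cconj (Rc c) = Rc c); last by rewrite /cconj /Rc /= oppr0.
  by rewrite /=; lra.
have er : rho (f1 t, 0) = `|c| by rewrite /rho -ec emapK cmod_Rc.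
have c1 : `|c| <= 1 by rewrite ler_norml; move: hc; rewrite in_itv.
rewrite lt_neqAle er c1 andbT; apply/negP => /eqP h; rewrite -er in h.
have [s [hs e1s e2s]] := rho_zero h.
by move: e2s; rewrite (f1_inj hs ht e1s) normr0; lra.
Qed.

Let slice_in (t y : R) : 0 <= t <= pi -> 0 <= y -> y < f2 t -> rho (f1 t, y) < 1.
Proof.
move=> ht y0 hy; rewrite ltNge; apply/negP => h1.
have h0 := axis_in ht (le_lt_trans y0 hy).
have [|c /andP[c0 cy] hc] := @ivt (f1 t) _ _ y0; first by rewrite ge_min (ltW h0) le_max h1 orbT.
have [s [hs e1s e2s]] := rho_zero hc.
by move: e2s; rewrite (f1_inj hs ht e1s) ger0_norm; lra.
Qed.

Let rho_abs x y : rho (x, `|y|) = rho (x, y).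
Proof. by have [y0|y0] := leP 0 y; [rewrite ger0_norm|rewrite ltr0_norm// rho_sym]. Qed.

Lemma domain_patch : patch f1 f2 g1 g2 D2.
Proof.
split.
- exact: df1.
- exact: df2.
- exact: cg1.
- exact: cg2.
- by move=> t; rewrite curveN.
- by move=> t; rewrite curveN.
- by move=> t; rewrite dcurveN ReN.
- by move=> t; rewrite dcurveN ImN /= opprK.
- by move=> t; rewrite curveP.
- by move=> t; rewrite curveP.
- by move=> t; rewrite dcurveP.
- by move=> t; rewrite dcurveP.
- exact: f20.
- exact: f2pi.
- exact: f2_gt0.
- exact: f1_dec.
- have -> : D2 = rho @^-1` [set u | u < 1] by apply/seteqP; split => p /=; rewrite D2E.
  rewrite -[_ @^-1` _]setTI; apply: (cont_meas2 crho) => //.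
  by rewrite (_ : [set u | u < 1] = `]-oo, 1[%classic)//; apply/seteqP; split => u /=; rewrite in_itv.
- move=> t y ht; rewrite D2E -rho_abs; split => h.
    by rewrite ltNge; apply/negP => h1; have := slice_out ht (normr_ge0 y) h1; rewrite leNgt h.
  exact: slice_in.
- move=> x y; rewrite D2E -rho_abs => h; apply/negP => hx.
  have : 1 < rho (x, `|y|).
    apply: out_up => // y' _ /rho_zero[s [hs e _]]; apply: hx.
    by rewrite -e; exact: f1_itv.
  by rewrite ltNge (ltW h).
- exists 2 => t; split; apply: le_trans (dcurve_le t); [exact: Re_le|exact: Im_le].
Qed.

(** t0 is the angle of z = einv x, so e^(i t0) is a point of the circle nearest to z and lies within
    2 |z - e^(i t)| of e^(i t). [emap_lo] gives another factor 2, and squaring gives 16. *)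
Lemma domain_chord x : exists t0, forall t, 16^-1 * chord2 (t - t0) <= dist2 x (f1 t, f2 t).
Proof.
pose z := einv m2 hb k8 (toC x); have [t0 ht0] := polar z; exists t0 => t.
have -> : dist2 x (f1 t, f2 t) = cmod (toC x - curve t) ^+ 2.
  by rewrite /dist2 cmod_sqr !(ReD, ImD, ReN, ImN) /=.
rewrite -(einvK m2 hb k8 (toC x)) -/z curve_emap -chord_expi.
have h1 := emap_lo m2 hb k8 z (expi t).
have h2 : cmod (z - expi t0) <= cmod (z - expi t).
  have -> : cmod (z - expi t0) = `|cmod z - 1|.
    by rewrite {1}ht0 -[X in _ - X]mul1r -mulrBl cmodM cmod_expi mulr1 -Rc1 -RcN -RcD cmod_Rc.
  have a1 := cmodD (z - expi t) (expi t); have a2 := cmodB z (z - expi t).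
  by rewrite subrK cmod_expi in a1; rewrite opprB addrC subrK cmod_expi in a2; rewrite ler_norml; lra.
have h3 := cmod_tri (expi t) z (expi t0); rewrite [cmod (expi t - z)]cmodC in h3.
have h4 : cmod (expi t - expi t0 : C) <= 4 * cmod (emap m b z - emap m b (expi t)) by lra.
have : cmod (expi t - expi t0 : C) ^+ 2 <= (4 * cmod (emap m b z - emap m b (expi t))) ^+ 2.
  by rewrite ler_sqr ?nnegrE ?cmod_ge0// mulr_ge0 ?cmod_ge0.
rewrite exprMn; move: (cmod _ ^+ 2) (cmod _ ^+ 2) => p q; rewrite (_ : 4 ^+ 2 = 16 :> R); last by rewrite -natrX.
lra.
Qed.

End PatchOfMap.

(** * Boundary equation along the branch *)

Section BoundaryEquation.
Context {R : realType}.
Local Notation C := ((R[i])^o).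
Local Notation Re := complex.Re.
Local Notation Im := complex.Im.
Notation mu := (@lebesgue_measure R).
Variable m : nat.
Hypothesis m2 : (1 < m)%N.
Notation mult := (mult m). Notation deg := (deg m).
Variables (eta : R) (b : nat -> R).
Hypothesis hb : wball (wt m) eta b.
Hypothesis k8 : kap1 m eta <= 8^-1.
Notation f1 := (fun t => Re (curve m b t)). Notation f2 := (fun t => Im (curve m b t)).
Notation g1 := (fun t => Re (dcurve m b t)). Notation g2 := (fun t => Im (dcurve m b t)).
Let w1 i : 1 <= wt m i :> R := wt_ge1 m2 i.
Let e1 (t : R) : cmod (expi t : C) <= 1. Proof. by rewrite cmod_expi. Qed.

(** Bridge between complex power sums and real mode sums: both are limits of the same partial sums,
    up to the factor [u]. *)
Lemma lin_lim (l1 l2 : nat -> R -> R -> R) (u L : C) (S : nat -> C) th et :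
  (forall i, wiener (wt m i) (l1 i)) -> (forall i, wiener (wt m i) (l2 i)) ->
  (forall K, S K = u * \sum_(i < K) Rc (b i) * Complex (l1 i th et) (l2 i th et)) ->
  S @ \oo --> L -> L = u * Complex (lin l1 b th et) (lin l2 b th et).
Proof.
move=> h1 h2 hS hL; apply: (cvg_unique _ hL).
  by [].
have -> : S = fun K => u * \sum_(i < K) Rc (b i) * Complex (l1 i th et) (l2 i th et) by apply/funext.
have h : (fun K => \sum_(i < K) Rc (b i) * Complex (l1 i th et) (l2 i th et) : C) @ \oo -->
    (Complex (lin l1 b th et) (lin l2 b th et) : C).
  apply: cvg_components.
  - under eq_fun => K.
      rewrite Re_sum; under eq_bigr => i _ do rewrite ReM /= mul0r subr0.
      over.
    exact: rsum_cvg (lin_wball _ _ h1 hb) _.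
  - under eq_fun => K.
      rewrite Im_sum; under eq_bigr => i _ do rewrite ImM /= mul0r addr0.
      over.
    exact: rsum_cvg (lin_wball _ _ h2 hb) _.
by apply: (cvg_comp _ _ h); exact: mulC_cont.
Qed.

Let expN (M : nat) (t : R) : (expi (- t) : C) ^+ M = cconj (expi (M%:R * t)).
Proof. by rewrite expiX mulrN expiN. Qed.

Let expdeg i (t : R) : (expi (- t) : C) ^+ deg i = expi t * cconj (expi ((mult i)%:R * t)).
Proof. by rewrite -expN (multE m2) [in RHS]exprS mulrA -expiD addrN expi0 mul1r. Qed.

Let mulR i (t : R) : (mult i)%:R * t = i.+1%:R * (m%:R * t).
Proof. by rewrite /mult natrM mulrA. Qed.

Lemma curve_polar t et : curve m b t = expi t * (1 + Complex (cP1 b (m%:R * t) et) (cP2 b (m%:R * t) et)).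
Proof.
rewrite curveE mulrDr mulr1; congr (_ + _).
apply: (lin_lim _ _ _ (psum_cvg (wball_deg m2 hb) (e1 (- t)))); [exact: wiener_mP1|exact: wiener_mP2|].
move=> K; rewrite mulr_sumr; apply: eq_bigr => i _; rewrite expdeg mulrCA; congr (_ * _).
congr (_ * _); rewrite mulR; exact: ceq.
Qed.

Lemma dcurve_polar t et :
  dcurve m b t = 'i * expi t * (1 + Complex (cE1 m b (m%:R * t) et) (cE2 m b (m%:R * t) et)).
Proof.
rewrite (dcurveE m2 hb) -mulrA; congr (_ * _); rewrite mulrDr mulr1 -[X in _ = _ + X]opprK -mulNr; congr (_ - _).
apply: (lin_lim _ _ _ (psum_cvg (wball_deg2 m2 hb) (e1 (- t)))); [exact: wiener_mE1|exact: wiener_mE2|].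
move=> K; rewrite mulr_sumr; apply: eq_bigr => i _; rewrite expdeg.
by rewrite mulR RcM; apply: ceq; rewrite !(ReM, ImM, ReN, ImN) /mE1 /mE2 /=; ring.
Qed.

Lemma dcurve_shift t et : dcurve m b (t + et) =
  'i * expi (t + et) * (1 + Complex (cT1 m b (m%:R * t) et) (cT2 m b (m%:R * t) et)).
Proof.
rewrite (dcurve_polar _ et); congr (_ * (1 + Complex _ _)); rewrite /cE1 /cE2 /cT1 /cT2 /lin;
  congr rsum; apply/funext => i; rewrite /mE1 /mE2 /mT1 /mT2 !mulrDr mulR;
  by rewrite -!mulR.
Qed.

(** A geometric sum: for a = e^(-i t) and x = e^(-i et) it extracts from each power the chord of the
    circle, leaving the mode [mG1] + i [mG2]. *)
Let telescope (a x : C) n : a != 0 -> x != 0 -> (a * x) ^+ n - a ^+ n =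
  ((a * x)^-1 - a^-1) * - (\sum_(j < n) a ^+ n.+1 * x ^+ j.+1).
Proof.
move=> a0 x0; rewrite exprMn -mulr_sumr.
have -> : \sum_(j < n) x ^+ j.+1 = x * \sum_(j < n) x ^+ j by rewrite mulr_sumr; apply: eq_bigr => j _; rewrite exprS.
have -> : a ^+ n * x ^+ n - a ^+ n = a ^+ n * (x ^+ n - 1) by ring.
by rewrite subrX1 exprS; move: (a ^+ n) (\sum_(_ < _) _) => p q; field; rewrite a0 x0.
Qed.

Lemma curve_chord t et : curve m b (t + et) - curve m b t =
  (expi (t + et) - expi t) * (1 + Complex (cG1 m b (m%:R * t) et) (cG2 m b (m%:R * t) et)).
Proof.
have -> : curve m b (t + et) - curve m b t = (expi (t + et) - expi t) + (psum deg b (expi (- (t + et))) - psum deg b (expi (- t))).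
  by rewrite !curveE; ring.
rewrite mulrDr mulr1; congr (_ + _).
apply: (lin_lim _ _ _ (cvgB (psum_cvg (wball_deg m2 hb) (e1 (- (t + et)))) (psum_cvg (wball_deg m2 hb) (e1 (- t)))));
  [exact: wiener_mG1|exact: wiener_mG2|].
move=> K; rewrite -[LHS]/(_ - _) -sumrB mulr_sumr; apply: eq_bigr => i _; rewrite -mulrBr mulrCA; congr (_ * _).
have u0 (s : R) : (expi s : C) != 0 by rewrite cmod1_neq0// cmod_expi.
have invE (s : R) : (expi (- s) : C)^-1 = expi s by rewrite expiN invC_unit ?cmod_conj ?cmod_expi// cconjK.
have -> : expi (- (t + et)) = expi (- t) * expi (- et) :> C by rewrite opprD expiD.
rewrite telescope// -expiD -opprD !invE; congr (_ * _); rewrite -(multE m2).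
apply: ceq; rewrite !(ReN, ImN) ?Re_sum ?Im_sum /mG1 /mG2 /=.
- congr (- _); apply: eq_bigr => j _; rewrite !expiX -expiD /= -mulR -[in RHS]cosN.
  by congr cos; ring.
- rewrite -sumrN; apply: eq_bigr => j _; rewrite !expiX -expiD /= -mulR -sinN.
  by congr sin; ring.
Qed.

Lemma stretch_ge0 th et : 0 <= 1 + stretch m b th et.
Proof.
rewrite /stretch; set x := cG1 _ _ _ _; set y := cG2 _ _ _ _.
by rewrite (_ : _ + _ = (1 + x) ^+ 2 + y ^+ 2) ?addr_ge0 ?sqr_ge0//; ring.
Qed.

Lemma kern_curve be t et : kern be (f1 t, f2 t) (f1 (t + et), f2 (t + et)) =
  kap be et * (1 + stretch m b (m%:R * t) et) `^ (- be).
Proof.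
rewrite /kern /kap -powRM ?chord2_ge0 ?stretch_ge0//; congr (_ `^ _).
rewrite dist2C /dist2 /= -!ReN -!ImN -!ReD -!ImD -cmod_sqr curve_chord cmodM exprMn chord_expi addrC addKr; congr (_ * _).
by rewrite cmod_sqr !(ReD, ImD) /stretch /=; ring.
Qed.

Lemma cross_curve t et : g1 (t + et) * g2 t - g2 (t + et) * g1 t = - crossp m b (m%:R * t) et.
Proof.
rewrite /= dcurve_shift (dcurve_polar t et) !(ReM, ImM, ReD, ImD) /= cosD sinD /crossp.
have := cos2Dsin2 t; move: (cos t) (sin t) => c s cs.
move: (cE1 _ _ _ _) (cE2 _ _ _ _) (cT1 _ _ _ _) (cT2 _ _ _ _) (cos et) (sin et) => x1 x2 y1 y2 p q.
rewrite -[RHS]mulr1 -[X in _ = _ * X]cs; ring.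
Qed.

Lemma dot_curve t : f1 t * g1 t + f2 t * g2 t =
  - ((1 + cP1 b (m%:R * t) 0) * cE2 m b (m%:R * t) 0 - cP2 b (m%:R * t) 0 * (1 + cE1 m b (m%:R * t) 0)).
Proof.
rewrite /= (curve_polar t 0) (dcurve_polar t 0) !(ReM, ImM, ReD, ImD) /=.
have := cos2Dsin2 t; move: (cos t) (sin t) => c s cs.
move: (cE1 _ _ _ _) (cE2 _ _ _ _) (cP1 _ _ _) (cP2 _ _ _) => x1 x2 y1 y2.
rewrite -[RHS]mulr1 -[X in _ = _ * X]cs; ring.
Qed.

Variables (alpha om : R).
Hypothesis alP : 0 < alpha < 1.
Notation be := (alpha / 2).
Hypothesis branch : forall th, Calpha alpha / (2 * pi) * kint be (cJ m be b) th +
  om * ((1 + cP1 b th 0) * cE2 m b th 0 - cP2 b th 0 * (1 + cE1 m b th 0)) = 0.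
Let beP : 0 < be < 2^-1. Proof. by have := alP; lra. Qed.
Let hP := domain_patch m2 hb k8.
Let c16 : (0 : R) < 16^-1. Proof. by []. Qed.

Lemma pot_curve_int (x : R * R) : mu.-integrable `[0, 2 * pi] (EFin \o (fun t => kern be x (f1 t, f2 t) * g1 t)) /\
  mu.-integrable `[0, 2 * pi] (EFin \o (fun t => kern be x (f1 t, f2 t) * g2 t)).
Proof.
have [G hG] := p_gb hP; have h := domain_chord m2 hb k8.
split; apply: (kern_integrable hP beP c16 h (G := G)).
- exact: p_cg1 hP.
- by move=> t; have [] := hG t.
- exact: p_g1P hP.
- exact: p_cg2 hP.
- by move=> t; have [] := hG t.
- exact: p_g2P hP.
Qed.

(** Shifting the period makes the angle from t the integration variable; [kern_curve] and
    [cross_curve] then recognize [cJ] at m t. *)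
Lemma boundary_curve t : Calpha alpha / (2 * pi) *
    (pot f1 f2 be g1 (f1 t, f2 t) * g2 t - pot f1 f2 be g2 (f1 t, f2 t) * g1 t) +
  om * (f1 t * g1 t + f2 t * g2 t) = 0.
Proof.
have [i1 i2] := pot_curve_int (f1 t, f2 t).
suff e : kint be (cJ m be b) (m%:R * t) =
    g1 t * pot f1 f2 be g2 (f1 t, f2 t) - g2 t * pot f1 f2 be g1 (f1 t, f2 t).
  have := branch (m%:R * t); rewrite e dot_curve.
  move: (_ - _) (pot _ _ _ _ _) (pot _ _ _ _ _) (g1 t) (g2 t) (_ / _) => d V1 V2 x y c h.
  rewrite -[RHS]oppr0 -h; ring.
rewrite /pot /oint -!RintegralZl// -RintegralB//; [|exact: intZ..].
rewrite -(Rint_period_shift t); first last.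
- by move=> s; rewrite (p_f1P hP) (p_f2P hP) (p_g1P hP) (p_g2P hP).
- by apply: measurable_funB; apply: measurable_funM => //; apply: measurable_funM;
    [exact: (kern_meas hP)|exact: cont_meas (p_cg2 hP)|exact: (kern_meas hP)|exact: cont_meas (p_cg1 hP)].
rewrite /kint; apply: eq_Rintegral => et _; rewrite [et + t]addrC kern_curve /cJ.
have := cross_curve t et; move: (kap _ _) (_ `^ _) => x y.
move: (crossp _ _ _ _) (Re _) (Im _) (Re _) (Im _) => c p q r s hc.
rewrite -[c]opprK -hc; ring.
Qed.

End BoundaryEquation.

(** * Regularity, distance and expansion of the boundary map *)

Section PowerSeriesMap.
Context {R : realType}.
Local Notation C := ((R[i])^o).
Variable m : nat.
Hypothesis m2 : (1 < m)%N.
Notation mult := (mult m). Notation deg := (deg m).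
Implicit Types (b : nat -> R) (eta d alpha : R) (z w : C).

Lemma phi_zero b z : (forall i, b i = 0) -> 1 <= cmod z -> phi m b z = z.
Proof.
move=> b0 z1; have hb : wball (wt m) 0 b by move=> K; rewrite big1// => i _; rewrite b0 normr0 mulr0.
have h := psum_le (wball_deg m2 hb) (inv_le1 z1); rewrite /phi [psum _ _ _]cmod_eq0 ?addr0//.
by apply/eqP; rewrite eq_le cmod_ge0 (le_trans h)// /kap1 mul0r.
Qed.

(** Distances on the circle are at most 2, so d = d^(1 - alpha) d^alpha <= 2 d^(1 - alpha). *)
Lemma holder_lip alpha L (f : C -> C) : 0 < alpha < 1 -> 0 <= L ->
  (forall w z, unitT w -> unitT z -> cmod (f w - f z) <= L * cmod (w - z)) -> holderT (1 - alpha) f (2 * L).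
Proof.
move=> /andP[a0 a1] L0 hf w z w1 z1; apply: le_trans (hf _ _ w1 z1) _.
rewrite [2 * L]mulrC -mulrA ler_wpM2l//.
have d2 : cmod (w - z) <= 2 by apply: le_trans (cmodB _ _) _; rewrite w1 z1.
set d := cmod (w - z) in d2 *; have d0 : 0 <= d := cmod_ge0 _.
have [->|dn] := eqVneq d 0; first by rewrite mulr_ge0// powR_ge0.
rewrite -{1}(powRr1 d0) -{1}(subrK alpha 1) powRD; last by apply/implyP; rewrite dn.
rewrite mulrC ler_wpM2r ?powR_ge0// (le_trans (ge0_ler_powR _ _ _ d2)) ?nnegrE ?(ltW a0)//.
by rewrite -[leRHS](powRr1 (ler0n R 2)) ler_powR ?ler1n// ltW.
Qed.

Section Regularity.
Variables (eta : R) (b : nat -> R) (alpha : R).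
Hypothesis hb : wball (wt m) eta b.
Hypothesis alP : 0 < alpha < 1.
Let k0 : 0 <= kap1 m eta. Proof. exact: wball_ge0 (wball_deg m2 hb). Qed.

Lemma phi_C2a : C2a alpha (phi m b).
Proof.
split=> [w w1|]; first by exists (dphi m b w); exact: (phi_has_derT m2 hb).
exists (2 * kap1 m eta); apply: holder_lip => // w z w1 z1.
by rewrite !(derT_phi m2 hb)//; apply: (dphi_lip m2 hb); rewrite ?w1 ?z1.
Qed.

Lemma phi_dist_le b' eta' d e : wball (wt m) eta' b' -> wball (wt m) d (fun i => b i - b' i) ->
  4 * kap1 m d <= e -> C2a_dist_le alpha (phi m b) (phi m b') e.
Proof.
move=> hb' hd de; have kd0 : 0 <= kap1 m d := wball_ge0 (wball_deg m2 hd).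
have dE z : 1 <= cmod z -> dphi m b z - dphi m b' z = dphi m (fun i => b i - b' i) z - 1.
  move=> z1; rewrite /dphi [RHS]addrAC subrr add0r opprB addrC addrA subrK.
  have -> : (fun i => (b i - b' i) * (deg i)%:R) = fun i => b i * (deg i)%:R - b' i * (deg i)%:R.
    by apply/funext => i; rewrite mulrBl.
  by rewrite (psumB (wball_mult m2 hb) (wball_mult m2 hb') (inv_le1 z1)) opprB.
have derE w : unitT w -> derT (phi m b) w - derT (phi m b') w = dphi m (fun i => b i - b' i) w - 1.
  by move=> w1; rewrite (derT_phi m2 hb)// (derT_phi m2 hb')// dE// w1.
exists (kap1 m d), (kap1 m d), (2 * kap1 m d); split; first by apply: le_trans de; lra.
split=> [w w1|].
  rewrite /phi opprD addrACA subrr add0r -(psumB (wball_deg m2 hb) (wball_deg m2 hb')); last first.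
    by apply: inv_le1; rewrite w1.
  by apply: (psum_le (wball_deg m2 hd)); apply: inv_le1; rewrite w1.
split=> [w w1|]; first by rewrite derE//; apply: (dphi_close m2 hd); rewrite w1.
apply: (holder_lip alP kd0) => w z w1 z1.
apply: le_trans (_ : cmod (dphi m (fun i => b i - b' i) w - 1 - (dphi m (fun i => b i - b' i) z - 1)) <= _).
  by rewrite -(derE w w1) -(derE z z1).
have h : 1 <= cmod w by rewrite w1.
have h' : 1 <= cmod z by rewrite z1.
have := dphi_lip m2 hd h h'; move: (dphi _ _ w) (dphi _ _ z) => p q.
by rewrite (_ : p - 1 - (q - 1) = p - q)//; ring.
Qed.

Lemma phi_series z : (b 0%N = 0 -> forall i, b i = 0) -> 1 <= cmod z -> exists L : C,
  (fun N : nat => \sum_(2 <= n < N) Rc (b n.-1 / b 0%N) / z ^+ (n * m) : C) @ \oo --> L /\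
  phi m b z = z * (1 + Rc (b 0%N) / z ^+ m + Rc (b 0%N) * L).
Proof.
move=> bz z1; have z0 := cmod1_neq0 z1; have iz := inv_le1 z1.
have hm : wball (fun i => 1 + (deg i).+1%:R) eta b.
  move=> K; apply: le_trans (hb K); apply: ler_sum => i _; rewrite ler_wpM2r//.
  by rewrite -multE// /wt -[i.+2%:R]natr1 mulrDr mulr1 lerD2r mulr_ege1 ?mult_ge1 ?ler1n.
have hs := psum_cvg hm iz.
have phiE : phi m b z = z * (1 + psum (fun i => (deg i).+1) b z^-1).
  by rewrite (psum_shift hm iz) mulrDr mulr1 mulrA mulfV// mul1r.
(* When b 0 = 0 the quotients in the series are 0 by convention, and [bz] makes phi the identity, so
   L = 0 fits. *)
pose L : C := if b 0%N == 0 then 0 else (Rc (b 0%N))^-1 * (psum (fun i => (deg i).+1) b z^-1 - Rc (b 0%N) / z ^+ m).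
exists L; rewrite /L; case: ifPn => b0.
  move/eqP: b0 => b0; split; last by rewrite (phi_zero (bz b0) z1) b0 Rc0 mul0r mulr0 !addr0 mulr1.
  rewrite (_ : (fun N => _) = cst 0); first exact: cvg_cst.
  by apply/funext => N; apply: big1 => n _; rewrite b0 invr0 mulr0 Rc0 mul0r.
have b0C : Rc (b 0%N) != 0 :> C by apply: contra b0 => /eqP/(congr1 (@complex.Re R)) /= ->.
split; last by rewrite phiE mulrA mulfV// mul1r; congr (_ * _); ring.
rewrite -(cvg_shiftn 2).
have h : (fun N => (Rc (b 0%N))^-1 * (\sum_(i < N.+1) Rc (b i) * z^-1 ^+ (deg i).+1 - Rc (b 0%N) / z ^+ m) : C) @ \oo -->
   ((Rc (b 0%N))^-1 * (psum (fun i => (deg i).+1) b z^-1 - Rc (b 0%N) / z ^+ m) : C).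
  apply: (@cvg_comp _ _ _ (fun N => \sum_(i < N.+1) Rc (b i) * z^-1 ^+ (deg i).+1 - Rc (b 0%N) / z ^+ m : C) (fun w => (Rc (b 0%N))^-1 * w)); last exact: mulC_cont.
  apply: cvgB; last exact: cvg_cst.
  by move: hs; rewrite -(cvg_shiftS).
apply: cvg_trans h; apply: near_eq_cvg; near=> N.
rewrite big_ord_recl /= addrAC -multE// /mult mul1n exprVn subrr add0r mulr_sumr.
rewrite addn2 -[2%N in RHS]add0n big_addn subn2 /= big_mkord; apply: eq_bigr => i _.
rewrite -multE// /mult exprVn mulrA addn2 /= -RcV -RcM [_^-1 * _]mulrC; congr (Rc (b _ / _) / z ^+ (_ * _)).
Unshelve. all: by end_near.
Qed.

End Regularity.
End PowerSeriesMap.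

(** * The V-state attached to a point of the branch *)

Section VState.
Context {R : realType}.
Local Notation C := ((R[i])^o).
Local Notation Re := complex.Re.
Local Notation Im := complex.Im.
Notation mu := (@lebesgue_measure R).
Variable m : nat.
Hypothesis m2 : (1 < m)%N.
Variables (eta : R) (b : nat -> R).
Hypothesis hb : wball (wt m) eta b.
Hypothesis k8 : kap1 m eta <= 8^-1.
Notation f1 := (fun t => Re (curve m b t)). Notation f2 := (fun t => Im (curve m b t)).
Notation g1 := (fun t => Re (dcurve m b t)). Notation g2 := (fun t => Im (dcurve m b t)).
Let hP := domain_patch m2 hb k8.
Let m0 : (m%:R : R) != 0. Proof. by rewrite pnatr_eq0 -lt0n ltnW. Qed.

(** If phi is the identity on the circle, the angular perturbations [cP2] and [cE2] vanish, and the
    functional [Phi] at index 0 of their difference is a positive multiple of b 0. The exponent 1/4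
    is an arbitrary choice in (0, 1/2). *)
Lemma phi_nontrivial : (forall w, unitT w -> phi m b w = w) -> b 0%N = 0.
Proof.
move=> h; have be : 0 < (4^-1 : R) < 2^-1 by apply/andP; split; lra.
have ce t : curve m b t = expi t by apply: h; exact: cmod_expi.
have e1 : f1 = cos by apply/funext => t; rewrite ce.
have e2 : f2 = sin by apply/funext => t; rewrite ce.
have ge t : dcurve m b t = 'i * expi t.
  have := p_df1 hP t; have := p_df2 hP t; rewrite e1 e2 => -[_ h2] [_ h1].
  have [_ c1] := dcos (dI t); have [_ c2] := dsin (dI t).
  have -> : dcurve m b t = Complex (- sin t) (cos t).
    by apply: ceq; rewrite -?h1 -?h2 ?c1 ?c2 mulr1.
  by apply: ceq; rewrite ?ReM ?ImM /=; ring.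
have z (u v : C) : u != 0 -> u = u * (1 + v) -> v = 0.
  by move=> u0 /esym; rewrite -[RHS]mulr1 => /(mulfI u0)/eqP; rewrite addrC -subr_eq0 addrK => /eqP.
have u0 (s : R) : (expi s : C) != 0 by rewrite cmod1_neq0// cmod_expi.
have i0 : ('i : C) != 0 by rewrite eq_complex /= oner_eq0 andbF.
have P2 th et : cP2 b th et = 0.
  have := curve_polar m2 hb (th / m%:R) et; rewrite ce [m%:R * _]mulrC divfK// => /(z _ _ (u0 _)).
  by move/(congr1 (@complex.Im R)).
have E2 th et : cE2 m b th et = 0.
  have := dcurve_polar m2 hb (th / m%:R) et; rewrite ge [m%:R * _]mulrC divfK// => /(z _ _ (mulf_neq0 i0 (u0 _))).
  by move/(congr1 (@complex.Im R)).
have := Phi_cE2P2 m2 be 0 hb.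
have -> : (fun th et => cE2 m b th et - cP2 b th et) = fun th et => cP2 b th et - cP2 b th et.
  by apply/funext => th; apply/funext => et; rewrite E2 P2.
have w2 := wiener_lin (@wt_ge1 R m m2) (wiener_mP2 m2) hb.
rewrite (PhiB be 0 w2 w2) subrr => /esym/eqP; rewrite mulf_eq0 => /orP[/eqP//|].
have g := gam_gt0 be 0; have p := @pi_gt0 R.
have m1 : (0 : R) < (mult m 0)%:R by rewrite ltr0n /mult mul1n ltnW.
by rewrite mulf_eq0 (gt_eqF g) orbF mulf_eq0 (gt_eqF m1) orbF mulf_eq0 (gt_eqF p) pnatr_eq0.
Qed.

Variables (alpha om : R).
Hypothesis alP : 0 < alpha < 1.
Notation be := (alpha / 2).
Hypothesis branch : forall th, Calpha alpha / (2 * pi) * kint be (cJ m be b) th +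
  om * ((1 + cP1 b th 0) * cE2 m b th 0 - cP2 b th 0 * (1 + cE1 m b th 0)) = 0.

Lemma vstate_eq_phi : vstate_eq alpha om (phi m b).
Proof.
rewrite /vstate_eq => w /unit_expi[t ->]; set F := (X in Tintegrable X).
have FE s : Tintegrand F s = dcurve m b s * Rc (kern be (f1 t, f2 t) (f1 s, f2 s)).
  rewrite /Tintegrand.
  have -> : F (expi s) = dphi m b (expi s) * Rc (kern be (f1 t, f2 t) (f1 s, f2 s)).
    have -> : F (expi s) = dphi m b (expi s) * (Rc (cmod (curve m b t - curve m b s) `^ alpha))^-1.
      by rewrite /F (derT_phi m2 hb (cmod_expi s)).
    rewrite -RcV; congr (_ * Rc _).
    rewrite /kern /dist2 /= -!ReN -!ImN -!ReD -!ImD -cmod_sqr powRN -powR_mulrn ?cmod_ge0// -powRrM.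
    by congr (_ `^ _)^-1; field.
  by rewrite /dcurve; move: (Rc _) (dphi m b (expi s)) (expi s) => x y z; ring.
have FR : (fun s => (Re (Tintegrand F s))%:E) = EFin \o (fun s => kern be (f1 t, f2 t) (f1 s, f2 s) * g1 s).
  by apply/funext => s /=; rewrite FE ReM /= mulr0 subr0 mulrC.
have FI : (fun s => (Im (Tintegrand F s))%:E) = EFin \o (fun s => kern be (f1 t, f2 t) (f1 s, f2 s) * g2 s).
  by apply/funext => s /=; rewrite FE ImM /= mulr0 add0r mulrC.
have sE : [set s : R | (0 <= s <= 2 * pi)%R] = `[0, 2 * pi]%classic.
  by apply/seteqP; split => x /=; rewrite in_itv.
have [i1 i2] := pot_curve_int m2 hb k8 alP (f1 t, f2 t).
split; first by rewrite /Tintegrable sE FR FI.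
have -> : Tint F = Complex (pot f1 f2 be g1 (f1 t, f2 t)) (pot f1 f2 be g2 (f1 t, f2 t)).
  by rewrite /Tint sE FR FI.
have := boundary_curve m2 hb k8 alP branch t.
rewrite (derT_phi m2 hb (cmod_expi t)).
(* The tangent [dcurve] is i w phi', so the last two factors of the equation form the conjugate of -
   i times the tangent. *)
have W z : z * cconj (expi t) * cconj (dphi m b (expi t)) = z * cconj (- 'i * dcurve m b t).
  rewrite -[LHS]mulrA -cconjM; congr (_ * cconj _).
  rewrite /dcurve; move: (dphi m b (expi t)) (expi t) => p q.
  by apply: ceq; rewrite !(ReM, ImM, ReN, ImN) /=; ring.
rewrite W.
rewrite -/(curve m b t); set V1 := pot f1 f2 be g1 _; set V2 := pot f1 f2 be g2 _.
move: V1 V2 (dcurve m b t) (curve m b t) => V1 V2 [p q] [x y].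
have -> : 1 / (Rc (2 * pi) * 'i) = Complex 0 (- (2 * pi)^-1) :> C.
  have p0 : 2 * pi != 0 :> R by rewrite gt_eqF ?twopi_gt0.
  have u0 : Rc (2 * pi) * 'i != 0 :> C by apply/eqP => /(congr1 (@complex.Im R)); rewrite ImM /= mulr1 mul0r addr0; exact/eqP.
  apply: (mulfI u0); rewrite mul1r mulfV//; apply: ceq; rewrite !(ReM, ImM) /=; move: p0; move: (2 * pi) => c c0; field; exact: c0.
move=> h; rewrite -[RHS]h /cconj !(ReM, ImM, ReN, ImN, ReD, ImD) /=.
by move: (Calpha alpha) (2 * pi)^-1 => c d; ring.
Qed.

Lemma domain_rotating_patch :
  rotating_patch alpha [set x | ~ exists z, 1 <= cmod z /\ phi m b z = x] om.
Proof.
split; first exact: (domain_bounded_domain m2 hb k8).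
split; first exact: (domain_simply_connected m2 hb k8).
exists 0; apply: (rotating_patch_solution hP alP _ (domain_chord m2 hb k8)) => //.
exact: (boundary_curve m2 hb k8 alP branch).
Qed.

Lemma domain_C2a_boundary : C2a_boundary alpha [set x | ~ exists z, 1 <= cmod z /\ phi m b z = x].
Proof.
exists (phi m b); split; first exact: (phi_C2a m2 hb alP).
split=> [w z w1 z1|].
  by rewrite -!emap_phi ?w1 ?z1//; exact: (emap_inj m2 hb k8).
split=> [w w1|]; last exact: (domain_boundary m2 hb k8).
rewrite (derT_phi m2 hb)// => d0; have := dphi_close m2 hb (eq_ind_r (fun x => 1 <= x) (lexx 1) w1).
rewrite d0 sub0r cmodN cmod1; have := k8; lra.
Qed.

Lemma phi_conformal : conformal_on [set z | 1 < cmod z] (phi m b).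
Proof.
split=> [z /= z1|z w /= /ltW z1 /ltW w1]; first exact: (phi_derivable m2 hb).
by rewrite -!emap_phi//; exact: (emap_inj m2 hb k8).
Qed.

End VState.

Unset Implicit Arguments.
Set Strict Implicit.
Local Open Scope complex_scope.

Local Open Scope complex_scope.

Theorem theorem6p1 (R : realType) (alpha : R) (m : nat) :
  0 < alpha < 1 -> (2 <= m)%N ->
  exists (a : R) (Om : R -> R) (phi : R -> (R[i])^o -> (R[i])^o),
    0 < a /\
    (* continuity of s |-> Omega(s) and of s |-> phi_s in C^{2-alpha}(T) *)
    {within [set s | - a < s < a], continuous Om} /\
    (forall s, - a < s < a -> C2a alpha (phi s)) /\
    (forall s0, - a < s0 < a -> forall e : R, 0 < e ->
       exists2 d : R, 0 < d &
         forall s, - a < s < a -> `|s - s0| < d ->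
           C2a_dist_le alpha (phi s) (phi s0) e) /\
    Om 0 = Omega_m alpha m /\
    (forall w, unitT w -> phi 0 w = w) /\
    forall s, - a < s < a ->
      vstate_eq alpha (Om s) (phi s) /\
      (s <> 0 -> exists w, unitT w /\ phi s w <> w) /\
      exists (c : nat -> R) (Phi : (R[i])^o -> (R[i])^o),
        (forall z, 1 <= cmod z ->
           exists L : (R[i])^o,
             (fun N : nat => \sum_(2 <= n < N) Rc (c n) / z ^+ (n * m))
               @ \oo --> L /\
             Phi z = z * (1 + Rc s / z ^+ m + Rc s * L)) /\
        (forall w, unitT w -> phi s w = Phi w) /\
        conformal_on [set z | 1 < cmod z] Phi /\
        let D := [set x | ~ exists z, 1 <= cmod z /\ Phi z = x] in
        m_fold_symmetric m D /\
        rotating_patch alpha D (Om s) /\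
        C2a_boundary alpha D.
Proof.
move=> alP m2; have be0 : 0 < alpha / 2 < 2^-1 by lra.
have m0 : 0 < m%:R :> R by rewrite ltr0n ltnW.
have a2 : 2 * (alpha / 2) = alpha by field.
(* With this radius [kap1] equals 1/8, the bound under which the domain was analysed. *)
have eta0 : 0 < (8 * m%:R)^-1 :> R by rewrite invr_gt0 mulr_gt0.
have k8 : kap1 m (8 * m%:R)^-1 <= 8^-1 :> R by rewrite /kap1 invfM -mulrA mulVf ?mulr1// gt_eqF.
have [a [L [b [Om [a0 L0 [Om0 b00 bs] H1 H2]]]]] := vstate_branch m2 be0 eta0.
rewrite a2 in Om0 H1.
have hs s : - a < s < a -> `|s| < a by rewrite ltr_norml.
have hb s (sa : - a < s < a) := (H1 s (hs s sa)).1.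
have bz s : - a < s < a -> b s 0%N = 0 -> forall i, b s i = 0.
  by move=> sa; rewrite bs ?hs// => -> i; exact: b00.
exists a, Om, (fun s => phi m (b s)); split; first exact: a0.
split.
  have -> : [set s : R | - a < s < a] = `]- a, a[%classic by apply/seteqP; split => x /=; rewrite in_itv.
  rewrite continuous_open_subspace; last exact: itv_open.
  move=> x /set_mem /= xa; apply/cvgrPdist_le => e e0.
  have L1 : 0 < L + 1 by rewrite ltr_wpDl.
  have hx : \forall y \near x, `|x - y| <= e / (L + 1).
    by apply/nbhs_ballP; exists (e / (L + 1)) => [/=|z /ltW]; rewrite ?divr_gt0.
  near=> y.
  have ya : y \in `]- a, a[%R by near: y; exact: near_in_itvoo.
  have xa' := xa; rewrite !in_itv /= in xa' ya; apply: le_trans (H2 _ _ (hs _ xa') (hs _ ya)).2 _.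
  apply: (@le_trans _ _ ((L + 1) * `|x - y|)); first by rewrite ler_wpM2r// lerDl.
  rewrite mulrC -ler_pdivlMr//; near: y; exact: hx.
split=> [s sa|]; first exact: (phi_C2a m2 (hb s sa) alP).
split=> [s0 s0a e e0|].
  (* The distance is at most 4 [kap1] at the radius L |s - s0|, that is 4 L m |s - s0|; the added 1
     keeps the divisor positive. *)
  have K0 : 0 < 4 * L * m%:R + 1 by rewrite ltr_wpDl// !mulr_ge0.
  exists (e / (4 * L * m%:R + 1)); first by rewrite divr_gt0.
  move=> s sa; rewrite ltr_pdivlMr// => he.
  apply: (phi_dist_le m2 (hb s sa) alP (hb s0 s0a) (H2 _ _ (hs s sa) (hs s0 s0a)).1).
  apply: le_trans (ltW he); rewrite /kap1 mulrDr mulr1.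
  have := normr_ge0 (s - s0); move: `|s - s0| => x x0.
  by rewrite (_ : 4 * (L * x * m%:R) = x * (4 * L * m%:R)) ?lerDl//; ring.
split; first exact: Om0.
split=> [w w1|s sa]; first by apply: (phi_zero m2 b00); rewrite w1.
have brn := (H1 s (hs s sa)).2.
split; first exact: (vstate_eq_phi m2 (hb s sa) k8 alP brn).
split.
  move=> s0; apply: contrapT => h; apply: s0; rewrite -(bs s (hs s sa)).
  apply: (phi_nontrivial m2 (hb s sa) k8) => w w1; apply: contrapT => hw.
  by apply: h; exists w.
(* [mult] counts from 1, so the frequency n m carries the coefficient b (n - 1), from which s = b 0
   is factored out. *)
exists (fun n => b s n.-1 / b s 0%N), (phi m (b s)).
split=> [z z1|].
  have [L' [hL hp]] := phi_series m2 (hb s sa) (bz s sa) z1; exists L'; split; first exact: hL.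
  by rewrite hp (bs s (hs s sa)).
split; first by [].
split; first exact: (phi_conformal m2 (hb s sa) k8).
split; first exact: (domain_sym m2 (hb s sa) k8).
split; first exact: (domain_rotating_patch m2 (hb s sa) k8 alP brn).
exact: (domain_C2a_boundary m2 (hb s sa) k8 alP).
Unshelve. all: by end_near.
Qed.
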